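(* Let $\theta>0$ and let $(X_t,B_t)_{t\ge0}$ be a weak solution, with $X_0=0$, of the system $$dX_t=1_{\{X_t\neq 0\}}\,dB_t,\qquad 1_{\{X_t=0\}}\,dt=\frac1\theta\,dl_t^0(X),$$ where $B$ is a Brownian motion and $l_t^0(X)$ is the local time of $X$ at $0$. Let $$A^0_1=\int_0^1 1_{\{X_s=0\}}\,ds,\qquad A^+_1=\int_0^1 1_{\{X_s>0\}}\,ds .$$ Then for every $0<t<1$: (i) $\displaystyle \mathbb{P}\{A^0_1>t\}=\operatorname{Erfc}\left(\frac{\theta t}{\sqrt{2(1-t)}}\right)$; (ii) $\displaystyle \mathbb{P}\{A^+_1>t\}=1-\mathbb{E}\left[\operatorname{Erfc}\left(\frac{-Z^2+|Z|\sqrt{Z^2+\theta^2(1-t)}}{\theta\sqrt{2t}}\right)\right]$, where $Z$ is a standard Gaussian random variable.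
   Context: $\operatorname{Erfc}(z)=\frac{2}{\sqrt\pi}\int_z^\infty e^{-\xi^2}\,d\xi$. A weak solution consists of a filtered probability space carrying an adapted Brownian motion $B$ with respect to the filtration and a continuous adapted process $X$ such that the two equations hold; it is known that weak solutions exist and are unique in law. The process $X$ is called (two-sided) sticky Brownian motion with stickiness parameter $\theta$. The local time is normalized as $l^0_t(X)=\lim_{\varepsilon\downarrow0}\frac1{2\varepsilon}\int_0^t1_{\{-\varepsilon\le X_s\le\varepsilon\}}\,d\langle X,X\rangle_s$ (limit in probability), so that Tanaka's formula reads $X_t^+=X_0^++\int_0^t1_{\{X_s>0\}}dX_s+\frac12 l_t^0(X)$. *)

(* Defs.v *)
From HB Require Import structures.
From mathcomp Require Import all_boot all_order all_algebra.
From mathcomp Require Import all_classical all_reals all_analysis.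

Set Implicit Arguments.
Unset Strict Implicit.
Unset Printing Implicit Defensive.
Import Order.TTheory GRing.Theory Num.Theory.
Import numFieldNormedType.Exports.
Local Open Scope classical_set_scope.
Local Open Scope ring_scope.

Definition Erfc (R : realType) (z : R) : R :=
  2 / Num.sqrt pi * \int[lebesgue_measure]_(x in `[z, +oo[) expR (- x ^+ 2).

(* A process is a function Y of time and outcome; time is a real number, and
   only the values at times t >= 0 are meaningful. *)
Section Processes.
Context {d : measure_display} {T : measurableType d} {R : realType}.

Definition filtration (F : R -> set_system T) : Prop :=
  [/\ forall t, 0 <= t -> sigma_algebra [set: T] (F t),
      forall t, 0 <= t -> F t `<=` measurable &
      forall s t, 0 <= s -> s <= t -> F s `<=` F t].

Definition measurable_wrt (G : set_system T) (Y : T -> R) : Prop :=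
  forall A : set R, measurable A -> G (Y @^-1` A).

Definition adapted (F : R -> set_system T) (Y : R -> T -> R) : Prop :=
  forall t, 0 <= t -> measurable_wrt (F t) (Y t).

Definition continuous_paths (Y : R -> T -> R) : Prop :=
  forall w, {within `[0, +oo[, continuous (fun t => Y t w)}.

(* Convergence in probability of Y a to Z as a runs along the filter G. *)
Definition cvg_in_probability (P : probability T R) (I : Type)
    (G : set_system I) (Y : I -> T -> R) (Z : T -> R) : Prop :=
  forall eps : R, 0 < eps ->
    P [set w | eps <= `|Y a w - Z w|] @[a --> G] --> 0%E.

Definition brownian_motion (P : probability T R) (F : R -> set_system T)
    (B : R -> T -> R) : Prop :=
  [/\ adapted F B,
      continuous_paths B,
      {ae P, forall w, B 0 w = 0},
      (forall s t (A : set R), 0 <= s -> s < t -> measurable A ->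
        P [set w | A (B t w - B s w)] =
          normal_prob 0 (Num.sqrt (t - s)) A) &
      (forall s t (A : set R) (E : set T),
        0 <= s -> s < t -> measurable A -> F s E ->
        P (E `&` [set w | A (B t w - B s w)]) =
          (P E * P [set w | A (B t w - B s w)%R])%E)].

(* Simple integrands: sum over i < n of xi_i 1_{]t_i, t_{i+1}]}, with xi_i
   bounded and F_{t_i}-measurable. *)
Record simple_integrand (F : R -> set_system T) := SimpleIntegrand {
  si_size : nat ;
  si_time : nat -> R ;
  si_coef : nat -> T -> R ;
  si_time_ge0 : 0 <= si_time 0%N ;
  si_time_nd : forall i, si_time i <= si_time i.+1 ;
  si_coef_meas : forall i, measurable_wrt (F (si_time i)) (si_coef i) ;
  si_coef_bnd : forall i, exists M : R, forall w, `|si_coef i w| <= M }.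

Definition si_val (F : R -> set_system T) (K : simple_integrand F)
    (s : R) (w : T) : R :=
  \sum_(i < si_size K)
    si_coef K i w * \1_(`]si_time K i, si_time K i.+1]) s.

Definition si_integral (F : R -> set_system T) (K : simple_integrand F)
    (B : R -> T -> R) (t : R) (w : T) : R :=
  \sum_(i < si_size K)
    si_coef K i w * (B (Num.min (si_time K i.+1) t) w
                     - B (Num.min (si_time K i) t) w).

(* I is a continuous version of the Ito integral of H with respect to the
   F-Brownian motion B: the L^2 limit of the integrals of simple integrands
   approximating H in L^2(P x ds). *)
Definition ito_integral (P : probability T R) (F : R -> set_system T)
    (B H I : R -> T -> R) : Prop :=
  [/\ forall t, 0 <= t -> measurable_fun [set: T] (I t),
      continuous_paths I &
      exists K : nat -> simple_integrand F, forall t, 0 <= t ->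
        (\int[P]_w \int[lebesgue_measure]_(s in `[0%R, t])
           ((si_val (K n) s w - H s w) ^+ 2)%:E @[n --> \oo] --> 0)%E /\
        ('E_P[fun w => ((I t w - si_integral (K n) B t w) ^+ 2)%R]
           @[n --> \oo] --> 0)%E].

Definition mesh (a b : R) (s : seq R) : R :=
  \big[Num.max/0]_(0 <= i < size s)
    (nth b (a :: s) i.+1 - nth b (a :: s) i).

Definition square_variation (a b : R) (f : R -> R) (s : seq R) : R :=
  \sum_(0 <= i < size s)
    (f (nth b (a :: s) i.+1) - f (nth b (a :: s) i)) ^+ 2.

(* V w is the path of the bracket <Y, Y>, extended by 0 to negative times so
   that it has a Lebesgue-Stieltjes measure. *)
Definition quadratic_variation (P : probability T R) (Y : R -> T -> R)
    (V : T -> cumulative R R) : Prop :=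
  [/\ forall t, measurable_fun [set: T] (fun w => V w t),
      forall w, continuous (V w),
      forall w t, t <= 0 -> V w t = 0 &
      forall t (D : nat -> seq R), 0 <= t ->
        (forall n, itv_partition 0 t (D n)) ->
        mesh 0 t (D n) @[n --> \oo] --> 0 ->
        cvg_in_probability P \oo
          (fun n w => square_variation 0 t (fun s => Y s w) (D n))
          (fun w => V w t)].

(* L is the symmetric local time at 0 of Y. *)
Definition local_time0 (P : probability T R) (Y L : R -> T -> R) : Prop :=
  [/\ forall t, 0 <= t -> measurable_fun [set: T] (L t),
      continuous_paths L &
      exists2 V : T -> cumulative R R, quadratic_variation P Y V &
        forall t, 0 <= t ->
          cvg_in_probability P 0^'+
            (fun eps w => (2 * eps)^-1 *
               \int[lebesgue_stieltjes_measure (V w)]_(s in `[0, t])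
                 \1_(`[- eps, eps]) (Y s w))
            (L t)].

Definition occupation_time (Y : R -> T -> R) (A : set R) (t : R) (w : T) : R :=
  \int[lebesgue_measure]_(s in `[0, t]) \1_A (Y s w).

(* Weak solutions of dX = 1_{X <> 0} dB, 1_{X = 0} dt = theta^-1 dl^0(X), on
   the filtered probability space (T, F, P). *)
Definition sticky_weak_solution (theta : R) (P : probability T R)
    (F : R -> set_system T) (X B : R -> T -> R) : Prop :=
  [/\ filtration F,
      brownian_motion P F B,
      adapted F X /\ continuous_paths X,
      (exists2 I, ito_integral P F B (fun s w => \1_(~` [set 0]) (X s w)) I &
         {ae P, forall w, forall t, 0 <= t -> X t w = X 0 w + I t w}) &
      (exists2 L, local_time0 P X L &
         {ae P, forall w, forall t, 0 <= t ->
           occupation_time X [set 0] t w = theta^-1 * L t w})].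

End Processes.

(* Main.v *)
Require Import Defs.
From HB Require Import structures.
From mathcomp Require Import all_boot all_order all_algebra.
From mathcomp Require Import all_classical all_reals all_analysis.
From mathcomp Require Import measurable_realfun lebesgue_integral_under ring lra.

Set Implicit Arguments.
Unset Strict Implicit.
Unset Printing Implicit Defensive.
Import Order.TTheory GRing.Theory Num.Theory.
Import numFieldNormedType.Exports.
Local Open Scope classical_set_scope.
Local Open Scope ring_scope.

(* The law of an occupation time A_s, s >= 0, is found through its double Laplace
   transform.  For a rate c that is constant on ]-oo, 0[, {0} and ]0, +oo[, let
   u(x) = k + C exp (-a max(x, 0)) + D exp (-b max(-x, 0)), with a, b, k, C, D
   such that c u - 1 matches the generator of X: the contributions of X at 0
   come from the local time, which is theta times the time spent at 0.  Then
   \int_0^oo E exp (- \int_0^s c(X)) ds = u(0).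

   The Tanaka formula for u is needed only
   in expectation against past-measurable weights: the two exponentials are
   smoothed with h(x) = (sqrt (x^2 + e^2) +- x) / 2; the Dynkin formula for the
   smoothed functions holds because its defect is additive in the time interval
   and bounded by a constant times (t - s)^(3/2), by the third moment of the
   increments; finally h'' is a mixture of normalized indicators of [-n, n], so
   that, as e -> 0, its time integral tends to the local time.

   Taking c = l + alpha 1_S, Laplace inversion in the level t gives
   \int_0^oo l e^(-l s) P(A_s <= t) ds for all l.  The latter is recognized as a
   mixture of exponentials exp (-l c(y)) over Gaussian variables y, which yields
   P(A_s > t) as the probability of {c(y) <= s}.  Both inversions use only the
   monotonicity of P(A_s <= t) in s and in t. *)

(** * Bounded integrands and an additivity lemma *)

(** The definitions give little to start from: the Ito integral is only an L^2 limit of simple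
    integrals at each fixed time, and the local time only a limit in probability of Stieltjes
    integrals against the bracket. So no stopping time and no pathwise formula appears; a martingale
    property is always an expectation against a bounded weight that is measurable at the start of
    the increment.

    To carry the local time from convergence in probability over to expectations, the bracket must
    be identified with the time spent away from 0, and the time spent in [-n, n] must have a second
    moment of order n^2.

    At the other end, the transforms depend on l through sqrt (2 l), whereas inversion calls for
    exponents linear in l. The bridge is that e^(-2m) is the mean of e^(-(m/x)^2) when x > 0 has
    density 2 pi^(-1/2) e^(-x^2): this is where the Gaussian variables and [Erfc] come from. *)

Section bounded_integrals.
Context d (T : measurableType d) (R : realType).
Variables (mu : {measure set T -> \bar R}) (D : set T).
Hypotheses (mD : measurable D) (muD : (mu D < +oo)%E).
Implicit Types (f g : T -> R) (M : R).

Lemma bounded_integrable f M : measurable_fun D f ->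
  (forall x, D x -> `|f x| <= M) -> mu.-integrable D (EFin \o f).
Proof.
move=> mf fM; apply: measurable_bounded_integrable => //.
exists M; split; first exact: num_real.
by move=> y My x Dx; exact: le_trans (fM x Dx) (ltW My).
Qed.

Lemma Rintegral_le_bound f M : measurable_fun D f ->
  (forall x, D x -> `|f x| <= M) -> `|\int[mu]_(x in D) f x| <= M * fine (mu D).
Proof.
move=> mf fM; have If := bounded_integrable mf fM.
rewrite (le_trans (le_normr_Rintegral mD If))// -Rintegral_cst//.
apply: le_Rintegral => //; last first.
- apply: (@bounded_integrable (cst M) `|M|) => //.
- exact: (integrable_norm If).
Qed.

Lemma bounded_cvg_Rintegral (f_ : nat -> T -> R) f M :
  (forall n, measurable_fun D (f_ n)) -> measurable_fun D f ->
  (forall n x, D x -> `|f_ n x| <= M) ->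
  (forall x, D x -> f_ ^~ x @ \oo --> f x) ->
  (\int[mu]_(x in D) f_ n x) @[n --> \oo] --> \int[mu]_(x in D) f x.
Proof.
move=> mf_ mf fM ff.
have fM' x : D x -> `|f x| <= M.
  move=> Dx; have /cvg_norm h := ff x Dx.
  by apply: (cvgr_to_le h); near=> n; exact: fM.
have If := bounded_integrable mf fM'.
apply: fine_cvg; rewrite fineK ?integrable_fin_num//.
apply: (@dominated_cvg _ _ _ mu D mD (fun n => EFin \o f_ n) (EFin \o f)
  (cst M%:E)) => //.
- by move=> n; exact/measurable_EFinP.
- by move=> x Dx; apply: cvg_EFin; [exact: nearW|exact: ff].
- exact: (@bounded_integrable (cst M) `|M|).
Unshelve. all: by end_near. Qed.

End bounded_integrals.

Section real_lemmas.
Context (R : realType).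

Lemma eq0_small (x C : R) : (forall e, 0 < e -> `|x| <= C * e) -> x = 0.
Proof.
move=> h; apply/eqP/negPn/negP => x0.
have x1 : 0 < `|x| by rewrite normr_gt0.
have C0 : 0 <= `|C| by [].
have := h (`|x| / (`|C| + 1) / 2); rewrite !divr_gt0// ?ltr_wpDl// => /(_ isT).
apply/negP; rewrite -ltNge.
apply: (@le_lt_trans _ _ (`|C| * (`|x| / (`|C| + 1) / 2))).
  by rewrite ler_wpM2r ?ler_norm// !divr_ge0// addr_ge0.
rewrite mulrA mulrA ltr_pdivrMr// ltr_pdivrMr ?ltr_wpDl//.
nra.
Qed.

(* Cutting [[a, b]] into n pieces bounds [D a b] by a multiple of [n^(-1/2)]. *)
Lemma sewing (D : R -> R -> R) (a b C : R) : a <= b ->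
  (forall r s u, a <= r -> r <= s -> s <= u -> u <= b -> D r u = D r s + D s u) ->
  (forall r s, a <= r -> r <= s -> s <= b ->
     `|D r s| <= C * ((s - r) * Num.sqrt (s - r))) ->
  D a b = 0.
Proof.
move=> ab Dadd Dle.
have key n : forall r s, a <= r -> r <= s -> s <= b ->
    `|D r s| <= C * ((s - r) * Num.sqrt (s - r)) * Num.sqrt 2^-1 ^+ n.
  elim: n => [|n IH] r s ar rs sb; first by rewrite expr0 mulr1 Dle.
  have rm : r <= (r + s) / 2 by lra.
  have ms : (r + s) / 2 <= s by lra.
  rewrite (Dadd r ((r + s) / 2) s)//.
  apply: le_trans (ler_normD _ _) _.
  apply: le_trans (lerD (IH _ _ ar rm (le_trans ms sb)) (IH _ _ (le_trans ar rm) ms sb)) _.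
  have -> : (r + s) / 2 - r = (s - r) * 2^-1 by lra.
  have -> : s - (r + s) / 2 = (s - r) * 2^-1 by lra.
  rewrite sqrtrM ?subr_ge0// exprSr.
  by rewrite le_eqVlt; apply/orP; left; apply/eqP; field.
have k0 : `|Num.sqrt (2^-1 : R)| < 1.
  by rewrite ger0_norm ?sqrtr_ge0// -[ltRHS]sqrtr1 ltr_sqrt// invf_lt1// ltr1n.
have /= h := @cvg_geometric R (C * ((b - a) * Num.sqrt (b - a))) _ k0.
apply/eqP; rewrite -normr_le0; apply: (cvgr_to_ge h).
by near=> n; exact: key.
Unshelve. all: by end_near. Qed.

End real_lemmas.

(** * Densities *)

Section density.
Context (R : realType).
Notation leb := (@lebesgue_measure R).

Lemma integral_indic_lt (x : R) : 0 <= x ->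
  (\int[leb]_(r in `[0%R, +oo[) (\1_[set r | r < x] r)%:E)%E = x%:E.
Proof.
move=> x0; rewrite integral_indic//=; last first.
  by rewrite -set_itvNyo; exact: measurable_itv.
have -> : [set r | r < x] `&` `[0, +oo[ = `[0, x[%classic :> set R.
  by apply/seteqP; split=> r /=; rewrite !in_itv/= ?andbT; [case=> -> ->|case/andP=> -> ->].
rewrite lebesgue_measure_itv/= lte_fin; case: ifPn => [|]; first by rewrite oppr0 addr0.
by rewrite -leNgt => xle; congr EFin; apply/eqP; rewrite eq_le x0 xle.
Qed.

(* Layer cake: f = \int_0^oo 1_{r < f} dr reduces the change of density to sets. *)
Lemma integral_density (nu : {sigma_finite_measure set (measurableTypeR R) -> \bar R})
    (p f : R -> R) :
  measurable_fun setT p -> (forall x, 0 <= p x) ->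
  measurable_fun setT f -> (forall x, 0 <= f x) ->
  (forall A, measurable A -> nu A = \int[leb]_(x in A) (p x)%:E)%E ->
  (\int[nu]_x (f x)%:E = \int[leb]_x (f x * p x)%:E)%E.
Proof.
move=> mp p0 mf f0 nuE.
pose g (z : R * R) : R := \1_[set z : R * R | (0 <= z.1) && (z.1 < f z.2)] z.
have mA : measurable [set z : R * R | (0 <= z.1) && (z.1 < f z.2)].
  have m2 : measurable_fun setT (fun z : R * R => f z.2) by exact: measurableT_comp.
  have -> : [set z : R * R | (0 <= z.1) && (z.1 < f z.2)] =
     (setT `&` (fun z : R * R => cst 0 z <= z.1) @^-1` [set true]) `&`
     (setT `&` (fun z : R * R => z.1 < f z.2) @^-1` [set true]).
    by apply/seteqP; split => z /=; [case/andP=> -> ->|case=> [[_ ->] [_ ->]]].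
  apply: measurableI.
    by apply: (measurable_fun_ler (measurable_cst _) measurable_fst).
  by apply: (measurable_fun_ltr measurable_fst m2).
have mg : measurable_fun setT g by exact: measurable_indic.
have g0 z : 0 <= g z by [].
have gE x : (\int[leb]_r (g (r, x))%:E = (f x)%:E)%E.
  rewrite -(integral_indic_lt (f0 x)) [RHS]integral_mkcond.
  apply: eq_integral => r _; rewrite patchE /g !indicE; case: ifPn.
    rewrite inE/= in_itv/= andbT => r0; congr (_%:R%:E)%R.
    by rewrite !(mem_setE,topredE)/= /mem/= /in_mem/= r0.
  rewrite notin_setE/= in_itv/= andbT => /negP/negbTE r0.
  by rewrite memNset//= r0.
transitivity (\int[nu]_x \int[leb]_r (g (r, x))%:E)%E.
  by apply: eq_integral => x _; rewrite gE.
rewrite -(@fubini_tonelli _ _ _ _ R leb nu (fun z => (g z)%:E)); last 2 first.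
- exact/measurable_EFinP.
- by move=> z; rewrite lee_fin.
transitivity (\int[leb]_r \int[leb]_x (g (r, x) * p x)%:E)%E; last first.
  rewrite (@fubini_tonelli _ _ _ _ R leb leb (fun z => (g z * p z.2)%:E)); last 2 first.
  - apply/measurable_EFinP; apply: measurable_funM => //.
    exact: measurableT_comp.
  - by move=> z; rewrite lee_fin mulr_ge0.
  apply: eq_integral => x _.
  under eq_integral do rewrite EFinM.
  have mgx : measurable_fun setT (fun r => (g (r, x))%:E).
    by apply/measurable_EFinP; apply: measurableT_comp mg _; exact: pair2_measurable.
  rewrite /= EFinM -(gE x) -ge0_integralZr//; first by move=> y _; rewrite lee_fin.
  by rewrite lee_fin.
apply: eq_integral => r _.
have mAr : measurable [set x | (0 <= r) && (r < f x)].
  by have := measurable_xsection r mA; rewrite /xsection/=; under eq_set do rewrite inE/=.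
transitivity (nu [set x | (0 <= r) && (r < f x)]).
  rewrite (_ : (fun x => _) = (fun x => (\1_[set x | (0 <= r) && (r < f x)] x)%:E))//.
  by rewrite integral_indic// setIT.
rewrite nuE// integral_mkcond; apply: eq_integral => x _.
rewrite patchE /g indicE.
case: ifPn => h; first by rewrite mem_set ?mul1r//; move: h; rewrite inE.
by rewrite memNset ?mul0r//; move: h; rewrite notin_setE.
Qed.

Section primitive.
Variable p : R -> R.
Hypotheses (cp : continuous p) (p0 : forall x, 0 <= p x)
  (ip : leb.-integrable setT (EFin \o p)).

Definition lower_primitive (x : R) : R := \int[leb]_(t in `]-oo, x]) p t.

Lemma is_derive_lower_primitive (x : R) : is_derive x 1 lower_primitive (p x).
Proof.
have [] := @continuous_FTC1 R p -oo%O x (x + 1).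
- by rewrite ltrDl.
- by apply: integrableS ip.
- by rewrite ltNyr.
- exact: cp.
move=> dF F'; apply: DeriveDef; first exact: dF.
by rewrite -derive1E F'.
Qed.

(** Both limits of the primitive are this one dominated convergence, with [q] equal to [p] at +oo
    and to 0 at -oo. *)
Let lower_primitive_seq (u : nat -> R) (q : R -> R) :
  measurable_fun setT q -> (forall x, 0 <= q x <= p x) ->
  (forall y, \forall n \near \oo, p y * \1_`]-oo, u n] y = q y) ->
  lower_primitive (u n) @[n --> \oo] --> \int[leb]_x q x.
Proof.
move=> mq qp hq.
have iq : leb.-integrable setT (EFin \o q).
  apply: (@le_integrable _ _ _ leb setT measurableT _ (EFin \o p)) => //.
    exact/measurable_EFinP.
  by move=> x _ /=; rewrite lee_fin; have /andP[q0 qle] := qp x; rewrite !ger0_norm.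
apply: fine_cvg; rewrite fineK; last exact: integrable_fin_num.
under eq_cvg do rewrite integral_mkcond.
apply: (@dominated_cvg _ _ _ leb setT measurableT _ _ (EFin \o p)) => //.
- move=> n; apply/(measurable_restrictT _ _).1 => //.
  by apply/measurable_funTS; apply/measurable_EFinP; exact: continuous_measurable_fun.
- move=> y _; apply: cvg_near_cst; have := hq y.
  apply: filterS => n /= <-; rewrite patchE indicE.
  by case: (y \in _); rewrite ?mulr1 ?mulr0.
- move=> n y _; rewrite patchE /=; case: ifPn => _ /=; rewrite lee_fin ?normr0//.
  by rewrite ger0_norm.
Qed.

Lemma lower_primitive_cvgy :
  lower_primitive x @[x --> +oo] --> \int[leb]_x p x.
Proof.
apply/cvg_pinftyP => u uy; apply: lower_primitive_seq.
- exact: continuous_measurable_fun.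
- by move=> x; rewrite p0 lexx.
- move=> y; have := cvgryPge u; move=> /(_ \oo _)/proj1/(_ uy y).
  apply: filterS => n yu; rewrite indicE mem_set ?mulr1//=.
Qed.

Lemma lower_primitive_cvgNy : lower_primitive x @[x --> -oo] --> 0.
Proof.
apply/cvg_ninftyP => u uy.
have -> : 0 = \int[leb]_x (cst 0 x : R).
  by rewrite Rintegral_cst// mul0r.
apply: lower_primitive_seq => //.
- by move=> x; rewrite lexx p0.
- move=> y; have := cvgrNyPle u; move=> /(_ \oo _)/proj1/(_ uy (y - 1)).
  apply: filterS => n yu; rewrite indicE memNset ?mulr0//=.
  by rewrite in_itv/=; apply/negP; rewrite -ltNge; lra.
Qed.

End primitive.
End density.

Section ftc_half_line.
Context (R : realType).
Notation leb := (@lebesgue_measure R).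

Lemma is_derive_continuous (F : R -> R) (x l : R) : is_derive x 1 F l -> {for x, continuous F}.
Proof. by move=> [dF _]; apply: differentiable_continuous; exact/derivable1_diffP. Qed.

Lemma ge0_integral_is_derive (f F : R -> R) (a l : R) :
  (forall x, a <= x -> 0 <= f x) -> continuous f ->
  (forall x : R, is_derive x 1 F (f x)) -> F x @[x --> +oo] --> l ->
  (\int[leb]_(x in `[a, +oo[) (f x)%:E = (l - F a)%:E)%E.
Proof.
move=> f0 cf dF Fl; rewrite EFinB; apply: ge0_continuous_FTC2y => //.
- exact: continuous_subspaceT.
- by apply: cvg_at_right_filter; exact: (is_derive_continuous (dF a)).
- by move=> x _; rewrite derive1E; exact: (@derive_val _ _ _ _ _ _ _ (dF x)).
Qed.

End ftc_half_line.

(** * Gaussian moments *)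

Section normal_moments.
Context (R : realType).
Notation leb := (@lebesgue_measure R).
Variable s : R.
Hypothesis s0 : 0 < s.
Let p : R -> R := normal_pdf 0 s.

Let pE x : p x = normal_peak s * expR (- (x ^+ 2 / (s ^+ 2 *+ 2))).
Proof. by rewrite /p normal_pdfE ?gt_eqF// /normal_fun subr0 mulNr. Qed.

Let cp : continuous p.
Proof. by apply: continuous_normal_pdf; rewrite gt_eqF. Qed.

Let p0 x : 0 <= p x. Proof. exact: normal_pdf_ge0. Qed.

Let dp (x : R) : is_derive x 1 p (- (x / s ^+ 2) * p x).
Proof.
have -> : p = (fun x => normal_peak s * expR (- (x ^+ 2 / (s ^+ 2 *+ 2)))).
  by apply/funext => y; exact: pE.
apply: is_derive_eq.
rewrite /= -?mulr_regl /GRing.scale/=; field.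
by rewrite gt_eqF.
Qed.

Let evenp x : p (- x) = p x. Proof. by rewrite !pE sqrrN. Qed.

Let x3p_le x : 1 <= x -> x ^+ 3 * p x <= (normal_peak s * 16 * s ^+ 4) / x.
Proof.
move=> x1; have x0 : 0 < x by exact: lt_le_trans x1.
rewrite pE; set y := x ^+ 2 / (s ^+ 2 *+ 2).
have y0 : 0 < y by rewrite divr_gt0 ?exprn_gt0// pmulrn_rgt0 ?exprn_gt0.
(* Squaring e^(y/2) >= y/2 gives a quadratic lower bound. As y = x^2 / (2 s^2), its inverse 4 / y^2
   is 16 s^4 / x^4, which beats x^3. *)
have h : y ^+ 2 / 4 <= expR y.
  have -> : expR y = expR (y / 2) ^+ 2 by rewrite -expRM_natl; congr expR; field.
  have h2 : y / 2 <= expR (y / 2) by rewrite (le_trans _ (expR_ge1Dx _))// lerDr.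
  by have := lerXn2r 2 _ _ h2; rewrite !nnegrE expR_ge0 divr_ge0 ?(ltW y0)// => /(_ isT isT); rewrite expr_div_n; congr (_ <= _); congr (_ / _); ring.
rewrite expRN [leLHS](_ : _ = normal_peak s * (x ^+ 3 * (expR y)^-1)); last by ring.
rewrite [leRHS](_ : _ = normal_peak s * (x ^+ 3 * (y ^+ 2 / 4)^-1)); last first.
  by rewrite /y; field; rewrite !gt_eqF.
rewrite ler_wpM2l ?normal_peak_ge0// ler_wpM2l ?exprn_ge0// ?(ltW x0)//.
by rewrite lef_pV2// ?posrE ?expR_gt0// divr_gt0 ?exprn_gt0.
Qed.

Let cvg_inv_y (C : R) : C / x @[x --> +oo] --> 0.
Proof.
rewrite -(mulr0 C); apply: cvgM; first exact: cvg_cst.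
apply: (proj2 (@gtr0_cvgV0 R R (pinfty_nbhs R) _ (fun x => x) _)); last exact: cvg_id.
exact: nbhs_pinfty_gt.
Qed.

Let x3p_cvg : x ^+ 3 * p x @[x --> +oo] --> 0.
Proof.
apply: (@squeeze_cvgr _ _ _ _ (cst 0) (fun x => (normal_peak s * 16 * s ^+ 4) / x)).
- near=> x; have x1 : 1 <= x by near: x; exact: nbhs_pinfty_ge.
  by rewrite mulr_ge0 ?exprn_ge0//= ?x3p_le// (le_trans _ x1).
- exact: cvg_cst.
- exact: cvg_inv_y.
Unshelve. all: by end_near. Qed.

Let xp_cvg : x * p x @[x --> +oo] --> 0.
Proof.
apply: (@squeeze_cvgr _ _ _ _ (cst 0) (fun x => (normal_peak s * 16 * s ^+ 4) / x)).
- near=> x; have x1 : 1 <= x by near: x; exact: nbhs_pinfty_ge.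
  rewrite mulr_ge0//= ?(le_trans _ x1)// (le_trans _ (x3p_le x1))//.
  by rewrite ler_wpM2r// exprS ler_peMr ?(le_trans _ x1)// exprn_ege1.
- exact: cvg_cst.
- exact: cvg_inv_y.
Unshelve. all: by end_near. Qed.

Let ip : leb.-integrable setT (EFin \o p).
Proof. exact: integrable_normal_pdf. Qed.

Let Phi := lower_primitive p.

Let Phi_cvg : Phi x @[x --> +oo] --> (1 : R).
Proof.
have := lower_primitive_cvgy cp p0 ip.
by rewrite /Rintegral integral_normal_pdf.
Qed.

Let cxp n : continuous (fun x : R => x ^+ n * p x).
Proof. by move=> x; apply: cvgM; [exact: exprn_continuous|exact: cp]. Qed.

Let even_integral (f : R -> R) : continuous f -> (forall x, 0 <= f x) ->
  (forall x, f (- x) = f x) ->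
  (\int[leb]_x (f x)%:E = 2%:E * \int[leb]_(x in `[0%R, +oo[) (f x)%:E)%E.
Proof.
move=> cf f0 fN; rewrite ge0_symfun_integralT//; last by move=> x /=; rewrite fN.
congr (_ * integral _ _ _)%E; apply/seteqP; split => x /=; rewrite in_itv/= andbT//.
Qed.

Let Phi0 : Phi 0 = 1 / 2.
Proof.
have := even_integral cp p0 evenp; rewrite /p integral_normal_pdf -/p.
rewrite (@ge0_integral_is_derive R p Phi 0 1 _ cp (is_derive_lower_primitive cp ip))//.
by rewrite -EFinM => -[] h; lra.
Qed.

(** Integration by parts: p' = -(x / s^2) p, so the power of x drops by two at the price of a factor
    s^2, down to a multiple of the distribution function [Phi]. The decay of x p at infinity and
    [Phi 0 = 1/2] then evaluate the primitive. *)
Lemma normal_moment2 : (\int[leb]_x (x ^+ 2 * normal_pdf 0 s x)%:E = (s ^+ 2)%:E)%E.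
Proof.
rewrite (even_integral (f := fun x => x ^+ 2 * p x)).
- pose F := fun x => - s ^+ 2 * (x * p x) + s ^+ 2 * Phi x.
  have dF (x : R) : is_derive x 1 F (x ^+ 2 * p x).
    have dPhi : is_derive x 1 Phi (p x) by exact: is_derive_lower_primitive.
    have dpx : is_derive x 1 p (- (x / s ^+ 2) * p x) by exact: dp.
    have gen (c c' : R) : is_derive x 1 (fun y => c' * (y * p y) + c * Phi y)
        (c' * (x * (- (x / s ^+ 2) * p x) + p x) + c * p x).
      by apply: is_derive_eq; rewrite /= /GRing.scale/= mulr1.
    by apply: (is_derive_eq (gen _ _)); field; rewrite gt_eqF.
  rewrite (@ge0_integral_is_derive R _ F 0 (- s ^+ 2 * 0 + s ^+ 2 * 1) _ _ dF).
  + by rewrite -EFinM /F Phi0; congr EFin; field.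
  + by move=> x _; rewrite mulr_ge0 ?sqr_ge0.
  + exact: cxp.
  + by apply: cvgD; apply: cvgM => //; exact: cvg_cst.
- exact: cxp.
- by move=> x; rewrite mulr_ge0 ?sqr_ge0.
- by move=> x; rewrite sqrrN evenp.
Qed.

Lemma normal_moment4 : (\int[leb]_x (x ^+ 4 * normal_pdf 0 s x)%:E = (3 * s ^+ 4)%:E)%E.
Proof.
rewrite (even_integral (f := fun x => x ^+ 4 * p x)).
(* Two integrations by parts, x^4 p to 3 s^2 x^2 p and then to 3 s^4 p. *)
- pose F := fun x => - s ^+ 2 * (x ^+ 3 * p x) + (- (3 * s ^+ 4) * (x * p x) + (3 * s ^+ 4) * Phi x).
  have dF (x : R) : is_derive x 1 F (x ^+ 4 * p x).
    have dPhi : is_derive x 1 Phi (p x) by exact: is_derive_lower_primitive.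
    have dpx : is_derive x 1 p (- (x / s ^+ 2) * p x) by exact: dp.
    have gen (c c' c'' : R) : is_derive x 1
        (fun y => c' * (y ^+ 3 * p y) + (c'' * (y * p y) + c * Phi y))
        (c' * (x ^+ 3 * (- (x / s ^+ 2) * p x) + 3 * x ^+ 2 * p x) +
         (c'' * (x * (- (x / s ^+ 2) * p x) + p x) + c * p x)).
      by apply: is_derive_eq; rewrite /= /GRing.scale/=; ring.
    by apply: (is_derive_eq (gen _ _ _)); field; rewrite gt_eqF.
  rewrite (@ge0_integral_is_derive R _ F 0 (- s ^+ 2 * 0 + (- (3 * s ^+ 4) * 0 + (3 * s ^+ 4) * 1)) _ _ dF).
  + by rewrite -EFinM /F Phi0; congr EFin; field.
  + by move=> x _; rewrite mulr_ge0 ?exprn_even_ge0.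
  + exact: cxp.
  + by apply: cvgD; [|apply: cvgD]; apply: cvgM => //; exact: cvg_cst.
- exact: cxp.
- by move=> x; rewrite mulr_ge0 ?exprn_even_ge0.
- by move=> x; rewrite evenp; congr (_ * _); ring.
Qed.

End normal_moments.

Lemma Rintegral_odd (R : realType) (f : R -> R) : measurable_fun setT f ->
  (forall x, f (- x) = - f x) ->
  (@lebesgue_measure R).-integrable setT (EFin \o f) ->
  \int[lebesgue_measure]_x f x = 0.
Proof.
move=> mf fN If.
have fNE : (EFin \o f) \o -%R = EFin \o (\- f).
  by apply/funext => x /=; rewrite fN.
have INf : (@lebesgue_measure R).-integrable setT (EFin \o (\- f)).
  by have := integrableN If; apply: eq_integrable.
suff: \int[lebesgue_measure]_x f x = - \int[lebesgue_measure]_x f x by lra.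
rewrite -[in RHS]mulN1r -RintegralZl// /Rintegral; congr fine.
transitivity (\int[pushforward (@lebesgue_measure R) (-%R : _ -> measurableTypeR R)]_x (f x)%:E)%E.
  by apply: eq_measure_integral => A mA _; exact/esym/lebesgue_measureN.
rewrite integral_pushforward//.
- by rewrite preimage_setT; apply: eq_integral => x _ /=; rewrite fN mulN1r.
- exact/measurable_EFinP.
- by rewrite preimage_setT fNE.
Qed.

Lemma measurable_inv (R : realType) : measurable_fun setT (fun x : R => x^-1).
Proof.
have -> : [set: R] = [set 0] `|` ~` [set 0] by rewrite setUv.
apply/measurable_funU => //; first exact: measurableC.
split; first exact: measurable_fun_set1.
apply: open_continuous_measurable_fun; first exact: closed_openC.
by move=> x; rewrite inE/= => /eqP x0; apply: cvgV => //; exact: cvg_id.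
Qed.

(** * Gaussian integrals with an inverse argument *)

Section gauss_inverse.
Context (R : realType).
Notation leb := (@lebesgue_measure R).
Notation gp := (lower_primitive (@gauss_fun R)).

Let gp_cvgy : gp x @[x --> +oo] --> Num.sqrt (pi : R).
Proof.
have := lower_primitive_cvgy (@continuous_gauss_fun R) (@gauss_fun_ge0 R) (@integrableT_gauss R).
by rewrite /Rintegral integralT_gauss.
Qed.

Let gp_cvgNy : gp x @[x --> -oo] --> (0 : R).
Proof. exact: (lower_primitive_cvgNy (@continuous_gauss_fun R) (@gauss_fun_ge0 R) (@integrableT_gauss R)). Qed.

Let dgp (x : R) : is_derive x 1 gp (gauss_fun x).
Proof. exact: (is_derive_lower_primitive (@continuous_gauss_fun R) (@integrableT_gauss R)). Qed.

Let invz_cvgy (C : R) : C / x @[x --> +oo] --> 0.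
Proof.
rewrite -(mulr0 C); apply: cvgM; first exact: cvg_cst.
apply: (proj2 (@gtr0_cvgV0 R R (pinfty_nbhs R) _ (fun x => x) _)); last exact: cvg_id.
exact: nbhs_pinfty_gt.
Qed.

Let invz_cvg0 (C : R) : 0 < C -> C / x @[x --> 0^'+] --> +oo.
Proof.
move=> C0; apply/cvgryPge => A.
near=> x.
have x0 : 0 < x by near: x; exact: nbhs_right_gt.
rewrite ler_pdivlMr// (le_trans (ler_norm _))// normrM (gtr0_norm x0).
have : x <= C / (`|A| + 1) by near: x; apply: nbhs_right_le; rewrite divr_gt0// ltr_wpDl.
rewrite ler_pdivlMr ?ltr_wpDl// mulrC => /(le_trans _); apply.
by rewrite ler_wpM2r ?(ltW x0)// lerDl.
Unshelve. all: by end_near. Qed.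

Variables (A M : R).
Hypotheses (A0 : 0 < A) (M0 : 0 < M).

Let f (z : R) : R := expR (- (A * z) ^+ 2 - (M / z) ^+ 2).
(** The squares of A z + M/z and A z - M/z differ from (A z)^2 + (M/z)^2 by 2 A M and -2 A M, so
    each exponential prefactor turns its Gaussian into [f]. The inner derivatives A - M/z^2 and A +
    M/z^2 add up to 2 A, which makes [F] a primitive of [f]. *)
Let F (z : R) : R := (2 * A)^-1 *
  (expR (2 * A * M) * gp (A * z + M / z) + expR (- (2 * A * M)) * gp (A * z - M / z)).

Let f_le (z : R) : 0 < z -> f z <= z ^+ 2 / M ^+ 2.
Proof.
move=> z0; have h : 0 < (M / z) ^+ 2 by rewrite exprn_gt0// divr_gt0.
apply: (@le_trans _ _ (expR (- (M / z) ^+ 2))).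
  by rewrite ler_expR gerDr oppr_le0 sqr_ge0.
rewrite expRN -[leRHS]invrK lef_pV2 ?posrE ?expR_gt0//; last first.
  by rewrite invr_gt0 divr_gt0// exprn_gt0.
rewrite (le_trans _ (expR_ge1Dx _))// (_ : (z ^+ 2 / M ^+ 2)^-1 = (M / z) ^+ 2) ?lerDr//.
by field; rewrite !gt_eqF.
Qed.

Let dF (z : R) : 0 < z -> is_derive z 1 F (f z).
Proof.
move=> z0; have z_neq0 : z != 0 by rewrite gt_eqF.
have dV : is_derive z 1 (fun x : R => x^-1) (- z ^- 2) 
  by apply: is_derive_eq (is_deriveV (f := id) z_neq0 (is_derive_id _ _)) _; rewrite /GRing.scale/= mulr1.
have d1 : is_derive z 1 (fun x : R => A * x + M / x) (A - M / z ^+ 2).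
  by apply: is_derive_eq; rewrite /GRing.scale/= mulr1 mulrN.
have d2 : is_derive z 1 (fun x : R => A * x - M / x) (A + M / z ^+ 2).
  by apply: is_derive_eq; rewrite /GRing.scale/= mulr1 mulrN opprK.
have c1 := @is_derive1_comp _ gp (fun x : R => A * x + M / x) z _ _ (dgp (A * z + M / z)) d1.
have c2 := @is_derive1_comp _ gp (fun x : R => A * x - M / x) z _ _ (dgp (A * z - M / z)) d2.
have gen (c k1 k2 : R) : is_derive z 1 (fun x => c * (k1 * gp (A * x + M / x) + k2 * gp (A * x - M / x)))
   (c * (k1 * (gauss_fun (A * z + M / z) * (A - M / z ^+ 2)) + k2 * (gauss_fun (A * z - M / z) * (A + M / z ^+ 2)))).
  have -> : (fun x => c * (k1 * gp (A * x + M / x) + k2 * gp (A * x - M / x))) =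
    c \*: ((k1 \*: (gp \o (fun x : R => A * x + M / x))) + (k2 \*: (gp \o (fun x : R => A * x - M / x)))).
    by [].
  by apply: is_derive_eq.
apply: (is_derive_eq (gen _ _ _)).
have e1 : expR (2 * A * M) * gauss_fun (A * z + M / z) = f z.
  by rewrite /gauss_fun /f -expRD; congr expR; field.
have e2 : expR (- (2 * A * M)) * gauss_fun (A * z - M / z) = f z.
  by rewrite /gauss_fun /f -expRD; congr expR; field.
rewrite [expR (2 * A * M) * _]mulrA e1 [expR (- _) * _]mulrA e2.
by field; rewrite z_neq0 gt_eqF.
Qed.

Lemma integral_gauss_inverse_gt0 :
  (\int[leb]_(z in `[0%R, +oo[) (expR (- (A * z) ^+ 2 - (M / z) ^+ 2))%:E
    = (Num.sqrt pi / (2 * A) * expR (- (2 * A * M)))%:E)%E.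
Proof.
(* As [M / 0] is 0, [f] takes the value 1 at 0 instead of its limit 0, and [F] is wrong there too.
   [f'] and [F'] carry the right limits: near 0 the arguments A z + M/z and A z - M/z tend to +oo
   and -oo. *)
pose f' (z : R) : R := if 0 < z then f z else 0.
pose F0 := (2 * A)^-1 * (expR (2 * A * M) * Num.sqrt pi).
pose F' (z : R) : R := if 0 < z then F z else F0.
have mf : measurable_fun setT f.
  apply: measurableT_comp => //; apply: measurable_funB => //.
  + by apply: measurable_funN; apply: measurable_funX; exact: measurable_funM.
  + by apply: measurable_funX; apply: measurable_funM => //; exact: measurable_inv.
have ff' (z : R) : 0 < z -> {near z, f' =1 f}.
  move=> z0; near=> y; rewrite /f'; case: ifPn => //.
  by rewrite -leNgt leNgt; have -> : 0 < y by near: y; exact: lt_nbhsr.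
have FF' (z : R) : 0 < z -> {near z, F =1 F'}.
  move=> z0; near=> y; rewrite /F'; case: ifPn => //.
  by rewrite -leNgt leNgt; have -> : 0 < y by near: y; exact: lt_nbhsr.
have cf (z : R) : 0 < z -> {for z, continuous f}.
  move=> z0; apply: continuous_comp; last exact: continuous_expR.
  have cV : {for z, continuous (fun x : R => M / x)}.
    by apply: cvgM; [exact: cvg_cst|apply: cvgV => //; rewrite gt_eqF].
  apply: cvgB.
    apply: cvgN; apply: (@cvg_comp _ _ _ (fun x => A * x) (fun x => x ^+ 2)); last exact: exprn_continuous.
    by apply: cvgM; [exact: cvg_cst|exact: cvg_id].
  by apply: (@cvg_comp _ _ _ (fun x => M / x) (fun x => x ^+ 2)); [exact: cV|exact: exprn_continuous].
have dF' (z : R) : 0 < z -> is_derive z 1 F' (f z).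
  by move=> z0; apply: near_eq_is_derive (dF z0); exact: FF'.
transitivity (\int[leb]_(z in `[0%R, +oo[) (f' z)%:E)%E.
  rewrite -!integral_itv_obnd_cbnd; last 2 first.
  - apply/measurable_EFinP; apply: (eq_measurable_fun f); last exact: measurable_funTS.
    by move=> z; rewrite inE/= in_itv/= andbT /f' => ->.
  - by apply/measurable_EFinP; exact: measurable_funTS.
  by apply: eq_integral => z; rewrite inE/= in_itv/= andbT /f' => ->.
rewrite (@ge0_continuous_FTC2y _ f' F' 0
  ((2 * A)^-1 * (expR (2 * A * M) * Num.sqrt pi + expR (- (2 * A * M)) * Num.sqrt pi))).
- rewrite -EFinB /F' ltxx /F0; congr EFin; field.
  by rewrite gt_eqF.
- by move=> x x0; rewrite /f'; case: ifPn => // _; exact: expR_ge0.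
- apply/continuous_within_itvcyP; split.
    move=> z; rewrite in_itv/= andbT => z0.
    apply: cvg_trans.
      by apply: near_eq_cvg; near=> y; apply/esym; near: y; exact: ff'.
    by rewrite /f' z0; exact: cf.
  rewrite {2}/f' ltxx.
  apply: (@squeeze_cvgr _ _ _ _ (cst 0) (fun z => z ^+ 2 / M ^+ 2)).
  + near=> z; have z0 : 0 < z by near: z; exact: nbhs_right_gt.
    by rewrite /f' z0 /= f_le// expR_ge0.
  + exact: cvg_cst.
  + rewrite [X in _ --> X](_ : 0 = 0 ^+ 2 / M ^+ 2); last by rewrite expr0n/= mul0r.
    apply: cvgM; last exact: cvg_cst.
    by apply: cvg_at_right_filter; exact: exprn_continuous.
- apply: (@cvg_trans _ (F z @[z --> +oo])).
    apply: near_eq_cvg; near=> z; rewrite /F'.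
    by have -> : 0 < z by near: z; exact: nbhs_pinfty_gt.
  have h1 : A * z + M / z @[z --> +oo] --> +oo.
    apply: (@ger_cvgy _ _ _ _ (fun z => A * z)).
      by near=> z; rewrite lerDl divr_ge0// ?(ltW M0)//; near: z; exact: nbhs_pinfty_ge.
    by apply: gt0_cvgMry => //; exact: cvg_id.
  have h2 : A * z - M / z @[z --> +oo] --> +oo.
    apply: (@ger_cvgy _ _ _ _ (fun z => A * z - M)).
      near=> z; have z1 : 1 <= z by near: z; exact: nbhs_pinfty_ge.
      by rewrite lerD2l lerN2 ler_pdivrMr ?(lt_le_trans _ z1)// ler_peMr// ltW.
    apply/cvgryPge => B; near=> z.
    rewrite lerBrDr -ler_pdivrMl//; near: z; exact: nbhs_pinfty_ge.
  apply: cvgM; first exact: cvg_cst.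
  by apply: cvgD; apply: cvgM; try exact: cvg_cst; apply: cvg_comp gp_cvgy; [exact: h1|exact: h2].
- by move=> z z0; have [] := dF' _ z0.
- rewrite {2}/F' ltxx (_ : F0 = (2 * A)^-1 *
    (expR (2 * A * M) * Num.sqrt pi + expR (- (2 * A * M)) * 0)); last first.
    by rewrite mulr0 addr0.
  apply: (@cvg_trans _ (F z @[z --> 0^'+])).
    apply: near_eq_cvg; near=> z; rewrite /F'.
    by have -> : 0 < z by near: z; exact: nbhs_right_gt.
  have Mz := invz_cvg0 M0.
  have h1 : A * z + M / z @[z --> 0^'+] --> +oo.
    apply: (ger_cvgy _ Mz); near=> z.
    have z0 : 0 < z by near: z; exact: nbhs_right_gt.
    by rewrite lerDr mulr_ge0 ?(ltW A0) ?(ltW z0).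
  have h2 : A * z - M / z @[z --> 0^'+] --> -oo.
    apply/cvgNry; under eq_cvg do rewrite opprB.
    apply/cvgryPge => B; near=> z.
    rewrite lerBrDr; apply: (@le_trans _ _ (B + A)).
      have z0 : 0 <= z by near: z; exact: nbhs_right_ge.
      rewrite lerD2l ler_piMr ?(ltW A0)//; near: z; exact: nbhs_right_le.
    by near: z; move/cvgryPge : Mz; apply.
  apply: cvgM; first exact: cvg_cst.
  by apply: cvgD; apply: cvgM; try exact: cvg_cst; [apply: cvg_comp gp_cvgy; exact: h1|apply: cvg_comp gp_cvgNy; exact: h2].
- move=> z; rewrite in_itv/= andbT => z0.
  by rewrite derive1E /f' z0; have [_ ->] := dF' _ z0.
Unshelve. all: by end_near. Qed.

End gauss_inverse.

(** The case [M = 0] is apart because M/z no longer blows up at 0; it is half of a rescaled Gauss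
    integral. *)
Lemma integral_gauss_inverse (R : realType) (A M : R) : 0 < A -> 0 <= M ->
  (\int[lebesgue_measure]_(z in `[0%R, +oo[) (expR (- (A * z) ^+ 2 - (M / z) ^+ 2))%:E
    = (Num.sqrt pi / (2 * A) * expR (- (2 * A * M)))%:E)%E.
Proof.
move=> A0; rewrite le_eqVlt => /predU1P[<-|M0]; last exact: integral_gauss_inverse_gt0.
under eq_integral do rewrite mul0r expr0n/= subr0.
pose gp := lower_primitive (@gauss_fun R).
have dgp (x : R) : is_derive x 1 gp (gauss_fun x).
  exact: (is_derive_lower_primitive (@continuous_gauss_fun R) (@integrableT_gauss R)).
have gpy : gp x @[x --> +oo] --> Num.sqrt (pi : R).
  have := lower_primitive_cvgy (@continuous_gauss_fun R) (@gauss_fun_ge0 R) (@integrableT_gauss R).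
  by rewrite /Rintegral integralT_gauss.
have gp0 : gp 0 = Num.sqrt pi / 2.
  have := @integral0y_gauss R.
  rewrite (@ge0_integral_is_derive R _ gp 0 (Num.sqrt pi) _ (@continuous_gauss_fun R) dgp gpy).
    by move=> [] h; lra.
  by move=> x _; exact: gauss_fun_ge0.
rewrite mulr0 oppr0 expR0 mulr1.
pose F (z : R) := A^-1 * gp (A * z).
have dF (z : R) : is_derive z 1 F (gauss_fun (A * z)).
  have d1 : is_derive z 1 (fun x : R => A * x) A.
    by apply: is_derive_eq; rewrite /GRing.scale/= mulr1.
  have c1 := @is_derive1_comp _ gp (fun x : R => A * x) z _ _ (dgp (A * z)) d1.
  have -> : F = A^-1 \*: (gp \o (fun x : R => A * x)) by [].
  by apply: is_derive_eq; rewrite /GRing.scale/=; field; rewrite gt_eqF.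
have cg : continuous (fun z : R => gauss_fun (A * z)).
  move=> z; apply: (@cvg_comp _ _ _ (fun x => A * x) (@gauss_fun R)); last exact: continuous_gauss_fun.
  by apply: cvgM; [exact: cvg_cst|exact: cvg_id].
rewrite (@ge0_integral_is_derive R _ F 0 (A^-1 * Num.sqrt pi) _ cg dF).
- by rewrite /F mulr0 gp0; congr EFin; field; rewrite gt_eqF.
- by move=> x _; exact: gauss_fun_ge0.
apply: cvgM; first exact: cvg_cst.
apply: cvg_comp gpy.
by apply: gt0_cvgMry => //; exact: cvg_id.
Qed.

(** * Brownian increments *)

Section normal_law.
Context (R : realType).
Notation leb := (@lebesgue_measure R).
Variable s : R.
Hypothesis s0 : 0 < s.
Notation nu := (normal_prob (0 : R) s).

Lemma integral_normal (f : R -> R) : measurable_fun setT f -> (forall x, 0 <= f x) ->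
  (\int[nu]_x (f x)%:E = \int[leb]_x (f x * normal_pdf 0 s x)%:E)%E.
Proof.
move=> mf f0; apply: (@integral_density R nu) => //.
- exact: measurable_normal_pdf.
- by move=> x; exact: normal_pdf_ge0.
Qed.

Lemma integrable_normal (f : R -> R) : measurable_fun setT f ->
  nu.-integrable setT (EFin \o f) ->
  leb.-integrable setT (fun x => (f x * normal_pdf 0 s x)%:E).
Proof.
move=> mf /integrableP[_ fi]; apply/integrableP; split.
  by apply/measurable_EFinP; apply: measurable_funM => //; exact: measurable_normal_pdf.
move: fi; rewrite (integral_normal (f := fun x => `|f x|))//; last first.
  exact: measurableT_comp.
congr (_ < _)%E; apply: eq_integral => x _.
by rewrite /= normrM (ger0_norm (normal_pdf_ge0 _ _ _)).
Qed.

Lemma Rintegral_normal (f : R -> R) : measurable_fun setT f ->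
  nu.-integrable setT (EFin \o f) ->
  \int[nu]_x f x = \int[leb]_x (f x * normal_pdf 0 s x).
Proof.
move=> mf fi; have fpi := integrable_normal mf fi.
have mfp := measurable_funrpos mf; have mfn := measurable_funrneg mf.
rewrite /Rintegral; congr fine.
rewrite [LHS]integralE [RHS]integralE.
congr (_ - _)%E.
- transitivity (\int[nu]_x (f^\+ x)%:E)%E; first by apply: eq_integral => x _; rewrite funeposE/= -EFin_max.
  rewrite integral_normal//.
  apply: eq_integral => x _; rewrite funeposE/= -EFin_max; congr EFin.
  by rewrite /funrpos maxr_pMl ?normal_pdf_ge0// mul0r.
- transitivity (\int[nu]_x (f^\- x)%:E)%E; first by apply: eq_integral => x _; rewrite funenegE/= -EFin_max.
  rewrite integral_normal//.
  apply: eq_integral => x _; rewrite funenegE/= -EFin_max; congr EFin.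
  by rewrite /funrneg maxr_pMl ?normal_pdf_ge0// mul0r mulNr.
Qed.

Let mX n : measurable_fun setT (fun x : R => x ^+ n).
Proof. exact: measurable_funX. Qed.

Let i4 : nu.-integrable setT (fun x => (x ^+ 4)%:E).
Proof.
apply/integrableP; split; first exact/measurable_EFinP.
under eq_integral do rewrite gee0_abs ?lee_fin ?exprn_even_ge0//.
rewrite integral_normal//; last by move=> x; rewrite exprn_even_ge0.
by rewrite normal_moment4 ?ltry.
Qed.

Lemma integrable_normalX n : (n <= 4)%N -> nu.-integrable setT (fun x => (x ^+ n)%:E).
Proof.
move=> n4; have i1 : nu.-integrable setT (fun x => (1 + x ^+ 4)%:E).
  have h : nu.-integrable setT (EFin \o cst (1:R)).
    by apply: finite_measure_integrable_cst.
  exact: (integrableD _ h i4).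
apply: le_integrable i1 => //; first exact/measurable_EFinP.
move=> x _ /=; rewrite lee_fin normrX (@ger0_norm _ (1 + x ^+ 4)); last first.
  by rewrite addr_ge0// exprn_even_ge0.
rewrite -[x ^+ 4]ger0_norm ?exprn_even_ge0// normrX.
move: `|x| (normr_ge0 x) => y y0.
have [y1|y1] := leP y 1.
  by rewrite (@le_trans _ _ 1)// ?exprn_ile1// lerDl exprn_ge0.
by rewrite (@le_trans _ _ (y ^+ 4))// ?lerDr// ler_weXn2l// ltW.
Qed.

Lemma normal_mean : \int[nu]_x x = 0.
Proof.
have h : nu.-integrable setT (EFin \o @id R).
  by have := integrable_normalX (isT : 1 <= 4)%N; apply: eq_integrable.
rewrite Rintegral_normal//.
have h2 := integrable_normal (@measurable_id _ _ setT) h.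
apply: Rintegral_odd => //.
- by apply: measurable_funM => //; exact: measurable_normal_pdf.
- by move=> x; rewrite mulNr normal_pdfE ?gt_eqF// /normal_fun !subr0 sqrrN.
Qed.

Lemma normal_third : \int[nu]_x (x ^+ 3) = 0.
Proof.
have h := integrable_normalX (isT : 3 <= 4)%N.
rewrite Rintegral_normal//.
have h2 := integrable_normal (mX 3) h.
apply: Rintegral_odd => //.
- by apply: measurable_funM => //; exact: measurable_normal_pdf.
- move=> x; rewrite normal_pdfE ?gt_eqF// /normal_fun !subr0 sqrrN.
  by rewrite exprNn -signr_odd/= expr1 mulN1r mulNr.
Qed.

Lemma normal_second : \int[nu]_x (x ^+ 2) = s ^+ 2.
Proof.
rewrite Rintegral_normal//; last exact: integrable_normalX.
by rewrite /Rintegral normal_moment2.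
Qed.

Lemma normal_fourth : \int[nu]_x (x ^+ 4) = 3 * s ^+ 4.
Proof.
rewrite Rintegral_normal//.
by rewrite /Rintegral normal_moment4.
Qed.

End normal_law.

Section filtration_measurability.
Context d (T : measurableType d) (R : realType).
Variable F : R -> set_system T.
Hypothesis fF : filtration F.
Implicit Types (s t : R) (Y : T -> R).

(** Measurability for [F s] phrased as [measurable_fun] on the type that carries the generated
    sigma-algebra, so that the closure lemmas for measurable functions apply to it directly. *)
Definition Fmeas (s : R) (Y : T -> R) :=
  measurable_fun [set: g_sigma_algebraType (F s)] (Y : g_sigma_algebraType (F s) -> R).

Lemma FmeasP s Y : 0 <= s -> Fmeas s Y <-> measurable_wrt (F s) Y.
Proof.
move=> s0; have [/(_ s s0) sF _ _] := fF.
split=> [mY A mA|mY _ A mA].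
- by have := mY measurableT A mA; rewrite setTI /measurable/= sigma_algebra_id.
- by rewrite setTI /measurable/= sigma_algebra_id//; exact: mY.
Qed.

Lemma Fmeas_fun s Y : 0 <= s -> Fmeas s Y -> measurable_fun [set: T] Y.
Proof.
move=> s0 /(FmeasP _ s0) mY _ A mA; rewrite setTI.
by have [_ /(_ s s0) sub _] := fF; apply: sub; exact: mY.
Qed.

Lemma Fmeas_le s t Y : 0 <= s -> s <= t -> Fmeas s Y -> Fmeas t Y.
Proof.
move=> s0 st /(FmeasP _ s0) mY; apply/FmeasP; first exact: le_trans st.
by move=> A mA; have [_ _ sub] := fF; apply: (sub s t) => //; exact: mY.
Qed.

End filtration_measurability.

Section brownian_increments.
Context d (T : measurableType d) (R : realType).
Variables (P : probability T R) (F : R -> set_system T) (B : R -> T -> R).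
Hypotheses (fF : filtration F) (bB : brownian_motion P F B).
Variables (s t : R).
Hypotheses (s0 : 0 <= s) (st : s < t).
Notation nu := (normal_prob (0 : R) (Num.sqrt (t - s))).

Let dB (w : T) : R := B t w - B s w.

Let t0 : 0 <= t. Proof. exact: le_trans (ltW st). Qed.

Let mB r : 0 <= r -> measurable_fun setT (B r).
Proof.
move=> r0; case: bB => aB _ _ _ _.
by apply: (Fmeas_fun fF r0); apply/FmeasP => //; exact: aB.
Qed.

Lemma measurable_increment : measurable_fun setT dB.
Proof. by apply: measurable_funB; exact: mB. Qed.

Variable z : T -> R.
Hypothesis Fz : Fmeas F s z.

Let mz : measurable_fun setT z. Proof. exact: Fmeas_fun Fz. Qed.

Let Z : {RV P >-> R} := HB.pack z (isMeasurableFun.Build _ _ _ _ z mz).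

Notation RR := (R * measurableTypeR R)%type.

Let mzB : measurable_fun setT (fun w => (z w, dB w) : RR).
Proof. by apply: measurable_fun_pair => //; exact: measurable_increment. Qed.

Let ZB : {RV P >-> RR} :=
  HB.pack (fun w => (z w, dB w)) (isMeasurableFun.Build _ _ _ _ _ mzB).

Let joint_law (C : set RR) : measurable C ->
  distribution P ZB C = (distribution P Z \x nu)%E C.
Proof.
move=> mC; have [_ _ _ hB iB] := bB.
apply/esym; apply: (@product_measure_unique _ _ _ _ _ (distribution P Z) nu (distribution P ZB)) => //.
move=> A1 A2 mA1 mA2; transitivity (P ((z @^-1` A1) `&` [set w | A2 (B t w - B s w)])); first by [].
rewrite iB// ?hB//.
by apply: (FmeasP fF _ s0).1.
Qed.

(** Independence is given on events: it says that the law of the pair ([z], increment) is a product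
    on rectangles, hence everywhere by uniqueness of the product measure. Fubini then factors the
    expectation; the computation is made on absolute values beforehand to get integrability. *)
Lemma indep_expectation (psi : R -> R) : measurable_fun setT psi ->
  P.-integrable setT (EFin \o z) -> nu.-integrable setT (EFin \o psi) ->
  P.-integrable setT (fun w => (z w * psi (dB w))%:E) /\
  \int[P]_w (z w * psi (dB w)) = (\int[P]_w z w) * \int[nu]_x psi x.
Proof.
move=> mpsi iz ipsi.
pose g (u : RR) : \bar R := (u.1 * psi u.2)%:E.
have mg : measurable_fun setT g.
  apply/measurable_EFinP; apply: measurable_funM => //.
  exact: measurableT_comp.
have mg' : measurable_fun setT (fun u => `|g u|)%E by exact: measurableT_comp.
have absE : (\int[P]_w `|z w * psi (dB w)|%:E =
    (\int[P]_w `|z w|%:E) * (\int[nu]_x `|psi x|%:E))%E.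
  transitivity (\int[distribution P ZB]_u `|g u|)%E.
    by rewrite ge0_integral_distribution.
  transitivity (\int[distribution P Z \x nu]_u `|g u|)%E.
    by apply: eq_measure_integral => A mA _; exact: joint_law.
  rewrite fubini_tonelli1// /fubini_F.
  transitivity (\int[distribution P Z]_x (`|x|%:E * \int[nu]_x `|psi x|%:E))%E.
    apply: eq_integral => x _; rewrite /g/=.
    under eq_integral do rewrite normrM EFinM.
    by rewrite ge0_integralZl//; apply/measurable_EFinP; exact: measurableT_comp.
  rewrite ge0_integralZr//; last 2 first.
    by apply/measurable_EFinP; exact: normr_measurable.
    by apply: integral_ge0.
  congr (_ * _)%E; rewrite ge0_integral_distribution//.
  by apply/measurable_EFinP; exact: normr_measurable.
have izB : P.-integrable setT (fun w => (z w * psi (dB w))%:E).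
  apply/integrableP; split.
    apply/measurable_EFinP; apply: measurable_funM => //.
    apply: measurableT_comp => //; exact: measurable_increment.
  rewrite absE lte_mul_pinfty//.
  - exact: integral_ge0.
  - by move/integrableP : iz => [_ iz]; rewrite ge0_fin_numE//; exact: integral_ge0.
  - by move/integrableP : ipsi => [].
split => //.
have ig : (distribution P Z \x nu)%E.-integrable setT g.
  apply/integrableP; split => //.
  rewrite (_ : integral _ _ _ = \int[P]_w `|z w * psi (dB w)|%:E)%E.
    by move/integrableP : izB => [].
  transitivity (\int[distribution P ZB]_u `|g u|)%E.
    by apply: eq_measure_integral => A mA _; apply/esym; exact: joint_law.
  by rewrite ge0_integral_distribution.
transitivity (fine (\int[distribution P Z \x nu]_u g u))%E.
  congr fine; transitivity (\int[distribution P ZB]_u g u)%E.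
    by rewrite integral_distribution.
  by apply: eq_measure_integral => A mA _; exact: joint_law.
rewrite -integral12_prod_meas1// /fubini_F.
transitivity (fine (\int[distribution P Z]_x (x%:E * \int[nu]_y (psi y)%:E)))%E.
  congr fine; apply: eq_integral => x _; rewrite /g/=.
  under eq_integral do rewrite EFinM.
  by rewrite integralZl.
have Epsi : (\int[nu]_y (psi y)%:E)%E = (\int[nu]_y psi y)%:E.
  by rewrite /Rintegral fineK//; exact: integrable_fin_num.
rewrite Epsi.
rewrite integralZr//; last first.
  apply/integrableP; split; first exact/measurable_EFinP.
  rewrite ge0_integral_distribution//; last by apply/measurable_EFinP; exact: normr_measurable.
  by move/integrableP : iz => [].
rewrite integral_distribution//.
by rewrite fineM//; exact: integrable_fin_num.
Qed.

End brownian_increments.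

Section moments.
Context d (T : measurableType d) (R : realType).
Variable P : probability T R.
Implicit Types (f g : T -> R) (M : R).

Lemma prob_ltyT : (P setT < +oo)%E.
Proof. by rewrite probability_setT ltry. Qed.

Lemma Rintegral_prob_cst (c : R) : \int[P]_w c = c.
Proof.
rewrite Rintegral_cst// [X in fine X](_ : _ = 1%E) ?mulr1//.
exact: probability_setT.
Qed.

Lemma prob_bounded_integrable f M : measurable_fun setT f -> (forall w, `|f w| <= M) ->
  P.-integrable setT (EFin \o f).
Proof. by move=> mf fM; exact: (bounded_integrable measurableT prob_ltyT mf (fun w _ => fM w)). Qed.

Lemma integrable_measurable f : P.-integrable setT (EFin \o f) -> measurable_fun setT f.
Proof. by move/integrableP => [/measurable_EFinP]. Qed.

Lemma integrable_bmul f g M : measurable_fun setT g -> (forall w, `|g w| <= M) ->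
  P.-integrable setT (EFin \o f) -> P.-integrable setT (fun w => (g w * f w)%:E).
Proof.
move=> mg gM fi; have mf := integrable_measurable fi.
apply: (@le_integrable _ _ _ P setT measurableT _ (fun w => (M%:E * (f w)%:E)%E)).
- by apply/measurable_EFinP; exact: measurable_funM.
- move=> w _ /=; rewrite lee_fin !normrM ler_wpM2r//.
  by rewrite (le_trans (gM w))// ler_norm.
- by apply: integrableZl.
Qed.

Lemma integrable_pow4 f k : measurable_fun setT f ->
  P.-integrable setT (fun w => (f w ^+ 4)%:E) -> (k <= 4)%N ->
  P.-integrable setT (fun w => (f w ^+ k)%:E).
Proof.
move=> mf f4 k4.
have h : P.-integrable setT (EFin \o cst (1 : R)).
  by apply: finite_measure_integrable_cst.
apply: le_integrable (integrableD _ h f4) => //.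
  by apply/measurable_EFinP; exact: measurable_funX.
move=> w _ /=; rewrite lee_fin normrX (@ger0_norm _ (1 + f w ^+ 4)); last first.
  by rewrite addr_ge0// exprn_even_ge0.
rewrite -[f w ^+ 4]ger0_norm ?exprn_even_ge0// normrX.
move: `|f w| (normr_ge0 (f w)) => y y0.
have [y1|y1] := leP y 1.
  by rewrite (@le_trans _ _ 1)// ?exprn_ile1// lerDl exprn_ge0.
by rewrite (@le_trans _ _ (y ^+ 4))// ?lerDr// ler_weXn2l// ltW.
Qed.

End moments.

Section brownian_moments.
Context d (T : measurableType d) (R : realType).
Variables (P : probability T R) (F : R -> set_system T) (B : R -> T -> R).
Hypotheses (fF : filtration F) (bB : brownian_motion P F B).

(** Conditional moments tested against a past weight [z], in the form in which powers of sums of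
    increments consume them term by term. The case [s = t] is apart because the normal law is used
    with positive deviation. *)
Lemma brownian_increment_moments (s t : R) (z : T -> R) : 0 <= s -> s <= t ->
  Fmeas F s z -> P.-integrable setT (EFin \o z) ->
  [/\ forall k, (k <= 4)%N -> P.-integrable setT (fun w => (z w * (B t w - B s w) ^+ k)%:E),
      \int[P]_w (z w * (B t w - B s w)) = 0,
      \int[P]_w (z w * (B t w - B s w) ^+ 2) = (\int[P]_w z w) * (t - s),
      \int[P]_w (z w * (B t w - B s w) ^+ 3) = 0 &
      \int[P]_w (z w * (B t w - B s w) ^+ 4) = (\int[P]_w z w) * (3 * (t - s) ^+ 2)].
Proof.
move=> s0; rewrite le_eqVlt => /predU1P[<-|st] Fz iz.
  have E0 k : \int[P]_w (z w * (B s w - B s w) ^+ k.+1) = 0.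
    under eq_Rintegral do rewrite subrr expr0n/= mulr0.
    by rewrite Rintegral_cst// mul0r.
  split.
  - move=> [|k] _; first by under eq_fun do rewrite expr0 mulr1.
    under eq_fun do rewrite subrr expr0n/= mulr0.
    exact: integrable0.
  - exact: (E0 0%N).
  - by rewrite (E0 1%N) subrr mulr0.
  - exact: (E0 2%N).
  - by rewrite (E0 3%N) subrr expr0n/= !mulr0.
have ts0 : 0 < t - s by rewrite subr_gt0.
have sts0 : 0 < Num.sqrt (t - s) by rewrite sqrtr_gt0.
have mX k : measurable_fun setT (fun x : R => x ^+ k) by exact: measurable_funX.
have key k (k4 : (k <= 4)%N) :=
  indep_expectation fF bB s0 st Fz (mX k) iz (integrable_normalX sts0 k4).
have e1 : (Num.sqrt (t - s)) ^+ 2 = t - s by rewrite sqr_sqrtr// ltW.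
split.
- by move=> k k4; have [] := key k k4.
- transitivity (\int[P]_w (z w * (B t w - B s w) ^+ 1)).
    by apply: eq_Rintegral => w _; rewrite expr1.
  have [_ ->] := key 1%N isT; rewrite -[RHS](mulr0 (\int[P]_w z w)); congr (_ * _).
  rewrite -[RHS](normal_mean sts0).
  by apply: eq_Rintegral => w _; rewrite expr1.
- by have [_ ->] := key 2%N isT; rewrite normal_second// e1.
- by have [_ ->] := key 3%N isT; rewrite normal_third// mulr0.
- by have [_ ->] := key 4%N isT; rewrite normal_fourth// -[in RHS]e1 -exprM.
Qed.

Lemma brownian_Fmeas (r : R) : 0 <= r -> Fmeas F r (B r).
Proof. by move=> r0; apply/FmeasP => //; case: bB => aB _ _ _ _; exact: aB. Qed.

Section dsum.
Variables (u : nat -> R) (x : nat -> T -> R).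
Hypotheses (u0 : 0 <= u 0%N) (u_nd : forall i, u i <= u i.+1)
  (Fx : forall i, Fmeas F (u i) (x i))
  (bx : forall i, exists M : R, forall w, `|x i w| <= M).

(** The martingale transform of [B] by [x]. Once the times of a simple integrand are clamped to
    [s, t], the increment of its integral over [s, t] has this form. *)
Definition dsum n (w : T) : R := \sum_(i < n) x i w * (B (u i.+1) w - B (u i) w).

Let uS n : 0 <= u n.
Proof. by elim: n => // n IH; exact: le_trans (u_nd n). Qed.

Let u_mono m n : (m <= n)%N -> u m <= u n.
Proof. by move=> mn; apply: (homo_leq (r := fun a b => a <= b)) => //; exact: le_trans. Qed.

Let dsumS n w : dsum n.+1 w = dsum n w + x n w * (B (u n.+1) w - B (u n) w).
Proof. by rewrite /dsum big_ord_recr. Qed.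

Lemma dsum_Fmeas n : Fmeas F (u n) (dsum n).
Proof.
elim: n => [|n IH].
  have -> : dsum 0 = cst 0 by apply/funext => w; rewrite /dsum big_ord0.
  exact: measurable_cst.
have -> : dsum n.+1 = (fun w => dsum n w + x n w * (B (u n.+1) w - B (u n) w)).
  by apply/funext => w; exact: dsumS.
apply: measurable_funD; first exact: (Fmeas_le fF (uS n) (u_nd n) IH).
apply: measurable_funM; first exact: (Fmeas_le fF (uS n) (u_nd n) (@Fx n)).
apply: measurable_funB; first exact: brownian_Fmeas.
exact: (Fmeas_le fF (uS n) (u_nd n) (@brownian_Fmeas _ (uS n))).
Qed.

Let mdsum n : measurable_fun setT (dsum n).
Proof. exact: (Fmeas_fun fF (uS n) (@dsum_Fmeas n)). Qed.

Let mx n : measurable_fun setT (x n).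
Proof. exact: (Fmeas_fun fF (uS n) (@Fx n)). Qed.

(* The products of powers of [x n] and of [dsum n], whose fourth power is integrable. *)
Let ixS n (z : T -> R) (Mz : R) a b : Fmeas F (u n) z -> (forall w, `|z w| <= Mz) ->
  P.-integrable setT (fun w => (dsum n w ^+ 4)%:E) -> (a <= 4)%N ->
  Fmeas F (u n) (fun w => (z w * x n w ^+ b) * dsum n w ^+ a) /\
  P.-integrable setT (fun w => ((z w * x n w ^+ b) * dsum n w ^+ a)%:E).
Proof.
move=> Fz zM i4 a4; split.
  apply: measurable_funM; first by apply: measurable_funM => //; apply: measurable_funX; exact: Fx.
  by apply: measurable_funX; exact: dsum_Fmeas.
have [M xM] := bx n.
apply: (integrable_bmul (M := Mz * M ^+ b) _ _ (integrable_pow4 (@mdsum n) i4 a4)).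
  apply: measurable_funM; last by apply: measurable_funX; exact: mx.
  exact: (Fmeas_fun fF (uS n) Fz).
by move=> w; rewrite normrM normrX ler_pM// ?exprn_ge0// lerXn2r// nnegrE (le_trans _ (xM w)).
Qed.

Let F1 n : Fmeas F (u n) (cst 1). Proof. exact: measurable_cst. Qed.

Lemma dsum_integrable4 n : P.-integrable setT (fun w => (dsum n w ^+ 4)%:E).
Proof.
elim: n => [|n IH].
  under eq_fun do rewrite /dsum big_ord0 expr0n/=.
  exact: integrable0.
have zM (w : T) : `|cst (1:R) w : R| <= 1 by rewrite normr1.
have h k (k4 : (k <= 4)%N) :
    P.-integrable setT (fun w => (1 * x n w ^+ k * dsum n w ^+ (4 - k) * (B (u n.+1) w - B (u n) w) ^+ k)%:E).
  have [Fk ik] := @ixS n _ _ _ k (@F1 n) zM IH (leq_subr k 4).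
  by have [/(_ k k4)] := brownian_increment_moments (uS n) (u_nd n) Fk ik.
have := integrableD measurableT (h 0%N isT) (integrableD measurableT
  (integrableZl measurableT 4 (h 1%N isT)) (integrableD measurableT
  (integrableZl measurableT 6 (h 2%N isT)) (integrableD measurableT
  (integrableZl measurableT 4 (h 3%N isT)) (h 4%N isT)))).
apply: eq_integrable => // w _ /=; rewrite dsumS -!EFinM -!EFinD; congr EFin.
by rewrite !subn0 /subn/=; ring.
Qed.

Section weight.
Variables (z : T -> R) (Mz : R).
Hypotheses (Fz : Fmeas F (u 0%N) z) (zM : forall w, `|z w| <= Mz).

Let Fzn n : Fmeas F (u n) z.
Proof. exact: (Fmeas_le fF u0 (u_mono (leq0n n)) Fz). Qed.

Lemma dsum_mean n : \int[P]_w (z w * dsum n w) = 0.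
Proof.
elim: n => [|n IH].
  under eq_Rintegral do rewrite /dsum big_ord0 mulr0.
  by rewrite Rintegral_cst// mul0r.
have [_ i0] := @ixS n _ _ 1 0 (@Fzn n) zM (dsum_integrable4 n) isT.
have [F1' i1] := @ixS n _ _ 0 1 (@Fzn n) zM (dsum_integrable4 n) isT.
have [/(_ 1%N isT) j1 e1 _ _ _] := brownian_increment_moments (uS n) (u_nd n) F1' i1.
transitivity (\int[P]_w (z w * x n w ^+ 0 * dsum n w ^+ 1 +
    z w * x n w ^+ 1 * dsum n w ^+ 0 * (B (u n.+1) w - B (u n) w) ^+ 1)).
  by apply: eq_Rintegral => w _; rewrite dsumS; ring.
rewrite RintegralD//; under [X in _ + X]eq_Rintegral do rewrite (expr1 (_ - _)).
rewrite e1 addr0 -[RHS]IH.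
by apply: eq_Rintegral => w _; rewrite expr0 mulr1 expr1.
Qed.

Lemma dsum_second n : \int[P]_w (z w * dsum n w ^+ 2) =
  \sum_(i < n) (\int[P]_w (z w * x i w ^+ 2)) * (u i.+1 - u i).
Proof.
elim: n => [|n IH].
  rewrite big_ord0; under eq_Rintegral do rewrite /dsum big_ord0 expr0n/= mulr0.
  by rewrite Rintegral_cst// mul0r.
rewrite big_ord_recr/= -IH.
have [_ i0] := @ixS n _ _ 2 0 (@Fzn n) zM (dsum_integrable4 n) isT.
have [F1' i1] := @ixS n _ _ 1 1 (@Fzn n) zM (dsum_integrable4 n) isT.
have [F2' i2] := @ixS n _ _ 0 2 (@Fzn n) zM (dsum_integrable4 n) isT.
have [/(_ 1%N isT) j1 e1 _ _ _] := brownian_increment_moments (uS n) (u_nd n) F1' i1.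
have [/(_ 2%N isT) j2 _ e2 _ _] := brownian_increment_moments (uS n) (u_nd n) F2' i2.
have j1' := integrableZl measurableT 2 j1.
transitivity (\int[P]_w ((z w * x n w ^+ 0 * dsum n w ^+ 2) +
    (2 * (z w * x n w ^+ 1 * dsum n w ^+ 1 * (B (u n.+1) w - B (u n) w) ^+ 1) +
     z w * x n w ^+ 2 * dsum n w ^+ 0 * (B (u n.+1) w - B (u n) w) ^+ 2))).
  by apply: eq_Rintegral => w _; rewrite dsumS; ring.
rewrite RintegralD//; last exact: (integrableD measurableT j1' j2).
rewrite RintegralD// RintegralZl//.
under [X in _ + (2 * X + _)]eq_Rintegral do rewrite (expr1 (_ - _)).
rewrite e1 mulr0 add0r e2; congr (_ + _ * _).
  by apply: eq_Rintegral => w _; rewrite expr0 mulr1.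
by apply: eq_Rintegral => w _; rewrite expr0 mulr1.
Qed.

End weight.

(** Induction on n: odd powers of the new increment vanish in expectation. With U the time elapsed
    so far and D the new step, the rest is at most 3 U^2 + 6 U D + 3 D^2 = 3 (U + D)^2, where 6 U D
    uses the second moment bound [S2]. *)
Lemma dsum_fourth n : (forall i w, `|x i w| <= 1) ->
  \int[P]_w (dsum n w ^+ 4) <= 3 * (u n - u 0%N) ^+ 2.
Proof.
move=> x1.
have zM (w : T) : `|cst (1:R) w : R| <= 1 by rewrite normr1.
have x2 i w : x i w ^+ 2 <= 1 by rewrite -real_normK ?num_real// exprn_ile1.
have x4 i w : x i w ^+ 4 <= 1.
  have -> : x i w ^+ 4 = (x i w ^+ 2) ^+ 2 by rewrite -exprM.
  by rewrite exprn_ile1 ?sqr_ge0.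
have S2 m : \int[P]_w (dsum m w ^+ 2) <= u m - u 0%N.
  have := @dsum_second _ _ (@F1 0) zM m; under eq_Rintegral do rewrite /= mul1r.
  move=> ->; rewrite -telescope_sumr// big_mkord; apply: ler_sum => i _.
  rewrite ler_piMl ?subr_ge0//.
  rewrite -[leRHS](Rintegral_prob_cst P 1).
  apply: le_Rintegral => //.
  - apply: (@prob_bounded_integrable _ _ _ P _ 1).
      by apply: measurable_funM => //; apply: measurable_funX; exact: mx.
    by move=> w; rewrite /= mul1r ger0_norm ?sqr_ge0.
  - by apply: finite_measure_integrable_cst.
  - by move=> w _; rewrite /= mul1r.
elim: n => [|n IH].
  under eq_Rintegral do rewrite /dsum big_ord0 expr0n/=.
  by rewrite Rintegral_cst// mul0r subrr expr0n/= mulr0.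
have [_ i0] := @ixS n _ _ 4 0 (@F1 n) zM (dsum_integrable4 n) isT.
have [F1' i1] := @ixS n _ _ 3 1 (@F1 n) zM (dsum_integrable4 n) isT.
have [F2' i2] := @ixS n _ _ 2 2 (@F1 n) zM (dsum_integrable4 n) isT.
have [F3' i3] := @ixS n _ _ 1 3 (@F1 n) zM (dsum_integrable4 n) isT.
have [F4' i4] := @ixS n _ _ 0 4 (@F1 n) zM (dsum_integrable4 n) isT.
have [/(_ 1%N isT) j1 e1 _ _ _] := brownian_increment_moments (uS n) (u_nd n) F1' i1.
have [/(_ 2%N isT) j2 _ e2 _ _] := brownian_increment_moments (uS n) (u_nd n) F2' i2.
have [/(_ 3%N isT) j3 _ _ e3 _] := brownian_increment_moments (uS n) (u_nd n) F3' i3.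
have [/(_ 4%N isT) j4 _ _ _ e4] := brownian_increment_moments (uS n) (u_nd n) F4' i4.
have j1' := integrableZl measurableT 4 j1.
have j2' := integrableZl measurableT 6 j2.
have j3' := integrableZl measurableT 4 j3.
have j34 := integrableD measurableT j3' j4.
have j234 := integrableD measurableT j2' j34.
have j1234 := integrableD measurableT j1' j234.
set D := fun w => B (u n.+1) w - B (u n) w.
have -> : \int[P]_w (dsum n.+1 w ^+ 4) = \int[P]_w ((1 * x n w ^+ 0 * dsum n w ^+ 4) +
    (4 * (1 * x n w ^+ 1 * dsum n w ^+ 3 * D w ^+ 1) +
    (6 * (1 * x n w ^+ 2 * dsum n w ^+ 2 * D w ^+ 2) +
    (4 * (1 * x n w ^+ 3 * dsum n w ^+ 1 * D w ^+ 3) +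
     1 * x n w ^+ 4 * dsum n w ^+ 0 * D w ^+ 4)))).
  by apply: eq_Rintegral => w _; rewrite dsumS /D; ring.
rewrite RintegralD// RintegralD// RintegralD// RintegralD// !RintegralZl//.
under [X in _ + (4 * X + _)]eq_Rintegral do rewrite (expr1 (D _)).
rewrite /D e1 e2 e3 e4.
have b0 : \int[P]_w (1 * x n w ^+ 0 * dsum n w ^+ 4) <= 3 * (u n - u 0%N) ^+ 2.
  by under eq_Rintegral do rewrite expr0 mulr1 mul1r.
have b2 : \int[P]_w (1 * x n w ^+ 2 * dsum n w ^+ 2) <= u n - u 0%N.
  apply: le_trans (S2 n); apply: le_Rintegral => //.
    exact: (integrable_pow4 (@mdsum n) (dsum_integrable4 n)).
  by move=> w _; rewrite mul1r ler_piMl ?sqr_ge0.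
have b4 : \int[P]_w (1 * x n w ^+ 4 * dsum n w ^+ 0) <= 1.
  rewrite -[leRHS](Rintegral_prob_cst P 1).
  apply: le_Rintegral => //.
  - by apply: finite_measure_integrable_cst.
  - by move=> w _; rewrite expr0 mulr1 mul1r.
have d0 : 0 <= u n.+1 - u n by rewrite subr_ge0.
move: b0 b2 b4; set b0' := \int[P]_w _; set b2' := \int[P]_w _; set b4' := \int[P]_w _ => b0 b2 b4.
have c2 := ler_wpM2r d0 b2.
have c4 : b4' * (3 * (u n.+1 - u n) ^+ 2) <= 3 * (u n.+1 - u n) ^+ 2.
  by rewrite ler_piMl// mulr_ge0 ?sqr_ge0.
rewrite !mulr0; nra.
Qed.

End dsum.
End brownian_moments.

(** * Time integrals of measurable processes *)

Section joint_measurability.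
Context d (T : measurableType d) (R : realType).
Notation RT := (measurableTypeR R * T)%type.

Definition joint_measurable (q : R -> T -> R) :=
  measurable_fun [set: RT] (fun z : RT => q z.1 z.2).

Lemma continuous_joint_measurable (Y : R -> T -> R) :
  (forall r, measurable_fun setT (Y r)) -> (forall w, continuous (Y ^~ w)) ->
  joint_measurable Y.
Proof.
move=> mY cY.
pose fl (n : nat) (r : R) : R := (Num.floor (r * n.+1%:R))%:~R / n.+1%:R.
have fl_cvg r : fl n r @[n --> \oo] --> r.
  apply: (@squeeze_cvgr _ _ _ _ (fun n => r - n.+1%:R^-1) (cst r)).
  - near=> n; have n0 : 0 < (n.+1%:R : R) by rewrite ltr0n.
    rewrite /fl ler_pdivlMr// ler_pdivrMr//= floor_le// andbT.
    rewrite mulrBl mulVf ?gt_eqF// lerBlDr.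
    by have := @floorD1_gt R (r * n.+1%:R); rewrite intrD => /ltW.
  - rewrite -[X in _ --> X]subr0; apply: cvgB; first exact: cvg_cst.
    exact: cvg_harmonic.
  - exact: cvg_cst.
apply: (@measurable_fun_cvg _ RT R setT (fun n z => Y (fl n z.1) z.2)); last first.
  by move=> z _; apply: (@continuous_cvg _ _ _ _ _ _ (fun r => Y r z.2)); [exact: cY|exact: fl_cvg].
move=> n _ A mA; rewrite setTI.
have -> : (fun z : RT => Y (fl n z.1) z.2) @^-1` A =
  \bigcup_(k : int) ([set r : measurableTypeR R | Num.floor (r * n.+1%:R) = k] `*`
     (Y (k%:~R / n.+1%:R) @^-1` A)).
  apply/seteqP; split => [z Az|z [k _ [/= <-]]//].
  by exists (Num.floor (z.1 * n.+1%:R)).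
apply: countable_bigcupT_measurable; first exact: countableP.
move=> k; apply: measurableX.
  rewrite (_ : [set r : measurableTypeR R | _] = `[k%:~R / n.+1%:R, (k + 1)%:~R / n.+1%:R[%classic); first exact: measurable_itv.
  have n0 : 0 < (n.+1%:R : R) by rewrite ltr0n.
  apply/seteqP; split => r /=; rewrite in_itv/= ler_pdivrMr// ltr_pdivlMr//.
    by move=> <-; rewrite floor_le floorD1_gt.
  by move=> h; apply/eqP; rewrite floor_eq.
by rewrite -[X in measurable X]setTI; exact: mY.
Unshelve. all: by end_near. Qed.

(** Paths are continuous on [0, +oo[ only; freezing them before time 0 gives the continuity on the
    whole line that [continuous_joint_measurable] asks for. *)
Lemma continuous_path_extend (f : R -> R) : {within `[0, +oo[, continuous f} ->
  continuous (fun r : R => f (Num.max r 0)).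
Proof.
move/continuous_within_itvcyP => [cf f0] x.
have [x0|x0|->] := ltgtP x 0.
- apply: cvg_near_cst; near=> r; rewrite !max_r// ltW//.
  by near: r; exact: lt_nbhsl.
- rewrite /continuous_at (max_l (ltW x0)).
  apply: (@cvg_trans _ (f r @[r --> x])).
    apply: near_eq_cvg; near=> r; rewrite max_l// ltW//.
    by near: r; exact: lt_nbhsr.
  by apply: cf; rewrite in_itv/= x0.
- rewrite /continuous_at maxxx; apply/cvgrPdist_lt => e e0.
  move/cvgrPdist_lt : f0 => /(_ e e0); rewrite near_withinE => h.
  near=> r; case: (leP r 0) => r0; first by rewrite subrr normr0.
  by move: r0; near: r; exact: h.
Unshelve. all: by end_near. Qed.

Lemma joint_measurable_comp (Y : R -> T -> R) (g : R -> R) :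
  measurable_fun setT g -> joint_measurable Y -> joint_measurable (fun r w => g (Y r w)).
Proof. by move=> mg mY; exact: measurableT_comp. Qed.

Lemma joint_measurable_sec (q : R -> T -> R) w : joint_measurable q ->
  measurable_fun setT (q ^~ w).
Proof. by move=> mq; apply: (measurable_fun_pair1 (f := fun z : RT => q z.1 z.2)). Qed.

Lemma joint_measurable_sec2 (q : R -> T -> R) r : joint_measurable q ->
  measurable_fun setT (q r).
Proof. by move=> mq; apply: (measurable_fun_pair2 (f := fun z : RT => q z.1 z.2)). Qed.

End joint_measurability.

Section time_integral.
Context d (T : measurableType d) (R : realType).
Notation leb := (@lebesgue_measure R).
Notation RT := (measurableTypeR R * T)%type.
Variables (q : R -> T -> R) (M : R).
Hypotheses (mq : joint_measurable q) (qM : forall r w, `|q r w| <= M).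

Lemma lebesgue_itvcc_lty (s t : R) : (leb `[s, t] < +oo)%E.
Proof.
rewrite lebesgue_measure_itv/=; case: ifPn => _; last by rewrite ltry.
by rewrite -EFinB ltry.
Qed.

Lemma fine_lebesgue_itvcc (s t : R) : s <= t -> fine (leb `[s, t]) = t - s.
Proof.
move=> st; rewrite lebesgue_measure_itv/= lte_fin; case: ltgtP st => //= -> _.
by rewrite subrr.
Qed.

Lemma time_integrable (s t : R) w : leb.-integrable `[s, t] (EFin \o q ^~ w).
Proof.
apply: (bounded_integrable _ (lebesgue_itvcc_lty s t) (M := M)) => //.
by apply: measurable_funTS; exact: joint_measurable_sec.
Qed.

Lemma time_integral_bound (s t : R) w : s <= t ->
  `|\int[leb]_(r in `[s, t]) q r w| <= M * (t - s).
Proof.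
move=> st; rewrite -fine_lebesgue_itvcc//; apply: Rintegral_le_bound => //.
- exact: lebesgue_itvcc_lty.
- by apply: measurable_funTS; exact: joint_measurable_sec.
Qed.

Lemma time_integral_split (s u t : R) w : s <= u -> u <= t ->
  \int[leb]_(r in `[s, t]) q r w =
  \int[leb]_(r in `[s, u]) q r w + \int[leb]_(r in `[u, t]) q r w.
Proof.
move=> su ut.
have := @Rintegral_itvB R (q ^~ w) (BLeft s) (BRight t) u (time_integrable s t w).
rewrite !bnd_simp => /(_ su ut).
rewrite Rintegral_itv_obnd_cbnd; last first.
  by apply: integrableS (time_integrable u t w) => //; apply: subset_itvr; rewrite bnd_simp.
by move=> <-; rewrite addrC subrK.
Qed.

Lemma time_integral_measurable (s t : R) :
  measurable_fun setT (fun w => \int[leb]_(r in `[s, t]) q r w).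
Proof.
(* Adding [M] makes the integrand nonnegative for Tonelli; its contribution is subtracted again at
   the end. *)
pose g (z : RT) : \bar R := ((q z.1 z.2 + M) * \1_(`[s, t]) z.1)%:E.
have mg : measurable_fun setT g.
  apply/measurable_EFinP; apply: measurable_funM; first exact: measurable_funD.
  by apply: measurableT_comp => //; exact: measurable_indic.
have g0 z : (0 <= g z)%E.
  rewrite lee_fin mulr_ge0// -lerBlDr sub0r.
  by have := qM z.1 z.2; rewrite ler_norml => /andP[].
have := measurable_fun_fubini_tonelli_G (m1 := leb) g mg g0.
move=> h; have mh : measurable_fun setT (fun w => fine (fubini_G leb g w) - M * fine (leb `[s, t])).
  by apply: measurable_funB => //; apply: measurableT_comp => //; exact: fine_measurable.
apply: eq_measurable_fun mh => w _.
rewrite /fubini_G /g -/(Rintegral leb setT (fun r => (q r w + M) * \1_(`[s, t]) r)).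
have -> : \int[leb]_r ((q r w + M) * \1_(`[s, t]) r) = \int[leb]_(r in `[s, t]) (q r w + M).
  rewrite [RHS]Rintegral_mkcond; apply: eq_Rintegral => r _.
  by rewrite patchE indicE; case: ifPn => _; rewrite ?mulr1 ?mulr0.
rewrite RintegralD//; last 2 first.
- exact: time_integrable.
- apply: (@bounded_integrable _ _ _ leb `[s, t] _ (lebesgue_itvcc_lty s t) (cst M) `|M|) => //.
by rewrite Rintegral_cst// addrK.
Qed.

Lemma time_integral_Fubini (P : probability T R) (s t : R) :
  \int[P]_w (\int[leb]_(r in `[s, t]) q r w) = \int[leb]_(r in `[s, t]) (\int[P]_w q r w).
Proof.
pose g (z : RT) : \bar R := (q z.1 z.2 * \1_(`[s, t]) z.1)%:E.
have mg : measurable_fun setT g.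
  apply/measurable_EFinP; apply: measurable_funM => //.
  by apply: measurableT_comp => //; exact: measurable_indic.
have M0 : 0 <= `|M| by [].
have ig : (leb \x P)%E.-integrable setT g.
  apply/integrable12ltyP => //.
  apply: (@le_lt_trans _ _ (\int[leb]_r ((`|M| * \1_(`[s, t]) r)%:E))%E).
    apply: ge0_le_integral => //.
    - by move=> r _; exact: integral_ge0.
    - apply: (measurable_fun_fubini_tonelli_F (m2 := P) (fun z => `|g z|%E)) => //.
      exact: measurableT_comp.
    - by apply/measurable_EFinP; apply: measurable_funM => //; exact: measurable_indic.
    - move=> r _; rewrite -[leRHS](mule1 _) -(probability_setT P) -integral_cst//; last first.
      apply: ge0_le_integral => //.
      + by apply: measurableT_comp => //; apply: measurableT_comp mg _; exact: pair1_measurable.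
      + move=> w _; rewrite /g/= lee_fin normrM (@ger0_norm _ (\1__ _))// ler_wpM2r//.
        by rewrite (le_trans (qM _ _))// ler_norm.
  under eq_integral do rewrite EFinM.
  rewrite ge0_integralZl//; last by apply/measurable_EFinP; exact: measurable_indic.
  rewrite integral_indic// setIT lte_mul_pinfty//; exact: lebesgue_itvcc_lty.
have gr r : (\int[P]_w g (r, w))%E = ((\int[P]_w q r w) * \1_(`[s, t]) r)%:E.
  rewrite /g/= EFinM /Rintegral fineK; last first.
    apply: integrable_fin_num => //; apply: (@prob_bounded_integrable _ _ _ P _ M) => //.
    exact: joint_measurable_sec2.
  under [LHS]eq_integral do rewrite EFinM.
  rewrite integralZr//; apply: (@prob_bounded_integrable _ _ _ P _ M) => //.
  exact: joint_measurable_sec2.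
have gw w : (\int[leb]_r g (r, w))%E = (\int[leb]_(r in `[s, t]) q r w)%:E.
  rewrite /g/= /Rintegral fineK; last first.
    apply: integrable_fin_num => //; exact: time_integrable.
  rewrite [RHS]integral_mkcond; apply: eq_integral => r _.
  by rewrite patchE indicE; case: ifPn => _; rewrite ?mulr1 ?mulr0.
have := Fubini ig.
under eq_integral do rewrite gr; under [RHS]eq_integral do rewrite gw.
rewrite [in RHS]/Rintegral => h.
rewrite [LHS]/Rintegral -h [RHS]Rintegral_mkcond /Rintegral; congr fine.
apply: eq_integral => r _.
by rewrite patchE indicE; case: ifPn => _; rewrite ?mulr1 ?mulr0.
Qed.

Lemma expectation_measurable (P : probability T R) :
  measurable_fun setT (fun r => \int[P]_w q r w).
Proof.
pose g (z : RT) : \bar R := (q z.1 z.2 + M)%:E.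
have mg : measurable_fun setT g.
  by apply/measurable_EFinP; exact: measurable_funD.
have g0 z : (0 <= g z)%E.
  rewrite lee_fin -lerBlDr sub0r.
  by have := qM z.1 z.2; rewrite ler_norml => /andP[].
have := measurable_fun_fubini_tonelli_F (m2 := P) g mg g0.
move=> h; have mh : measurable_fun setT (fun r => fine (fubini_F P g r) - M).
  by apply: measurable_funB => //; apply: measurableT_comp => //; exact: fine_measurable.
apply: eq_measurable_fun mh => r _.
rewrite /fubini_F /g -/(Rintegral P setT (fun w => q r w + M)) RintegralD//.
- by rewrite Rintegral_prob_cst addrK.
- by apply: (@prob_bounded_integrable _ _ _ P _ M) => //; exact: joint_measurable_sec2.
- exact: (@prob_bounded_integrable _ _ _ P (cst M) `|M|).
Qed.

End time_integral.

Ltac case_minmax := repeat match goal with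
  | |- context[Order.min ?a ?b] => is_var a; is_var b; case: (leP a b) => ?
  | |- context[Order.max ?a ?b] => is_var a; is_var b; case: (leP a b) => ?
  | |- context[(?a < ?b)%O] => is_var a; is_var b; case: (ltP a b) => ?
  end.

(** * Moments of the increments of Ito integrals *)

Section clamped_intervals.
Context (R : realType).
Notation leb := (@lebesgue_measure R).
Implicit Types (s t a b : R).

Definition clamp s t a : R := Num.max s (Num.min a t).

Lemma clamp_homo s t a b : a <= b -> clamp s t a <= clamp s t b.
Proof.
by move=> ab; rewrite /clamp; case_minmax; lra.
Qed.

Lemma clamp_ge s t a : s <= clamp s t a.
Proof. by rewrite /clamp le_max lexx. Qed.

Lemma clamp_le s t a : s <= t -> clamp s t a <= t.
Proof. by move=> st; rewrite /clamp ge_max st ge_min lexx orbT. Qed.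

Lemma Rintegral_itvoc s t a b : s <= t -> a <= b ->
  \int[leb]_(r in `[s, t]) \1_(`]a, b]) r = clamp s t b - clamp s t a.
Proof.
move=> st ab; rewrite /Rintegral integral_indic//=.
have [as_|sa] := ltP a s.
  have -> : `]a, b] `&` `[s, t] = `[s, Num.min b t]%classic.
    apply/seteqP; split => r /=; rewrite !in_itv/= le_min.
      by case=> /andP[_ ->] /andP[-> ->].
    by move=> /andP[sr /andP[-> ->]]; rewrite sr (lt_le_trans as_ sr).
  have -> : clamp s t a = s by rewrite /clamp max_l// ge_min (ltW as_).
  rewrite lebesgue_measure_itv/= lte_fin /clamp; case: (leP b t) => bt.
    by case: (leP s b) => sb; case: ltP => sb' /=; lra.
  by rewrite max_r//; case: ltP => st' /=; lra.
have -> : `]a, b] `&` `[s, t] = `]a, Num.min b t]%classic.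
  apply/seteqP; split => r /=; rewrite !in_itv/= le_min.
    by case=> /andP[-> ->] /andP[_ ->].
  by move=> /andP[ar /andP[-> ->]]; rewrite ar (le_trans sa (ltW ar)).
have -> : clamp s t b = Num.min b t by rewrite /clamp max_r// le_min (le_trans sa ab).
rewrite lebesgue_measure_itv/= lte_fin; case: (leP a t) => at_.
  rewrite /clamp (min_l at_) (max_r sa); case: (leP b t) => bt; case: ltP => h /=; lra.
have -> : clamp s t a = t by rewrite /clamp (min_r (ltW at_)) max_r.
by rewrite (min_r (le_trans (ltW at_) ab)) ltNge (ltW at_)/= subrr.
Qed.

(** The intervals are disjoint, so at most one term of the sum survives at [r]; when none does, both
    sides are 0 because [phi 0 = 0]. *)
Lemma step_function_comp (tau c : nat -> R) n (phi : R -> R) (r : R) :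
  (forall i, tau i <= tau i.+1) -> phi 0 = 0 ->
  phi (\sum_(i < n) c i * \1_(`]tau i, tau i.+1]) r) =
  \sum_(i < n) phi (c i) * \1_(`]tau i, tau i.+1]) r.
Proof.
move=> tau_nd phi0; elim: n => [|n IH]; first by rewrite !big_ord0.
rewrite !big_ord_recr/=; have [rn|rn] := boolP (r \in `]tau n, tau n.+1]).
  have z i : (i < n)%N -> \1_(`]tau i, tau i.+1]) r = 0 :> R.
    move=> i_n; rewrite indicE memNset//= in_itv/=; apply/negP; rewrite negb_and -!ltNge -leNgt.
    move: rn; rewrite in_itv/= => /andP[rn _].
    apply/orP; right; apply: le_lt_trans rn.
    by apply: (homo_leq (r := fun a b => a <= b)) => //; exact: le_trans.
  rewrite !big1 ?add0r; last 2 first.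
  - by move=> i _; rewrite z ?mulr0.
  - by move=> i _; rewrite z ?mulr0.
  by rewrite indicE mem_set//= !mulr1.
by rewrite indicE memNset ?mulr0 ?addr0 ?IH//; exact/negP.
Qed.

Lemma step_function_measurable (tau c : nat -> R) n :
  measurable_fun setT (fun r : R => \sum_(i < n) c i * \1_(`]tau i, tau i.+1]) r : R).
Proof.
by apply: measurable_sum => i; apply: measurable_funM.
Qed.

Lemma Rintegral_step_function (tau c : nat -> R) n s t : s <= t ->
  (forall i, tau i <= tau i.+1) ->
  \int[leb]_(r in `[s, t]) (\sum_(i < n) c i * \1_(`]tau i, tau i.+1]) r) =
  \sum_(i < n) c i * (clamp s t (tau i.+1) - clamp s t (tau i)).
Proof.
move=> st tau_nd.
have ii i : leb.-integrable `[s, t] (fun r => (\1_(`]tau i, tau i.+1]) r)%:E).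
  apply: (bounded_integrable _ (lebesgue_itvcc_lty s t) (M := 1)) => //.
  by move=> r _; rewrite indicE; case: (_ \in _); rewrite ?normr1 ?normr0.
elim: n => [|n IH].
  rewrite big_ord0; under eq_Rintegral do rewrite big_ord0.
  by rewrite Rintegral_cst// mul0r.
under eq_Rintegral do rewrite big_ord_recr/=.
rewrite big_ord_recr/= RintegralD//; last 2 first.
- apply: (bounded_integrable _ (lebesgue_itvcc_lty s t) (M := \sum_(i < n) `|c i|)) => //.
    by apply: measurable_funTS; exact: step_function_measurable.
  move=> r _; apply: le_trans (ler_norm_sum _ _ _) _; apply: ler_sum => i _.
  rewrite normrM ler_piMr// indicE; case: (_ \in _); by rewrite ?normr1 ?normr0.
- apply: (bounded_integrable _ (lebesgue_itvcc_lty s t) (M := `|c n|)) => //.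
    by apply: measurable_funTS; apply: measurable_funM.
  by move=> r _; rewrite normrM ler_piMr// indicE; case: (_ \in _); rewrite ?normr1 ?normr0.
rewrite IH; congr (_ + _); rewrite RintegralZl//; last exact: (@ii n).
by congr (_ * _); exact: Rintegral_itvoc.
Qed.

End clamped_intervals.

Lemma Rintegral_sum_ord d (T : measurableType d) (R : realType)
    (mu : {measure set T -> \bar R}) n (f : nat -> T -> R) :
  (forall i, (i < n)%N -> mu.-integrable setT (EFin \o f i)) ->
  mu.-integrable setT (fun x => (\sum_(i < n) f i x)%:E) /\
  \int[mu]_x (\sum_(i < n) f i x) = \sum_(i < n) \int[mu]_x f i x.
Proof.
elim: n => [|n IH] fi.
  split; first by under eq_fun do rewrite big_ord0; exact: integrable0.
  by rewrite big_ord0; under eq_Rintegral do rewrite big_ord0; rewrite Rintegral_cst// mul0r.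
have [i1 e1] := IH (fun i i_n => fi i (ltnW i_n)).
split.
  under eq_fun do rewrite big_ord_recr/=.
  exact: (integrableD measurableT i1 (fi n (leqnn _))).
under eq_Rintegral do rewrite big_ord_recr/=.
rewrite RintegralD//; last exact: (fi n (leqnn _)).
by rewrite e1 big_ord_recr.
Qed.

Section simple_integrands.
Context d (T : measurableType d) (R : realType).
Notation leb := (@lebesgue_measure R).
Variables (P : probability T R) (F : R -> set_system T) (B : R -> T -> R).
Hypotheses (fF : filtration F) (bB : brownian_motion P F B).
Implicit Types K : simple_integrand F.

Lemma si_time_ge0' K i : 0 <= si_time K i.
Proof.
elim: i => [|i IH]; first exact: si_time_ge0.
by rewrite (le_trans IH)//; exact: si_time_nd.
Qed.

Lemma si_coef_Fmeas K i : Fmeas F (si_time K i) (si_coef K i).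
Proof. by apply/(FmeasP fF _ (si_time_ge0' K i)); exact: si_coef_meas. Qed.

Lemma si_coef_measurable K i : measurable_fun setT (si_coef K i).
Proof. exact: (Fmeas_fun fF (si_time_ge0' K i) (@si_coef_Fmeas K i)). Qed.

Lemma si_val_joint K : joint_measurable (si_val K).
Proof.
rewrite /joint_measurable /si_val; apply: measurable_sum => i.
apply: measurable_funM.
- by apply: measurableT_comp => //; exact: si_coef_measurable.
- by apply: measurableT_comp => //; exact: measurable_indic.
Qed.

Lemma si_val_bounded K : exists M : R, forall r w, `|si_val K r w| <= M.
Proof.
have /choice[M MP] := @si_coef_bnd _ _ _ _ K.
exists (\sum_(i < si_size K) M i) => r w.
apply: le_trans (ler_norm_sum _ _ _) _; apply: ler_sum => i _.
rewrite normrM -[leRHS]mulr1 ler_pM// indicE; case: (_ \in _); by rewrite ?normr1 ?normr0.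
Qed.

Section increments.
Variables (K : simple_integrand F) (s t : R).
Hypotheses (s0 : 0 <= s) (st : s <= t).

Let u i := clamp s t (si_time K i).
(** A coefficient fixed after time t is not measurable at the clamped time, which is then at most
    max(s, t) and too early. It is replaced by 0, harmlessly, since the clamped interval it
    multiplies is reduced to a point. *)
Let x i w := if si_time K i <= t then si_coef K i w else 0.
Let n := si_size K.

Let u0 : 0 <= u 0%N. Proof. exact: le_trans (clamp_ge _ _ _). Qed.
Let u_nd i : u i <= u i.+1. Proof. exact/clamp_homo/si_time_nd. Qed.

Let u_flat i : ~~ (si_time K i <= t) -> u i.+1 = u i.
Proof.
rewrite -ltNge => ti; have ti1 := lt_le_trans ti (@si_time_nd _ _ _ _ K i).
by rewrite /u /clamp !min_r// ltW.
Qed.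

Let Fx i : Fmeas F (u i) (x i).
Proof.
rewrite /x; case: (boolP (si_time K i <= t)) => tau; last exact: measurable_cst.
apply: (Fmeas_le fF (si_time_ge0' K i) _ (@si_coef_Fmeas K i)).
by rewrite /u /clamp min_l// le_max lexx orbT.
Qed.

Let bx i : exists M : R, forall w, `|x i w| <= M.
Proof.
have [M MP] := @si_coef_bnd _ _ _ _ K i; exists M => w.
rewrite /x; case: ifPn => _; first exact: MP.
by rewrite normr0 (le_trans _ (MP w)).
Qed.

Lemma si_increment w : si_integral K B t w - si_integral K B s w = dsum B u x n w.
Proof.
rewrite /si_integral /dsum -sumrB; apply: eq_bigr => i _.
have cl a : B (Num.min a t) w - B (Num.min a s) w = B (clamp s t a) w - B s w.
  rewrite /clamp; case: (leP a s) => as_.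
    by rewrite min_l ?(le_trans as_)// max_l// !subrr.
  by rewrite max_r// le_min (ltW as_) st.
transitivity (si_coef K i w * (B (u i.+1) w - B (u i) w)).
  rewrite -mulrBr; congr (_ * _).
  by have := cl (si_time K i.+1); have := cl (si_time K i); rewrite /u; lra.
rewrite /x; case: ifPn => // tau; rewrite u_flat// subrr !mulr0//.
Qed.

Lemma si_val_time_integral (phi : R -> R) w : phi 0 = 0 ->
  \int[leb]_(r in `[s, t]) phi (si_val K r w) =
  \sum_(i < n) phi (x i w) * (u i.+1 - u i).
Proof.
move=> phi0.
transitivity (\int[leb]_(r in `[s, t])
    (\sum_(i < n) phi (si_coef K i w) * \1_(`]si_time K i, si_time K i.+1]) r)).
  apply: eq_Rintegral => r _.
  exact: (step_function_comp (fun i => si_coef K i w) _ _ (@si_time_nd _ _ _ _ K) phi0).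
rewrite (Rintegral_step_function (fun i => phi (si_coef K i w)))//; last exact: si_time_nd.
apply: eq_bigr => i _; rewrite /x -/(u _) -/(u _); case: ifPn => // tau.
by rewrite u_flat// subrr !mulr0.
Qed.

Lemma si_increment_measurable :
  measurable_fun setT (fun w => si_integral K B t w - si_integral K B s w).
Proof.
have := Fmeas_fun fF (le_trans u0 (homo_leq (r := fun a b => a <= b) lexx (fun _ _ _ => @le_trans _ _ _ _ _) u_nd (leq0n n))) (dsum_Fmeas fF bB u0 u_nd Fx (n := n)).
by apply: eq_measurable_fun => w _; rewrite si_increment.
Qed.

Lemma si_increment_integrable4 :
  P.-integrable setT (fun w => ((si_integral K B t w - si_integral K B s w) ^+ 4)%:E).
Proof.
have := dsum_integrable4 fF bB u0 u_nd Fx bx n.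
by apply: eq_integrable => // w _; rewrite si_increment.
Qed.

Section weight.
Variables (z : T -> R) (Mz : R).
Hypotheses (Fz : Fmeas F s z) (zM : forall w, `|z w| <= Mz).

Let Fzu : Fmeas F (u 0%N) z.
Proof. by apply: (Fmeas_le fF s0 _ Fz); exact: clamp_ge. Qed.

Lemma si_increment_mean :
  \int[P]_w (z w * (si_integral K B t w - si_integral K B s w)) = 0.
Proof.
rewrite -[RHS](dsum_mean fF bB u0 u_nd Fx bx Fzu zM n).
by apply: eq_Rintegral => w _; rewrite si_increment.
Qed.

Lemma si_increment_second :
  \int[P]_w (z w * (si_integral K B t w - si_integral K B s w) ^+ 2) =
  \int[P]_w (z w * \int[leb]_(r in `[s, t]) (si_val K r w) ^+ 2).
Proof.
transitivity (\int[P]_w (z w * dsum B u x n w ^+ 2)).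
  by apply: eq_Rintegral => w _; rewrite si_increment.
rewrite (dsum_second fF bB u0 u_nd Fx bx Fzu zM n).
have mx i : measurable_fun setT (x i).
  by rewrite /x; case: (boolP (si_time K i <= t)) => _ //; exact: si_coef_measurable.
have mz : measurable_fun setT z := Fmeas_fun fF s0 Fz.
have iz i : P.-integrable setT (EFin \o (fun w => z w * x i w ^+ 2)).
  have [M xM] := bx i.
  apply: (@prob_bounded_integrable _ _ _ P _ (Mz * M ^+ 2)).
    by apply: measurable_funM => //; exact: measurable_funX.
  by move=> w; rewrite normrM normrX ler_pM// ?exprn_ge0// lerXn2r// nnegrE (le_trans _ (xM w)).
have iz' i : P.-integrable setT (EFin \o (fun w => z w * x i w ^+ 2 * (u i.+1 - u i))).
  by have := integrableZr measurableT (u i.+1 - u i) (iz i).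
transitivity (\int[P]_w (\sum_(i < n) z w * x i w ^+ 2 * (u i.+1 - u i))).
  rewrite (Rintegral_sum_ord (fun i _ => iz' i)).2; apply: eq_bigr => i _.
  by rewrite RintegralZr//; exact: iz.
apply: eq_Rintegral => w _.
rewrite (si_val_time_integral (phi := fun y => y ^+ 2)) ?expr0n//= mulr_sumr.
by apply: eq_bigr => i _; rewrite mulrA.
Qed.

End weight.

Lemma si_increment_fourth : (forall i w, `|si_coef K i w| <= 1) ->
  \int[P]_w ((si_integral K B t w - si_integral K B s w) ^+ 4) <= 3 * (t - s) ^+ 2.
Proof.
move=> c1; have x1 i w : `|x i w| <= 1.
  by rewrite /x; case: ifPn => // _; rewrite normr0.
have := dsum_fourth fF bB u0 u_nd Fx bx n x1.
under eq_Rintegral do rewrite -si_increment.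
move=> /le_trans; apply; rewrite ler_wpM2l// lerXn2r// ?nnegrE ?subr_ge0//.
- exact/(homo_leq (r := fun a b => a <= b) lexx (fun _ _ _ => @le_trans _ _ _ _ _) u_nd).
- by rewrite lerB// ?clamp_le// clamp_ge.
Qed.

End increments.
End simple_integrands.

Section expectation_bounds.
Context d (T : measurableType d) (R : realType) (P : probability T R).

Lemma expectation_affine (a b c : R) (f g : T -> R) :
  P.-integrable setT (EFin \o f) -> P.-integrable setT (EFin \o g) ->
  P.-integrable setT (EFin \o (fun w => a + b * f w + c * g w)) /\
  \int[P]_w (a + b * f w + c * g w) = a + b * (\int[P]_w f w) + c * (\int[P]_w g w).
Proof.
move=> fi gi.
have ia : P.-integrable setT (EFin \o cst a) by apply: finite_measure_integrable_cst.
have ib : P.-integrable setT (EFin \o (fun w => b * f w)) := integrableZl measurableT b fi.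
have ic : P.-integrable setT (EFin \o (fun w => c * g w)) := integrableZl measurableT c gi.
have iab : P.-integrable setT (EFin \o (fun w => a + b * f w)) := integrableD measurableT ia ib.
split; first exact: (integrableD measurableT iab ic).
rewrite RintegralD// RintegralD// !RintegralZl//; congr (_ + _ + _).
exact: Rintegral_prob_cst.
Qed.

Lemma expectation_affine_le (a b c : R) (f g h : T -> R) :
  P.-integrable setT (EFin \o f) -> P.-integrable setT (EFin \o g) ->
  measurable_fun setT h -> (forall w, `|h w| <= a + b * f w + c * g w) ->
  P.-integrable setT (EFin \o h) /\
  `|\int[P]_w h w| <= a + b * (\int[P]_w f w) + c * (\int[P]_w g w).
Proof.
move=> fi gi mh hle; have [i e] := expectation_affine a b c fi gi.
have hi : P.-integrable setT (EFin \o h).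
  apply: (le_integrable measurableT _ _ i); first exact/measurable_EFinP.
  by move=> w _ /=; rewrite lee_fin (le_trans (hle w))// ler_norm.
split => //; rewrite -e; apply: le_trans (le_normr_Rintegral measurableT hi) _.
apply: le_Rintegral => //; exact: (integrable_norm hi).
Qed.

End expectation_bounds.

(** Young's inequality applied to 2 |a| |a - b|. In the uses, [k] is fixed first and the second
    moment of a - b is then made small compared with it. *)
Lemma sqr_gap (R : realFieldType) (a b k : R) : 0 < k ->
  `|a ^+ 2 - b ^+ 2| <= k * a ^+ 2 + (1 + k^-1) * (a - b) ^+ 2.
Proof.
move=> k0; have h1 : 2 * `|a| * `|a - b| <= k * a ^+ 2 + k^-1 * (a - b) ^+ 2.
  have -> : k * a ^+ 2 + k^-1 * (a - b) ^+ 2 = ((k * `|a|) ^+ 2 + `|a - b| ^+ 2) / k.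
    by rewrite exprMn !real_normK ?num_real//; field; rewrite gt_eqF.
  by rewrite ler_pdivlMr//; have := sqr_ge0 (k * `|a| - `|a - b|); nra.
have -> : a ^+ 2 - b ^+ 2 = 2 * a * (a - b) - (a - b) ^+ 2 by ring.
apply: le_trans (ler_normB _ _) _; rewrite (ger0_norm (sqr_ge0 _)) 2!normrM normr_nat.
by rewrite mulrDl mul1r; lra.
Qed.

Lemma sqrB_le (R : realFieldType) (a b : R) : (a - b) ^+ 2 <= 2 * a ^+ 2 + 2 * b ^+ 2.
Proof. by have := sqr_ge0 (a + b); nra. Qed.

Lemma double_bound (R : realFieldType) (e x y u : R) :
  `|x| <= 0 + 2 * y + 2 * u -> y <= e -> u <= e -> x <= 4 * e.
Proof. by have := ler_norm x; lra. Qed.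

Lemma sixteenth_le (R : realFieldType) (e : R) : 0 < e -> e / 16 <= e.
Proof. by lra. Qed.

(** Here [a] stands for min(u, N). If a > b, then a^2 - b^2 = (a - b)(a + b) is at most (u - b) 2N,
    linear in the error x instead of quadratic. *)
Lemma truncated_square_gap (R : realFieldType) (a b u x N : R) :
  0 <= a -> 0 <= b -> a <= u -> a <= N -> u - b <= x -> a ^+ 2 <= b ^+ 2 + 2 * N * `|x|.
Proof.
move=> a0 b0 au aN /le_trans/(_ (ler_norm x)) ux.
have [ab|ba] := leP a b; last by nra.
by have := normr_ge0 x; nra.
Qed.

Lemma cvge0_near_lt (R : realType) (I : Type) (G : set_system I)
    (f : I -> \bar R) (e : R) : 0 < e -> f x @[x --> G] --> 0%E ->
  \forall x \near G, (f x < e%:E)%E.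
Proof.
move=> e0 h; apply: (h [set y | (y < e%:E)%E]); apply: open_nbhs_nbhs; split => //.
exact: open_ereal_lt_ereal.
Qed.

Lemma ereal_time_integral d (T : measurableType d) (R : realType) (P : probability T R)
    (q : R -> T -> R) (M s t : R) : joint_measurable q -> (forall r w, `|q r w| <= M) ->
  (\int[P]_w \int[lebesgue_measure]_(r in `[s, t]) (q r w)%:E =
   (\int[P]_w (\int[lebesgue_measure]_(r in `[s, t]) q r w))%:E)%E.
Proof.
move=> mq qM; rewrite [in RHS]/Rintegral fineK.
  apply: eq_integral => w _; rewrite /Rintegral fineK//.
  by apply: integrable_fin_num => //; exact: (time_integrable mq qM).
apply: integrable_fin_num => //.
apply: (@prob_bounded_integrable _ _ _ P _ (`|M| * `|t - s|)).
  exact: (time_integral_measurable mq qM).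
move=> w; have [st|ts] := leP s t.
  apply: le_trans (time_integral_bound mq qM w st) _.
  by rewrite ler_pM ?subr_ge0 ?ler_norm// (le_trans _ (qM 0 w)).
have -> : `[s, t]%classic = set0 :> set R.
  by apply/seteqP; split => // r /=; rewrite in_itv/= => /andP[]; lra.
by rewrite integral_set0 normr0 mulr_ge0.
Qed.

Section coef_comp.
Context d (T : measurableType d) (R : realType).
Variables (F : R -> set_system T) (K : simple_integrand F) (phi : R -> R).
Hypotheses (mphi : measurable_fun setT phi) (phi_le : forall y, `|phi y| <= `|y|).

Let coef_meas i : measurable_wrt (F (si_time K i)) (fun w => phi (si_coef K i w)).
Proof.
move=> A mA.
have -> : (fun w => phi (si_coef K i w)) @^-1` A = si_coef K i @^-1` (phi @^-1` A) by [].
by apply: si_coef_meas; rewrite -[X in measurable X]setTI; exact: mphi.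
Qed.

Let coef_bnd i : exists M : R, forall w, `|phi (si_coef K i w)| <= M.
Proof.
have [M MP] := @si_coef_bnd _ _ _ _ K i; exists M => w.
exact: le_trans (phi_le _) (MP w).
Qed.

(** The bound [|phi y| <= |y|] keeps the coefficients bounded and forces [phi 0 = 0], so that [phi]
    also commutes with the value off the intervals. *)
Definition si_comp : simple_integrand F :=
  @SimpleIntegrand d T R F (si_size K) (si_time K) (fun i w => phi (si_coef K i w))
    (@si_time_ge0 _ _ _ _ K) (@si_time_nd _ _ _ _ K) coef_meas coef_bnd.

Lemma si_val_comp r w : si_val si_comp r w = phi (si_val K r w).
Proof.
rewrite /si_val /= (step_function_comp (fun i => si_coef K i w) _ _ (@si_time_nd _ _ _ _ K))//.
by have := phi_le 0; rewrite normr0 normr_le0 => /eqP.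
Qed.

End coef_comp.

Section ito_moments.
Context d (T : measurableType d) (R : realType).
Notation leb := (@lebesgue_measure R).
Variables (P : probability T R) (F : R -> set_system T) (B H0 H I : R -> T -> R).
Hypotheses (fF : filtration F) (bB : brownian_motion P F B)
  (mH : joint_measurable H) (HH : forall r w, H r w ^+ 2 = H r w)
  (H0E : forall r w, 0 <= r -> H0 r w = H r w)
  (iI : ito_integral P F B H0 I).

Let H01 r w : 0 <= H r w <= 1.
Proof. by have := HH r w; have := sqr_ge0 (1 - H r w); nra. Qed.

(** [H] takes values in [0, 1], so truncating a simple integrand to [-1, 1] only brings it closer to
    [H]. It also bounds the coefficients by 1 whatever the precision, which is what the fourth
    moment estimate needs. *)
Let trunc (y : R) : R := Num.max (- 1) (Num.min y 1).

Let trunc_le y : `|trunc y| <= `|y|.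
Proof.
rewrite /trunc; case: (leP y 1) => y1.
  case: (leP (-1) y) => y2 //.
  by rewrite normrN normr1 ler_normr; apply/orP; right; lra.
by rewrite max_r ?normr1 ?ler_normr ?(ltW y1)//; lra.
Qed.

Let trunc_le1 y : `|trunc y| <= 1.
Proof.
rewrite /trunc; case: (leP y 1) => y1.
  by case: (leP (-1) y) => y2; rewrite ler_norml; apply/andP; split; lra.
by rewrite max_r ?normr1//; lra.
Qed.

Let m_trunc : measurable_fun setT trunc.
Proof. by apply: measurable_maxr => //; exact: measurable_minr. Qed.

Let trunc_near y h : 0 <= h <= 1 -> (trunc y - h) ^+ 2 <= (y - h) ^+ 2.
Proof.
move=> /andP[h0 h1]; rewrite /trunc; case: (leP y 1) => y1.
  case: (leP (-1) y) => y2 //.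
  by rewrite -subr_ge0 subr_sqr; apply: mulr_le0; lra.
rewrite max_r; last by lra.
by rewrite -subr_ge0 subr_sqr; apply: mulr_ge0; lra.
Qed.

Let rem (y : R) : R := y - trunc y.

Let rem_le y : `|rem y| <= `|y|.
Proof.
rewrite /rem /trunc; case: (leP y 1) => y1.
  case: (leP (-1) y) => y2; first by rewrite subrr normr0.
  by rewrite !ler0_norm; lra.
by rewrite max_r; [rewrite !ger0_norm; lra|lra].
Qed.

Let m_rem : measurable_fun setT rem.
Proof. exact: measurable_funB. Qed.

Let rem_near y h : 0 <= h <= 1 -> rem y ^+ 2 <= (y - h) ^+ 2.
Proof.
move=> /andP[h0 h1]; rewrite /rem /trunc; case: (leP y 1) => y1.
  case: (leP (-1) y) => y2; first by rewrite subrr expr0n/= sqr_ge0.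
  by rewrite -subr_ge0 subr_sqr; apply: mulr_le0; lra.
rewrite max_r; last by lra.
by rewrite -subr_ge0 subr_sqr; apply: mulr_ge0; lra.
Qed.

Lemma si_integral0 (K : simple_integrand F) w : si_integral K B 0 w = 0.
Proof.
by rewrite /si_integral big1// => i _; rewrite !min_r ?subrr ?mulr0//; exact: (si_time_ge0' K).
Qed.

Let sq_joint (K : simple_integrand F) :
  joint_measurable (fun r w => (si_val K r w - H r w) ^+ 2) /\
  exists M : R, forall r w, `|(si_val K r w - H r w) ^+ 2| <= M.
Proof.
split.
  by apply: measurable_funX; apply: measurable_funB => //; exact: (si_val_joint fF).
have [M MP] := si_val_bounded K; exists ((M + 1) ^+ 2) => r w.
rewrite normrX lerXn2r// ?nnegrE ?addr_ge0 ?(le_trans _ (MP r w))//.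
rewrite (le_trans (ler_normB _ _))// lerD//.
by have /andP[h0 h1] := H01 r w; rewrite ger0_norm.
Qed.

Let const1_fmeas s : Fmeas F s (cst 1). Proof. exact: measurable_cst. Qed.
Let const1_le (w : T) : `|cst (1 : R) w| <= 1. Proof. by rewrite normr1. Qed.

(** The truncated integrand still approximates [I]: the part [rem] cut away is at most the distance
    to [H], so by the isometry its integral has second moment at most [e]. The two errors combine to
    2 e + 2 e. *)
Let ito_approx_fixed (v e : R) (K : simple_integrand F) : 0 <= v ->
  (\int[P]_w \int[leb]_(r in `[0%R, v]) ((si_val K r w - H0 r w) ^+ 2)%:E < e%:E)%E ->
  ('E_P[fun w => ((I v w - si_integral K B v w) ^+ 2)%R] < e%:E)%E ->
  let K' := si_comp K m_trunc trunc_le in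
  [/\ P.-integrable setT (fun w => ((I v w - si_integral K' B v w) ^+ 2)%:E),
    \int[P]_w ((I v w - si_integral K' B v w) ^+ 2) <= 4 * e &
    \int[P]_w (\int[leb]_(r in `[0, v]) ((si_val K' r w - H r w) ^+ 2)) <= e].
Proof.
move=> v0 hval hint K'; pose Kr := si_comp K m_rem rem_le.
have mI : measurable_fun setT (I v) by case: iI => + _ _; exact.
have mS (L : simple_integrand F) : measurable_fun setT (si_integral L B v).
  have := si_increment_measurable fF bB L (lexx 0) v0.
  by apply: eq_measurable_fun => w _; rewrite si_integral0 subr0.
have sE w : si_integral K B v w = si_integral K' B v w + si_integral Kr B v w.
  rewrite /si_integral -big_split/=; apply: eq_bigr => i _.
  by rewrite -mulrDl /rem subrKC.
have [mq [M qM]] := sq_joint K.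
have hval' : \int[P]_w (\int[leb]_(r in `[0, v]) ((si_val K r w - H r w) ^+ 2)) < e.
  rewrite -lte_fin -(ereal_time_integral P 0 v mq qM) (le_lt_trans _ hval)//.
  rewrite le_eqVlt; apply/orP; left; apply/eqP.
  apply: eq_integral => w _; apply: eq_integral => r; rewrite inE/= in_itv/= => /andP[r0 _].
  by rewrite H0E.
have iq w : leb.-integrable `[0, v] (EFin \o (fun r => (si_val K r w - H r w) ^+ 2)).
  exact: (time_integrable mq qM).
have Eq : P.-integrable setT (EFin \o (fun w => \int[leb]_(r in `[0, v]) ((si_val K r w - H r w) ^+ 2))).
  apply: (@prob_bounded_integrable _ _ _ P _ (M * (v - 0))).
    exact: (time_integral_measurable mq qM).
  by move=> w; exact: (time_integral_bound mq qM).
have iI2 : P.-integrable setT (fun w => ((I v w - si_integral K B v w) ^+ 2)%:E).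
  apply/integrableP; split.
    by apply/measurable_EFinP; apply: measurable_funX; exact: measurable_funB.
  move: hint; rewrite unlock => hint; rewrite (le_lt_trans _ (lt_le_trans hint (leey _)))//.
  rewrite le_eqVlt; apply/orP; left; apply/eqP; apply: eq_integral => w _ /=.
  by rewrite ger0_norm ?sqr_ge0.
have EI2 : \int[P]_w ((I v w - si_integral K B v w) ^+ 2) < e.
  rewrite -lte_fin /Rintegral fineK; last exact: integrable_fin_num.
  by move: hint; rewrite unlock.
have ir4 := si_increment_integrable4 fF bB Kr (lexx 0) v0.
have ir2 : P.-integrable setT (fun w => (si_integral Kr B v w ^+ 2)%:E).
  have := integrable_pow4 (si_increment_measurable fF bB Kr (lexx 0) v0) ir4 (isT : 2 <= 4)%N.
  by apply: eq_integrable => // w _; rewrite si_integral0 subr0.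
have Er2 : \int[P]_w (si_integral Kr B v w ^+ 2) <= e.
  have := si_increment_second fF bB Kr (lexx 0) v0 (const1_fmeas (s := 0)) const1_le.
  under eq_Rintegral do rewrite si_integral0 subr0 mul1r.
  move=> ->; apply: le_trans (ltW hval').
  have [mqr [Mr qrM]] : joint_measurable (fun r w => (si_val Kr r w) ^+ 2) /\
      exists M : R, forall r w, `|(si_val Kr r w) ^+ 2| <= M.
    split; first by apply: measurable_funX; exact: (si_val_joint fF).
    have [M' MP] := si_val_bounded Kr; exists (M' ^+ 2) => r w.
    by rewrite normrX lerXn2r// nnegrE (le_trans _ (MP r w)).
  apply: le_Rintegral => //.
  - apply: (@prob_bounded_integrable _ _ _ P _ (Mr * (v - 0))).
      by apply: measurable_funM => //; exact: (time_integral_measurable mqr qrM).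
    by move=> w; rewrite /= mul1r; exact: (time_integral_bound mqr qrM).
  - move=> w _; rewrite /= mul1r; apply: le_Rintegral => //.
    + exact: (time_integrable mqr qrM).
    + by move=> r _; rewrite si_val_comp rem_near.
have le2 w : (I v w - si_integral K' B v w) ^+ 2 <=
    2 * (I v w - si_integral K B v w) ^+ 2 + 2 * si_integral Kr B v w ^+ 2.
  rewrite sE -[2 * si_integral Kr B v w ^+ 2]/(_) -(sqrrN (si_integral Kr B v w)).
  apply: le_trans (sqrB_le _ _); rewrite le_eqVlt; apply/orP; left; apply/eqP; ring.
have [iK' eK'] : P.-integrable setT (EFin \o (fun w => (I v w - si_integral K' B v w) ^+ 2)) /\
    `|\int[P]_w ((I v w - si_integral K' B v w) ^+ 2)| <= 0 +
      2 * (\int[P]_w ((I v w - si_integral K B v w) ^+ 2)) +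
      2 * (\int[P]_w (si_integral Kr B v w ^+ 2)).
  apply: expectation_affine_le => //; first by apply: measurable_funX; exact: measurable_funB.
  by move=> w; rewrite ger0_norm ?sqr_ge0// add0r le2.
split; first exact: iK'.
- exact: double_bound eK' (ltW EI2) Er2.
- have [mq' [M' qM']] := sq_joint K'.
  apply: le_trans (ltW hval'); apply: le_Rintegral => //.
  + apply: (@prob_bounded_integrable _ _ _ P _ (M' * (v - 0))).
      exact: (time_integral_measurable mq' qM').
    by move=> w; exact: (time_integral_bound mq' qM').
  + move=> w _; apply: le_Rintegral => //.
      exact: (time_integrable mq' qM').
    by move=> r _; rewrite si_val_comp trunc_near.
Qed.

Lemma ito_approx (s t e : R) : 0 <= s -> s <= t -> 0 < e ->
  exists2 K : simple_integrand F, forall i w, `|si_coef K i w| <= 1 &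
  [/\ P.-integrable setT (fun w => (((I t w - I s w) - (si_integral K B t w - si_integral K B s w)) ^+ 2)%:E),
    \int[P]_w (((I t w - I s w) - (si_integral K B t w - si_integral K B s w)) ^+ 2) <= e &
    \int[P]_w (\int[leb]_(r in `[s, t]) ((si_val K r w - H r w) ^+ 2)) <= e].
Proof.
move=> s0 st e0; have t0 : 0 <= t := le_trans s0 st.
have [mI _ [Ks hK]] := iI.
(* Each endpoint costs 4 (e / 16), and the difference of the two endpoints another factor 4. One
   sequence of integrands serves all times, so the same index n can be taken for [s] and [t]. *)
have e16 : 0 < e / 16 by rewrite divr_gt0.
have e16e : e / 16 <= e by move: e0; apply: sixteenth_le.
have [h1 h2] := hK t t0; have [h3 h4] := hK s s0.
have [n [[n1 n2] [n3 n4]]] := filter_ex (filterI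
  (filterI (cvge0_near_lt e16 h1) (cvge0_near_lt e16 h2))
  (filterI (cvge0_near_lt e16 h3) (cvge0_near_lt e16 h4))).
have [i1 e1 v1] := ito_approx_fixed t0 n1 n2.
have [i2 e2 v2] := ito_approx_fixed s0 n3 n4.
exists (si_comp (Ks n) m_trunc trunc_le); first by move=> i w; exact: trunc_le1.
set K := si_comp _ _ _ in i1 e1 v1 i2 e2 v2 *.
have le2 w : ((I t w - I s w) - (si_integral K B t w - si_integral K B s w)) ^+ 2 <=
   2 * (I t w - si_integral K B t w) ^+ 2 + 2 * (I s w - si_integral K B s w) ^+ 2.
  apply: le_trans (sqrB_le _ _); rewrite le_eqVlt; apply/orP; left; apply/eqP; ring.
have [ii ei] : P.-integrable setT (EFin \o (fun w => ((I t w - I s w) - (si_integral K B t w - si_integral K B s w)) ^+ 2)) /\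
    `|\int[P]_w (((I t w - I s w) - (si_integral K B t w - si_integral K B s w)) ^+ 2)| <= 0 +
      2 * (\int[P]_w ((I t w - si_integral K B t w) ^+ 2)) +
      2 * (\int[P]_w ((I s w - si_integral K B s w) ^+ 2)).
  apply: expectation_affine_le => //; last by move=> w; rewrite ger0_norm ?sqr_ge0// add0r le2.
  apply: measurable_funX; apply: measurable_funB.
    by apply: measurable_funB; exact: mI.
  exact: (si_increment_measurable fF bB K s0 st).
split; first exact: ii.
- apply: le_trans (double_bound ei e1 e2) _.
  rewrite le_eqVlt; apply/orP; left; apply/eqP; by field.
- have [mq [M qM]] := sq_joint K.
  apply: le_trans e16e.
  apply: le_trans v1; apply: le_Rintegral => //.
  + apply: (@prob_bounded_integrable _ _ _ P _ (M * (t - s))).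
      exact: (time_integral_measurable mq qM).
    by move=> w; exact: (time_integral_bound mq qM).
  + apply: (@prob_bounded_integrable _ _ _ P _ (M * (t - 0))).
      exact: (time_integral_measurable mq qM).
    by move=> w; exact: (time_integral_bound mq qM).
  + move=> w _; rewrite (time_integral_split mq qM w s0 st) lerDr.
    by apply: Rintegral_ge0 => r _; exact: sqr_ge0.
Qed.

Section increment.
Variables (s t : R).
Hypotheses (s0 : 0 <= s) (st : s <= t).
Let D (w : T) : R := I t w - I s w.

Let mD : measurable_fun setT D.
Proof.
case: iI => mI _ _; apply: measurable_funB; apply: mI => //; exact: le_trans s0 st.
Qed.

Let S (K : simple_integrand F) (w : T) : R := si_integral K B t w - si_integral K B s w.

Let mS K : measurable_fun setT (S K).
Proof. exact: (si_increment_measurable fF bB K s0 st). Qed.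

Let iS2 K : P.-integrable setT (fun w => (S K w ^+ 2)%:E).
Proof.
exact: (integrable_pow4 (@mS K) (si_increment_integrable4 fF bB K s0 st)).
Qed.

Let iS1 K : P.-integrable setT (fun w => (S K w)%:E).
Proof.
exact: (integrable_pow4 (@mS K) (si_increment_integrable4 fF bB K s0 st) (isT : 1 <= 4)%N).
Qed.

Lemma ito_increment_integrable2 : P.-integrable setT (fun w => (D w ^+ 2)%:E).
Proof.
have [K _ [i1 _ _]] := ito_approx s0 st ltr01.
have [] := @expectation_affine_le _ _ _ P 0 2 2 _ _ (fun w => D w ^+ 2) i1 (@iS2 K) _ _ => //.
  exact: measurable_funX.
move=> w; rewrite ger0_norm ?sqr_ge0// add0r -/(D w) -/(S K w); set a := D w; set b := S K w.
by have := sqr_ge0 (a - 2 * b); nra.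
Qed.

Let iD1 : P.-integrable setT (EFin \o D).
Proof.
have [] := @expectation_affine_le _ _ _ P 1 1 0 _ _ D ito_increment_integrable2 ito_increment_integrable2 mD _ => //.
by move=> w; rewrite ler_norml mul1r mul0r addr0; apply/andP; split; nra.
Qed.

Section weight.
Variables (z : T -> R) (Mz : R).
Hypotheses (Fz : Fmeas F s z) (zM : forall w, `|z w| <= Mz).

Let mz : measurable_fun setT z. Proof. exact: (Fmeas_fun fF s0 Fz). Qed.
Let Mz0 (w : T) : 0 <= Mz. Proof. exact: le_trans (zM w). Qed.

(** The simple integrals have mean 0 against [z], and the error a is absorbed by |a| <= (k + a^2 /
    k) / 2, which turns a second moment at most k^2 into a first moment at most k. *)
Lemma ito_increment_mean : \int[P]_w (z w * D w) = 0.
Proof.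
apply: (@eq0_small _ _ `|Mz|) => k k0.
have [K _ [i1 e1 _]] := ito_approx s0 st (mulr_gt0 k0 k0).
have E0 := si_increment_mean fF bB K s0 st Fz zM.
have izD : P.-integrable setT (EFin \o (fun w => z w * D w)) by exact: (integrable_bmul mz zM iD1).
have izS : P.-integrable setT (EFin \o (fun w => z w * S K w)) by exact: (integrable_bmul mz zM (@iS1 K)).
rewrite -[\int[P]_w _]subr0 -[X in _ - X]E0 -RintegralB//.
have [] := @expectation_affine_le _ _ _ P (`|Mz| / 2 * k) (`|Mz| / 2 / k) 0 _ _
  (fun w => z w * D w - z w * S K w) i1 i1 _ _ => //.
- by apply: measurable_funB; apply: measurable_funM.
- move=> w; rewrite -/(D w) -/(S K w) mul0r addr0 -mulrBr normrM; set a := D w - S K w.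
  have Mzw : `|z w| <= `|Mz| by rewrite (le_trans (zM w))// ler_norm.
  apply: le_trans (ler_wpM2r (normr_ge0 a) Mzw) _.
  rewrite -!mulrA -mulrDr ler_wpM2l// -mulrDr ler_pdivlMl//.
  have -> : k + k^-1 * a ^+ 2 = (k ^+ 2 + `|a| ^+ 2) / k.
    by rewrite real_normK ?num_real//; field; rewrite gt_eqF.
  by rewrite ler_pdivlMr//; have := sqr_ge0 (`|a| - k); nra.
- move=> _ /le_trans; apply; rewrite mul0r addr0 -!mulrA -mulrDr ler_wpM2l//.
  have : k^-1 * (\int[P]_w ((I t w - I s w - (si_integral K B t w - si_integral K B s w)) ^+ 2)) <= k.
    by rewrite ler_pdivrMl.
  by set x := k^-1 * _; rewrite -mulrDr; lra.
Qed.

Let approx_second (k : R) (K : simple_integrand F) : 0 < k ->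
  P.-integrable setT (fun w => ((D w - S K w) ^+ 2)%:E) ->
  \int[P]_w ((D w - S K w) ^+ 2) <= k ^+ 2 / (1 + k) ->
  `|\int[P]_w (z w * D w ^+ 2) - \int[P]_w (z w * S K w ^+ 2)| <=
  `|Mz| * (k * (\int[P]_w (D w ^+ 2)) + k).
Proof.
move=> k0 i1 e1; have iD2 := ito_increment_integrable2.
have izD : P.-integrable setT (EFin \o (fun w => z w * D w ^+ 2)) by exact: (integrable_bmul mz zM iD2).
have izS : P.-integrable setT (EFin \o (fun w => z w * S K w ^+ 2)) by exact: (integrable_bmul mz zM (@iS2 K)).
rewrite -RintegralB//.
have [] := @expectation_affine_le _ _ _ P 0 (`|Mz| * k) (`|Mz| * (1 + k^-1)) _ _
  (fun w => z w * D w ^+ 2 - z w * S K w ^+ 2) iD2 i1 _ _ => //.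
- by apply: measurable_funB; apply: measurable_funM => //; exact: measurable_funX.
- move=> w; rewrite add0r -mulrBr normrM -!mulrA -mulrDr ler_pM//.
    by rewrite (le_trans (zM w))// ler_norm.
  exact: sqr_gap.
move=> _ /le_trans; apply; rewrite add0r -!mulrA -mulrDr ler_wpM2l// lerD2l.
have -> : 1 + k^-1 = (1 + k) / k by field; rewrite gt_eqF.
rewrite mulrAC ler_pdivrMr// -expr2 mulrC -ler_pdivlMr//; lra.
Qed.

(** The isometry passes to the limit from the simple integrands on both sides with [sqr_gap];
    [H^2 = H] is what lets [H] itself stand under the time integral. *)
Lemma ito_increment_second :
  \int[P]_w (z w * D w ^+ 2) = \int[P]_w (z w * \int[leb]_(r in `[s, t]) H r w).
Proof.
set m := \int[P]_w (D w ^+ 2).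
apply/eqP; rewrite -subr_eq0; apply/eqP.
apply: (@eq0_small _ _ (`|Mz| * (m + 1) + `|Mz| * (t - s + 1))) => k k0.
(* The precision for which the second term of [sqr_gap] gives (1 + 1/k) k^2 / (1 + k) = k. *)
have e0 : 0 < k ^+ 2 / (1 + k) by rewrite divr_gt0 ?exprn_gt0//; lra.
have [K _ [i1 e1 v1]] := ito_approx s0 st e0.
have E0 := si_increment_second fF bB K s0 st Fz zM.
have E1 := approx_second k0 i1 e1.
rewrite -[X in `|X|](subrKA (\int[P]_w (z w * S K w ^+ 2))) mulrDl.
apply: le_trans (ler_normD _ _) _; apply: lerD.
  by rewrite -mulrA mulrDl mul1r (mulrC m).
rewrite {1}/S E0.
have [mq [M qM]] := sq_joint K.
have mk2 : joint_measurable (fun r w => si_val K r w ^+ 2).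
  by apply: measurable_funX; exact: (si_val_joint fF).
have [Mk MkP] : exists M : R, forall r w, `|si_val K r w ^+ 2| <= M.
  have [M' MP] := si_val_bounded K; exists (M' ^+ 2) => r w.
  by rewrite normrX lerXn2r// nnegrE (le_trans _ (MP r w)).
have H1 r w : `|H r w| <= 1 by have /andP[h0 h1] := H01 r w; rewrite ger0_norm.
have iz (q : R -> T -> R) M' : joint_measurable q -> (forall r w, `|q r w| <= M') ->
    P.-integrable setT (EFin \o (fun w => z w * \int[leb]_(r in `[s, t]) q r w)).
  move=> mq' qM'; apply: (integrable_bmul mz zM).
  apply: (@prob_bounded_integrable _ _ _ P _ (M' * (t - s))).
    exact: (time_integral_measurable mq' qM').
  by move=> w; exact: (time_integral_bound mq' qM').
have i2 := iz _ _ mk2 MkP; have i3 := iz _ _ mH H1.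
rewrite -RintegralB//.
have i4 : P.-integrable setT (EFin \o (fun w => \int[leb]_(r in `[s, t]) (si_val K r w - H r w) ^+ 2)).
  apply: (@prob_bounded_integrable _ _ _ P _ (M * (t - s))).
    exact: (time_integral_measurable mq qM).
  by move=> w; exact: (time_integral_bound mq qM).
have [] := @expectation_affine_le _ _ _ P (`|Mz| * (k * (t - s))) (`|Mz| * (1 + k^-1)) 0 _ _
  (fun w => z w * \int[leb]_(r in `[s, t]) (si_val K r w ^+ 2) - z w * \int[leb]_(r in `[s, t]) H r w) i4 i4 _ _ => //.
- by apply: measurable_funB; exact: (integrable_measurable (P := P)).
- move=> w; rewrite mul0r addr0 -mulrBr normrM -!mulrA -mulrDr ler_pM//.
    by rewrite (le_trans (zM w))// ler_norm.
  have j1 := time_integrable mk2 MkP s t w; have j2 := time_integrable mH H1 s t w.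
  have j3 := time_integrable mq qM s t w.
  rewrite -RintegralB//.
  have j12 : leb.-integrable `[s, t] (EFin \o (fun r => si_val K r w ^+ 2 - H r w)).
    exact: (integrableB _ j1 j2).
  apply: le_trans (le_normr_Rintegral _ j12) _ => //.
  have jk : leb.-integrable `[s, t] (EFin \o cst k).
    apply: (bounded_integrable _ (lebesgue_itvcc_lty s t) (M := `|k|)) => //.
  have jq : leb.-integrable `[s, t] (EFin \o (fun r => (1 + k^-1) * (si_val K r w - H r w) ^+ 2)).
    exact: (integrableZl _ _ j3).
  apply: (@le_trans _ _ (\int[leb]_(r in `[s, t]) (k + (1 + k^-1) * (si_val K r w - H r w) ^+ 2))).
    apply: le_Rintegral => //.
    + exact: (integrable_norm j12).
    + exact: (integrableD _ jk jq).
    + move=> r _; rewrite -{1}(HH r w) -normrN opprB.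
      apply: le_trans (sqr_gap _ _ k0) _; rewrite HH; apply: lerD.
        by have /andP[h0 h1] := H01 r w; rewrite -[leRHS]mulr1 ler_wpM2l// ltW.
      by rewrite -sqrrN opprB.
  by rewrite RintegralD// RintegralZl// Rintegral_cst// fine_lebesgue_itvcc.
move=> _ /le_trans; apply; rewrite mul0r addr0 -!mulrA -mulrDr ler_wpM2l// (mulrDl (t - s)) mul1r (mulrC k) lerD2l.
have -> : 1 + k^-1 = (1 + k) / k by field; rewrite gt_eqF.
rewrite mulrAC ler_pdivrMr// -expr2 mulrC -ler_pdivlMr//; lra.
Qed.

End weight.

(** Convergence in L^2 says nothing about fourth moments. But min(D^2, n)^2 differs from the fourth
    power of an approximating simple integral by at most 2 n times a quantity small in mean, and
    those fourth powers have a bound independent of the approximation. Let the error go to 0 with n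
    fixed, then n to infinity by monotone convergence. *)
Lemma ito_increment_fourth :
  P.-integrable setT (fun w => (D w ^+ 4)%:E) /\ \int[P]_w (D w ^+ 4) <= 3 * (t - s) ^+ 2.
Proof.
have iD2 := ito_increment_integrable2.
set m := \int[P]_w (D w ^+ 2).
have m0 : 0 <= m by apply: Rintegral_ge0 => w _; exact: sqr_ge0.
pose g (n : nat) (w : T) : R := Num.min (D w ^+ 2) n%:R ^+ 2.
have mg n : measurable_fun setT (g n).
  by apply: measurable_funX; apply: measurable_minr => //; exact: measurable_funX.
have g0 n w : 0 <= Num.min (D w ^+ 2) n%:R by rewrite le_min sqr_ge0/=.
have ig n : P.-integrable setT (EFin \o g n).
  apply: (@prob_bounded_integrable _ _ _ P _ (n%:R ^+ 2)) => // w.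
  by rewrite ger0_norm ?sqr_ge0// lerXn2r ?nnegrE// ge_min lexx orbT.
have gle n : \int[P]_w g n w <= 3 * (t - s) ^+ 2.
  apply/ler_addgt0Pr => e e0.
  (* Chosen so that c k = e dominates the total error 2 n (k m + k). *)
  pose c : R := 2 * n%:R * (m + 1) + 1.
  have c0 : 0 < c by rewrite ltr_wpDl// !mulr_ge0//; lra.
  pose k := e / c; have k0 : 0 < k by rewrite divr_gt0.
  have e'0 : 0 < k ^+ 2 / (1 + k) by rewrite divr_gt0 ?exprn_gt0//; lra.
  have [K K1 [i1 e1 _]] := ito_approx s0 st e'0.
  have S4 := si_increment_fourth fF bB s0 st K1.
  have iS4 := si_increment_integrable4 fF bB K s0 st.
  have [ia ea] := expectation_affine 0 k (1 + k^-1) iD2 i1.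
  have [] := @expectation_affine_le _ _ _ P 0 1 (2 * n%:R) _ _ (g n) iS4 ia _ _ => //.
    move=> w; rewrite add0r mul1r add0r ger0_norm ?sqr_ge0//.
    rewrite -/(D w) -/(S K w).
    have gap := sqr_gap (D w) (S K w) k0.
    have n0 : 0 <= 2 * n%:R :> R by rewrite mulr_ge0.
    apply: le_trans _ (lerD (lexx (S K w ^+ 4)) (ler_wpM2l n0 gap)).
    rewrite /g -[4%N]/(2 * 2)%N exprM -[X in 2 * n%:R * X]normr_id.
    apply: (truncated_square_gap (u := D w ^+ 2)); rewrite ?sqr_ge0 ?ge_min ?lexx ?orbT//.
    exact: ler_norm.
  move=> _ /(le_trans (ler_norm _)) /le_trans; apply.
  rewrite ea !add0r mul1r lerD//.
  have -> : e = c * k by rewrite /k mulrC divfK// gt_eqF.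
  rewrite -/D; have : (1 + k^-1) * (\int[P]_w ((D w - S K w) ^+ 2)) <= k.
    have -> : 1 + k^-1 = (1 + k) / k by field; rewrite gt_eqF.
    rewrite mulrAC ler_pdivrMr// -expr2 mulrC -ler_pdivlMr//; lra.
  rewrite -/D -/m; set y := (1 + k^-1) * _ => yk.
  apply: (@le_trans _ _ (2 * n%:R * (k * m + k))).
    by rewrite ler_wpM2l ?mulr_ge0// lerD2l.
  by rewrite /c; nra.
have cvg_g (w : T) : g n w @[n --> \oo] --> D w ^+ 4.
  apply: cvg_near_cst.
  near=> n; rewrite /g min_l; first by rewrite -exprM.
  by near: n; exact: nbhs_infty_ger.
have le4 : (\int[P]_w (D w ^+ 4)%:E <= (3 * (t - s) ^+ 2)%:E)%E.
  have mg' n : measurable_fun setT (fun w => (g n w)%:E) by exact/measurable_EFinP.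
  have nd w : setT w -> {homo (fun n => (g n w)%:E) : n n' / (n <= n')%N >-> (n <= n')%E}.
    move=> _ n n' nn'; rewrite lee_fin lerXn2r ?nnegrE// le_min !ge_min lexx/=.
    by rewrite ler_nat nn' orbT.
  have := @monotone_convergence _ _ _ P setT measurableT (fun n w => (g n w)%:E) mg'
    (fun n w _ => sqr_ge0 _) nd.
  have limE w : limn (fun n => (g n w)%:E) = (D w ^+ 4)%:E.
    by apply/cvg_lim => //; apply: cvg_EFin (cvg_g w); exact: nearW.
  under eq_integral do rewrite limE.
  move=> ->; apply: lime_le.
    apply: ereal_nondecreasing_is_cvgn => n n' nn'.
    by apply: ge0_le_integral => // w _; rewrite ?lee_fin ?sqr_ge0//; exact: nd.
  apply: nearW => n; apply: le_trans (_ : ((\int[P]_w g n w)%:E <= _)%E); last by rewrite lee_fin.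
  rewrite /Rintegral fineK; first exact: lexx.
  by apply: integrable_fin_num => //; exact: ig.
have i4 : P.-integrable setT (fun w => (D w ^+ 4)%:E).
  apply/integrableP; split; first by apply/measurable_EFinP; exact: measurable_funX.
  apply: le_lt_trans (ltry (3 * (t - s) ^+ 2)); apply: le_trans le4.
  rewrite le_eqVlt; apply/orP; left; apply/eqP; apply: eq_integral => w _ /=.
  by rewrite ger0_norm// exprn_even_ge0.
split => //; rewrite -lee_fin /Rintegral fineK//; exact: integrable_fin_num.
Unshelve. all: by end_near. Qed.

End increment.
End ito_moments.

(** * Dynkin formula *)

Section taylor.
Context (R : realType).

Lemma mean_value (f f' : R -> R) (x y : R) :
  (forall z : R, is_derive z 1 f (f' z)) ->
  exists2 c : R, `|c - x| <= `|y - x| & f y - f x = f' c * (y - x).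
Proof.
move=> df; have cf z : {for z, continuous f} by exact: is_derive_continuous (df z).
have [xy|yx] := leP x y.
  have [|c] := @MVT_segment R f f' x y xy (fun z _ => df z).
    by apply: continuous_subspaceT => z; exact: cf.
  rewrite in_itv/= => /andP[xc cy] e; exists c => //.
  by rewrite !ger0_norm ?subr_ge0// lerB.
have [|c] := @MVT_segment R f f' y x (ltW yx) (fun z _ => df z).
  by apply: continuous_subspaceT => z; exact: cf.
rewrite in_itv/= => /andP[yc cx] e; exists c; last by rewrite -opprB e -mulrN opprB.
rewrite distrC (distrC y) !ger0_norm ?subr_ge0//; last exact: ltW.
by rewrite lerD2l lerN2.
Qed.

Lemma lipschitz_is_derive (f f' : R -> R) (C x y : R) :
  (forall z : R, is_derive z 1 f (f' z)) -> (forall z, `|f' z| <= C) ->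
  `|f y - f x| <= C * `|y - x|.
Proof. by move=> df fC; have [c _ ->] := mean_value x y df; rewrite normrM ler_wpM2r. Qed.

(** Two uses of the mean value theorem, which give the constant [C] instead of C/6 but ask only for
    a Lipschitz [f2]. *)
Lemma taylor2_bound (f f1 f2 : R -> R) (C x y : R) : 0 <= C ->
  (forall z : R, is_derive z 1 f (f1 z)) -> (forall z : R, is_derive z 1 f1 (f2 z)) ->
  (forall u v, `|f2 v - f2 u| <= C * `|v - u|) ->
  `|f y - f x - f1 x * (y - x) - 2^-1 * f2 x * (y - x) ^+ 2| <= C * `|y - x| ^+ 3.
Proof.
move=> C0 df df1 lip.
pose g (z : R) := f z - (f1 x * (z - x) + 2^-1 * f2 x * (z - x) ^+ 2).
pose g' (z : R) := f1 z - (f1 x + f2 x * (z - x)).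
have dg z : is_derive z (1 : R) g (g' z).
  rewrite /g /g'; apply: is_derive_eq; rewrite /GRing.scale/=; by field.
have [c cx] := mean_value x y dg.
have [e ex] := mean_value x c df1.
rewrite /g /g' subrr expr0n/= !mulr0 addr0 subr0 => e1 e2.
have -> : f y - f x - f1 x * (y - x) - 2^-1 * f2 x * (y - x) ^+ 2 =
    (f2 e - f2 x) * (c - x) * (y - x) by
  transitivity ((f1 c - f1 x - f2 x * (c - x)) * (y - x)); [move: e2; lra | rewrite e1; ring].
rewrite 2!normrM (_ : C * _ = C * `|y - x| * `|y - x| * `|y - x|); last by ring.
rewrite ler_wpM2r// ler_pM ?mulr_ge0//.
by rewrite (le_trans (lip _ _))// ler_wpM2l// (le_trans ex).
Qed.

End taylor.

Section diffusion.
Context d (T : measurableType d) (R : realType).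
Notation leb := (@lebesgue_measure R).

(* The only properties of [dX = sqrt H dB] that the Dynkin formula uses. *)
Definition diffusion_increments (P : probability T R) (F : R -> set_system T)
    (X H : R -> T -> R) : Prop :=
  forall s t, 0 <= s -> s <= t ->
  [/\ P.-integrable setT (EFin \o (fun w => (X t w - X s w) ^+ 4)),
      \int[P]_w ((X t w - X s w) ^+ 4) <= 3 * (t - s) ^+ 2,
      forall (z : T -> R) M, Fmeas F s z -> (forall w, `|z w| <= M) ->
        \int[P]_w (z w * (X t w - X s w)) = 0 &
      forall (z : T -> R) M, Fmeas F s z -> (forall w, `|z w| <= M) ->
        \int[P]_w (z w * (X t w - X s w) ^+ 2) =
        \int[P]_w (z w * \int[leb]_(r in `[s, t]) H r w)].

Variables (P : probability T R) (F : R -> set_system T) (X H : R -> T -> R).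
Hypotheses (fF : filtration F) (mX : joint_measurable X)
  (FX : forall t, 0 <= t -> Fmeas F t (X t))
  (mH : joint_measurable H) (HH : forall r w, H r w ^+ 2 = H r w)
  (dX : diffusion_increments P F X H).

Lemma idem01 r w : 0 <= H r w <= 1.
Proof. by have := HH r w; have := sqr_ge0 (1 - H r w); nra. Qed.

Lemma idem_norm r w : `|H r w| <= 1.
Proof. by have /andP[h0 h1] := idem01 r w; rewrite ger0_norm. Qed.

Lemma const1_Fmeas s : Fmeas F s (cst 1). Proof. exact: measurable_cst. Qed.

Section increment.
Variables (s t : R).
Hypotheses (s0 : 0 <= s) (st : s <= t).
Let D w := X t w - X s w.
Let tau := t - s.

Lemma increment_measurable : measurable_fun setT D.
Proof. by apply: measurable_funB; exact: joint_measurable_sec2. Qed.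

Lemma increment_integrable k : (k <= 4)%N -> P.-integrable setT (EFin \o (fun w => D w ^+ k)).
Proof. by move=> k4; have [i4 _ _ _] := dX s0 st; exact: (integrable_pow4 increment_measurable i4). Qed.

Lemma increment_second_le : \int[P]_w (D w ^+ 2) <= tau.
Proof.
have [_ _ _ /(_ (cst 1) 1 (@const1_Fmeas s))] := dX s0 st.
under eq_Rintegral do rewrite mul1r.
move=> -> //; last by move=> w; rewrite normr1.
have [] := @expectation_affine_le _ _ _ P tau 0 0 (cst 0) (cst 0) (fun w => 1 * \int[leb]_(r in `[s, t]) H r w).
- exact: integrable0.
- exact: integrable0.
- by apply: measurable_funM => //; exact: (time_integral_measurable mH idem_norm).
- move=> w; rewrite !mulr0 !addr0 mul1r; apply: le_trans (time_integral_bound mH idem_norm w st) _.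
  by rewrite mul1r.
by move=> _ /(le_trans (ler_norm _)); rewrite !mul0r !addr0.
Qed.

Lemma increment_abs_le : s < t -> \int[P]_w `|D w| <= Num.sqrt tau.
Proof.
move=> lt_st; have t0 : 0 < Num.sqrt tau by rewrite sqrtr_gt0 subr_gt0.
set q := Num.sqrt tau in t0 *; have qE : q ^+ 2 = tau by rewrite sqr_sqrtr// subr_ge0.
have [] := @expectation_affine_le _ _ _ P (q / 2) (q^-1 / 2) 0 _ _ (fun w => `|D w|)
  (@increment_integrable 2 isT) (@increment_integrable 2 isT).
- by apply: measurableT_comp => //; exact: increment_measurable.
- move=> w; rewrite normr_id mul0r addr0.
  have -> : q / 2 + q^-1 / 2 * D w ^+ 2 = (q ^+ 2 + `|D w| ^+ 2) / q / 2.
    by rewrite real_normK ?num_real//; field; rewrite gt_eqF.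
  rewrite !ler_pdivlMr//; have := sqr_ge0 (q - `|D w|); nra.
move=> _ /(le_trans (ler_norm _)) /le_trans; apply; rewrite mul0r addr0 mulrAC -mulrDl ler_pdivrMr//.
have : q^-1 * \int[P]_w (D w ^+ 2) <= q.
  by rewrite ler_pdivrMl// -expr2 qE; exact: increment_second_le.
by move: (q^-1 * _) => x; lra.
Qed.

(** With q = sqrt tau, |D|^3 <= (q D^2 + D^4 / q) / 2. The second and fourth moments, at most tau
    and 3 tau^2, give (1 + 3) / 2 times tau q. *)
Lemma increment_third_le : s < t ->
  P.-integrable setT (EFin \o (fun w => `|D w| ^+ 3)) /\
  \int[P]_w (`|D w| ^+ 3) <= 2 * (tau * Num.sqrt tau).
Proof.
move=> lt_st; have t0 : 0 < Num.sqrt tau by rewrite sqrtr_gt0 subr_gt0.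
set q := Num.sqrt tau in t0 *; have qE : q ^+ 2 = tau by rewrite sqr_sqrtr// subr_ge0.
have [_ i4 _ _] := dX s0 st; rewrite -/tau in i4.
have [] := @expectation_affine_le _ _ _ P 0 (q / 2) (q^-1 / 2) _ _ (fun w => `|D w| ^+ 3)
  (@increment_integrable 2 isT) (@increment_integrable 4 isT).
- by apply: measurable_funX; apply: measurableT_comp => //; exact: increment_measurable.
- move=> w; rewrite ger0_norm ?exprn_ge0// add0r.
  have -> : q / 2 * D w ^+ 2 + q^-1 / 2 * D w ^+ 4 = (q ^+ 2 * `|D w| ^+ 2 + `|D w| ^+ 2 * `|D w| ^+ 2) / q / 2.
    by rewrite real_normK ?num_real//; field; rewrite gt_eqF.
  rewrite !ler_pdivlMr//; move: (`|D w|) (normr_ge0 (D w)) => x x0.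
  have := mulr_ge0 (sqr_ge0 x) (sqr_ge0 (q - x)); nra.
move=> i /(le_trans (ler_norm _)) le; split => //; apply: le_trans le _.
rewrite add0r.
have h2 : q / 2 * \int[P]_w (D w ^+ 2) <= q / 2 * tau.
  apply: ler_wpM2l; first by rewrite divr_ge0// ltW.
  exact: increment_second_le.
have h4 : q^-1 / 2 * \int[P]_w (D w ^+ 4) <= 3 / 2 * (tau * q).
  rewrite mulrAC ler_pdivrMr// ler_pdivrMl//; apply: le_trans i4 _.
  by rewrite -qE le_eqVlt; apply/orP; left; apply/eqP; field.
by apply: le_trans (lerD h2 h4) _; rewrite le_eqVlt; apply/orP; left; apply/eqP; field.
Qed.

End increment.

Section dynkin.
Variables (f f1 f2 : R -> R) (C0 C1 C2 C3 : R).
Hypotheses (df : forall x : R, is_derive x 1 f (f1 x))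
  (df1 : forall x : R, is_derive x 1 f1 (f2 x))
  (fC : forall x, `|f x| <= C0) (f1C : forall x, `|f1 x| <= C1)
  (f2C : forall x, `|f2 x| <= C2) (f2L : forall x y, `|f2 y - f2 x| <= C3 * `|y - x|).

Let C30 : 0 <= C3.
Proof. by have := f2L 0 1; rewrite subr0 normr1 mulr1; exact: le_trans. Qed.

Let mf : measurable_fun setT f.
Proof. by apply: continuous_measurable_fun => x; exact: is_derive_continuous (df x). Qed.

Let mf1 : measurable_fun setT f1.
Proof. by apply: continuous_measurable_fun => x; exact: is_derive_continuous (df1 x). Qed.

Let mf2 : measurable_fun setT f2.
Proof.
apply: continuous_measurable_fun => x; apply/cvgrPdist_lt => e e0.
have C31 : 0 < C3 + 1 by rewrite ltr_wpDl.
near=> y; rewrite (le_lt_trans (f2L y x))// (@le_lt_trans _ _ ((C3 + 1) * `|x - y|))//.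
  by rewrite ler_wpM2r// lerDl.
rewrite mulrC -ltr_pdivlMr//; near: y.
by apply: cvgr_dist_lt => //; rewrite divr_gt0.
Unshelve. all: by end_near. Qed.

Section weight.
Variables (s0 : R) (z : T -> R) (Mz : R).
Hypotheses (s00 : 0 <= s0) (Fz : Fmeas F s0 z) (zM : forall w, `|z w| <= Mz).

Let mz : measurable_fun setT z. Proof. exact: (Fmeas_fun fF s00 Fz). Qed.

Let mHf2 : joint_measurable (fun r w => H r w * f2 (X r w)).
Proof. by apply: measurable_funM => //; exact: (joint_measurable_comp mf2 mX). Qed.

Let bHf2 r w : `|H r w * f2 (X r w)| <= C2.
Proof. by rewrite normrM -[leRHS]mul1r ler_pM// idem_norm. Qed.

Let gap s t := \int[P]_w (z w * (f (X t w) - f (X s w))) -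
  2^-1 * \int[P]_w (z w * \int[leb]_(r in `[s, t]) (H r w * f2 (X r w))).

Let if_ s t : P.-integrable setT (EFin \o (fun w => z w * (f (X t w) - f (X s w)))).
Proof.
apply: (integrable_bmul mz zM (f := fun w => f (X t w) - f (X s w))).
apply: (@prob_bounded_integrable _ _ _ P _ (C0 + C0)).
  by apply: measurable_funB; apply: (measurableT_comp mf); exact: joint_measurable_sec2.
by move=> w; rewrite (le_trans (ler_normB _ _))// lerD.
Qed.

Let iH s t : s <= t ->
  P.-integrable setT (EFin \o (fun w => z w * \int[leb]_(r in `[s, t]) (H r w * f2 (X r w)))).
Proof.
move=> st; apply: (integrable_bmul mz zM).
apply: (@prob_bounded_integrable _ _ _ P _ (C2 * (t - s))).
  exact: (time_integral_measurable mHf2 bHf2).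
by move=> w; exact: (time_integral_bound mHf2 bHf2).
Qed.

Let gap_add r s u : r <= s -> s <= u -> gap r u = gap r s + gap s u.
Proof.
move=> rs su; rewrite /gap addrACA -opprD -mulrDr -!RintegralD//; try exact: iH.
congr (_ - _ * _); apply: eq_Rintegral => w _.
  by rewrite -mulrDr [X in _ = _ * X]addrC subrKA.
by rewrite -mulrDr -(time_integral_split mHf2 bHf2 w rs su).
Qed.

(** Taylor expansion at [X s]. The first-order term has mean 0 and the second-order one becomes a
    time integral of [H] with [f2] frozen at [X s]. There remain the Taylor remainder, which the
    third moment bounds with constant 2, and the error of freezing [f2], which the first moment of
    the increments bounds with constant 1; hence the factor 3. *)
Let gap_le s t : s0 <= s -> s < t -> `|gap s t| <= Mz * C3 * 3 * ((t - s) * Num.sqrt (t - s)).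
Proof.
move=> s0s lt_st; have st := ltW lt_st; have s_0 : 0 <= s := le_trans s00 s0s.
have Mz0 : 0 <= Mz by exact: le_trans (normr_ge0 _) (zM point).
have [_ _ X1 X2] := dX s_0 st.
have Fzs : Fmeas F s z := Fmeas_le fF s00 s0s Fz.
have Fa : Fmeas F s (fun w => z w * f1 (X s w)).
  by apply: measurable_funM => //; apply: measurableT_comp => //; exact: FX.
have Fb : Fmeas F s (fun w => 2^-1 * (z w * f2 (X s w))).
  apply: measurable_funM => //; apply: measurable_funM => //.
  by apply: measurableT_comp => //; exact: FX.
have aM w : `|z w * f1 (X s w)| <= Mz * C1 by rewrite normrM ler_pM.
have bM w : `|2^-1 * (z w * f2 (X s w))| <= Mz * C2.
  rewrite normrM normfV normr_nat -[leRHS]mul1r ler_pM// ?invf_le1// ?ler1n//.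
  by rewrite normrM ler_pM.
have {X1} X1 := X1 _ _ Fa aM; have {X2} X2 := X2 _ _ Fb bM.
set D := fun w => X t w - X s w.
have mD := increment_measurable s t.
have ia : P.-integrable setT (EFin \o (fun w => z w * f1 (X s w) * D w)).
  apply: (integrable_bmul (Fmeas_fun fF s_0 Fa) aM (f := D)).
  exact: (@increment_integrable s t s_0 st 1).
have ib : P.-integrable setT (EFin \o (fun w => 2^-1 * (z w * f2 (X s w)) * D w ^+ 2)).
  exact: (integrable_bmul (Fmeas_fun fF s_0 Fb) bM (@increment_integrable s t s_0 st 2 isT)).
have ic := integrableB measurableT (integrableB measurableT (if_ s t) ia) ib.
have ih : P.-integrable setT (EFin \o (fun w => 2^-1 * (z w * f2 (X s w)) * \int[leb]_(r in `[s, t]) H r w)).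
  apply: (integrable_bmul (Fmeas_fun fF s_0 Fb) bM).
  apply: (@prob_bounded_integrable _ _ _ P _ (1 * (t - s))).
    exact: (time_integral_measurable mH idem_norm).
  by move=> w; exact: (time_integral_bound mH idem_norm).
have E1 : gap s t = \int[P]_w (z w * (f (X t w) - f (X s w)) - z w * f1 (X s w) * D w
      - 2^-1 * (z w * f2 (X s w)) * D w ^+ 2) +
    (\int[P]_w (2^-1 * (z w * f2 (X s w)) * \int[leb]_(r in `[s, t]) H r w) -
     2^-1 * \int[P]_w (z w * \int[leb]_(r in `[s, t]) (H r w * f2 (X r w)))).
  rewrite RintegralB//; last exact: (integrableB measurableT (if_ s t) ia).
  rewrite RintegralB// X1 X2 subr0 /gap addrA subrK//.
have [i3 e3] := increment_third_le s_0 st lt_st.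
have b1 : `|\int[P]_w (z w * (f (X t w) - f (X s w)) - z w * f1 (X s w) * D w
      - 2^-1 * (z w * f2 (X s w)) * D w ^+ 2)| <= Mz * C3 * (2 * ((t - s) * Num.sqrt (t - s))).
  have [] := @expectation_affine_le _ _ _ P 0 (Mz * C3) 0 _ _ (fun w => z w * (f (X t w) - f (X s w)) - z w * f1 (X s w) * D w
      - 2^-1 * (z w * f2 (X s w)) * D w ^+ 2) i3 i3.
  - exact: (integrable_measurable ic).
  - move=> w; rewrite add0r mul0r addr0.
    have -> : z w * (f (X t w) - f (X s w)) - z w * f1 (X s w) * D w
      - 2^-1 * (z w * f2 (X s w)) * D w ^+ 2 =
      z w * (f (X t w) - f (X s w) - f1 (X s w) * D w - 2^-1 * f2 (X s w) * D w ^+ 2) by ring.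
    rewrite normrM -[leRHS]mulrA; apply: ler_pM => //.
    exact: (@taylor2_bound _ f f1 f2 C3 (X s w) (X t w) C30 df df1 f2L).
  move=> _ /le_trans; apply; rewrite add0r mul0r addr0 ler_wpM2l// mulr_ge0//.
pose q r w := 2^-1 * (z w * (H r w * (f2 (X s w) - f2 (X r w)))).
have mq : joint_measurable q.
  apply: measurable_funM => //; apply: measurable_funM; first exact: measurableT_comp.
  apply: measurable_funM => //; apply: measurable_funB; last exact: (joint_measurable_comp mf2 mX).
  by apply: (measurableT_comp mf2); apply: measurableT_comp => //; exact: joint_measurable_sec2.
have qM r w : `|q r w| <= Mz * (C2 + C2).
  rewrite /q normrM normfV normr_nat -[leRHS]mul1r ler_pM// ?invf_le1// ?ler1n//.
  rewrite normrM ler_pM// normrM -[leRHS]mul1r ler_pM// ?idem_norm//.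
  by rewrite (le_trans (ler_normB _ _))// lerD.
have E2 : \int[P]_w (2^-1 * (z w * f2 (X s w)) * \int[leb]_(r in `[s, t]) H r w) -
     2^-1 * \int[P]_w (z w * \int[leb]_(r in `[s, t]) (H r w * f2 (X r w))) =
     \int[leb]_(r in `[s, t]) (\int[P]_w q r w).
  rewrite -(time_integral_Fubini mq qM) -RintegralZl//; last exact: iH.
  rewrite -RintegralB//; last exact: (integrableZl measurableT _ (iH st)).
  apply: eq_Rintegral => w _.
  have jH := time_integrable mH idem_norm s t w; have jf := time_integrable mHf2 bHf2 s t w.
  rewrite mulrA -RintegralZl// -RintegralZl// -RintegralB//; last 2 first.
  - exact: (integrableZl _ _ jH).
  - exact: (integrableZl _ _ jf).
  by apply: eq_Rintegral => r _; rewrite /q; ring.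
have b2 : `|\int[leb]_(r in `[s, t]) (\int[P]_w q r w)| <= Mz * C3 * Num.sqrt (t - s) * (t - s).
  rewrite -[X in _ * X](fine_lebesgue_itvcc st); apply: Rintegral_le_bound => //.
  - exact: lebesgue_itvcc_lty.
  - apply: measurable_funTS; exact: (expectation_measurable mq qM P).
  - move=> r /=; rewrite in_itv/= => /andP[]; rewrite le_eqVlt => /predU1P[<- _|sr rt].
      under eq_Rintegral do rewrite /q subrr !mulr0.
      by rewrite Rintegral_prob_cst normr0 !mulr_ge0.
    have ir : P.-integrable setT (EFin \o (fun w => `|X r w - X s w|)).
      apply: integrable_norm; exact: (@increment_integrable s r s_0 (ltW sr) 1).
    have [] := @expectation_affine_le _ _ _ P 0 (Mz * C3) 0 _ _ (q r) ir ir.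
    + exact: joint_measurable_sec2.
    + move=> w; rewrite add0r mul0r addr0 /q normrM normfV normr_nat.
      rewrite -[leRHS]mul1r ler_pM// ?invf_le1// ?ler1n//.
      rewrite normrM -mulrA ler_pM// normrM -[leRHS]mul1r ler_pM// ?idem_norm//.
      by rewrite (distrC (X r w)).
    move=> _ /le_trans; apply; rewrite add0r mul0r addr0 ler_wpM2l// ?mulr_ge0//.
    apply: le_trans (increment_abs_le s_0 (ltW sr) sr) _.
    by rewrite ler_sqrt ?subr_ge0// lerB.
rewrite E1 E2; apply: le_trans (ler_normD _ _) _; apply: le_trans (lerD b1 b2) _.
by rewrite le_eqVlt; apply/orP; left; apply/eqP; ring.
Qed.

Lemma dynkin_formula t : s0 <= t ->
  \int[P]_w (z w * (f (X t w) - f (X s0 w))) =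
  2^-1 * \int[P]_w (z w * \int[leb]_(r in `[s0, t]) (H r w * f2 (X r w))).
Proof.
move=> s0t; apply/eqP; rewrite -subr_eq0; apply/eqP.
apply: (@sewing _ gap s0 t (Mz * C3 * 3)) => //.
- by move=> r s u _ rs su _; exact: gap_add.
- move=> r s s0r; rewrite le_eqVlt => /predU1P[<-|rs] _; last exact: gap_le.
  rewrite /gap subrr mul0r mulr0.
  under eq_Rintegral do rewrite subrr mulr0.
  under [in X in `|_ - X|]eq_Rintegral do rewrite set_itv1 Rintegral_set1 mulr0.
  by rewrite !Rintegral_prob_cst mulr0 subrr normr0.
Qed.

End weight.
End dynkin.
End diffusion.

(** * Smoothed exponentials *)

Section smoothing.
Context (R : realType).
Variables (e : R) (e0 : 0 < e).

Definition hyp (x : R) : R := Num.sqrt (x ^+ 2 + e ^+ 2).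
Definition hypV (x : R) : R := (hyp x)^-1.
Definition hypD (x : R) : R := x * hypV x.
(** The second derivative of [smooth_side], half that of [hyp]. It equals e^2 / (2 (x^2 +
    e^2)^(3/2)), which has total mass 1 and concentrates at 0 as e tends to 0. *)
Definition curv (x : R) : R := 2^-1 * (1 - hypD x ^+ 2) * hypV x.

Lemma hyp_gt0 x : 0 < hyp x.
Proof. by rewrite sqrtr_gt0 ltr_wpDl ?sqr_ge0// exprn_gt0. Qed.

Lemma hyp_sqr x : hyp x ^+ 2 = x ^+ 2 + e ^+ 2.
Proof. by rewrite sqr_sqrtr// addr_ge0 ?sqr_ge0. Qed.

Lemma hyp_ge_norm x : `|x| <= hyp x.
Proof. by rewrite -sqrtr_sqr ler_sqrt ?addr_ge0 ?sqr_ge0// lerDl sqr_ge0. Qed.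

Lemma hyp_ge x : e <= hyp x.
Proof. by rewrite -[leLHS]gtr0_norm// -sqrtr_sqr ler_sqrt ?addr_ge0 ?sqr_ge0// lerDr sqr_ge0. Qed.

Lemma hypV_gt0 x : 0 < hypV x.
Proof. by rewrite invr_gt0 hyp_gt0. Qed.

Lemma hypV_le x : hypV x <= e^-1.
Proof. by rewrite lef_pV2 ?posrE ?hyp_gt0 ?hyp_ge. Qed.

Lemma hypDE x : hypD x ^+ 2 = x ^+ 2 / (x ^+ 2 + e ^+ 2).
Proof. by rewrite /hypD exprMn exprVn hyp_sqr. Qed.

Lemma oneB_hypD x : 1 - hypD x ^+ 2 = e ^+ 2 * hypV x ^+ 2.
Proof.
rewrite hypDE exprVn hyp_sqr; field.
by rewrite gt_eqF// ltr_wpDl ?sqr_ge0// exprn_gt0.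
Qed.

Lemma hypD_le1 x : `|hypD x| <= 1.
Proof. by rewrite normrM (ger0_norm (ltW (hypV_gt0 x))) ler_pdivrMr ?hyp_gt0// mul1r hyp_ge_norm. Qed.

Lemma curvE x : curv x = 2^-1 * e ^+ 2 * hypV x ^+ 3.
Proof. by rewrite /curv oneB_hypD; ring. Qed.

Lemma curv_ge0 x : 0 <= curv x.
Proof. by have h := ltW (hypV_gt0 x); rewrite curvE mulr_ge0 ?exprn_ge0// mulr_ge0 ?invr_ge0 ?sqr_ge0. Qed.

Lemma curv_le x : curv x <= 2^-1 * e^-1.
Proof.
have := hypD_le1 x; rewrite ler_norml => /andP[h1 h2].
rewrite /curv ler_pM ?hypV_le ?(ltW (hypV_gt0 x))//; last by rewrite ler_piMr ?invr_ge0// lerBlDl lerDr sqr_ge0.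
by rewrite mulr_ge0 ?invr_ge0// oneB_hypD mulr_ge0 ?sqr_ge0.
Qed.

Lemma is_derive_hyp x : is_derive x (1 : R) hyp (hypD x).
Proof.
have q0 : 0 < x ^+ 2 + e ^+ 2 by rewrite ltr_wpDl ?sqr_ge0// exprn_gt0.
have dq : is_derive x (1 : R) (fun x : R => x ^+ 2 + e ^+ 2) (2 * x).
  by apply: is_derive_eq; rewrite /GRing.scale/=; ring.
have := @is_derive1_comp _ (Num.sqrt : R -> R) (fun x : R => x ^+ 2 + e ^+ 2) x _ _ (is_derive1_sqrt q0) dq.
move=> h; apply: is_derive_eq; rewrite /hypD /hypV /hyp; field.
by rewrite gt_eqF// sqrtr_gt0.
Qed.

Lemma is_derive_hypV x : is_derive x (1 : R) hypV (- (hypD x * hypV x ^+ 2)).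
Proof.
have h0 : hyp x != 0 by rewrite gt_eqF// hyp_gt0.
have dh := is_derive_hyp x; rewrite /hypV.
have dV := is_deriveV h0 dh.
apply: is_derive_eq; rewrite /GRing.scale/=; field.
by rewrite gt_eqF// hyp_gt0.
Qed.

Lemma is_derive_hypD x : is_derive x (1 : R) hypD ((1 - hypD x ^+ 2) * hypV x).
Proof.
have dh := is_derive_hypV x; rewrite /hypD.
by apply: is_derive_eq; rewrite /GRing.scale/= /hypD; ring.
Qed.

Lemma is_derive_curv x : is_derive x (1 : R) curv
  (- (3 / 2 * hypD x * (1 - hypD x ^+ 2) * hypV x ^+ 2)).
Proof.
have dh := is_derive_hypV x; have dv := is_derive_hypD x; rewrite /curv.
by apply: is_derive_eq; rewrite /GRing.scale/=; field.
Qed.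

Variables (a sg : R).
Hypotheses (a0 : 0 <= a) (sg1 : sg ^+ 2 = 1).

Definition smooth_side (x : R) : R := 2^-1 * (hyp x + sg * x).
Definition smooth_exp (x : R) : R := expR (- (a * smooth_side x)).
Definition smooth_exp1 (x : R) : R := - (2^-1 * a * (sg + hypD x)) * smooth_exp x.
(** As e tends to 0, the factor (sg + hypD x)^2 / 4 tends to 1 where sg x > 0 and to 0 on the other
    side, while the term in [curv] produces the local time. *)
Definition smooth_exp2 (x : R) : R :=
  (4^-1 * a ^+ 2 * (sg + hypD x) ^+ 2 - a * curv x) * smooth_exp x.
Definition smooth_exp3 (x : R) : R :=
  (2^-1 * a ^+ 2 * (sg + hypD x) * ((1 - hypD x ^+ 2) * hypV x) +
   a * (3 / 2 * hypD x * (1 - hypD x ^+ 2) * hypV x ^+ 2)) * smooth_exp x +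
  (4^-1 * a ^+ 2 * (sg + hypD x) ^+ 2 - a * curv x) * smooth_exp1 x.

Lemma sg_norm : `|sg| = 1.
Proof.
by apply/eqP; rewrite -(@eqrXn2 _ 2)//; rewrite expr1n -sg1 real_normK ?num_real.
Qed.

Lemma smooth_side_ge0 x : 0 <= smooth_side x.
Proof.
rewrite mulr_ge0 ?invr_ge0// -lerBlDr sub0r (le_trans (ler_norm _))//.
by rewrite normrN normrM sg_norm mul1r hyp_ge_norm.
Qed.

Lemma smooth_side_le x : smooth_side x <= hyp x.
Proof.
have : sg * x <= hyp x.
  by rewrite (le_trans (ler_norm _))// normrM sg_norm mul1r hyp_ge_norm.
by rewrite /smooth_side; lra.
Qed.

Lemma smooth_exp_gt0 x : 0 < smooth_exp x. Proof. exact: expR_gt0. Qed.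

Lemma smooth_exp_le1 x : smooth_exp x <= 1.
Proof. by rewrite -expR0 ler_expR oppr_le0 mulr_ge0// smooth_side_ge0. Qed.

Lemma is_derive_smooth_exp x : is_derive x (1 : R) smooth_exp (smooth_exp1 x).
Proof.
have dh := is_derive_hyp x.
have dg : is_derive x (1 : R) (fun x => - (a * (2^-1 * (hyp x + sg * x)))) (- (2^-1 * a * (sg + hypD x))).
  by apply: is_derive_eq; rewrite /GRing.scale/=; ring.
have := @is_derive1_comp _ (expR : R -> R) _ x _ _ (is_derive_expR _) dg.
by move=> h; apply: is_derive_eq; rewrite /smooth_exp1 mulrC.
Qed.

Lemma is_derive_smooth_exp1 x : is_derive x (1 : R) smooth_exp1 (smooth_exp2 x).
Proof.
have df := is_derive_smooth_exp x; have dv := is_derive_hypD x.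
rewrite /smooth_exp1; apply: is_derive_eq; rewrite /GRing.scale/= /smooth_exp2 /smooth_exp1 /curv; by field.
Qed.

Lemma is_derive_smooth_exp2 x : is_derive x (1 : R) smooth_exp2 (smooth_exp3 x).
Proof.
have df := is_derive_smooth_exp x; have dv := is_derive_hypD x; have db := is_derive_curv x.
rewrite /smooth_exp2; apply: is_derive_eq; rewrite /GRing.scale/= /smooth_exp3; by field.
Qed.

Let sgD_le x : `|sg + hypD x| <= 2.
Proof. by rewrite (le_trans (ler_normD _ _))// sg_norm; have := hypD_le1 x; lra. Qed.

Lemma smooth_exp1_bounded x : `|smooth_exp1 x| <= a.
Proof.
rewrite normrM (gtr0_norm (smooth_exp_gt0 x)) -[leRHS]mulr1 ler_pM ?(ltW (smooth_exp_gt0 x)) ?smooth_exp_le1//.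
rewrite normrN !normrM (ger0_norm a0) normfV normr_nat.
by have := ler_wpM2l a0 (sgD_le x); rewrite mulrAC -mulrA; lra.
Qed.

Lemma drift_bounded x : `|4^-1 * a ^+ 2 * (sg + hypD x) ^+ 2 - a * curv x| <= a ^+ 2 + a * (2^-1 * e^-1).
Proof.
rewrite (le_trans (ler_normB _ _))// lerD//.
  rewrite ger0_norm; last by apply: mulr_ge0; [rewrite mulr_ge0 ?invr_ge0 ?sqr_ge0|exact: sqr_ge0].
  have : `|sg + hypD x| ^+ 2 <= 2 ^+ 2 by rewrite lerXn2r ?nnegrE.
  rewrite real_normK ?num_real// => h2; have := ler_wpM2l (sqr_ge0 a) h2.
  by rewrite -mulrA; lra.
by rewrite normrM (ger0_norm a0) (ger0_norm (curv_ge0 x)) ler_wpM2l// curv_le.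
Qed.

Lemma smooth_exp2_bounded x : `|smooth_exp2 x| <= a ^+ 2 + a * (2^-1 * e^-1).
Proof.
rewrite normrM (gtr0_norm (smooth_exp_gt0 x)) -[leRHS]mulr1.
by rewrite ler_pM ?smooth_exp_le1 ?(ltW (smooth_exp_gt0 x))// drift_bounded.
Qed.

Lemma smooth_exp2_lipschitz : exists C3 : R, forall x y,
  `|smooth_exp2 y - smooth_exp2 x| <= C3 * `|y - x|.
Proof.
exists (a ^+ 2 * e^-1 + a * (3 / 2 * e^-1 ^+ 2) + (a ^+ 2 + a * (2^-1 * e^-1)) * a) => x y.
apply: (lipschitz_is_derive _ _ is_derive_smooth_exp2) => {x y} x.
have v1 : `|1 - hypD x ^+ 2| <= 1.
  rewrite ger0_norm; first by rewrite lerBlDl lerDr sqr_ge0.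
  by rewrite oneB_hypD mulr_ge0 ?sqr_ge0.
have w1 : `|hypV x| <= e^-1 by rewrite gtr0_norm ?hypV_gt0 ?hypV_le.
have e1 : 0 <= e^-1 by rewrite invr_ge0 ltW.
rewrite (le_trans (ler_normD _ _))// lerD//; last first.
  by rewrite normrM ler_pM// ?drift_bounded ?smooth_exp1_bounded.
rewrite normrM (gtr0_norm (smooth_exp_gt0 x)) -[leRHS]mulr1.
rewrite ler_pM ?smooth_exp_le1 ?(ltW (smooth_exp_gt0 x))//.
rewrite (le_trans (ler_normD _ _))// lerD//.
  have a2 := sqr_ge0 a; rewrite 2!normrM [`|2^-1 * _|]normrM normfV normr_nat (ger0_norm a2) normrM.
  rewrite (_ : a ^+ 2 * e^-1 = 2^-1 * a ^+ 2 * 2 * (1 * e^-1)); last by field; rewrite gt_eqF.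
  by rewrite ler_pM ?mulr_ge0 ?invr_ge0 ?sqr_ge0// ler_pM ?mulr_ge0 ?invr_ge0 ?sqr_ge0.
rewrite 4!normrM (ger0_norm a0) ler_wpM2l//.
rewrite (_ : 3 / 2 * e^-1 ^+ 2 = 3 / 2 * 1 * 1 * e^-1 ^+ 2); last by ring.
rewrite ger0_norm ?divr_ge0// normrX.
by rewrite ler_pM ?mulr_ge0 ?divr_ge0// ?lerXn2r ?nnegrE// ler_pM ?mulr_ge0 ?divr_ge0// ler_pM ?mulr_ge0 ?divr_ge0// ?hypD_le1.
Qed.

(* The correction [f phi - phi] vanishes as [e -> 0]: [curv] only sees [x] of order [e], where [f] is close to 1. *)
Lemma smooth_exp_curv x : `|(smooth_exp x - 1) * curv x| <= 2^-1 * a * (e ^+ 2 / (x ^+ 2 + e ^+ 2)).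
Proof.
have h0 := hyp_gt0 x.
rewrite normrM (ger0_norm (curv_ge0 x)) distrC ger0_norm ?subr_ge0 ?smooth_exp_le1//.
have le1 : 1 - smooth_exp x <= a * hyp x.
  have := expR_ge1Dx (- (a * smooth_side x)); rewrite -/(smooth_exp x).
  by have := ler_wpM2l a0 (smooth_side_le x); lra.
apply: le_trans (ler_wpM2r (curv_ge0 x) le1) _.
rewrite curvE -hyp_sqr /hypV le_eqVlt; apply/orP; left; apply/eqP; field.
by rewrite gt_eqF.
Qed.

End smoothing.

(** The factors are peeled off one at a time, so that each exchange is Tonelli for two measures. *)
Lemma fubini_tonelli_product d1 d2 d3 (T1 : measurableType d1) (T2 : measurableType d2)
    (T3 : measurableType d3) (R : realType)
    (m1 : {sigma_finite_measure set T1 -> \bar R})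
    (m2 : {sigma_finite_measure set T2 -> \bar R})
    (m3 : {sigma_finite_measure set T3 -> \bar R}) (f : T1 * T2 * T3 -> \bar R) :
  measurable_fun setT f -> (forall x, 0 <= f x)%E ->
  (\int[m1 \x m2]_z \int[m3]_u f (z, u) = \int[m3]_u \int[m1 \x m2]_z f (z, u))%E.
Proof.
move=> mf f0.
have mz (u : T3) : measurable_fun setT (fun z : T1 * T2 => f (z, u)).
  by apply: (measurableT_comp mf); exact: measurable_fun_pair.
have mxu (y : T2) : measurable_fun setT (fun z : T1 * T3 => f ((z.1, y), z.2)).
  apply: (measurableT_comp mf); apply: measurable_fun_pair => //.
  exact: measurable_fun_pair.
have mxyu : measurable_fun setT (fun z : T1 * (T2 * T3) => f ((z.1, z.2.1), z.2.2)).
  apply: (measurableT_comp mf); apply: measurable_fun_pair; last exact: (measurableT_comp measurable_snd).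
  by apply: measurable_fun_pair => //; exact: (measurableT_comp measurable_fst).
rewrite fubini_tonelli2; last 2 first.
- exact: (measurable_fun_fubini_tonelli_F (m2 := m3) f mf f0).
- by move=> z; exact: integral_ge0.
transitivity (\int[m2]_y \int[m3]_u \int[m1]_x f ((x, y), u))%E.
  by apply: eq_integral => y _; exact: (fubini_tonelli (fun z : T1 * T3 => f ((z.1, y), z.2)) (mxu y)).
rewrite (fubini_tonelli (fun z : T2 * T3 => \int[m1]_x f ((x, z.1), z.2))%E); last 2 first.
- exact: (measurable_fun_fubini_tonelli_G (m1 := m1) _ mxyu).
- by move=> z; exact: integral_ge0.
by apply: eq_integral => u _; rewrite (fubini_tonelli2 (fun z => f (z, u)))//.
Qed.

(** * The curvature as a mixture of indicators of intervals *)

Section curv_mixture.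
Context (R : realType).
Notation leb := (@lebesgue_measure R).

(* The weight of [1 / 2] times the indicator of [[-u, u]] in the mixture representing [curv 1]. *)
Definition mix_weight (u : R) : R := 3 * hypD 1 u * hypV 1 u ^+ 4.

Let hV := is_derive_hypV (@ltr01 R).
Let hD := is_derive_hypD (@ltr01 R).

Lemma hypV_cvg0 : hypV 1 u @[u --> +oo] --> (0 : R).
Proof.
apply/cvgrPdist_lt => e e0; near=> u.
have u0 : e^-1 < u by near: u; apply: nbhs_pinfty_gt; rewrite num_real.
have u00 : 0 < u by apply: lt_trans u0; rewrite invr_gt0.
rewrite sub0r normrN gtr0_norm ?hypV_gt0// -[ltRHS]invrK ltf_pV2 ?posrE ?hyp_gt0 ?invr_gt0//.
by apply: lt_le_trans u0 _; rewrite (le_trans _ (hyp_ge_norm 1 u))// ler_norm.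
Unshelve. all: by end_near. Qed.

Lemma hypD_cvg1 : hypD 1 u @[u --> +oo] --> (1 : R).
Proof.
have h : (1 - hypV 1 u) @[u --> +oo] --> (1 : R).
  by rewrite -[X in _ --> X]subr0; apply: cvgB; [exact: cvg_cst|exact: hypV_cvg0].
apply: (@squeeze_cvgr _ _ _ _ (fun u : R => 1 - hypV 1 u) (fun=> 1)); [|exact: h|exact: cvg_cst].
near=> u; apply/andP; split; last first.
  by have := hypD_le1 (@ltr01 R) u; rewrite ler_norml => /andP[].
have u0 : 0 <= u by near: u; apply: nbhs_pinfty_ge; rewrite num_real.
have h0 := hyp_gt0 (@ltr01 R) u.
rewrite lerBlDr /hypD /hypV -{2}[(hyp 1 u)^-1]mul1r -mulrDl ler_pdivlMr// mul1r.
rewrite -ler_sqr ?nnegrE ?(ltW h0) ?addr_ge0//.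
by rewrite hyp_sqr//; nra.
Unshelve. all: by end_near. Qed.

Lemma continuous_mix_weight : continuous (mix_weight : R -> R).
Proof.
move=> u; have cV := is_derive_continuous (hV u); have cD := is_derive_continuous (hD u).
apply: cvgM; first by apply: cvgM => //; exact: cvg_cst.
by do 3! apply: (cvgM cV).
Qed.

Lemma mix_weight_ge0 (u : R) : 0 <= u -> 0 <= mix_weight u.
Proof.
move=> u0; have := ltW (hypV_gt0 (@ltr01 R) u) => v0.
by rewrite mulr_ge0 ?exprn_ge0// mulr_ge0// mulr_ge0.
Qed.

Lemma integral_mix_weight (x : R) : 0 <= x ->
  (\int[leb]_(u in `[x, +oo[) (mix_weight u)%:E = (hypV 1 x ^+ 3)%:E)%E.
Proof.
move=> x0.
have dF (u : R) : is_derive u 1 (fun u : R => - (hypV 1 u ^+ 3)) (mix_weight u).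
  have h := hV u; apply: is_derive_eq; rewrite /GRing.scale/= /mix_weight; ring.
rewrite (ge0_integral_is_derive _ continuous_mix_weight dF (l := 0)) ?sub0r ?opprK//.
  by move=> u xu; rewrite mix_weight_ge0// (le_trans x0).
rewrite -oppr0; apply: cvgN.
have : hypV 1 u * (hypV 1 u * hypV 1 u) @[u --> +oo] --> (0 * (0 * 0) : R).
  by apply: (cvgM hypV_cvg0); exact: (cvgM hypV_cvg0 hypV_cvg0).
rewrite !mulr0; apply: cvg_trans; apply: near_eq_cvg; apply: nearW => u /=; ring.
Qed.

(** Written with the normalized indicators 1/(2u) of [-u, u], the mixture has the weights u
    [mix_weight u]. Their total mass is 1, so the mixture inherits the limit of its components. The
    weight u [mix_weight u] is the derivative of [hypD^3]. *)
Lemma integral_mix_weightM : (\int[leb]_(u in `[0%R, +oo[) (u * mix_weight u)%:E = 1)%E.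
Proof.
have dF (u : R) : is_derive u 1 (fun u : R => hypD 1 u ^+ 3) (u * mix_weight u).
  have h := hD u; apply: is_derive_eq; rewrite /GRing.scale/= /mix_weight.
  by rewrite oneB_hypD// /hypD; ring.
rewrite (ge0_integral_is_derive _ _ dF (l := 1)).
- by rewrite /hypD mul0r expr0n/= subr0.
- by move=> u u0; rewrite mulr_ge0// mix_weight_ge0.
- by move=> u; apply: cvgM; [exact: cvg_id|exact: continuous_mix_weight].
- have : hypD 1 u * (hypD 1 u * hypD 1 u) @[u --> +oo] --> (1 * (1 * 1) : R).
    by apply: (cvgM hypD_cvg1); exact: (cvgM hypD_cvg1 hypD_cvg1).
  rewrite !mulr1; apply: cvg_trans; apply: near_eq_cvg; apply: nearW => u /=; ring.
Qed.

Lemma hypV_scale (e x : R) : 0 < e -> hypV e x = e^-1 * hypV 1 (`|x| / e).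
Proof.
move=> e0; rewrite /hypV -invfM; congr (_^-1).
rewrite -[X in X * _](gtr0_norm e0) -sqrtr_sqr /hyp -sqrtrM ?sqr_ge0//; congr (Num.sqrt _).
by rewrite expr1n exprMn real_normK ?num_real//; field; rewrite gt_eqF.
Qed.

(** The indicator selects u >= |x| / e, and the tail of [mix_weight] is the cube of [hypV 1], that
    is [curv] up to scaling. *)
Lemma curv_mixture (e x : R) : 0 < e ->
  (\int[leb]_(u in `[0%R, +oo[) ((2 * e)^-1 * mix_weight u * \1_(`[- (e * u), e * u]) x)%:E =
   (curv e x)%:E)%E.
Proof.
move=> e0; have xe0 : 0 <= `|x| / e by rewrite divr_ge0// ltW.
transitivity (\int[leb]_(u in `[(`|x| / e)%R, +oo[) ((2 * e)^-1 * mix_weight u)%:E)%E.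
  rewrite integral_mkcond [RHS]integral_mkcond; apply: eq_integral => u _.
  rewrite !patchE indicE; have [h|h] := leP (`|x| / e) u.
    have u0 : 0 <= u by exact: le_trans h.
    rewrite !mem_set/= ?in_itv/= ?u0// ?andbT//; first by rewrite mulr1.
    by rewrite -ler_norml mulrC -ler_pdivrMr.
  rewrite [X in _ = if X then _ else _]memNset/=; last by rewrite in_itv/= andbT; apply/negP; rewrite -ltNge.
  case: ifP => // _; rewrite memNset ?mulr0//= in_itv/= -ler_norml mulrC -ler_pdivrMr//.
  by apply/negP; rewrite -ltNge.
under eq_integral do rewrite EFinM.
rewrite ge0_integralZl//; last 3 first.
- by apply/measurable_EFinP; apply: measurable_funTS; apply: continuous_measurable_fun; exact: continuous_mix_weight.
- by move=> u /=; rewrite in_itv/= andbT lee_fin => h; rewrite mix_weight_ge0// (le_trans xe0).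
- by rewrite lee_fin invr_ge0 mulr_ge0// ltW.
rewrite integral_mix_weight// -EFinM curvE// (hypV_scale x e0); congr EFin.
by field; rewrite gt_eqF.
Qed.

Section process.
Context d (T : measurableType d).
Variables (P : probability T R) (X k : R -> T -> R) (M s t : R).
Hypotheses (mX : joint_measurable X) (mk : joint_measurable k)
  (k0 : forall r w, 0 <= k r w) (kM : forall r w, k r w <= M).
Notation RT := (measurableTypeR R * T)%type.

Definition occupation_near (eta : R) : R :=
  \int[P]_w \int[leb]_(r in `[s, t]) (k r w * \1_(`[- eta, eta]) (X r w)).

Let kMn r w : `|k r w| <= M. Proof. by rewrite ger0_norm. Qed.

Let kM0 (r : R) (w : T) : 0 <= M. Proof. exact: le_trans (kM r w). Qed.

Let product_integral (q : R -> T -> R) (Mq : R) : joint_measurable q ->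
  (forall r w, 0 <= q r w <= Mq) ->
  (\int[leb \x P]_z (q z.1 z.2 * \1_(`[s, t]) z.1)%:E =
   (\int[P]_w \int[leb]_(r in `[s, t]) q r w)%:E)%E.
Proof.
move=> mq q01; rewrite fubini_tonelli2.
- rewrite -(ereal_time_integral P s t mq (M := Mq)); last first.
    by move=> r w; have /andP[q0 q1] := q01 r w; rewrite ger0_norm.
  apply: eq_integral => w _; rewrite /fubini_G/= [RHS]integral_mkcond.
  by apply: eq_integral => r _; rewrite patchE indicE; case: ifPn => _; rewrite ?mulr1 ?mulr0.
- apply/measurable_EFinP; apply: measurable_funM => //.
  by apply: measurableT_comp => //; exact: measurable_indic.
- by move=> z; rewrite lee_fin mulr_ge0//; have /andP[] := q01 z.1 z.2.
Qed.

Lemma expectation_curv_mixture (e : R) : 0 < e ->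
  ((\int[P]_w \int[leb]_(r in `[s, t]) (k r w * curv e (X r w)))%:E =
   \int[leb]_(u in `[0%R, +oo[) ((2 * e)^-1 * mix_weight u * occupation_near (e * u))%:E)%E.
Proof.
move=> e0; have mb : measurable_fun setT (curv e : R -> R).
  by apply: continuous_measurable_fun => x; exact: is_derive_continuous (is_derive_curv e0 x).
have mw : measurable_fun setT (mix_weight : R -> R).
  by apply: continuous_measurable_fun; exact: continuous_mix_weight.
rewrite -(product_integral (Mq := M * (2^-1 * e^-1))); last 2 first.
- by apply: measurable_funM => //; exact: joint_measurable_comp.
- move=> r w; rewrite mulr_ge0 ?curv_ge0//= ler_pM ?curv_ge0//.
  exact: curv_le.
pose g (y : RT * measurableTypeR R) : R := k y.1.1 y.1.2 * \1_(`[s, t]) y.1.1 *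
  ((2 * e)^-1 * mix_weight y.2 * \1_(`[0, +oo[) y.2) * \1_[set v : R * R | `|v.1| <= e * v.2] (X y.1.1 y.1.2, y.2).
have mA : measurable [set v : R * R | `|v.1| <= e * v.2].
  have -> : [set v : R * R | `|v.1| <= e * v.2] = setT `&` (fun v : R * R => `|v.1| <= e * v.2) @^-1` [set true].
    by apply/seteqP; split => v //= [].
  apply: (measurable_fun_ler (f := fun v : R * R => `|v.1|) (g := fun v : R * R => e * v.2)) => //.
    by apply: measurableT_comp.
  by apply: measurable_funM.
have mg : measurable_fun setT g.
  apply: measurable_funM; last first.
    apply: (measurableT_comp (measurable_indic mA)).
    apply: measurable_fun_pair => //.
    exact: (measurableT_comp mX measurable_fst).
  apply: measurable_funM.
    apply: measurable_funM; first exact: (measurableT_comp mk measurable_fst).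
    apply: (measurableT_comp (measurable_indic _)) => //.
    exact: (measurableT_comp measurable_fst measurable_fst).
  apply: measurable_funM; last by apply: (measurableT_comp (measurable_indic _)).
  by apply: measurable_funM => //; exact: measurableT_comp.
have g0 y : 0 <= g y.
  rewrite /g mulr_ge0// mulr_ge0//; first by rewrite mulr_ge0.
  rewrite indicE; case: (boolP (_ \in _)) => [|_]; last by rewrite mulr0.
  rewrite inE/= in_itv/= andbT mulr1 => u0.
  by rewrite mulr_ge0 ?mix_weight_ge0// invr_ge0 mulr_ge0// ltW.
have indE x u : \1_[set v : R * R | `|v.1| <= e * v.2] (x, u) = \1_(`[- (e * u), e * u]) x :> R.
  rewrite !indicE; congr (_%:R); congr nat_of_bool; apply/idP/idP; rewrite !inE/= in_itv/= ler_norml//.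
transitivity (\int[leb \x P]_z \int[leb]_u (g (z, u))%:E)%E.
  apply: eq_integral => z _.
  rewrite mulrAC EFinM -(curv_mixture (X z.1 z.2) e0) -ge0_integralZl//; last 3 first.
  - apply/measurable_EFinP; apply: measurable_funTS; apply: measurable_funM; first exact: measurable_funM.
    apply: eq_measurable_fun (measurableT_comp (measurable_indic mA) (_ : measurable_fun setT (fun u => (X z.1 z.2, u)))).
      by move=> u _ /=; rewrite indE.
    exact: measurable_fun_pair.
  - move=> u /=; rewrite in_itv/= andbT lee_fin => u0.
    by rewrite mulr_ge0// mulr_ge0 ?mix_weight_ge0// invr_ge0 mulr_ge0// ltW.
  - by rewrite lee_fin mulr_ge0.
  rewrite integral_mkcond; apply: eq_integral => u _.
  rewrite patchE /g/= indE -EFinM; have [u0|u0] := boolP (u \in `[0, +oo[).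
    have u0' : `[0, +oo[%classic u by [].
    by rewrite [\1_(`[0, +oo[) u]indicE !(mem_set u0') mulr1; congr EFin; ring.
  have u0' : ~ `[0, +oo[%classic u by exact/negP.
  by rewrite [\1_(`[0, +oo[) u]indicE !(memNset u0') !(mulr0, mul0r).
rewrite (@fubini_tonelli_product _ _ _ _ _ _ _ _ _ _ (fun y => (g y)%:E)); last 2 first.
- exact/measurable_EFinP.
- by move=> y; rewrite lee_fin.
rewrite [RHS]integral_mkcond; apply: eq_integral => u _.
rewrite patchE; have [u0|u0] := boolP (u \in `[0, +oo[); last first.
  rewrite memNset//=; last by apply/negP.
  apply: integral0_eq => z _; rewrite /g/= [X in _ * X * _](_ : _ = 0) ?mulr0 ?mul0r//.
  by rewrite indicE memNset ?mulr0//=; apply/negP.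
rewrite mem_set// EFinM -(product_integral (Mq := M)); last 2 first.
- apply: measurable_funM => //; apply: (joint_measurable_comp (g := \1_(`[- (e * u), e * u]))) => //.
- move=> r w; rewrite mulr_ge0//= -[leRHS]mulr1 ler_pM// indicE; by case: (_ \in _).
rewrite -ge0_integralZl//; last 3 first.
- apply/measurable_EFinP; apply: measurable_funM; last by apply: (measurableT_comp (measurable_indic _)).
  apply: measurable_funM => //; apply: (joint_measurable_comp (g := \1_(`[- (e * u), e * u]))) => //.
- by move=> z _; rewrite lee_fin !mulr_ge0.
- move: u0; rewrite in_itv/= andbT => u0.
  by rewrite lee_fin mulr_ge0 ?mix_weight_ge0// invr_ge0 mulr_ge0// ltW.
apply: eq_integral => z _; rewrite /g/= indE -EFinM; congr EFin.
rewrite [X in _ * X * _](_ : _ = (2 * e)^-1 * mix_weight u); last by rewrite indicE mem_set// mulr1.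
by ring.
Qed.

(** After exchanging the integrals, this is dominated convergence in the mixing variable u: the
    normalized occupation at scale e_n u tends to [l], and the linear bound [GC] dominates the
    integrand by C/2 times the integrable u [mix_weight u]. Measurability in u comes from
    monotonicity of [occupation_near]. *)
Lemma curv_limit (e : nat -> R) (C l : R) : (forall n, 0 < e n) -> e n @[n --> \oo] --> 0 ->
  (forall eta, 0 < eta -> occupation_near eta <= C * eta) ->
  (2 * eta)^-1 * occupation_near eta @[eta --> 0^'+] --> l ->
  \int[P]_w \int[leb]_(r in `[s, t]) (k r w * curv (e n) (X r w)) @[n --> \oo] --> l.
Proof.
move=> en0 e0 GC Gl.
pose a n := \int[P]_w \int[leb]_(r in `[s, t]) (k r w * curv (e n) (X r w)).
pose f n (u : R) : R := (2 * e n)^-1 * mix_weight u * occupation_near (e n * u).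
pose g (u : R) : R := u * mix_weight u.
have mw : measurable_fun setT (mix_weight : R -> R).
  by apply: continuous_measurable_fun; exact: continuous_mix_weight.
have mg : measurable_fun setT g by exact: measurable_funM.
have g0 (u : R) : 0 <= u -> 0 <= g u by move=> u0; rewrite mulr_ge0// mix_weight_ge0.
have ig : leb.-integrable `[0, +oo[ (EFin \o g).
  apply/integrableP; split; first by apply/measurable_EFinP; exact: measurable_funTS.
  rewrite (_ : (\int[leb]_(x in _) _ = 1)%E) ?ltry// -integral_mix_weightM.
  by apply: eq_integral => u; rewrite inE/= in_itv/= andbT => u0; rewrite ger0_norm// g0.
have mono_G : {homo occupation_near : x y / x <= y}.
  move=> x y xy; have mi (eta : R) : joint_measurable (fun r w => k r w * \1_(`[- eta, eta]) (X r w)).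
    by apply: measurable_funM => //; apply: (joint_measurable_comp (g := \1_(`[- eta, eta]))).
  have bi (eta : R) r w : `|k r w * \1_(`[- eta, eta]) (X r w)| <= M.
    by rewrite normrM -[leRHS]mulr1 ler_pM// indicE; case: (_ \in _); rewrite ?normr1 ?normr0.
  have ii (eta : R) : P.-integrable setT (EFin \o (fun w => \int[leb]_(r in `[s, t]) (k r w * \1_(`[- eta, eta]) (X r w)))).
    have [st|ts] := leP s t.
      apply: (@prob_bounded_integrable _ _ _ P _ (M * (t - s))).
        exact: (time_integral_measurable (mi eta) (bi eta)).
      by move=> w; exact: (time_integral_bound (mi eta) (bi eta)).
    apply: (@prob_bounded_integrable _ _ _ P _ 0).
      exact: (time_integral_measurable (mi eta) (bi eta)).
    move=> w; rewrite (_ : `[s, t]%classic = set0) ?Rintegral_set0 ?normr0//.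
    by apply/seteqP; split => // r /=; rewrite in_itv/= => /andP[]; lra.
  apply: le_Rintegral => // w _; apply: le_Rintegral => //.
  - exact: (time_integrable (mi x) (bi x)).
  - exact: (time_integrable (mi y) (bi y)).
  - move=> r _; rewrite ler_wpM2l// !indicE ler_nat.
    case: (boolP (X r w \in `[- x, x]%classic)) => //; rewrite inE/= in_itv/= => /andP[h1 h2].
    rewrite mem_set//= in_itv/=; apply/andP; split; lra.
have mf n : measurable_fun setT (f n).
  apply: measurable_funM; first exact: measurable_funM.
  apply: (@nondecreasing_measurable R setT (fun u => occupation_near (e n * u)) measurableT).
  by move=> x y xy; apply: mono_G; apply: ler_wpM2l => //; exact: ltW.
have G0 eta : 0 <= occupation_near eta.
  by apply: Rintegral_ge0 => w _; apply: Rintegral_ge0 => r _; rewrite mulr_ge0.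
have C0 : 0 <= C by have := GC 1 ltr01; rewrite mulr1; exact: le_trans.
have w0 : mix_weight (0 : R) = 0 by rewrite /mix_weight /hypD mul0r mulr0 mul0r.
have fg n (u : R) : 0 <= u -> `|f n u| <= C / 2 * g u.
  rewrite le_eqVlt => /predU1P[<-|u0].
    by rewrite /f /g w0 !(mulr0, mul0r) normr0.
  have en := en0 n; rewrite ger0_norm; last first.
    by rewrite mulr_ge0// mulr_ge0 ?mix_weight_ge0 ?(ltW u0)// invr_ge0 mulr_ge0// ltW.
  have h : (2 * e n)^-1 * mix_weight u * occupation_near (e n * u) <=
      (2 * e n)^-1 * mix_weight u * (C * (e n * u)).
    rewrite ler_wpM2l// ?GC ?mulr_gt0//.
    by rewrite mulr_ge0 ?mix_weight_ge0 ?(ltW u0)// invr_ge0 mulr_ge0// ltW.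
  apply: le_trans h _; rewrite /g le_eqVlt; apply/orP; left; apply/eqP; field.
  by rewrite gt_eqF.
have fl (u : R) : 0 <= u -> f n u @[n --> \oo] --> l * g u.
  rewrite le_eqVlt => /predU1P[<-|u0].
    by rewrite /f /g w0; under eq_cvg do rewrite mulr0 mul0r; rewrite !mulr0; exact: cvg_cst.
  have h : ((2 * (e n * u))^-1 * occupation_near (e n * u) * g u) @[n --> \oo] --> l * g u.
    apply: cvgM; last exact: cvg_cst.
    move/cvg_at_rightP : Gl; apply; split; first by move=> n; rewrite mulr_gt0.
    by rewrite -(mul0r u); apply: cvgM => //; exact: cvg_cst.
  apply: cvg_trans h; apply: near_eq_cvg; apply: nearW => n.
  by rewrite /f /g; field; rewrite !gt_eqF// .
have il : (\int[leb]_(u in `[0%R, +oo[) (l * g u)%:E = l%:E)%E.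
  under eq_integral do rewrite EFinM.
  by rewrite integralZl// integral_mix_weightM mule1.
have mf' n : measurable_fun (`[0, +oo[ : set R) (fun u => (f n u)%:E).
  by apply/measurable_EFinP; exact: measurable_funTS.
have ml : measurable_fun (`[0, +oo[ : set R) (fun u => (l * g u)%:E).
  by apply/measurable_EFinP; apply: measurable_funTS; exact: measurable_funM.
have m0y : measurable (`[0, +oo[%classic : set (measurableTypeR R)) by exact: measurable_itv.
have iC : leb.-integrable `[0, +oo[ (fun u => (C / 2 * g u)%:E) := integrableZl m0y (C / 2) ig.
have [] := dominated_convergence m0y mf' ml _ iC _.
- apply: aeW => u; rewrite /= in_itv/= andbT => u0.
  by apply: cvg_EFin; [exact: nearW|exact: fl].
- by apply: aeW => u n; rewrite /= in_itv/= andbT lee_fin => u0; exact: fg.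
move=> _ _; rewrite il => h.
apply: cvg_trans (fine_cvg h); apply: near_eq_cvg; apply: nearW => n /=.
by rewrite -expectation_curv_mixture.
Qed.

End process.
End curv_mixture.

Lemma clamp_norm_le (R : realType) (N x : R) : 0 <= N -> `|clamp (- N) N x| <= `|x|.
Proof.
move=> N0; rewrite /clamp; case: (leP x N) => h.
  case: (leP (- N) x) => h'; first by [].
  by rewrite normrN (ger0_norm N0) ltr0_norm; lra.
by rewrite max_r ?ger0_norm ?ler_normr ?(ltW h)//; lra.
Qed.

(** * Quadratic variation and local time *)

Section expectation_limits.
Context d (T : measurableType d) (R : realType) (P : probability T R).

Lemma dominated_cvg_Rintegral (f_ : nat -> T -> R) (f g : T -> R) :
  (forall n, measurable_fun setT (f_ n)) -> measurable_fun setT f ->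
  (forall w, f_ n w @[n --> \oo] --> f w) -> P.-integrable setT (EFin \o g) ->
  (forall n w, `|f_ n w| <= g w) ->
  \int[P]_w f_ n w @[n --> \oo] --> \int[P]_w f w.
Proof.
move=> mf_ mf f_f ig fg.
have mf_' n : measurable_fun setT (EFin \o f_ n) by exact/measurable_EFinP.
have mf' : measurable_fun setT (EFin \o f) by exact/measurable_EFinP.
have [] := dominated_convergence measurableT mf_' mf' _ ig _.
- by apply: aeW => w _; apply: cvg_EFin; [exact: nearW|exact: f_f].
- by apply: aeW => w n _ /=; rewrite lee_fin.
move=> if_ _ h; rewrite -(fineK (integrable_fin_num measurableT if_)) in h.
exact: (fine_cvg h).
Qed.

(** Chebyshev's inequality makes [W] a limit in probability as well; then each event |V - W| >=
    1/(k+1) is null, and their union contains the event that V and W differ. *)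
Lemma cvg_in_probability_unique (Y : nat -> T -> R) (V W : T -> R) :
  (forall n, measurable_fun setT (Y n)) -> measurable_fun setT V -> measurable_fun setT W ->
  cvg_in_probability P \oo Y V ->
  (forall n, P.-integrable setT (EFin \o (fun w => (Y n w - W w) ^+ 2))) ->
  \int[P]_w ((Y n w - W w) ^+ 2) @[n --> \oo] --> (0 : R) ->
  {ae P, forall w, V w = W w}.
Proof.
move=> mY mV mW YV iYW YW0.
have mdist (f g : T -> R) (e : R) : measurable_fun setT f -> measurable_fun setT g ->
    measurable [set w | e <= `|f w - g w|].
  move=> mf mg; have mm : measurable_fun setT (fun w => e <= `|f w - g w|).
    apply: measurable_fun_ler => //; apply: measurableT_comp => //; exact: measurable_funB.
  by rewrite -[X in measurable X]setTI; exact: (mm measurableT [set true]).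
pose A (k : nat) := [set w | k.+1%:R^-1 <= `|V w - W w|].
have PA k : P (A k) = 0%E.
  apply/eqP; rewrite eq_le measure_ge0 andbT; apply/lee_addgt0Pr => e e0; rewrite add0e.
  pose c : R := k.+1%:R^-1 / 2; have c0 : 0 < c by rewrite divr_gt0.
  have e2 : 0 < e / 2 by rewrite divr_gt0.
  have n1 := cvge0_near_lt e2 (YV c c0).
  have n2 : \forall n \near \oo, \int[P]_w ((Y n w - W w) ^+ 2) < c ^+ 2 * (e / 2).
    move/cvgrPdist_lt : YW0 => /(_ (c ^+ 2 * (e / 2))) []; first by rewrite mulr_gt0// exprn_gt0.
    move=> N _ h; exists N => // n Nn; have := h n Nn; rewrite /= sub0r normrN.
    by apply: le_lt_trans; exact: ler_norm.
  have [n [h1 h2]] := filter_ex (filterI n1 n2).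
  have sub : A k `<=` [set w | c <= `|Y n w - V w|] `|` [set w | c <= `|Y n w - W w|].
    move=> w; rewrite /A/= => kw; have [h|h] := leP c `|Y n w - V w|; [by left|right].
    have : `|V w - W w| <= `|Y n w - V w| + `|Y n w - W w|.
      by rewrite (distrC (Y n w) (V w)); exact: (ler_distD (Y n w)).
    have ckk : k.+1%:R^-1 = c + c by rewrite /c -splitr.
    by move: kw h; rewrite ckk; lra.
  pose B1 := [set w | c <= `|Y n w - V w|]; pose B2 := [set w | c <= `|Y n w - W w|].
  apply: (@le_trans _ _ (P B1 + P B2)%E).
    apply: (le_trans (le_measure P _ _ sub)); rewrite ?inE; [exact: mdist|apply: measurableU; exact: mdist|].
    by apply: measureU2; exact: mdist.
  rewrite (splitr e) EFinD; apply: leeD; first exact: ltW.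
  have mB : measurable [set w | c <= `|Y n w - W w|] by exact: mdist.
  have : ((c ^+ 2)%:E * P B2 <= (c ^+ 2 * (e / 2))%:E)%E.
    apply: (@le_trans _ _ (\int[P]_w ((Y n w - W w) ^+ 2)%:E)%E); last first.
      rewrite -(fineK (integrable_fin_num measurableT (iYW n))) lee_fin; exact: ltW h2.
    have m2 : measurable_fun setT (fun w => ((Y n w - W w) ^+ 2)%:E).
      by apply/measurable_EFinP; apply: measurable_funX; exact: measurable_funB.
    rewrite -integral_cst//.
    apply: (@le_trans _ _ (\int[P]_(w in B2) ((Y n w - W w) ^+ 2)%:E)%E).
      apply: ge0_le_integral => //.
      - by move=> w _; rewrite lee_fin sqr_ge0.
      - exact: measurable_funTS.
      - move=> w /= cw; rewrite lee_fin -(real_normK (num_real (Y n w - W w))).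
        by rewrite lerXn2r ?nnegrE// ltW.
    by apply: ge0_subset_integral => // w _; rewrite lee_fin sqr_ge0.
  by rewrite [X in (_ <= X)%E -> _]EFinM lee_pmul2l// lte_fin exprn_gt0.
have : P.-negligible (\bigcup_k A k).
  apply: negligible_bigcup => k; apply/negligibleP; [exact: mdist|exact: PA].
apply: negligibleS => w /= VW; have VW' : 0 < `|V w - W w|.
  by rewrite normr_gt0 subr_eq0; apply/eqP.
exists (Num.truncn (`|V w - W w|^-1)) => //; rewrite /A/=.
rewrite -[leRHS]invrK lef_pV2 ?posrE ?invr_gt0//.
by rewrite ltW// truncnS_gt.
Qed.

End expectation_limits.

Section stieltjes_density.
Context (R : realType).
Notation leb := (@lebesgue_measure R).

(** The Stieltjes measure and Lebesgue measure restricted to [E] agree on half-open intervals, hence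
    on all measurable sets; [integral_density] does the rest. *)
Lemma lebesgue_stieltjes_density (V : cumulative R R) (E : set R) (f : R -> R) :
  measurable E -> (forall a b : R, a <= b -> (V b - V a)%:E = leb (`]a, b] `&` E)) ->
  measurable_fun setT f -> (forall x, 0 <= f x) ->
  (\int[lebesgue_stieltjes_measure V]_x (f x)%:E = \int[leb]_x (f x * \1_E x)%:E)%E.
Proof.
move=> mE VE mf f0.
apply: (@integral_density R (lebesgue_stieltjes_measure V) (\1_E) f) => //.
move=> A mA.
transitivity (mrestr leb mE A); last first.
  by rewrite /mrestr integral_indic// setIC.
apply: lebesgue_stieltjes_measure_unique => // _ [[a b] _ <-]; rewrite /mrestr.
have [ab|ba] := leP a b; last first.
  rewrite set_itv_ge ?set0I ?measure0//= bnd_simp -leNgt; exact: ltW.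
rewrite [LHS]measurable_mu_extE/=; last exact: is_ocitv.
by rewrite wlength_itv_bnd// VE.
Qed.

End stieltjes_density.

Section quadratic_variation_identification.
Context d (T : measurableType d) (R : realType).
Notation leb := (@lebesgue_measure R).
Variables (P : probability T R) (F : R -> set_system T) (X : R -> T -> R) (phi : R -> R).
Let H r w := phi (X r w).
Hypotheses (fF : filtration F) (cX : forall w, continuous (X ^~ w))
  (FX : forall t, 0 <= t -> Fmeas F t (X t))
  (mX : joint_measurable X) (mphi : measurable_fun setT phi)
  (phi2 : forall x, phi x ^+ 2 = phi x)
  (dX : diffusion_increments P F X H).

(** Progressive measurability: with the time clamped to [0, t], the process is continuous and all
    its values are measurable for [F t]. So joint measurability and the measurability of time
    integrals can be applied with [F t] in place of the ambient sigma-algebra. *)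
Lemma progressive_time_integral (psi : R -> R) (M s t : R) : measurable_fun setT psi ->
  (forall x, `|psi x| <= M) -> 0 <= s -> s <= t ->
  Fmeas F t (fun w => \int[leb]_(r in `[s, t]) psi (X r w)).
Proof.
move=> mpsi psiM s0 st; have t0 : 0 <= t := le_trans s0 st.
pose Y (r : R) (w : g_sigma_algebraType (F t)) : R := X (clamp 0 t r) w.
have mY : joint_measurable Y.
  apply: continuous_joint_measurable => [r|w].
    have c0 : 0 <= clamp 0 t r by exact: clamp_ge.
    exact: (Fmeas_le fF c0 (clamp_le _ t0) (FX c0)).
  move=> r; apply: (continuous_comp (f := clamp 0 t) (g := fun r => X r w)); last exact: cX.
  apply: continuous_max; first exact: cst_continuous.
  by apply: continuous_min; [exact: cvg_id|exact: cst_continuous].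
have mq : joint_measurable (fun r w => psi (Y r w)) by exact: joint_measurable_comp.
have := time_integral_measurable mq (M := M) (fun r w => psiM _) s t.
apply: eq_measurable_fun => w _; apply: eq_Rintegral => r; rewrite inE/= in_itv/= => /andP[sr rt].
by rewrite /Y /clamp min_l// max_r// (le_trans s0).
Qed.

Let mH : joint_measurable H. Proof. exact: joint_measurable_comp. Qed.
Let HH r w : H r w ^+ 2 = H r w. Proof. exact: phi2. Qed.
Let H1 r w : `|H r w| <= 1. Proof. exact: (idem_norm HH). Qed.
Let phi1 x : `|phi x| <= 1.
Proof.
have := phi2 x; have := sqr_ge0 (1 - phi x); rewrite ler_norml => h1 h2.
by apply/andP; split; nra.
Qed.

(** The compensated squared increment, centred given the past. Its second moment is at most 2 times
    3 (t - s)^2 plus 2 (t - s)^2, whence the 8 below. *)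
Let comp s t w := (X t w - X s w) ^+ 2 - \int[leb]_(r in `[s, t]) H r w.

Let comp_measurable s t : measurable_fun setT (comp s t).
Proof.
apply: measurable_funB; last exact: (time_integral_measurable mH H1).
by apply: measurable_funX; exact: increment_measurable.
Qed.

Let comp_second s t : 0 <= s -> s <= t ->
  P.-integrable setT (EFin \o (fun w => comp s t w ^+ 2)) /\
  \int[P]_w (comp s t w ^+ 2) <= 8 * (t - s) ^+ 2.
Proof.
move=> s0 st; have [i4 e4 _ _] := dX s0 st.
have [] := @expectation_affine_le _ _ _ P (2 * (t - s) ^+ 2) 2 0 _ _ (fun w => comp s t w ^+ 2) i4 i4.
- exact: measurable_funX.
- move=> w; rewrite mul0r addr0 ger0_norm ?sqr_ge0//.
  apply: le_trans (sqrB_le _ _) _; rewrite addrC lerD//; last by rewrite -exprM.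
  rewrite ler_wpM2l// -real_normK ?num_real// lerXn2r ?nnegrE ?subr_ge0//.
  by have := time_integral_bound mH H1 w st; rewrite mul1r.
move=> i2 /(le_trans (ler_norm _)) h; split => //; apply: le_trans h _.
by rewrite mul0r addr0; have := ler_wpM2l (ler0n R 2) e4; lra.
Qed.

(** [diffusion_increments] tests against bounded weights, whereas here [z] will be a sum of earlier
    compensated squares, only square integrable. It is clamped to [-n, n], and dominated convergence
    removes the clamp. *)
Let comp_orthogonal (s t : R) (z : T -> R) : 0 <= s -> s <= t -> Fmeas F s z ->
  P.-integrable setT (EFin \o (fun w => z w ^+ 2)) ->
  P.-integrable setT (EFin \o (fun w => z w * comp s t w)) /\
  \int[P]_w (z w * comp s t w) = 0.
Proof.
move=> s0 st Fz iz2; have [ic2 _] := comp_second s0 st.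
have mz : measurable_fun setT z := Fmeas_fun fF s0 Fz.
have ab_le (a b : R) : `|a * b| <= 0 + 2^-1 * a ^+ 2 + 2^-1 * b ^+ 2.
  rewrite normrM -(real_normK (num_real a)) -(real_normK (num_real b)).
  by have := sqr_ge0 (`|a| - `|b|); nra.
have [izc _] := @expectation_affine_le _ _ _ P 0 2^-1 2^-1 _ _ (fun w => z w * comp s t w) iz2 ic2
  (measurable_funM mz (@comp_measurable s t)) (fun w => ab_le _ _).
split => //.
pose zn (n : nat) w : R := clamp (- n%:R) n%:R (z w).
have mzn n : measurable_fun setT (zn n).
  by apply: measurable_maxr => //; exact: measurable_minr.
have znM n w : `|zn n w| <= n%:R.
  by rewrite ler_norml clamp_ge clamp_le// (le_trans _ (ler0n _ _))// oppr_le0.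
have zn0 n : \int[P]_w (zn n w * comp s t w) = 0.
  have Fzn : Fmeas F s (zn n).
    by apply: measurable_maxr => //; exact: measurable_minr.
  have [_ _ _ /(_ _ _ Fzn (znM n)) e2] := dX s0 st.
  have i1 : P.-integrable setT (EFin \o (fun w => zn n w * (X t w - X s w) ^+ 2)).
    exact: (integrable_bmul (mzn n) (znM n) (increment_integrable mX dX s0 st (isT : 2 <= 4)%N)).
  have i2 : P.-integrable setT (EFin \o (fun w => zn n w * \int[leb]_(r in `[s, t]) H r w)).
    apply: (integrable_bmul (mzn n) (znM n)).
    apply: (@prob_bounded_integrable _ _ _ P _ (1 * (t - s))).
      exact: (time_integral_measurable mH H1).
    by move=> w; exact: (time_integral_bound mH H1).
  under eq_Rintegral do rewrite mulrBr.
  by rewrite RintegralB// e2 subrr.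
have : \int[P]_w (zn n w * comp s t w) @[n --> \oo] --> \int[P]_w (z w * comp s t w).
  apply: (@dominated_cvg_Rintegral _ _ _ P _ _ (fun w => `|z w * comp s t w|)).
  - by move=> n; exact: measurable_funM.
  - exact: measurable_funM.
  - move=> w; apply: cvgM; last exact: cvg_cst.
    apply: cvg_near_cst; near=> n.
    have : `|z w| <= n%:R by near: n; exact: nbhs_infty_ger.
    by rewrite ler_norml => /andP[h1 h2]; rewrite /zn /clamp min_l// max_r.
  - exact: (integrable_norm izc).
  - move=> n w; rewrite !normrM ler_wpM2r//.
    exact: clamp_norm_le.
under eq_cvg do rewrite zn0.
by move=> h; apply: esym; apply: (cvg_unique _ (cvg_cst 0) h).
Unshelve. all: by end_near. Qed.

Section partition.
Variables (t : R) (n : nat).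
Hypothesis t0 : 0 < t.
Let tau (i : nat) : R := t * i%:R / n.+1%:R.

Definition regular_partition : seq R := [seq tau i.+1 | i <- iota 0 n.+1].

Let nth_partition i : (i <= n.+1)%N -> nth t (0 :: regular_partition) i = tau i.
Proof.
case: i => [_|i i_n]; first by rewrite /tau /= mulr0 mul0r.
by rewrite /= (nth_map 0%N) ?size_iota// nth_iota.
Qed.

Let tau_nd i : tau i <= tau i.+1.
Proof. by rewrite ler_pM2r ?invr_gt0// ler_pM2l// ler_nat. Qed.

Let tauB i : tau i.+1 - tau i = t / n.+1%:R.
Proof. by rewrite /tau -mulrBl -mulrBr -natrB// subSnn mulr1. Qed.

Let tau_ge0 i : 0 <= tau i.
Proof. by rewrite !mulr_ge0 ?invr_ge0// ltW. Qed.

Let tau_last : tau n.+1 = t.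
Proof. by rewrite /tau mulfK// pnatr_eq0. Qed.

Lemma regular_itv_partition : itv_partition 0 t regular_partition.
Proof.
split.
  apply/(pathP t) => i; rewrite size_map size_iota => i_n.
  rewrite nth_partition; last exact: ltnW.
  rewrite -[nth t regular_partition i]/(nth t (0 :: regular_partition) i.+1) nth_partition//.
  by rewrite ltr_pM2r ?invr_gt0// ltr_pM2l// ltr_nat.
by rewrite (last_nth t) size_map size_iota nth_partition// tau_last.
Qed.

Lemma regular_mesh : mesh 0 t regular_partition = t / n.+1%:R.
Proof.
rewrite /mesh size_map size_iota big_nat.
under eq_bigr => i /andP[_ i_n] do rewrite !nth_partition ?(ltnW i_n)// tauB.
rewrite -big_nat big_const_nat subn0.
have h0 : 0 <= t / n.+1%:R by rewrite divr_ge0// ltW.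
move: (t / n.+1%:R) h0 => c c0; elim: n => [|m /= ->]; first by rewrite /= max_l.
by rewrite max_l.
Qed.

Let N k w := \sum_(i < k) comp (tau i) (tau i.+1) w.

Lemma square_variation_compensated w :
  square_variation 0 t (X ^~ w) regular_partition - \int[leb]_(r in `[0, t]) H r w = N n.+1 w.
Proof.
have tI k : \int[leb]_(r in `[0, tau k]) H r w = \sum_(i < k) \int[leb]_(r in `[tau i, tau i.+1]) H r w.
  elim: k => [|k IH].
    by rewrite big_ord0 /tau mulr0 mul0r set_itv1 Rintegral_set1.
  by rewrite big_ord_recr/= -IH -(time_integral_split mH H1 w (tau_ge0 k) (tau_nd k)).
rewrite -{2}tau_last tI /N /comp sumrB; congr (_ - _).
rewrite /square_variation size_map size_iota big_nat.
under eq_bigr => i /andP[_ i_n] do rewrite !nth_partition ?(ltnW i_n)//.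
by rewrite -big_nat big_mkord.
Qed.

(** By orthogonality the second moments add up. With all n+1 steps of length t/(n+1) the total is 8
    t^2 / (n+1), which tends to 0: this is the L^2 convergence of the square variation. *)
Lemma compensated_second k :
  [/\ Fmeas F (tau k) (N k), P.-integrable setT (EFin \o (fun w => N k w ^+ 2)) &
    \int[P]_w (N k w ^+ 2) <= k%:R * (8 * (t / n.+1%:R) ^+ 2)].
Proof.
elim: k => [|k [Fk ik ek]].
  have N0 : N 0 = cst 0 by apply/funext => w; rewrite /N big_ord0.
  split; first by rewrite N0; exact: measurable_cst.
    apply: (@prob_bounded_integrable _ _ _ P _ 0).
      by apply: measurable_funX; rewrite N0.
    by move=> w; rewrite N0 /= expr0n normr0.
  under eq_Rintegral do rewrite N0 /= expr0n.
  by rewrite Rintegral_prob_cst mul0r.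
have NS : N k.+1 = fun w => N k w + comp (tau k) (tau k.+1) w.
  by apply/funext => w; rewrite /N big_ord_recr.
have [ic2 ec2] := comp_second (tau_ge0 k) (tau_nd k).
have [io eo] := comp_orthogonal (tau_ge0 k) (tau_nd k) Fk ik.
have FS : Fmeas F (tau k.+1) (N k.+1).
  rewrite NS; apply: measurable_funD; first exact: (Fmeas_le fF (tau_ge0 k) (tau_nd k) Fk).
  apply: measurable_funB; last exact: (progressive_time_integral mphi phi1).
  apply: measurable_funX; apply: measurable_funB; first exact: FX.
  by apply: (Fmeas_le fF (tau_ge0 k) (tau_nd k)); exact: FX.
have [i1 e1] := expectation_affine 0 1 2 ik io.
have [i2 e2] := expectation_affine 0 1 1 i1 ic2.
have sE w : N k.+1 w ^+ 2 = 0 + 1 * (0 + 1 * N k w ^+ 2 + 2 * (N k w * comp (tau k) (tau k.+1) w)) +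
    1 * comp (tau k) (tau k.+1) w ^+ 2 by rewrite NS; ring.
split => //.
- by apply: eq_integrable i2 => // w _ /=; rewrite sE.
- under eq_Rintegral do rewrite sE.
  rewrite e2 e1 eo (_ : k.+1%:R * _ = k%:R * (8 * (t / n.+1%:R) ^+ 2) + 8 * (tau k.+1 - tau k) ^+ 2).
    by rewrite !mul1r mulr0 !add0r addr0 lerD.
  by rewrite tauB -[k.+1%:R]natr1 mulrDl mul1r.
Qed.

End partition.

Lemma square_variation_measurable (t : R) (n : nat) : 0 < t ->
  measurable_fun setT (fun w => square_variation 0 t (X ^~ w) (regular_partition t n)).
Proof.
move=> t0; rewrite /square_variation; apply: measurable_sum => i.
by apply: measurable_funX; apply: measurable_funB; exact: joint_measurable_sec2.
Qed.

(** At each fixed time the square variation has [V] as limit in probability and the time integral of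
    [H] as limit in L^2, so both agree almost surely. One null set serves all rational times, and
    continuity of both sides extends the equality to all times. *)
Lemma quadratic_variation_eq (V : T -> cumulative R R) : quadratic_variation P X V ->
  {ae P, forall w, forall t, 0 <= t -> V w t = \int[leb]_(r in `[0, t]) H r w}.
Proof.
move=> [mV cV V0 hV].
have eq_t (t : R) : 0 <= t -> {ae P, forall w, V w t = \int[leb]_(r in `[0, t]) H r w}.
  rewrite le_eqVlt => /predU1P[<-|t0].
    by apply: aeW => w; rewrite V0// set_itv1 Rintegral_set1.
  have := hV t (regular_partition t) (ltW t0) (fun n => regular_itv_partition n t0).
  have mesh0 : mesh 0 t (regular_partition t n) @[n --> \oo] --> (0 : R).
    have -> : (fun n => mesh 0 t (regular_partition t n)) = (fun n => t * harmonic n).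
      by apply/funext => n; rewrite regular_mesh.
    rewrite -(mulr0 t); apply: cvgM; [exact: cvg_cst|exact: cvg_harmonic].
  move=> /(_ mesh0) VP.
  apply: (cvg_in_probability_unique (Y := fun n w => square_variation 0 t (X ^~ w) (regular_partition t n))) => //.
  - by move=> n; exact: square_variation_measurable.
  - exact: (time_integral_measurable mH H1).
  - move=> n; have [_ i2 _] := compensated_second n t0 n.+1.
    by apply: eq_integrable i2 => // w _ /=; rewrite square_variation_compensated.
  - apply: (@squeeze_cvgr _ _ _ _ (fun=> 0) (fun n => 8 * t ^+ 2 * harmonic n)).
    + apply: nearW => n; apply/andP; split.
        by apply: Rintegral_ge0 => w _; exact: sqr_ge0.
      under eq_Rintegral do rewrite square_variation_compensated//.
      have [_ _ e2] := compensated_second n t0 n.+1.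
      apply: le_trans e2 _; rewrite le_eqVlt /harmonic/=; apply/orP; left; apply/eqP; field.
      by rewrite nat1r pnatr_eq0.
    + exact: cvg_cst.
    + rewrite -(mulr0 (8 * t ^+ 2)); apply: cvgM; [exact: cvg_cst|exact: cvg_harmonic].
(* The rationals are enumerated through [unpickle]; a code that decodes to nothing stands for the
   time 0. *)
have : {ae P, forall w, forall n : nat, let q : R := ratr (odflt 0 (unpickle n : option rat)) in
    0 <= q -> V w q = \int[leb]_(r in `[0, q]) H r w}.
  apply: ae_foralln => n /=; set q : R := ratr _.
  have [q0|q0] := leP 0 q; last exact: aeW.
  by apply: filterS (eq_t q q0) => w h.
apply: filterS => w h t t0.
apply/eqP; rewrite -subr_eq0; apply/eqP.
apply: (@eq0_small _ _ 2) => e e0.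
have /cvgrPdist_lt/(_ e e0)/nbhs_ballP[dl /= dl0 hdl] := cV w t.
have mn : 0 < Num.min dl e by rewrite lt_min dl0.
have [q] := @rat_in_itvoo R t (t + Num.min dl e) (ltac:(by rewrite ltrDl)).
rewrite in_itv/= => /andP[tq qt]; have q0 : 0 <= (ratr q : R) by rewrite (le_trans t0)// ltW.
have := h (pickle q); rewrite pickleK => /(_ q0) Vq.
have qdl : ratr q - t < dl by move: qt; rewrite -ltrBlDl lt_min => /andP[].
have qe : ratr q - t < e by move: qt; rewrite -ltrBlDl lt_min => /andP[].
have h1 : `|V w t - V w (ratr q)| < e.
  by apply: hdl; rewrite /ball/= distrC ger0_norm// subr_ge0 ltW.
rewrite Vq (time_integral_split mH H1 w t0 (ltW tq)) opprD addrA in h1.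
have h2 := time_integral_bound mH H1 w (ltW tq).
rewrite -[X in `|X|](subrK (\int[leb]_(r in `[t, ratr q]) H r w)).
apply: le_trans (ler_normD _ _) _; rewrite mulr_natl mulr2n lerD//; first exact: ltW.
by rewrite (le_trans h2)// mul1r ltW.
Qed.

End quadratic_variation_identification.

(** * Riemann sums for Stieltjes integrals *)

Section stieltjes_riemann.
Context (R : realType).

Lemma step_function_value (tau c : nat -> R) n (r : R) : (forall i, tau i <= tau i.+1) ->
  tau 0%N < r -> r <= tau n ->
  exists i, [/\ (i < n)%N, r \in `]tau i, tau i.+1] &
    \sum_(i < n) c i * \1_(`]tau i, tau i.+1]) r = c i].
Proof.
move=> nd r0; elim: n => [|n IH] rn; first by move: (lt_le_trans r0 rn); rewrite ltxx.
have [rn'|nr] := leP r (tau n).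
  have [i [i_n ri e]] := IH rn'; exists i; split => //; first exact: ltnW.
  rewrite big_ord_recr/= e indicE memNset ?mulr0 ?addr0//= in_itv/=.
  by rewrite ltNge rn'.
exists n; rewrite ltnSn in_itv/= nr rn; split => //.
rewrite big_ord_recr/= big1 ?add0r; last first.
  move=> i _; rewrite indicE memNset ?mulr0//= in_itv/=; apply/negP; rewrite negb_and -!ltNge -leNgt.
  apply/orP; right; apply: le_lt_trans nr.
  by apply: (homo_leq (r := fun a b => a <= b) lexx (fun _ _ _ => @le_trans _ _ _ _ _) nd).
by rewrite indicE mem_set ?mulr1//= in_itv/= nr rn.
Qed.

Lemma lebesgue_stieltjes_itvoc (V : cumulative R R) (a b : R) : a <= b ->
  lebesgue_stieltjes_measure V `]a, b] = (V b - V a)%:E.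
Proof. by move=> ab; rewrite [LHS]measurable_mu_extE/= ?wlength_itv_bnd//; exact: is_ocitv. Qed.

Variables (V : cumulative R R) (t : R).
Hypothesis t0 : 0 <= t.
Let mu := lebesgue_stieltjes_measure V.

Lemma lebesgue_stieltjes_itvoc_lty (a b : R) : (mu `]a, b] < +oo)%E.
Proof.
have [ab|ba] := leP a b; first by rewrite /mu lebesgue_stieltjes_itvoc// ltry.
have -> : `]a, b]%classic = set0 :> set R.
  by apply/seteqP; split => // r /=; rewrite in_itv/= => /andP[]; lra.
by rewrite /mu measure0.
Qed.

(** The partition starts at -1 so that the half-open interval ]-1, t] contains the time 0. Negative
    times are later removed by an indicator. *)
Definition riemann_point (n i : nat) : R := -1 + (t + 1) * i%:R / n.+1%:R.

Lemma riemann_point_le n i : riemann_point n i <= riemann_point n i.+1.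
Proof. by rewrite lerD2l ler_pM2r ?invr_gt0// ler_wpM2l ?ler_nat// addr_ge0. Qed.

Lemma riemann_point0 n : riemann_point n 0 = -1.
Proof. by rewrite /riemann_point mulr0 mul0r addr0. Qed.

Lemma riemann_point_last n : riemann_point n n.+1 = t.
Proof. by rewrite /riemann_point mulfK ?pnatr_eq0// addrC addrK. Qed.

Lemma riemann_pointB n i : riemann_point n i.+1 - riemann_point n i = (t + 1) * harmonic n.
Proof.
rewrite /riemann_point /harmonic/= -natr1; field.
by rewrite nat1r pnatr_eq0.
Qed.

Lemma riemann_point_bounds n i : (i <= n.+1)%N -> -1 <= riemann_point n i <= t.
Proof.
move=> i_n; have mono := homo_leq (r := fun a b => a <= b) lexx (fun _ _ _ => @le_trans _ _ _ _ _) (@riemann_point_le n).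
by have := mono _ _ (leq0n i); have := mono _ _ i_n; rewrite riemann_point0 riemann_point_last => -> ->.
Qed.

(** Sampling at right endpoints makes continuity from the right sufficient. This matters because the
    integrand to which it is applied is cut off before time 0 and jumps there. *)
Lemma stieltjes_riemann_cvg (f : R -> R) (M : R) : measurable_fun setT f -> (forall r, `|f r| <= M) ->
  (forall s, -1 < s -> s <= t -> forall e, 0 < e -> exists2 dl, 0 < dl &
     forall r, s <= r -> r < s + dl -> r <= t -> `|f r - f s| < e) ->
  \sum_(i < n.+1) f (riemann_point n i.+1) * (V (riemann_point n i.+1) - V (riemann_point n i))
    @[n --> \oo] --> \int[mu]_(r in `]-1, t]) f r.
Proof.
move=> mf fM rc.
pose st n (r : R) := \sum_(i < n.+1) f (riemann_point n i.+1) * \1_(`]riemann_point n i, riemann_point n i.+1]) r.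
have mst n : measurable_fun setT (st n).
  exact: (step_function_measurable (riemann_point n) (fun i => f (riemann_point n i.+1))).
have ist n : \int[mu]_(r in `]-1, t]) st n r =
    \sum_(i < n.+1) f (riemann_point n i.+1) * (V (riemann_point n i.+1) - V (riemann_point n i)).
  have ii i : mu.-integrable `]-1, t] (EFin \o (fun r => f (riemann_point n i.+1) * \1_(`]riemann_point n i, riemann_point n i.+1]) r)).
    apply: (bounded_integrable _ (lebesgue_stieltjes_itvoc_lty _ _) (M := M)) => //.
      by apply: measurable_funTS; apply: measurable_funM.
    move=> r _; rewrite normrM -[leRHS]mulr1 ler_pM// indicE.
    by case: (_ \in _); rewrite ?normr1 ?normr0.
  have : forall k, (k <= n.+1)%N -> mu.-integrable `]-1, t] (EFin \o (fun r => \sum_(i < k) f (riemann_point n i.+1) * \1_(`]riemann_point n i, riemann_point n i.+1]) r)) /\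
     \int[mu]_(r in `]-1, t]) (\sum_(i < k) f (riemann_point n i.+1) * \1_(`]riemann_point n i, riemann_point n i.+1]) r) =
     \sum_(i < k) f (riemann_point n i.+1) * (V (riemann_point n i.+1) - V (riemann_point n i)).
    elim=> [|k IH] kn.
      split.
        apply: (bounded_integrable _ (lebesgue_stieltjes_itvoc_lty _ _) (M := 0)) => //.
          rewrite (_ : (fun r : R => _) = cst 0); first exact: measurable_cst.
          by apply/funext => r; rewrite big_ord0.
        by move=> r _; rewrite big_ord0 normr0.
      by rewrite big_ord0; under eq_Rintegral do rewrite big_ord0; rewrite Rintegral_cst// mul0r.
    have [i1 e1] := IH (ltnW kn); split.
      by apply: eq_integrable (integrableD _ i1 (ii k)) => // r _; rewrite /= big_ord_recr/= EFinD.
    under eq_Rintegral do rewrite big_ord_recr/=.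
    rewrite RintegralD// e1 big_ord_recr/=; congr (_ + _).
    have i1k : mu.-integrable `]-1, t] (EFin \o \1_(`]riemann_point n k, riemann_point n k.+1])).
      apply: (bounded_integrable _ (lebesgue_stieltjes_itvoc_lty _ _) (M := 1)) => //.
      by move=> r _; rewrite indicE; case: (_ \in _); rewrite ?normr1 ?normr0.
    rewrite RintegralZl//; congr (_ * _); rewrite /Rintegral integral_indic//=.
    rewrite setIidl ?lebesgue_stieltjes_itvoc//; first exact: riemann_point_le.
    have /andP[h1 _] := riemann_point_bounds (ltnW kn).
    have /andP[_ h2] := riemann_point_bounds kn.
    move=> r /=; rewrite !in_itv/= => /andP[r1 r2].
    by rewrite (le_lt_trans h1)//= (le_trans r2).
  by move=> /(_ n.+1 (leqnn _)) [].
under eq_cvg do rewrite -ist.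
apply: (bounded_cvg_Rintegral _ (lebesgue_stieltjes_itvoc_lty _ _) (M := M)) => //.
- by move=> n; apply: measurable_funTS; exact: mst.
- exact: measurable_funTS.
- move=> n r /=; rewrite in_itv/= => /andP[r1 r2]; rewrite /st.
  have [||i [_ _ ->]//] := @step_function_value (riemann_point n) (fun i => f (riemann_point n i.+1)) n.+1 r (riemann_point_le n).
    by rewrite riemann_point0.
  by rewrite riemann_point_last.
- move=> r /=; rewrite in_itv/= => /andP[r1 r2]; apply/cvgrPdist_lt => e e0.
  have [dl dl0 hdl] := rc r r1 r2 e e0.
  have hd : 0 < dl / (t + 1) by rewrite divr_gt0// ltr_wpDl.
  have /cvgrPdist_lt/(_ _ hd) hN := @cvg_harmonic R.
  near=> n; rewrite /st.
  have hn : (t + 1) * harmonic n < dl.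
    rewrite mulrC -ltr_pdivlMr ?ltr_wpDl//.
    have : `|0 - harmonic n| < dl / (t + 1) :> R.
      by near: n; exact: hN.
    by apply: le_lt_trans; rewrite sub0r normrN ler_norm.
  have [||i [i_n ri ->]] := @step_function_value (riemann_point n) (fun i => f (riemann_point n i.+1)) n.+1 r (riemann_point_le n).
  + by rewrite riemann_point0.
  + by rewrite riemann_point_last.
  + rewrite distrC; move: ri; rewrite in_itv/= => /andP[h1 h2]; apply: hdl => //.
      have := riemann_pointB n i; lra.
    by have /andP[] := riemann_point_bounds i_n.
Unshelve. all: by end_near. Qed.

End stieltjes_riemann.

Section local_time_approximation.
Context d (T : measurableType d) (R : realType).
Notation leb := (@lebesgue_measure R).
Variables (X : R -> T -> R) (V : T -> cumulative R R).
Hypotheses (cX : forall w, continuous (X ^~ w)) (mX : joint_measurable X)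
  (mV : forall t, measurable_fun setT (fun w => V w t)).

(* Measurability in [w] holds as a limit of Riemann-Stieltjes sums; [cvg_in_probability]
   says nothing about a family that is not measurable. *)
Lemma stieltjes_integral_measurable (g : R -> R) (M t : R) : 0 <= t -> continuous g ->
  (forall x, `|g x| <= M) ->
  measurable_fun setT (fun w =>
    \int[lebesgue_stieltjes_measure (V w)]_(r in `]-1, t]) (g (X r w) * \1_(`[0, +oo[) r)).
Proof.
move=> t0 cg gM.
have mg : measurable_fun setT g by exact: continuous_measurable_fun.
pose f w r := g (X r w) * \1_(`[0, +oo[) r : R.
apply: (measurable_fun_cvg (h := fun n w => \sum_(i < n.+1) f w (riemann_point t n i.+1) *
   (V w (riemann_point t n i.+1) - V w (riemann_point t n i)))).
  move=> n; apply: measurable_sum => i; apply: measurable_funM; last exact: measurable_funB.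
  apply: measurable_funM => //.
  by apply: (measurableT_comp mg); exact: joint_measurable_sec2.
move=> w _; apply: (@stieltjes_riemann_cvg R (V w) t t0 (f w) M).
- apply: measurable_funM; last by exact: measurable_indic.
  by apply: (measurableT_comp mg); exact: joint_measurable_sec.
- move=> r; rewrite normrM -[leRHS]mulr1 ler_pM// indicE.
  by case: (_ \in _); rewrite ?normr1 ?normr0.
- move=> s _ _ e e0; rewrite /f; have [s0|s0] := leP 0 s.
    have cgX : {for s, continuous (fun r => g (X r w))}.
      by apply: continuous_comp; [exact: cX|exact: cg].
    have /cvgrPdist_lt/(_ e e0)/nbhs_ballP[dl /= dl0 hdl] := cgX.
    exists dl => // r sr rd _.
    rewrite !indicE !mem_set//= ?in_itv/= ?s0 ?(le_trans s0)// !mulr1 distrC.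
    by apply: hdl; rewrite /ball/= distrC ger0_norm ?subr_ge0//; lra.
  exists (- s); first by rewrite oppr_gt0.
  move=> r _ rs _; rewrite !indicE !memNset ?mulr0 ?subrr ?normr0//= in_itv/= andbT; apply/negP; rewrite -ltNge//.
  by move: rs; lra.
Qed.

Lemma closed_indicator_cvg (eta x : R) :
  Num.max 0 (1 - n%:R * Num.max 0 (`|x| - eta)) @[n --> \oo] --> (\1_(`[- eta, eta]) x : R).
Proof.
apply: cvg_near_cst; have [xe|ex] := leP `|x| eta.
  have m0 : Num.max 0 (`|x| - eta) = 0 by rewrite max_l// subr_le0.
  apply: nearW => n; rewrite m0 mulr0 subr0 max_r//.
  by rewrite indicE mem_set//= in_itv/= -ler_norml.
have de : 0 < `|x| - eta by rewrite subr_gt0.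
near=> n; rewrite (_ : Num.max 0 (`|x| - eta) = `|x| - eta); last by rewrite max_r// ltW.
rewrite indicE memNset; last by rewrite /= in_itv/= -ler_norml leNgt ex.
rewrite max_l// subr_le0 -ler_pdivrMr// mul1r.
by near: n; exact: nbhs_infty_ger.
Unshelve. all: by end_near. Qed.

Lemma local_time_approximation_measurable (eta t : R) : 0 <= t ->
  measurable_fun setT (fun w => \int[lebesgue_stieltjes_measure (V w)]_(r in `[0, t]) \1_(`[- eta, eta]) (X r w)).
Proof.
move=> t0; pose g (n : nat) (x : R) : R := Num.max 0 (1 - n%:R * Num.max 0 (`|x| - eta)).
have g01 n x : `|g n x| <= 1.
  rewrite ger0_norm /g ?le_max ?lexx// ge_max ler01/= lerBlDr lerDl mulr_ge0//.
  by rewrite le_max lexx.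
have cg n : continuous (g n : R -> R).
  suff h x : {for x, continuous (fun x : R => Num.max 0 (1 - n%:R * Num.max 0 (`|x| - eta)))} by move=> x; exact: h.
  apply: continuous_max; first exact: cst_continuous.
  apply: continuousB; first exact: cst_continuous.
  apply: continuousM; first exact: cst_continuous.
  apply: continuous_max; first exact: cst_continuous.
  by apply: continuousB; [exact: norm_continuous|exact: cst_continuous].
apply: (measurable_fun_cvg (h := fun n w => \int[lebesgue_stieltjes_measure (V w)]_(r in `]-1, t]) (g n (X r w) * \1_(`[0, +oo[) r))).
  by move=> n; exact: (stieltjes_integral_measurable t0 (cg n) (g01 n)).
move=> w _.
have -> : \int[lebesgue_stieltjes_measure (V w)]_(r in `[0, t]) \1_(`[- eta, eta]) (X r w) =
    \int[lebesgue_stieltjes_measure (V w)]_(r in `]-1, t]) (\1_(`[- eta, eta]) (X r w) * \1_(`[0, +oo[) r).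
  rewrite Rintegral_mkcond [RHS]Rintegral_mkcond; apply: eq_Rintegral => r _; rewrite !patchE.
  have [r0|r0] := leP 0 r.
    rewrite [X in _ * X]indicE (mem_set (_ : `[0, +oo[%classic r)) ?mulr1; last by rewrite /= in_itv/= r0.
    congr (if _ then _ else _); apply/idP/idP; rewrite !inE/= !in_itv/= => /andP[_ ->].
      by rewrite andbT (lt_le_trans _ r0)// ltrN10.
    by rewrite r0.
  rewrite memNset; last by rewrite /= in_itv/= leNgt r0.
  have r0' : ~ `[0, +oo[%classic r by rewrite /= in_itv/= leNgt r0.
  by rewrite [X in _ * X]indicE (memNset r0') mulr0; case: (r \in `]-1, t]%classic).
apply: (bounded_cvg_Rintegral _ (lebesgue_stieltjes_itvoc_lty _ _ _) (M := 1)) => //.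
- move=> n; apply: measurable_funTS; apply: measurable_funM; last exact: measurable_indic.
  apply: (measurableT_comp (continuous_measurable_fun (cg n))).
  exact: joint_measurable_sec.
- apply: measurable_funTS; apply: measurable_funM; last exact: measurable_indic.
  by apply: (measurableT_comp (measurable_indic _)) => //; exact: joint_measurable_sec.
- move=> n r _; rewrite normrM -[leRHS]mulr1 ler_pM// indicE.
  by case: (_ \in _); rewrite ?normr1 ?normr0.
- by move=> r _; apply: cvgM; [exact: closed_indicator_cvg|exact: cvg_cst].
Qed.

(** The two assumptions on the path [V w] say that its Stieltjes measure is Lebesgue measure
    restricted to [E], the positive times at which X is not 0. Time 0 belongs to [0, t] but carries
    no mass. *)
Lemma local_time_approximation_eq (w : T) (eta t : R) : 0 <= t ->
  (forall r, r <= 0 -> V w r = 0) ->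
  (forall r, 0 <= r -> V w r = \int[leb]_(u in `[0, r]) \1_(~` [set 0]) (X u w)) ->
  \int[lebesgue_stieltjes_measure (V w)]_(r in `[0, t]) \1_(`[- eta, eta]) (X r w) =
  \int[leb]_(r in `[0, t]) (\1_(~` [set 0]) (X r w) * \1_(`[- eta, eta]) (X r w)).
Proof.
move=> t0 V0 VE.
have mXw : measurable_fun setT (X ^~ w) := joint_measurable_sec w mX.
have mN0 : measurable (~` [set 0 : R]) by apply: measurableC.
pose XN := [set r | X r w != 0].
have mXN : measurable XN.
  have -> : XN = (X ^~ w) @^-1` (~` [set 0]).
    by apply/seteqP; split => r /=; [move/eqP|move=> h; apply/eqP].
  by rewrite -[X in measurable X]setTI; exact: mXw.
pose E := [set r | 0 < r] `&` XN.
have mE : measurable E.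
  apply: measurableI => //.
  by rewrite (_ : [set r | 0 < r] = `]0, +oo[%classic)//; apply/seteqP; split => r /=; rewrite in_itv/= andbT.
have ind1 r : `|\1_(~` [set 0]) (X r w)| <= 1 :> R.
  by rewrite indicE; case: (_ \in _); rewrite ?normr1 ?normr0.
have mind : measurable_fun setT (fun r => \1_(~` [set 0]) (X r w) : R).
  by apply: (measurableT_comp (measurable_indic mN0)).
have Voc (a b : R) : 0 <= a -> a <= b -> (V w b - V w a)%:E = leb (`]a, b] `&` XN).
  move=> a0 ab; rewrite !VE ?(le_trans a0 ab)//.
  have iE (r : R) : leb.-integrable `[0, r] (EFin \o (fun u => \1_(~` [set 0]) (X u w) : R)).
    apply: (bounded_integrable _ (lebesgue_itvcc_lty 0 r) (M := 1)) => //.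
    exact: measurable_funTS.
  rewrite Rintegral_itvB//; rewrite ?bnd_simp//.
  rewrite /Rintegral.
  have -> : (\int[leb]_(x in `]a, b]) (\1_(~` [set 0]) (X x w))%:E = leb (`]a, b] `&` XN))%E.
    rewrite setIC -integral_indic//; apply: eq_integral => r _; rewrite !indicE; congr EFin; congr (_%:R)%R.
    by congr nat_of_bool; apply/idP/idP; rewrite !inE/= => /eqP.
  rewrite fineK// ge0_fin_numE ?measure_ge0//.
  apply: le_lt_trans (lebesgue_itvcc_lty a b); apply: le_measure; rewrite ?inE//.
    exact: measurableI.
  by move=> r [/= +] _; rewrite !in_itv/= => /andP[h1 ->]; rewrite (ltW h1).
have VEE (a b : R) : a <= b -> (V w b - V w a)%:E = leb (`]a, b] `&` E).
  move=> ab; pose a' := Num.max a 0; pose b' := Num.max b 0.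
  have Vm (c : R) : V w c = V w (Num.max c 0).
    by have [c0|c0] := leP c 0; first by rewrite (V0 c c0) (V0 0 (lexx 0)).
  have a'0 : 0 <= a' by rewrite le_max lexx orbT.
  have ab' : a' <= b' by rewrite /a' /b'; case: (leP a 0); case: (leP b 0); lra.
  rewrite (Vm a) (Vm b) (Voc _ _ a'0 ab').
  congr (leb _); rewrite /E setIA; congr (_ `&` _).
  apply/seteqP; split => r /=; rewrite !in_itv/= gt_max le_max.
    by move=> /andP[/andP[ar r0] /orP[rb|]]; [rewrite ar rb r0|rewrite leNgt r0].
  by move=> [/andP[-> ->] ->].
have ig : leb.-integrable `]0, t] (EFin \o (fun r => \1_(~` [set 0]) (X r w) * \1_(`[- eta, eta]) (X r w) : R)).
  apply: (bounded_integrable _ _ (M := 1)) => //.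
  - apply: le_lt_trans (lebesgue_itvcc_lty 0 t); apply: le_measure; rewrite ?inE//.
    by move=> r /=; rewrite !in_itv/= => /andP[h1 ->]; rewrite (ltW h1).
  - apply: measurable_funTS; apply: measurable_funM => //.
    exact: (measurableT_comp (measurable_indic _) mXw).
  - move=> r _; rewrite normrM -[leRHS]mulr1 ler_pM// indicE.
    by case: (_ \in _); rewrite ?normr1 ?normr0.
pose f (r : R) : R := \1_(`[- eta, eta]) (X r w) * \1_(`[0, t]) r.
have mf : measurable_fun setT f.
  apply: measurable_funM; last exact: measurable_indic.
  exact: (measurableT_comp (measurable_indic _) mXw).
have := lebesgue_stieltjes_density mE VEE mf (fun r => mulr_ge0 _ _) => /(_ (fun=> ler0n _ _) (fun=> ler0n _ _)) h.
transitivity (fine (\int[lebesgue_stieltjes_measure (V w)]_x (f x)%:E)%E).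
  rewrite /Rintegral integral_mkcond; congr fine; apply: eq_integral => r _.
  by rewrite patchE /f [\1_(`[0, t]) r]indicE; case: ifPn; rewrite ?mulr1 ?mulr0.
rewrite h {h}.
rewrite -Rintegral_itv_obnd_cbnd// /Rintegral; congr fine; rewrite [RHS]integral_mkcond.
apply: eq_integral => r _; rewrite patchE /f.
have [r0|r0] := leP r 0.
  rewrite [\1_E r]indicE memNset ?mulr0; last by rewrite /E/= => -[]; rewrite ltNge r0.
  by rewrite memNset//= in_itv/= ltNge r0.
have -> : \1_E r = \1_(~` [set 0]) (X r w) :> R.
  rewrite !indicE; congr (_%:R); congr nat_of_bool; apply/idP/idP; rewrite !inE/=.
    by move=> [_ /eqP].
  by move=> /eqP ?; split.
rewrite [\1_(`[0, t]) r]indicE; have [rt|tr] := leP r t.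
  by rewrite !mem_set ?mulr1 ?(mulrC (\1_(~` _) _))//= in_itv/= ?r0 ?(ltW r0).
have n1 : ~ `[0, t]%classic r by rewrite /= in_itv/= (leNgt r t) tr andbF.
have n2 : ~ `]0, t]%classic r by rewrite /= in_itv/= (leNgt r t) tr andbF.
by rewrite (memNset n1) (memNset n2) mulr0 mul0r.
Qed.

End local_time_approximation.

(* Replaces a derivative bound: the losses over n equal pieces add up to O(1/n). *)
Lemma quadratic_decrease (R : realType) (u : R -> R) (s t K : R) : s <= t ->
  (forall a b, s <= a -> a <= b -> b <= t -> u a - u b <= K * (b - a) ^+ 2) -> u s <= u t.
Proof.
move=> st h; rewrite -subr_le0; apply/ler_addgt0Pr => e e0; rewrite add0r.
pose c : R := `|K| * (t - s) ^+ 2; have c0 : 0 <= c by rewrite mulr_ge0// sqr_ge0.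
have [n] : exists n : nat, c / e < n.+1%:R.
  by exists (Num.truncn (c / e)); rewrite truncnS_gt.
rewrite ltr_pdivrMr// => cn.
pose tau (i : nat) : R := s + (t - s) * i%:R / n.+1%:R.
have tauB i : tau i.+1 - tau i = (t - s) / n.+1%:R.
  by rewrite /tau -[in LHS]natr1; field; rewrite nat1r pnatr_eq0.
have tau0 : tau 0 = s by rewrite /tau mulr0 mul0r addr0.
have taun : tau n.+1 = t by rewrite /tau mulfK ?pnatr_eq0// addrC subrK.
have tau_le i : tau i <= tau i.+1 by rewrite -subr_ge0 tauB divr_ge0// subr_ge0.
have mono := homo_leq (r := fun a b => a <= b) lexx (fun _ _ _ => @le_trans _ _ _ _ _) tau_le.
have step i : (i < n.+1)%N -> u (tau i) - u (tau i.+1) <= `|K| * ((t - s) / n.+1%:R) ^+ 2.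
  move=> i_n; apply: (le_trans (h _ _ _ _ _)); rewrite ?tauB ?ler_wpM2r ?sqr_ge0 ?ler_norm//.
    by rewrite -tau0 mono.
  by rewrite -taun mono.
have tel k : (k <= n.+1)%N -> u s - u (tau k) <= k%:R * (`|K| * ((t - s) / n.+1%:R) ^+ 2).
  elim: k => [|k IH] kn; first by rewrite tau0 subrr mul0r.
  have := lerD (IH (ltnW kn)) (step k kn).
  by rewrite subrKA => /le_trans; apply; rewrite -[k.+1%:R]natr1 [leRHS]mulrDl mul1r.
have := tel n.+1 (leqnn _); rewrite taun => /le_trans; apply.
rewrite (_ : n.+1%:R * (`|K| * _) = c / n.+1%:R); first by rewrite ler_pdivrMr// ltW// mulrC.
by rewrite /c; field; rewrite nat1r pnatr_eq0.
Qed.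

Lemma norm_le_sqr (R : realFieldType) (x : R) : `|x| <= 1 + x ^+ 2.
Proof. by rewrite ler_norml; apply/andP; split; nra. Qed.

Lemma second_moment_arith (R : realFieldType) (x1 x2 x3 x4 x5 h C : R) :
  x1 <= h + 2 * x3 + 1 * x2 -> x3 <= C * x4 ->
  x1 - 2 * C * (x4 + x5) - (x2 - 2 * C * x5) <= h.
Proof. by rewrite !mulrDr; lra. Qed.

(** Bounded second moments give uniform integrability. The difference is at most [dl] off the event
    [A]; on [A] it is at most k (Y - L)^2 + 1/k. The square has mean at most 4 K and [A] has
    probability below k dl, so the total is at most 2 dl + 4 K k. *)
Lemma cvg_in_probability_expectation d (T : measurableType d) (R : realType)
    (P : probability T R) (G : set_system R) (FG : ProperFilter G) (Y : R -> T -> R) (L z : T -> R) (K Mz : R) :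
  (forall a, measurable_fun setT (Y a)) -> measurable_fun setT L ->
  measurable_fun setT z -> (forall w, `|z w| <= Mz) ->
  (\forall a \near G, P.-integrable setT (EFin \o (fun w => Y a w ^+ 2)) /\ \int[P]_w (Y a w ^+ 2) <= K) ->
  P.-integrable setT (EFin \o (fun w => L w ^+ 2)) -> \int[P]_w (L w ^+ 2) <= K ->
  cvg_in_probability P G Y L ->
  \int[P]_w (z w * Y a w) @[a --> G] --> \int[P]_w (z w * L w).
Proof.
move=> mY mL mz zM YK iL LK YL; apply/cvgrPdist_le => e e0.
have K0 : 0 <= K by apply: le_trans LK; apply: Rintegral_ge0 => w _; exact: sqr_ge0.
pose M := `|Mz| + 1; have M0 : 0 < M by rewrite ltr_wpDl.
pose dl := e / (3 * M); have dl0 : 0 < dl by rewrite divr_gt0// mulr_gt0.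
(* Chosen so that k (4 K + 1) = [dl]; the three contributions then add up to 3 M dl = e. *)
pose k := e / (3 * M * (4 * K + 1)).
have k0 : 0 < k by rewrite divr_gt0// !mulr_gt0// ltr_wpDl// mulr_ge0.
have q0 : 0 < k * dl by rewrite mulr_gt0.
near=> a.
have [iY YK'] : P.-integrable setT (EFin \o (fun w => Y a w ^+ 2)) /\ \int[P]_w (Y a w ^+ 2) <= K by near: a.
pose A := [set w | dl <= `|Y a w - L w|].
have Pa : (P A < (k * dl)%:E)%E by rewrite /A; near: a; apply: cvge0_near_lt q0 _; exact: YL.
have mA : measurable A.
  have mm : measurable_fun setT (fun w => dl <= `|Y a w - L w|).
    apply: measurable_fun_ler => //; apply: measurableT_comp => //; exact: measurable_funB.
  by rewrite -[X in measurable X]setTI; exact: (mm measurableT [set true]).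
have iA : P.-integrable setT (EFin \o (\1_A : T -> R)).
  apply: (@prob_bounded_integrable _ _ _ P _ 1) => // w.
  by rewrite indicE; case: (_ \in _); rewrite ?normr1 ?normr0.
have eA : \int[P]_w (\1_A w : R) <= k * dl.
  rewrite /Rintegral integral_indic// setIT -lee_fin fineK ?fin_num_measure//.
  exact: ltW Pa.
have sq_int (f : T -> R) : measurable_fun setT f -> P.-integrable setT (EFin \o (fun w => f w ^+ 2)) ->
    P.-integrable setT (EFin \o (fun w => z w * f w)).
  move=> mf if2; apply: (integrable_bmul mz zM).
  have bd w : `|f w| <= 1 + 1 * f w ^+ 2 + 0 * f w ^+ 2 by rewrite mul1r mul0r addr0 norm_le_sqr.
  by have [] := @expectation_affine_le _ _ _ P 1 1 0 _ _ f if2 if2 mf bd.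
have i1 := sq_int _ mL iL; have i2 := sq_int _ (mY a) iY.
rewrite -RintegralB//.
have [i3 e3] := expectation_affine 0 2 2 iY iL.
have [i4 e4] := expectation_affine dl k k^-1 i3 iA.
have [] := @expectation_affine_le _ _ _ P 0 M 0 _ _ (fun w => z w * L w - z w * Y a w) i4 i4.
- by apply: measurable_funB; apply: measurable_funM.
- move=> w; rewrite add0r mul0r addr0 -mulrBr normrM ler_pM//.
    by rewrite (le_trans (zM w))// /M (le_trans (ler_norm _))// lerDl.
  rewrite distrC indicE; have [wA|wA] := boolP (w \in A); last first.
    have : `|Y a w - L w| < dl by rewrite ltNge; apply/negP => h; move/negP: wA; apply; rewrite inE.
    move=> /ltW/le_trans; apply; rewrite mulr0 addr0 lerDl mulr_ge0 ?(ltW k0)//.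
    by rewrite add0r addr_ge0// mulr_ge0// sqr_ge0.
  have h1 : `|Y a w - L w| <= k * (Y a w - L w) ^+ 2 + k^-1.
    have -> : k * (Y a w - L w) ^+ 2 + k^-1 = ((k * `|Y a w - L w|) ^+ 2 + 1) / k.
      by rewrite exprMn real_normK ?num_real//; field; rewrite gt_eqF.
    by rewrite ler_pdivlMr//; have := sqr_ge0 (k * `|Y a w - L w| - 1); nra.
  apply: (le_trans h1); rewrite mulr1 lerD2r -[leLHS]add0r lerD ?(ltW dl0)//.
  by rewrite ler_wpM2l ?(ltW k0)// add0r sqrB_le.
move=> _ /le_trans; apply; rewrite add0r mul0r addr0 e4 e3 add0r.
have -> : e = M * (dl + dl + dl) by rewrite /dl; field; rewrite gt_eqF.
rewrite ler_wpM2l ?(ltW M0)// lerD//; last by rewrite ler_pdivrMl.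
rewrite lerD2l (@le_trans _ _ (k * (4 * K + 1)))//; last first.
  rewrite /k /dl le_eqVlt; apply/orP; left; apply/eqP; field.
  by rewrite !gt_eqF// ltr_wpDl// mulr_ge0.
rewrite ler_wpM2l ?(ltW k0)//; move: YK' LK; clear; lra.
Unshelve. all: by end_near. Qed.

(** * Time spent near zero *)

Section occupation.
Context d (T : measurableType d) (R : realType).
Notation leb := (@lebesgue_measure R).
Variables (P : probability T R) (F : R -> set_system T) (X : R -> T -> R).
Let ne : R -> R := \1_(~` [set 0]).
Hypotheses (fF : filtration F) (cX : forall w, continuous (X ^~ w))
  (FX : forall t, 0 <= t -> Fmeas F t (X t)) (mX : joint_measurable X)
  (dX : diffusion_increments P F X (fun r w => ne (X r w))).

Let mne : measurable_fun setT ne. Proof. by apply: measurable_indic; exact: measurableC. Qed.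
Let ne01 x : 0 <= ne x <= 1.
Proof. by rewrite /ne indicE; case: (_ \in _); rewrite ?lexx ler01. Qed.
Let ne2 r w : ne (X r w) ^+ 2 = ne (X r w).
Proof. by rewrite /ne indicE; case: (_ \in _); rewrite ?expr1n ?expr0n. Qed.
Let mH : joint_measurable (fun r w => ne (X r w)). Proof. exact: joint_measurable_comp. Qed.

Lemma smooth_exp_dynkin (e a sg s t Mz : R) (z : T -> R) : 0 < e -> 0 <= a -> sg ^+ 2 = 1 ->
  0 <= s -> s <= t -> Fmeas F s z -> (forall w, `|z w| <= Mz) ->
  \int[P]_w (z w * (smooth_exp e a sg (X t w) - smooth_exp e a sg (X s w))) =
  2^-1 * \int[P]_w (z w * \int[leb]_(r in `[s, t]) (ne (X r w) * smooth_exp2 e a sg (X r w))).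
Proof.
move=> e0 a0 sg1 s0 st Fz zM; have [C3 hC3] := smooth_exp2_lipschitz e0 a0 sg1.
have f1 x : `|smooth_exp e a sg x| <= 1.
  by rewrite gtr0_norm ?smooth_exp_gt0// smooth_exp_le1.
have := (dynkin_formula fF mX FX mH ne2 dX (is_derive_smooth_exp e0 a sg) (is_derive_smooth_exp1 e0 a sg) f1
  (smooth_exp1_bounded e0 a0 sg1) (smooth_exp2_bounded e0 a0 sg1) hC3 s0 Fz zM st).
move=> h; apply: h.
Qed.

Definition near0 (eta : R) (r : R) (w : T) : R := ne (X r w) * \1_(`[- eta, eta]) (X r w).

Lemma near0_joint eta : joint_measurable (near0 eta).
Proof. by apply: measurable_funM => //; apply: (joint_measurable_comp (g := \1_(`[- eta, eta]))). Qed.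

Lemma near0_bounded eta r w : 0 <= near0 eta r w <= 1.
Proof.
rewrite /near0 [X in _ * X]indicE; case: (_ \in _); rewrite ?mulr1 ?mulr0 ?lexx ?ler01//.
Qed.

Lemma near0_norm eta r w : `|near0 eta r w| <= 1.
Proof. by have /andP[h0 h1] := near0_bounded eta r w; rewrite ger0_norm. Qed.

(** Dynkin's formula for the smoothed exponential with e = [eta] and a = 1. Everywhere [f2] is at
    most 1 - curv f, and on [-eta, eta] the product curv f is at least e^(-2) / (16 eta), since
    [hyp] <= 2 eta there. As f lies in [0, 1], the integral of [f2] is at least -2 E z, so the time
    spent near 0 is of order eta; the 2 in t - s + 2 is that term. *)
Lemma near0_first_moment (eta s t Mz : R) (z : T -> R) : 0 < eta -> eta <= 1 ->
  0 <= s -> s <= t -> Fmeas F s z -> (forall w, 0 <= z w) -> (forall w, z w <= Mz) ->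
  \int[P]_w (z w * \int[leb]_(r in `[s, t]) near0 eta r w) <=
  16 * expR 2 * eta * (t - s + 2) * \int[P]_w z w.
Proof.
move=> eta0 eta1 s0 st Fz z0 zM'.
have zM w : `|z w| <= Mz by rewrite ger0_norm.
have mz : measurable_fun setT z := Fmeas_fun fF s0 Fz.
pose f2 := smooth_exp2 eta 1 1; pose f := smooth_exp eta 1 1; pose K := 16 * expR 2 * eta.
have s1 : 1 ^+ 2 = 1 :> R by rewrite expr1n.
have K0 : 0 < K by rewrite !mulr_gt0// expR_gt0.
have pw x : \1_(`[- eta, eta]) x <= K * (1 - f2 x).
  have v1 : `|1 + hypD eta x| <= 2.
    by rewrite (le_trans (ler_normD _ _))// normr1; have := hypD_le1 eta0 x; lra.
  have h1 : curv eta x * f x <= 1 - f2 x.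
    have : 4^-1 * 1 ^+ 2 * (1 + hypD eta x) ^+ 2 * f x <= 1.
      rewrite -[leRHS]mulr1 ler_pM ?(ltW (smooth_exp_gt0 _ _ _ _)) ?smooth_exp_le1//.
        by rewrite mulr_ge0 ?sqr_ge0// mulr_ge0 ?sqr_ge0.
      have : `|1 + hypD eta x| ^+ 2 <= 2 ^+ 2 by rewrite lerXn2r ?nnegrE.
      by rewrite real_normK ?num_real// expr1n mulr1; lra.
    by rewrite /f2 /smooth_exp2 -/f mul1r mulrBl; lra.
  have cf0 : 0 <= curv eta x * f x by rewrite mulr_ge0 ?curv_ge0// ltW// smooth_exp_gt0.
  rewrite indicE; have [xe|xe] := boolP (x \in _); last first.
    by rewrite mulr_ge0 ?(ltW K0)// (le_trans cf0).
  move: xe; rewrite inE/= in_itv/= -ler_norml => xe.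
  have R2 : hyp eta x <= 2 * eta.
    rewrite -ler_sqr ?nnegrE ?(ltW (hyp_gt0 eta0 x)) ?mulr_ge0 ?(ltW eta0)//.
    rewrite hyp_sqr//; have : `|x| ^+ 2 <= eta ^+ 2 by rewrite lerXn2r ?nnegrE// ltW.
    by rewrite real_normK ?num_real//; have := sqr_ge0 eta; nra.
  have fe : expR (- 2) <= f x.
    rewrite ler_expR mul1r lerN2 (le_trans (smooth_side_le eta s1 x))// (le_trans R2)//; lra.
  have ce : (16 * eta)^-1 <= curv eta x.
    rewrite curvE// (_ : (16 * eta)^-1 = 2^-1 * eta ^+ 2 * ((2 * eta)^-1) ^+ 3); last by field; rewrite gt_eqF.
    apply: ler_wpM2l; first by rewrite mulr_ge0 ?sqr_ge0 ?invr_ge0.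
    rewrite lerXn2r ?nnegrE ?invr_ge0 ?mulr_ge0 ?(ltW eta0) ?(ltW (hypV_gt0 eta0 x)) ?(ltW (hyp_gt0 eta0 x))//.
    by rewrite lef_pV2 ?posrE ?hyp_gt0 ?mulr_gt0.
  apply: (@le_trans _ _ (K * (curv eta x * f x))); last by rewrite ler_wpM2l// ltW.
  have : (16 * eta)^-1 * expR (- 2) <= curv eta x * f x.
    by rewrite ler_pM ?invr_ge0 ?mulr_ge0 ?expR_ge0 ?(ltW eta0).
  move=> /(ler_wpM2l (ltW K0)); apply: le_trans.
  rewrite /K expRN le_eqVlt; apply/orP; left; apply/eqP; field.
  by rewrite !gt_eqF// expR_gt0.
have mf2 : measurable_fun setT f2.
  by apply: continuous_measurable_fun => x; exact: is_derive_continuous (is_derive_smooth_exp2 eta0 1 1 x).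
pose C2 : R := 1 ^+ 2 + 1 * (2^-1 * eta^-1).
have f2b x : `|f2 x| <= C2 := smooth_exp2_bounded eta0 ler01 s1 x.
have mq : joint_measurable (fun r w => ne (X r w) * f2 (X r w)).
  by apply: measurable_funM => //; exact: (joint_measurable_comp mf2 mX).
have qM r w : `|ne (X r w) * f2 (X r w)| <= C2.
  rewrite normrM -[leRHS]mul1r ler_pM//; have /andP[h0 h1] := ne01 (X r w); by rewrite ger0_norm.
have pI w : \int[leb]_(r in `[s, t]) near0 eta r w <=
    K * (t - s) - K * \int[leb]_(r in `[s, t]) (ne (X r w) * f2 (X r w)).
  have j1 := time_integrable (near0_joint eta) (near0_norm eta) s t w.
  have j2 := time_integrable mq qM s t w.
  have jK : leb.-integrable `[s, t] (EFin \o cst K).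
    by apply: (bounded_integrable _ (lebesgue_itvcc_lty s t) (M := `|K|)).
  have j3 : leb.-integrable `[s, t] (EFin \o (fun r => K * (ne (X r w) * f2 (X r w)))).
    exact: (integrableZl _ _ j2).
  rewrite -RintegralZl// -(fine_lebesgue_itvcc st) -Rintegral_cst// -RintegralB//.
  apply: le_Rintegral => //; first exact: (integrableB _ jK j3).
  move=> r _; rewrite /near0; have /andP[h0 h1] := ne01 (X r w).
  apply: le_trans (ler_wpM2l h0 (pw (X r w))) _.
  set n0 := ne (X r w); set y := f2 (X r w).
  rewrite (_ : n0 * (K * (1 - y)) = K * n0 - K * (n0 * y)); last by ring.
  by rewrite lerD2r -[leRHS]mulr1 ler_wpM2l// ltW.
have iq : P.-integrable setT (EFin \o (fun w => z w * \int[leb]_(r in `[s, t]) (ne (X r w) * f2 (X r w)))).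
  apply: (integrable_bmul mz zM).
  apply: (@prob_bounded_integrable _ _ _ P _ (C2 * (t - s))).
    exact: (time_integral_measurable mq qM).
  by move=> w; exact: (time_integral_bound mq qM).
have iz : P.-integrable setT (EFin \o z) by exact: (@prob_bounded_integrable _ _ _ P _ Mz).
have [iR eR] := expectation_affine 0 (K * (t - s)) (- K) iz iq.
apply: (@le_trans _ _ (\int[P]_w (0 + K * (t - s) * z w + (- K) * (z w * \int[leb]_(r in `[s, t]) (ne (X r w) * f2 (X r w)))))).
  apply: le_Rintegral => //.
    apply: (integrable_bmul mz zM).
    apply: (@prob_bounded_integrable _ _ _ P _ (1 * (t - s))).
      exact: (time_integral_measurable (near0_joint eta) (near0_norm eta)).
    by move=> w; exact: (time_integral_bound (near0_joint eta) (near0_norm eta)).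
  move=> w _; apply: le_trans (ler_wpM2l (z0 w) (pI w)) _.
  rewrite le_eqVlt; apply/orP; left; apply/eqP; ring.
rewrite eR add0r.
have dyn := smooth_exp_dynkin eta0 ler01 s1 s0 st Fz zM; rewrite -/f2 -/f in dyn.
have lo : - (\int[P]_w z w) <= \int[P]_w (z w * (f (X t w) - f (X s w))).
  have i1 : P.-integrable setT (EFin \o (fun w => -1 * z w)) := integrableZl measurableT (-1) iz.
  have -> : - (\int[P]_w z w) = \int[P]_w (-1 * z w) by rewrite RintegralZl// mulN1r.
  apply: le_Rintegral => //.
    apply: (integrable_bmul mz zM (f := fun w => f (X t w) - f (X s w))).
    apply: (@prob_bounded_integrable _ _ _ P _ 2).
      have mf : measurable_fun setT f.
        by apply: continuous_measurable_fun => x; exact: is_derive_continuous (is_derive_smooth_exp eta0 1 1 x).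
      by apply: measurable_funB; apply: (measurableT_comp mf); exact: joint_measurable_sec2.
    move=> w; have := smooth_exp_gt0 eta 1 1 (X t w); have := smooth_exp_gt0 eta 1 1 (X s w).
    have := smooth_exp_le1 eta ler01 s1 (X t w); have := smooth_exp_le1 eta ler01 s1 (X s w).
    by rewrite -/f ler_norml => *; apply/andP; split; lra.
  move=> w _; rewrite mulrC ler_wpM2l//.
  have := smooth_exp_gt0 eta 1 1 (X t w); have := smooth_exp_le1 eta ler01 s1 (X s w).
  by rewrite -/f; lra.
rewrite dyn in lo; move: lo; set q := \int[P]_w (z w * _); set Ez := \int[P]_w z w => lo.
have : - (2 * Ez) <= q by lra.
move=> /(ler_wpM2l (ltW K0)) h; rewrite -/K mulrDr mulrDl mulNr.
by move: h; rewrite mulrN -mulrA (mulrC 2) -mulrA; lra.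
Qed.

Let near0_integrable (z : T -> R) (Mz eta s t : R) : s <= t -> measurable_fun setT z -> (forall w, `|z w| <= Mz) ->
  P.-integrable setT (EFin \o (fun w => z w * \int[leb]_(r in `[s, t]) near0 eta r w)).
Proof.
move=> st mz zM; apply: (integrable_bmul mz zM).
apply: (@prob_bounded_integrable _ _ _ P _ (1 * (t - s))).
  exact: (time_integral_measurable (near0_joint eta) (near0_norm eta)).
by move=> w; exact: (time_integral_bound (near0_joint eta) (near0_norm eta)).
Qed.

(** Let G_a be the time spent near 0 during [a, t], and g that during [a, b]. Then G_a^2 = G_b^2 + 2
    g G_b + g^2, and the first moment bound with the past weight g gives E (g G_b) <= C E g. So [u]
    a = E G_a^2 - 2 C E G_a exceeds [u] b by at most (b - a)^2, and [quadratic_decrease] yields u 0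
    <= u t = 0. It remains to bound E G_0 by C. *)
Lemma near0_second_moment (eta t : R) : 0 < eta -> eta <= 1 -> 0 <= t ->
  \int[P]_w ((\int[leb]_(r in `[0, t]) near0 eta r w) ^+ 2) <=
  2 * (16 * expR 2 * eta * (t + 2)) ^+ 2.
Proof.
move=> eta0 eta1 t0; set C := 16 * expR 2 * eta * (t + 2).
have C0 : 0 <= C by rewrite !mulr_ge0 ?expR_ge0 ?(ltW eta0)// addr_ge0.
pose G a w := \int[leb]_(r in `[a, t]) near0 eta r w.
have G0 a w : 0 <= G a w by apply: Rintegral_ge0 => r _; have /andP[] := near0_bounded eta r w.
have Gle a w : a <= t -> G a w <= t - a.
  move=> at_; have := time_integral_bound (near0_joint eta) (near0_norm eta) w at_.
  by rewrite mul1r => /(le_trans (ler_norm _)).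
have mG a : measurable_fun setT (G a) := time_integral_measurable (near0_joint eta) (near0_norm eta) a t.
have GB a w : a <= t -> `|G a w| <= t - a by move=> at_; rewrite ger0_norm ?Gle.
have iG a : a <= t -> P.-integrable setT (EFin \o G a).
  by move=> at_; apply: (@prob_bounded_integrable _ _ _ P _ (t - a)) => // w; exact: GB.
have iG2 a : a <= t -> P.-integrable setT (EFin \o (fun w => G a w ^+ 2)).
  move=> at_; apply: (@prob_bounded_integrable _ _ _ P _ ((t - a) ^+ 2)).
    exact: measurable_funX.
  by move=> w; rewrite normrX lerXn2r ?nnegrE ?subr_ge0// GB.
have first (b : R) (z : T -> R) Mz : 0 <= b -> b <= t -> Fmeas F b z -> (forall w, 0 <= z w) ->
    (forall w, z w <= Mz) -> \int[P]_w (z w * G b w) <= C * \int[P]_w z w.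
  move=> b0 bt Fz z0 zM; apply: le_trans (near0_first_moment eta0 eta1 b0 bt Fz z0 zM) _.
  rewrite ler_wpM2r//; first by apply: Rintegral_ge0 => w _.
  by rewrite ler_wpM2l ?mulr_ge0 ?expR_ge0 ?(ltW eta0)// lerD2r lerBlDr lerDl.
pose u a := \int[P]_w (G a w ^+ 2) - 2 * C * \int[P]_w G a w.
have ut : u t = 0.
  have Gt w : G t w = 0 by rewrite /G set_itv1 Rintegral_set1.
  rewrite /u; under eq_Rintegral do rewrite Gt expr0n.
  under [X in _ - _ * X]eq_Rintegral do rewrite Gt.
  by rewrite !Rintegral_prob_cst mulr0 subrr.
have us : u 0 <= u t.
  apply: (quadratic_decrease (K := 1) t0) => a b a0 ab bt.
  have at_ := le_trans ab bt; have b0 := le_trans a0 ab.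
  pose g w := \int[leb]_(r in `[a, b]) near0 eta r w.
  have Gab w : G a w = g w + G b w := time_integral_split (near0_joint eta) (near0_norm eta) w ab bt.
  have g0 w : 0 <= g w by apply: Rintegral_ge0 => r _; have /andP[] := near0_bounded eta r w.
  have gle w : g w <= b - a.
    have := time_integral_bound (near0_joint eta) (near0_norm eta) w ab.
    by rewrite mul1r => /(le_trans (ler_norm _)).
  have mg : measurable_fun setT g := time_integral_measurable (near0_joint eta) (near0_norm eta) a b.
  have Fg : Fmeas F b g.
    apply: (progressive_time_integral fF cX FX (psi := fun x => ne x * \1_(`[- eta, eta]) x) (M := 1)) => //.
      by apply: measurable_funM.
    move=> x; rewrite [X in _ * X]indicE; have /andP[h0 h1] := ne01 x.
    by case: (_ \in _); rewrite ?mulr1 ?mulr0 ?normr0// ger0_norm.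
  have h1 := first b g (b - a) b0 bt Fg g0 gle.
  have ig : P.-integrable setT (EFin \o g).
    by apply: (@prob_bounded_integrable _ _ _ P _ (b - a)) => // w; rewrite ger0_norm.
  have igG : P.-integrable setT (EFin \o (fun w => g w * G b w)).
    apply: (near0_integrable (Mz := b - a)) => // w; by rewrite ger0_norm.
  have e1 : \int[P]_w G a w = \int[P]_w g w + \int[P]_w G b w.
    by rewrite -RintegralD//; [apply: eq_Rintegral => w _; exact: Gab|exact: iG].
  have [i2 e2] := expectation_affine ((b - a) ^+ 2) 2 1 igG (iG2 b bt).
  have e3 : \int[P]_w (G a w ^+ 2) <= (b - a) ^+ 2 + 2 * \int[P]_w (g w * G b w) + 1 * \int[P]_w (G b w ^+ 2).
    rewrite -e2; apply: le_Rintegral => //; first exact: iG2.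
    move=> w _; rewrite Gab mul1r.
    have : g w ^+ 2 <= (b - a) ^+ 2 by rewrite lerXn2r ?nnegrE ?subr_ge0.
    by move=> h; rewrite sqrrD -mulr_natl lerD2r lerD2r.
  by rewrite /u e1 mul1r; exact: second_moment_arith e3 h1.
rewrite ut /u in us.
have h0 : \int[P]_w G 0 w <= C.
  have := first 0 (cst 1) 1 (lexx 0) t0 (@const1_Fmeas _ _ _ F 0) (fun=> ler01) (fun=> lexx 1).
  under eq_Rintegral do rewrite mul1r.
  by rewrite Rintegral_prob_cst mulr1.
rewrite -/(G 0); have := ler_wpM2l C0 h0; rewrite -expr2.
by move: us; rewrite -mulrA; lra.
Qed.

End occupation.

Lemma prob_le_ae d (T : measurableType d) (R : realType) (P : probability T R) (A B : set T) :
  measurable A -> measurable B -> {ae P, forall w, A w -> B w} -> (P A <= P B)%E.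
Proof.
move=> mA mB AB; have mD : measurable (A `\` B) by exact: measurableD.
have D0 : P (A `\` B) = 0%E.
  apply: measure_negligible => //; apply: negligibleS AB => w [Aw Bw] /=.
  by move=> h; exact/Bw/h.
rewrite -[leRHS]adde0 -D0; apply: le_trans (measureU2 _ mB mD); apply: le_measure.
- by rewrite inE.
- by rewrite inE; exact: measurableU.
- by move=> w Aw; have [Bw|Bw] := pselect (B w); [left|right].
Qed.

Lemma local_time0_extend d (T : measurableType d) (R : realType) (P : probability T R)
    (X L : R -> T -> R) :
  local_time0 P X L -> local_time0 P (fun r => X (Num.max r 0)) L.
Proof.
move=> [mL cL [V [mV cV V0 hV] hL]]; split => //; exists V.
  split => // t D t0 pD mD e e0.
  have := hV t D t0 pD mD e e0.
  apply: cvg_trans; apply: near_eq_cvg; apply: nearW => n /=.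
  have ge0 i : 0 <= nth t (0 :: D n) i.
    have [|i_n] := ltnP i (size (0 :: D n)); last by rewrite nth_default.
    case: i => [|i] //= i_n; have [pn _] := pD n.
    by apply: ltW; apply: (allP (order_path_min lt_trans pn)); exact: mem_nth.
  suff E w : square_variation 0 t (X ^~ w) (D n) = square_variation 0 t (fun r => X (Num.max r 0) w) (D n).
    by congr (P _); apply/seteqP; split => w /=; rewrite E.
  by apply: eq_bigr => i _; rewrite !(max_l (ge0 _)).
move=> t t0 e e0; have := hL t t0 e e0.
apply: cvg_trans; apply: near_eq_cvg; apply: nearW => n /=.
suff E w : \int[lebesgue_stieltjes_measure (V w)]_(r in `[0, t]) \1_(`[- n, n]) (X r w) =
    \int[lebesgue_stieltjes_measure (V w)]_(r in `[0, t]) \1_(`[- n, n]) (X (Num.max r 0) w).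
  by congr (P _); apply/seteqP; split => w /=; rewrite E.
by apply: eq_Rintegral => r; rewrite inE/= in_itv/= => /andP[r0 _]; rewrite (max_l r0).
Qed.

Section local_time_expectation.
Context d (T : measurableType d) (R : realType).
Notation leb := (@lebesgue_measure R).
Variables (theta : R) (P : probability T R) (F : R -> set_system T) (X L : R -> T -> R).
Let ne : R -> R := \1_(~` [set 0]).
Let z0ind : R -> R := \1_[set 0].
Hypotheses (theta0 : 0 < theta) (fF : filtration F) (cX : forall w, continuous (X ^~ w))
  (FX : forall t, 0 <= t -> Fmeas F t (X t)) (mX : joint_measurable X)
  (dX : diffusion_increments P F X (fun r w => ne (X r w)))
  (hL : local_time0 P X L)
  (occ : {ae P, forall w, forall t, 0 <= t -> occupation_time X [set 0] t w = theta^-1 * L t w}).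

Let mne : measurable_fun setT ne. Proof. by apply: measurable_indic; exact: measurableC. Qed.
Let mz0 : measurable_fun setT z0ind. Proof. exact: measurable_indic. Qed.
Let ne2 x : ne x ^+ 2 = ne x.
Proof. by rewrite /ne indicE; case: (_ \in _); rewrite ?expr1n ?expr0n. Qed.
Let ne01 x : 0 <= ne x <= 1.
Proof. by rewrite /ne indicE; case: (_ \in _); rewrite ?lexx ler01. Qed.
Let z0n x : `|z0ind x| <= 1.
Proof. by rewrite /z0ind indicE; case: (_ \in _); rewrite ?normr1 ?normr0. Qed.
Let mZ : joint_measurable (fun r w => z0ind (X r w)). Proof. exact: joint_measurable_comp. Qed.

Definition time_at0 (s t : R) (w : T) : R := \int[leb]_(r in `[s, t]) z0ind (X r w).

Let nm eta : joint_measurable (near0 X eta) := near0_joint mX eta.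
Let nn eta r w : `|near0 X eta r w| <= 1 := near0_norm X eta r w.
Let mI eta s t : measurable_fun setT (fun w => \int[leb]_(r in `[s, t]) near0 X eta r w) :=
  time_integral_measurable (nm eta) (nn eta) s t.
Let bI eta s t w : s <= t -> `|\int[leb]_(r in `[s, t]) near0 X eta r w| <= t - s.
Proof. by move=> st; have := time_integral_bound (nm eta) (nn eta) w st; rewrite mul1r. Qed.
Let mA s t : measurable_fun setT (time_at0 s t) := time_integral_measurable mZ (fun r w => z0n (X r w)) s t.
Let bA s t w : s <= t -> `|time_at0 s t w| <= t - s.
Proof. by move=> st; have := time_integral_bound mZ (fun r w => z0n (X r w)) w st; rewrite mul1r. Qed.

(** By [occ] the limit in probability, the local time, is theta times the time spent at 0. The
    factor eta^2 in the second moment bound cancels the normalization, so second moments are bounded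
    uniformly for eta <= 1 and [cvg_in_probability_expectation] applies. *)
Lemma near0_expectation_cvg0 (t Mz : R) (z : T -> R) : 0 <= t -> measurable_fun setT z ->
  (forall w, `|z w| <= Mz) ->
  \int[P]_w (z w * ((2 * eta)^-1 * \int[leb]_(r in `[0, t]) near0 X eta r w)) @[eta --> 0^'+] -->
  \int[P]_w (z w * (theta * time_at0 0 t w)).
Proof.
move=> t0 mz zM; have [mL _ [V qV hV]] := hL.
have VE := quadratic_variation_eq fF cX FX mX mne ne2 dX qV.
have [mV _ V0 _] := qV.
pose Y eta w := (2 * eta)^-1 * \int[leb]_(r in `[0, t]) near0 X eta r w.
have mY eta : measurable_fun setT (Y eta) by exact: measurable_funM.
pose K := 2^-1 * (16 * expR 2 * (t + 2)) ^+ 2 + (theta * t) ^+ 2.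
have sqt w : (theta * time_at0 0 t w) ^+ 2 <= (theta * t) ^+ 2.
  rewrite -real_normK ?num_real// lerXn2r ?nnegrE ?mulr_ge0 ?(ltW theta0)//.
  rewrite normrM (gtr0_norm theta0) ler_pM2l//.
  by have := bA w t0; rewrite subr0.
have mL2 : measurable_fun setT (fun w => (theta * time_at0 0 t w) ^+ 2).
  by apply: measurable_funX; exact: measurable_funM.
have iL2 : P.-integrable setT (EFin \o (fun w => (theta * time_at0 0 t w) ^+ 2)).
  by apply: (@prob_bounded_integrable _ _ _ P _ ((theta * t) ^+ 2)) => // w; rewrite ger0_norm ?sqr_ge0.
apply: (@cvg_in_probability_expectation _ _ _ P _ _ Y (fun w => theta * time_at0 0 t w) z K Mz) => //.
- exact: measurable_funM.
- near=> eta.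
  have eta0 : 0 < eta by near: eta; exact: nbhs_right_gt.
  have eta1 : eta <= 1 by near: eta; exact: nbhs_right_le.
  have iI2 : P.-integrable setT (EFin \o (fun w => (\int[leb]_(r in `[0, t]) near0 X eta r w) ^+ 2)).
    apply: (@prob_bounded_integrable _ _ _ P _ (t ^+ 2)); first exact: measurable_funX.
    move=> w; rewrite normrX lerXn2r ?nnegrE//.
    by have := bI eta w t0; rewrite subr0.
  have YE w : Y eta w ^+ 2 = (2 * eta)^-1 ^+ 2 * (\int[leb]_(r in `[0, t]) near0 X eta r w) ^+ 2.
    by rewrite /Y exprMn.
  split; first by apply: eq_integrable (integrableZl measurableT ((2 * eta)^-1 ^+ 2) iI2) => // w _; rewrite /= YE.
  under eq_Rintegral do rewrite YE.
  rewrite RintegralZl//.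
  apply: le_trans (ler_wpM2l (sqr_ge0 _) (near0_second_moment fF cX FX mX dX eta0 eta1 t0)) _.
  rewrite (_ : _ * _ = 2^-1 * (16 * expR 2 * (t + 2)) ^+ 2); first by rewrite lerDl sqr_ge0.
  by field; rewrite gt_eqF.
- apply: (@le_trans _ _ ((theta * t) ^+ 2)); last by rewrite lerDr mulr_ge0 ?invr_ge0 ?sqr_ge0.
  rewrite -[leRHS](Rintegral_prob_cst P); apply: le_Rintegral => //.
  exact: (@prob_bounded_integrable _ _ _ P _ `|(theta * t) ^+ 2|).
- move=> e e0; have := hV t t0 e e0.
  apply: cvg_trans; apply: near_eq_cvg; near=> eta.
  have eta0 : 0 < eta by near: eta; exact: nbhs_right_gt.
  have mdist (f g : T -> R) : measurable_fun setT f -> measurable_fun setT g ->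
      measurable [set w | e <= `|f w - g w|].
    move=> mf mg; have mm : measurable_fun setT (fun w => e <= `|f w - g w|).
      apply: measurable_fun_ler => //; apply: measurableT_comp => //; exact: measurable_funB.
    by rewrite -[X in measurable X]setTI; exact: (mm measurableT [set true]).
  have m1 := mdist _ _ (measurable_funM (measurable_cst (2 * eta)^-1) (local_time_approximation_measurable cX mX mV eta t0)) (mL t t0).
  have m2 := mdist _ _ (mY eta) (measurable_funM (measurable_cst theta) (mA 0 t)).
  have eqae : {ae P, forall w, (2 * eta)^-1 * \int[lebesgue_stieltjes_measure (V w)]_(r in `[0, t]) \1_(`[- eta, eta]) (X r w) - L t w =
      Y eta w - theta * time_at0 0 t w}.
    apply: filterS2 VE occ => w h1 h2.
    rewrite (local_time_approximation_eq mX eta t0 (V0 w) h1) /Y; congr (_ - _).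
    have := h2 t t0; rewrite /occupation_time -/(time_at0 0 t w) => ->.
    by rewrite mulVKf// gt_eqF.
  apply/eqP; rewrite eq_le; apply/andP; split; apply: prob_le_ae => //.
    by apply: filterS eqae => w Ew h; rewrite /= -Ew; exact: h.
  by apply: filterS eqae => w Ew h; rewrite /= Ew; exact: h.
Unshelve. all: by end_near. Qed.

Section weight.
Variables (s t Mz : R) (z : T -> R).
Hypotheses (s0 : 0 <= s) (st : s <= t) (Fz : Fmeas F s z) (z0 : forall w, 0 <= z w)
  (zM : forall w, z w <= Mz).

Let zMn w : `|z w| <= Mz. Proof. by rewrite ger0_norm. Qed.
Let mz : measurable_fun setT z. Proof. exact: (Fmeas_fun fF s0 Fz). Qed.
Let k (r : R) (w : T) : R := z w * ne (X r w).

Let kE eta : occupation_near P X k s t eta = \int[P]_w (z w * \int[leb]_(r in `[s, t]) near0 X eta r w).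
Proof.
apply: eq_Rintegral => w _; rewrite -RintegralZl//; last exact: (time_integrable (nm eta) (nn eta)).
by apply: eq_Rintegral => r _; rewrite /k /near0 mulrA.
Qed.

Lemma near0_expectation_cvg :
  (2 * eta)^-1 * occupation_near P X k s t eta @[eta --> 0^'+] -->
  theta * \int[P]_w (z w * time_at0 s t w).
Proof.
have t0 := le_trans s0 st.
have split_near eta w : \int[leb]_(r in `[0, t]) near0 X eta r w =
    \int[leb]_(r in `[0, s]) near0 X eta r w + \int[leb]_(r in `[s, t]) near0 X eta r w.
  exact: (time_integral_split (nm eta) (nn eta)).
have split_0 w : time_at0 0 t w = time_at0 0 s w + time_at0 s t w.
  exact: (time_integral_split mZ (fun r w => z0n (X r w))).
have h := cvgB (near0_expectation_cvg0 t0 mz zMn) (near0_expectation_cvg0 s0 mz zMn).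
have iz (c : R) (q : T -> R) M : measurable_fun setT q -> (forall w, `|q w| <= M) ->
    P.-integrable setT (EFin \o (fun w => z w * (c * q w))).
  move=> mq qM; apply: (integrable_bmul mz zMn (f := fun w => c * q w)).
  apply: (@prob_bounded_integrable _ _ _ P _ (`|c| * M)); first exact: measurable_funM.
  by move=> w; rewrite normrM ler_wpM2l.
have e1 : \int[P]_w (z w * (theta * time_at0 0 t w)) - \int[P]_w (z w * (theta * time_at0 0 s w)) =
    theta * \int[P]_w (z w * time_at0 s t w).
  rewrite -RintegralB//; last 2 first.
  - exact: (iz _ _ _ (mA 0 t) (fun w => bA w t0)).
  - exact: (iz _ _ _ (mA 0 s) (fun w => bA w s0)).
  rewrite -RintegralZl//; last first.
    have := iz 1 _ _ (mA s t) (fun w => bA w st).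
    by apply: eq_integrable => // w _ /=; rewrite mul1r.
  by apply: eq_Rintegral => w _; rewrite split_0; ring.
rewrite -e1.
pose near_int eta u := \int[P]_w (z w * ((2 * eta)^-1 * \int[leb]_(r in `[0, u]) near0 X eta r w)).
suff -> : (fun eta => (2 * eta)^-1 * occupation_near P X k s t eta) = (fun eta => near_int eta t - near_int eta s) by exact: h.
apply/funext => eta; rewrite /near_int.
rewrite -RintegralB//; last 2 first.
- exact: (iz _ _ _ (mI eta 0 t) (fun w => bI eta w t0)).
- exact: (iz _ _ _ (mI eta 0 s) (fun w => bI eta w s0)).
rewrite kE -RintegralZl//; last first.
  have := iz 1 _ _ (mI eta s t) (fun w => bI eta w st).
  by apply: eq_integrable => // w _ /=; rewrite mul1r.
by apply: eq_Rintegral => w _; rewrite split_near; ring.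
Qed.

Lemma curv_expectation_cvg :
  \int[P]_w (z w * \int[leb]_(r in `[s, t]) (ne (X r w) * curv (harmonic n) (X r w))) @[n --> \oo] -->
  theta * \int[P]_w (z w * time_at0 s t w).
Proof.
have mk : joint_measurable k.
  apply: measurable_funM; first exact: (measurableT_comp mz).
  exact: (joint_measurable_comp mne mX).
have k0 r w : 0 <= k r w by rewrite mulr_ge0//; have /andP[] := ne01 (X r w).
have kM r w : k r w <= Mz.
  by rewrite -[leRHS]mulr1 ler_pM//; have /andP[] := ne01 (X r w).
have Mz0 : 0 <= Mz := le_trans (z0 point) (zM point).
(* The second entry is the first moment bound, valid for eta <= 1; for larger eta the length of
   [s, t] is a sufficient bound. *)
pose C := Num.max (Mz * (t - s)) (16 * expR 2 * (t - s + 2) * \int[P]_w z w).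
have GC eta : 0 < eta -> occupation_near P X k s t eta <= C * eta.
  move=> eta0; rewrite kE; have [eta1|eta1] := leP eta 1.
    apply: le_trans (near0_first_moment fF FX mX dX eta0 eta1 s0 st Fz z0 zM) _.
    rewrite (_ : _ * _ = 16 * expR 2 * (t - s + 2) * \int[P]_w z w * eta); last by ring.
    by rewrite ler_wpM2r ?(ltW eta0)// le_max lexx orbT.
  apply: (@le_trans _ _ (Mz * (t - s))); last first.
    rewrite -[leLHS]mulr1 ler_pM ?(ltW eta1)//; last by rewrite le_max lexx.
    by rewrite mulr_ge0// subr_ge0.
  rewrite -[leRHS](Rintegral_prob_cst P); apply: le_Rintegral => //.
  - apply: (integrable_bmul mz zMn).
    by apply: (@prob_bounded_integrable _ _ _ P _ (t - s)) => // w; exact: bI.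
  - exact: (@prob_bounded_integrable _ _ _ P _ `|Mz * (t - s)|).
  - move=> w _; rewrite ler_pM//.
      by apply: Rintegral_ge0 => r _; have /andP[] := near0_bounded X eta r w.
    by have := bI eta w st; apply: le_trans; exact: ler_norm.
have := @curv_limit _ _ _ P X k Mz s t mX mk k0 kM harmonic C _ (fun n => harmonic_gt0 n) cvg_harmonic GC near0_expectation_cvg.
apply: cvg_trans; apply: near_eq_cvg; apply: nearW => n /=.
apply: eq_Rintegral => w _; rewrite -RintegralZl//.
  by apply: eq_Rintegral => r _; rewrite /k mulrA.
have mc : measurable_fun setT (curv (harmonic n) : R -> R).
  by apply: continuous_measurable_fun => x; exact: is_derive_continuous (is_derive_curv (harmonic_gt0 n) x).
have mq : joint_measurable (fun r w => ne (X r w) * curv (harmonic n) (X r w)).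
  by apply: measurable_funM; [exact: (joint_measurable_comp mne mX)|exact: (joint_measurable_comp mc mX)].
have qM r w' : `|ne (X r w') * curv (harmonic n) (X r w')| <= 2^-1 * (harmonic n)^-1.
  rewrite normrM -[leRHS]mul1r ler_pM//.
    by have /andP[h0 h1] := ne01 (X r w'); rewrite ger0_norm.
  by rewrite ger0_norm ?curv_ge0 ?curv_le// harmonic_gt0.
exact: (time_integrable mq qM s t w).
Qed.

End weight.
End local_time_expectation.

(** * Tanaka formula in expectation *)

Section side_exponential.
Context (R : realType).
Implicit Types (a sg x : R).

Definition side_exp a sg x : R := expR (- (a * Num.max (sg * x) 0)).

Lemma continuous_side_exp a sg : continuous (side_exp a sg).
Proof.
move=> x; apply: continuous_comp; last exact: continuous_expR.
apply: continuousN; apply: continuousM; first exact: cst_continuous.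
apply: continuous_max; last exact: cst_continuous.
by apply: continuousM; [exact: cst_continuous|exact: cvg_id].
Qed.

Lemma side_exp_gt0 a sg x : 0 < side_exp a sg x.
Proof. exact: expR_gt0. Qed.

Lemma side_exp_le1 a sg x : 0 <= a -> side_exp a sg x <= 1.
Proof. by move=> a0; rewrite -expR0 ler_expR oppr_le0 mulr_ge0// le_max lexx orbT. Qed.

Lemma side_exp_bounded a sg x : 0 <= a -> `|side_exp a sg x| <= 1.
Proof. by move=> a0; rewrite gtr0_norm ?side_exp_gt0// side_exp_le1. Qed.

Lemma cvg_hyp x : hyp (harmonic n : R) x @[n --> \oo] --> `|x|.
Proof.
rewrite -sqrtr_sqr; apply: continuous_cvg; first exact: sqrt_continuous.
rewrite -[X in _ --> X]addr0; apply: cvgD; first exact: cvg_cst.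
have h := cvgM (@cvg_harmonic R) (@cvg_harmonic R); rewrite mulr0 in h; exact: h.
Qed.

Lemma cvg_hypV x : x != 0 -> hypV (harmonic n : R) x @[n --> \oo] --> `|x|^-1.
Proof. by move=> x0; apply: cvgV; rewrite ?normr_eq0//; exact: cvg_hyp. Qed.

Lemma cvg_hypD x : x != 0 -> hypD (harmonic n : R) x @[n --> \oo] --> x / `|x|.
Proof. by move=> x0; apply: cvgM; [exact: cvg_cst|exact: cvg_hypV]. Qed.

Lemma cvg_curv x : x != 0 -> curv (harmonic n : R) x @[n --> \oo] --> (0 : R).
Proof.
move=> x0; rewrite [X in _ --> X](_ : (0 : R) = 2^-1 * (1 - (x / `|x|) * (x / `|x|)) * `|x|^-1).
  rewrite /curv; under eq_cvg do rewrite expr2.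
  apply: cvgM; last exact: cvg_hypV.
  apply: cvgM; first exact: cvg_cst.
  apply: cvgB; first exact: cvg_cst.
  by apply: cvgM; exact: cvg_hypD.
have -> : x / `|x| * (x / `|x|) = 1.
  by rewrite mulrACA -expr2 -(real_normK (num_real x)) expr2 -mulrACA divff ?normr_eq0// mulr1.
by rewrite subrr mulr0 mul0r.
Qed.

Lemma cvg_smooth_exp a sg x : sg ^+ 2 = 1 ->
  smooth_exp (harmonic n : R) a sg x @[n --> \oo] --> side_exp a sg x.
Proof.
move=> sg1; have sgn : `|sg| = 1.
  by apply/eqP; rewrite -(@eqrXn2 _ 2)// ?expr1n real_normK ?num_real// sg1.
apply: continuous_cvg; first exact: continuous_expR.
apply: cvgN; apply: cvgM; first exact: cvg_cst.
rewrite [X in _ --> X](_ : _ = 2^-1 * (`|x| + sg * x)).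
  by apply: cvgM; [exact: cvg_cst|apply: cvgD; [exact: cvg_hyp|exact: cvg_cst]].
have -> : `|x| = `|sg * x| by rewrite normrM sgn mul1r.
by have [h|h] := leP (sg * x) 0; [rewrite ler0_norm//|rewrite gtr0_norm//]; lra.
Qed.

End side_exponential.

Section tanaka.
Context d (T : measurableType d) (R : realType).
Notation leb := (@lebesgue_measure R).
Variables (theta : R) (P : probability T R) (F : R -> set_system T) (X L : R -> T -> R).
Let ne : R -> R := \1_(~` [set 0]).
Hypotheses (theta0 : 0 < theta) (fF : filtration F) (cX : forall w, continuous (X ^~ w))
  (FX : forall t, 0 <= t -> Fmeas F t (X t)) (mX : joint_measurable X)
  (dX : diffusion_increments P F X (fun r w => ne (X r w)))
  (hL : local_time0 P X L)
  (occ : {ae P, forall w, forall t, 0 <= t -> occupation_time X [set 0] t w = theta^-1 * L t w}).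

Variables (a sg s t Mz : R) (z : T -> R).
Hypotheses (a0 : 0 <= a) (sg1 : sg ^+ 2 = 1) (s0 : 0 <= s) (st : s <= t)
  (Fz : Fmeas F s z) (z0 : forall w, 0 <= z w) (zM : forall w, z w <= Mz).

Let ind : R -> R := \1_[set x | 0 < sg * x].

Let mind : measurable_fun setT ind.
Proof.
apply: measurable_indic; rewrite (_ : [set _ | _] = (fun x => sg * x) @^-1` `]0, +oo[).
  rewrite -[X in measurable X]setTI; apply: (_ : measurable_fun setT (fun x => sg * x)) => //.
  by apply: measurable_funM.
by apply/seteqP; split => x /=; rewrite in_itv/= andbT.
Qed.

Let ind01 x : 0 <= ind x <= 1.
Proof. by rewrite /ind indicE; case: (_ \in _); rewrite ?lexx ler01. Qed.
Let ne01 x : 0 <= ne x <= 1.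
Proof. by rewrite /ne indicE; case: (_ \in _); rewrite ?lexx ler01. Qed.
Let mz : measurable_fun setT z. Proof. exact: (Fmeas_fun fF s0 Fz). Qed.
Let zMn w : `|z w| <= Mz. Proof. by rewrite ger0_norm. Qed.
Let mne : measurable_fun setT ne. Proof. by apply: measurable_indic; exact: measurableC. Qed.

(** [smooth_exp2] without its singular part -a [curv]. Replacing the curvature times the exponential
    by the curvature alone leaves an error that [smooth_exp_curv] bounds uniformly in n, so
    dominated convergence handles [G], and [curv_expectation_cvg] the singular part. *)
Let G (n : nat) (x : R) : R := 4^-1 * a ^+ 2 * (sg + hypD (harmonic n) x) ^+ 2 * smooth_exp (harmonic n) a sg x -
  a * ((smooth_exp (harmonic n) a sg x - 1) * curv (harmonic n) x).

Let GE n x : smooth_exp2 (harmonic n) a sg x = G n x - a * curv (harmonic n) x.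
Proof. by rewrite /smooth_exp2 /G; ring. Qed.

Let neG_bounded n x : `|ne x * G n x| <= a ^+ 2 + 2^-1 * a ^+ 2.
Proof.
rewrite normrM -[leRHS]mul1r ler_pM//; first by have /andP[h0 h1] := ne01 x; rewrite ger0_norm.
have n0 := @harmonic_gt0 R n.
apply: le_trans (ler_normB _ _) _; rewrite lerD//.
  rewrite normrM -[leRHS]mulr1 ler_pM//; last first.
    by rewrite gtr0_norm ?smooth_exp_gt0// smooth_exp_le1.
  have sgn : `|sg| = 1 by apply/eqP; rewrite -(@eqrXn2 _ 2)// ?expr1n real_normK ?num_real// sg1.
  rewrite ger0_norm; last by apply: mulr_ge0; [rewrite mulr_ge0 ?invr_ge0 ?sqr_ge0|exact: sqr_ge0].
  have : `|sg + hypD (harmonic n) x| ^+ 2 <= 2 ^+ 2.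
    rewrite lerXn2r ?nnegrE// (le_trans (ler_normD _ _))// sgn.
    by have := hypD_le1 n0 x; lra.
  rewrite real_normK ?num_real// => h2; have := ler_wpM2l (sqr_ge0 a) h2.
  by rewrite -mulrA; lra.
rewrite [leRHS](_ : _ = a * (2^-1 * a)); last by ring.
rewrite normrM (ger0_norm a0) ler_wpM2l//.
apply: le_trans (smooth_exp_curv n0 a0 sg1 x) _.
rewrite -[leRHS]mulr1 ler_wpM2l ?mulr_ge0//.
by rewrite ler_pdivrMr ?mul1r ?lerDr ?sqr_ge0// ltr_wpDl ?sqr_ge0// exprn_gt0.
Qed.

Let cvg_neG x : ne x * G n x @[n --> \oo] --> a ^+ 2 * (ind x * side_exp a sg x).
Proof.
have [->|x0] := eqVneq x 0.
  have -> : ne 0 = 0 :> R by rewrite /ne indicE memNset//=; exact.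
  have -> : ind 0 = 0 :> R by rewrite /ind indicE memNset//= mulr0 ltxx.
  by under eq_cvg do rewrite mul0r; rewrite mul0r mulr0; exact: cvg_cst.
have -> : ne x = 1 :> R by rewrite /ne indicE mem_set//=; exact/eqP.
rewrite (_ : (fun n => 1 * G n x) = G ^~ x); last by apply/funext => n; rewrite mul1r.
rewrite [X in _ --> X](_ : _ = 4^-1 * a ^+ 2 * ((sg + x / `|x|) * (sg + x / `|x|)) * side_exp a sg x -
    a * ((side_exp a sg x - 1) * 0)).
  rewrite /G; under eq_cvg do rewrite [X in _ * X * _ - _]expr2.
  have cs : sg + hypD (harmonic n) x @[n --> \oo] --> sg + x / `|x|.
    by apply: cvgD; [exact: cvg_cst|exact: cvg_hypD].
  apply: cvgB.
    apply: cvgM; last exact: cvg_smooth_exp.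
    by apply: cvgM; [exact: cvg_cst|exact: cvgM].
  apply: cvgM; first exact: cvg_cst.
  apply: cvgM; last exact: cvg_curv.
  by apply: cvgB; [exact: cvg_smooth_exp|exact: cvg_cst].
rewrite mulr0 mulr0 subr0 mulrA; congr (_ * _).
have : (sg - 1) * (sg + 1) = 0 by rewrite -subr_sqr_1 sg1 subrr.
have xn : x / `|x| = 1 /\ 0 < x \/ x / `|x| = -1 /\ x < 0.
  have [h|h|h] := ltgtP x 0; last by rewrite h eqxx in x0.
    by right; rewrite ltr0_norm// invrN mulrN divff.
  by left; rewrite gtr0_norm// divff.
move=> /eqP; rewrite mulf_eq0 subr_eq0 addr_eq0 => /orP[]/eqP sgE; case: xn => -[-> hx]; rewrite /ind {1}sgE indicE sgE.
- rewrite mem_set/= ?mul1r//; by field.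
- rewrite memNset/= ?mul1r; last by apply/negP; rewrite -leNgt ltW.
  by ring.
- rewrite memNset/= ?mulN1r; last by apply/negP; rewrite -leNgt oppr_le0 ltW.
  by ring.
- rewrite mem_set/= ?mulN1r ?oppr_gt0//; by field.
Qed.

Let side_joint : joint_measurable (fun r w => ind (X r w) * side_exp a sg (X r w)).
Proof.
apply: measurable_funM; first exact: (joint_measurable_comp mind mX).
apply: (joint_measurable_comp _ mX); apply: continuous_measurable_fun; exact: continuous_side_exp.
Qed.

Let side_norm r w : `|ind (X r w) * side_exp a sg (X r w)| <= 1.
Proof.
rewrite normrM -[leRHS]mul1r ler_pM//; last exact: side_exp_bounded.
by have /andP[h0 h1] := ind01 (X r w); rewrite ger0_norm.
Qed.

(** The limit of the Dynkin formulas for the smoothed exponentials with e = 1/(n+1). *)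
Lemma tanaka_expectation :
  \int[P]_w (z w * (side_exp a sg (X t w) - side_exp a sg (X s w))) =
  2^-1 * (a ^+ 2 * \int[P]_w (z w * \int[leb]_(r in `[s, t]) (\1_[set x | 0 < sg * x] (X r w) * side_exp a sg (X r w))) -
          a * (theta * \int[P]_w (z w * time_at0 X s t w))).
Proof.
have mse n : measurable_fun setT (smooth_exp (harmonic n) a sg).
  by apply: continuous_measurable_fun => x; exact: is_derive_continuous (is_derive_smooth_exp (harmonic_gt0 n) a sg x).
have mhD n : measurable_fun setT (smooth_exp2 (harmonic n) a sg).
  by apply: continuous_measurable_fun => x; exact: is_derive_continuous (is_derive_smooth_exp2 (harmonic_gt0 n) a sg x).
have mcv n : measurable_fun setT (curv (harmonic n) : R -> R).
  by apply: continuous_measurable_fun => x; exact: is_derive_continuous (is_derive_curv (harmonic_gt0 n) x).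
have mside : measurable_fun setT (side_exp a sg).
  by apply: continuous_measurable_fun; exact: continuous_side_exp.
have mG n : measurable_fun setT (G n).
  rewrite (_ : G n = fun x => smooth_exp2 (harmonic n) a sg x + a * curv (harmonic n) x).
    by apply: measurable_funD => //; exact: measurable_funM.
  by apply/funext => x; rewrite GE subrK.
have PT : (P setT < +oo)%E by rewrite probability_setT ltry.
have lhs : \int[P]_w (z w * (smooth_exp (harmonic n) a sg (X t w) - smooth_exp (harmonic n) a sg (X s w))) @[n --> \oo] -->
    \int[P]_w (z w * (side_exp a sg (X t w) - side_exp a sg (X s w))).
  apply: (@bounded_cvg_Rintegral _ _ _ P _ measurableT PT _ _ (Mz * (1 + 1))) => //.
  - move=> n; apply: measurable_funM => //; apply: measurable_funB.
      exact: (measurableT_comp (mse n) (joint_measurable_sec2 t mX)).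
    exact: (measurableT_comp (mse n) (joint_measurable_sec2 s mX)).
  - apply: measurable_funM => //; apply: measurable_funB.
      exact: (measurableT_comp mside (joint_measurable_sec2 t mX)).
    exact: (measurableT_comp mside (joint_measurable_sec2 s mX)).
  - move=> n w _; rewrite normrM ler_pM//; apply: le_trans (ler_normB _ _) _.
    by rewrite lerD// gtr0_norm ?smooth_exp_gt0// smooth_exp_le1.
  - move=> w _; apply: cvgM; first exact: cvg_cst.
    by apply: cvgB; exact: cvg_smooth_exp.
have mq n : joint_measurable (fun r w => ne (X r w) * G n (X r w)).
  by apply: measurable_funM; [exact: (joint_measurable_comp mne mX)|exact: (joint_measurable_comp (mG n) mX)].
have qM n r w : `|ne (X r w) * G n (X r w)| <= a ^+ 2 + 2^-1 * a ^+ 2 := neG_bounded n (X r w).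
have mcq n : joint_measurable (fun r w => ne (X r w) * curv (harmonic n) (X r w)).
  by apply: measurable_funM; [exact: (joint_measurable_comp mne mX)|exact: (joint_measurable_comp (mcv n) mX)].
have cqM n r w : `|ne (X r w) * curv (harmonic n) (X r w)| <= 2^-1 * (harmonic n)^-1.
  rewrite normrM -[leRHS]mul1r ler_pM//.
    by have /andP[h0 h1] := ne01 (X r w); rewrite ger0_norm.
  by rewrite ger0_norm ?curv_ge0 ?curv_le// harmonic_gt0.
have drift : \int[P]_w (z w * \int[leb]_(r in `[s, t]) (ne (X r w) * G n (X r w))) @[n --> \oo] -->
    \int[P]_w (z w * (a ^+ 2 * \int[leb]_(r in `[s, t]) (ind (X r w) * side_exp a sg (X r w)))).
  apply: (@bounded_cvg_Rintegral _ _ _ P _ measurableT PT _ _ (Mz * ((a ^+ 2 + 2^-1 * a ^+ 2) * (t - s)))) => //.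
  - by move=> n; apply: measurable_funM => //; exact: (time_integral_measurable (mq n) (qM n)).
  - apply: measurable_funM => //; apply: measurable_funM => //.
    exact: (time_integral_measurable side_joint side_norm).
  - by move=> n w _; rewrite normrM ler_pM//; exact: (time_integral_bound (mq n) (qM n)).
  - move=> w _; apply: cvgM; first exact: cvg_cst.
    rewrite -RintegralZl//; last exact: (time_integrable side_joint side_norm).
    apply: (@bounded_cvg_Rintegral _ _ _ leb _ _ _ _ _ (a ^+ 2 + 2^-1 * a ^+ 2)) => //.
    + exact: lebesgue_itvcc_lty.
    + by move=> n; apply: measurable_funTS; exact: (joint_measurable_sec w (mq n)).
    + apply: measurable_funTS; apply: measurable_funM => //.
      exact: (joint_measurable_sec w side_joint).
have lt := curv_expectation_cvg theta0 fF cX FX mX dX hL occ s0 st Fz z0 zM.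
have rhs := cvgM (cvg_cst (2^-1 : R)) (cvgB drift (cvgM (cvg_cst a) lt)).
have eqn n : \int[P]_w (z w * (smooth_exp (harmonic n) a sg (X t w) - smooth_exp (harmonic n) a sg (X s w))) =
    2^-1 * (\int[P]_w (z w * \int[leb]_(r in `[s, t]) (ne (X r w) * G n (X r w))) -
     a * \int[P]_w (z w * \int[leb]_(r in `[s, t]) (ne (X r w) * curv (harmonic n) (X r w)))).
  rewrite (smooth_exp_dynkin fF FX mX dX (harmonic_gt0 n) a0 sg1 s0 st Fz zMn).
  congr (_ * _).
  have i1 : P.-integrable setT (EFin \o (fun w => z w * \int[leb]_(r in `[s, t]) (ne (X r w) * G n (X r w)))).
    apply: (integrable_bmul mz zMn).
    apply: (@prob_bounded_integrable _ _ _ P _ ((a ^+ 2 + 2^-1 * a ^+ 2) * (t - s))).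
      exact: (time_integral_measurable (mq n) (qM n)).
    by move=> w; exact: (time_integral_bound (mq n) (qM n)).
  have i2 : P.-integrable setT (EFin \o (fun w => z w * \int[leb]_(r in `[s, t]) (ne (X r w) * curv (harmonic n) (X r w)))).
    apply: (integrable_bmul mz zMn).
    apply: (@prob_bounded_integrable _ _ _ P _ (2^-1 * (harmonic n)^-1 * (t - s))).
      exact: (time_integral_measurable (mcq n) (cqM n)).
    by move=> w; exact: (time_integral_bound (mcq n) (cqM n)).
  rewrite -RintegralZl// -RintegralB//; last exact: (integrableZl measurableT a i2).
  apply: eq_Rintegral => w _; rewrite mulrCA -mulrBr; congr (_ * _).
  have j1 := time_integrable (mq n) (qM n) s t w.
  have j2 := time_integrable (mcq n) (cqM n) s t w.
  rewrite -RintegralZl// -RintegralB//; last exact: (integrableZl _ a j2).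
  by apply: eq_Rintegral => r _; rewrite GE; ring.
have -> : a ^+ 2 * \int[P]_w (z w * \int[leb]_(r in `[s, t]) (\1_[set x | 0 < sg * x] (X r w) * side_exp a sg (X r w))) =
    \int[P]_w (z w * (a ^+ 2 * \int[leb]_(r in `[s, t]) (ind (X r w) * side_exp a sg (X r w)))).
  rewrite -RintegralZl//; first by apply: eq_Rintegral => w _; rewrite mulrCA.
  apply: (integrable_bmul mz zMn).
  apply: (@prob_bounded_integrable _ _ _ P _ (1 * (t - s))).
    exact: (time_integral_measurable side_joint side_norm).
  by move=> w; exact: (time_integral_bound side_joint side_norm).
move: lhs; under eq_cvg do rewrite eqn; move=> lhs.
by apply: (cvg_unique _ lhs) => //; exact: rhs.
Qed.

End tanaka.

Lemma time_integral_lipschitz d (T : measurableType d) (R : realType) (q : R -> T -> R) (M s t : R) w :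
  joint_measurable q -> (forall r w, `|q r w| <= M) ->
  `|\int[lebesgue_measure]_(r in `[0, t]) q r w - \int[lebesgue_measure]_(r in `[0, s]) q r w| <= M * `|t - s|.
Proof.
move=> mq qM; have M0 : 0 <= M := le_trans (normr_ge0 _) (qM 0 w).
have neg (v : R) : v < 0 -> \int[lebesgue_measure]_(r in `[0, v]) q r w = 0.
  by move=> v0; rewrite set_itv_ge ?Rintegral_set0// bnd_simp -ltNge.
wlog st : s t / s <= t => [H|].
  have [st|/ltW ts] := leP s t; first exact: H.
  by rewrite distrC (distrC t); exact: H.
rewrite (ger0_norm (_ : 0 <= t - s)) ?subr_ge0//.
have [s0|s0] := leP 0 s.
  rewrite (time_integral_split mq qM w s0 st) addrC addKr.
  exact: (time_integral_bound mq qM).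
rewrite (neg s s0) subr0; have [t0|t0] := leP 0 t; last first.
  by rewrite neg// normr0 mulr_ge0// subr_ge0.
apply: le_trans (time_integral_bound mq qM w t0) _.
by rewrite ler_wpM2l//; lra.
Qed.

Lemma Rintegral_itvcc_cst (R : realType) (s t k : R) : s <= t ->
  \int[lebesgue_measure]_(r in `[s, t]) k = (t - s) * k.
Proof. by move=> st; rewrite Rintegral_cst// fine_lebesgue_itvcc// mulrC. Qed.

Lemma time_integral_continuous d (T : measurableType d) (R : realType) (q : R -> T -> R) (M : R) w :
  joint_measurable q -> (forall r w, `|q r w| <= M) ->
  continuous (fun t : R => \int[lebesgue_measure]_(r in `[0, t]) q r w).
Proof.
move=> mq qM t; have M0 : 0 <= M := le_trans (normr_ge0 _) (qM 0 w).
apply/cvgrPdist_lt => e e0; near=> s.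
apply: le_lt_trans (time_integral_lipschitz s t w mq qM) _.
have h : `|t - s| < e / (M + 1).
  by near: s; apply/nbhs_ballP; exists (e / (M + 1)) => //=; rewrite divr_gt0// ltr_wpDl.
apply: (@le_lt_trans _ _ ((M + 1) * `|t - s|)); first by rewrite ler_wpM2r// lerDl.
by rewrite mulrC -ltr_pdivlMr// ltr_wpDl.
Unshelve. all: by end_near. Qed.

Lemma expR_taylor1 (R : realType) (x : R) : 0 <= x -> 0 <= expR (- x) - 1 + x <= x ^+ 2.
Proof.
move=> x0; have h1 := expR_ge1Dx (- x); have h2 := expR_ge1Dx x; have e0 := expR_gt0 (- x).
have ee : expR (- x) * expR x = 1 by rewrite -expRD addNr expR0.
move: (expR (- x)) (expR x) h1 h2 e0 ee => u v h1 h2 e0 ee.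
by apply/andP; split; [lra|nra].
Qed.

(** Errors of order h^2 are brought to the order h^(3/2) required by [sewing], at the price of a
    constant that depends on the horizon. *)
Lemma mul_sqrt_le (R : realType) (h q k : R) : 0 <= h -> 0 <= q -> q <= k -> h = q * q ->
  h * h <= k * (h * q).
Proof.
move=> h0 q0 qk hE; rewrite (_ : h * h = q * (h * q)); last by rewrite mulrCA -hE.
by rewrite ler_wpM2r// mulr_ge0.
Qed.

Lemma gap_arith (R : realType) (h q k M U K : R) : 0 <= h -> 0 <= q -> q <= k -> h = q * q ->
  0 <= M -> 0 <= U ->
  M ^+ 2 * h ^+ 2 * U + M * K * q * h + M * h * h <= ((M ^+ 2 * U + M) * k + M * K) * (h * q).
Proof.
move=> h0 q0 qk hE M0 U0; have hh := mul_sqrt_le h0 q0 qk hE.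
have h5 := ler_wpM2l (mulr_ge0 (sqr_ge0 M) U0) hh; have h6 := ler_wpM2l M0 hh.
by move: h5 h6; move: (M ^+ 2) => M2; rewrite expr2; lra.
Qed.

(** * Resolvents *)

Section bounded_expectations.
Context d (T : measurableType d) (R : realType) (P : probability T R).

Lemma expectation_bound (f : T -> R) (k : R) : measurable_fun setT f -> (forall w, `|f w| <= k) ->
  `|\int[P]_w f w| <= k.
Proof.
move=> mf fk; have PT : (P setT < +oo)%E by rewrite probability_setT ltry.
have := Rintegral_le_bound measurableT PT mf (fun w _ => fk w).
by rewrite (_ : fine _ = 1) ?mulr1//; have := @probability_setT _ _ _ P => /= ->.
Qed.

Definition bounded_rv (f : T -> R) := measurable_fun setT f /\ exists k : R, forall w, `|f w| <= k.

Lemma bounded_rv_integrable f : bounded_rv f -> P.-integrable setT (EFin \o f).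
Proof. by move=> [mf [k fk]]; exact: prob_bounded_integrable mf fk. Qed.

Lemma bounded_rvM f g : bounded_rv f -> bounded_rv g -> bounded_rv (fun w => f w * g w).
Proof.
move=> [mf [k fk]] [mg [l gl]]; split; first exact: measurable_funM.
by exists (k * l) => w; rewrite normrM ler_pM.
Qed.

Lemma bounded_rvD f g : bounded_rv f -> bounded_rv g -> bounded_rv (fun w => f w + g w).
Proof.
move=> [mf [k fk]] [mg [l gl]]; split; first exact: measurable_funD.
by exists (k + l) => w; rewrite (le_trans (ler_normD _ _))// lerD.
Qed.

Lemma bounded_rvB f g : bounded_rv f -> bounded_rv g -> bounded_rv (fun w => f w - g w).
Proof.
move=> [mf [k fk]] [mg [l gl]]; split; first exact: measurable_funB.
by exists (k + l) => w; rewrite (le_trans (ler_normB _ _))// lerD.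
Qed.

Lemma bounded_rv_cst (k : R) : bounded_rv (cst k).
Proof. by split => //; exists `|k|. Qed.

Lemma bounded_rv_time_integral (q : R -> T -> R) (k s t : R) : joint_measurable q ->
  (forall r w, `|q r w| <= k) -> s <= t ->
  bounded_rv (fun w => \int[lebesgue_measure]_(r in `[s, t]) q r w).
Proof.
move=> mq qk st; split; first exact: (time_integral_measurable mq qk).
by exists (k * (t - s)) => w; exact: (time_integral_bound mq qk).
Qed.

Lemma bounded_expectationD f g : bounded_rv f -> bounded_rv g ->
  \int[P]_w (f w + g w) = \int[P]_w f w + \int[P]_w g w.
Proof. by move=> /bounded_rv_integrable fi /bounded_rv_integrable gi; rewrite RintegralD. Qed.

Lemma bounded_expectationB f g : bounded_rv f -> bounded_rv g ->
  \int[P]_w (f w - g w) = \int[P]_w f w - \int[P]_w g w.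
Proof. by move=> /bounded_rv_integrable fi /bounded_rv_integrable gi; rewrite RintegralB. Qed.

Lemma bounded_expectationZ (k : R) f : bounded_rv f -> \int[P]_w (k * f w) = k * \int[P]_w f w.
Proof. by move=> /bounded_rv_integrable fi; rewrite RintegralZl. Qed.

Lemma expectation_ler f g : bounded_rv f -> bounded_rv g -> (forall w, f w <= g w) ->
  \int[P]_w f w <= \int[P]_w g w.
Proof.
by move=> /bounded_rv_integrable fi /bounded_rv_integrable gi fg; apply: le_Rintegral.
Qed.

End bounded_expectations.
Arguments bounded_rv_cst {d T R} k.

(** * Discounted expectations *)

Section discounting.
Context d (T : measurableType d) (R : realType).
Notation leb := (@lebesgue_measure R).
Variables (P : probability T R) (F : R -> set_system T) (X H : R -> T -> R).
Hypotheses (fF : filtration F) (cX : forall w, continuous (X ^~ w))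
  (FX : forall t, 0 <= t -> Fmeas F t (X t)) (mX : joint_measurable X)
  (mH : joint_measurable H) (HH : forall r w, H r w ^+ 2 = H r w)
  (dX : diffusion_increments P F X H).
Variables (c u : R -> R) (m M U K : R).
Hypotheses (m0 : 0 < m) (mc : measurable_fun setT c) (cm : forall x, m <= c x) (cM : forall x, c x <= M)
  (mu : measurable_fun setT u) (uU : forall x, `|u x| <= U)
  (uK : forall x y, `|u x - u y| <= K * `|x - y|).
Hypothesis (generator : forall (s t : R) (z : T -> R), 0 <= s -> s <= t -> Fmeas F s z ->
  (forall w, 0 <= z w) -> (forall w, z w <= 1) ->
  \int[P]_w (z w * (u (X t w) - u (X s w))) =
  \int[P]_w (z w * \int[leb]_(r in `[s, t]) (c (X r w) * u (X r w) - 1))).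

Let c0 x : 0 <= c x. Proof. exact: le_trans (ltW m0) (cm x). Qed.
Let cn x : `|c x| <= M. Proof. by rewrite ger0_norm. Qed.
Let M0 : 0 <= M. Proof. exact: le_trans (c0 0) (cM 0). Qed.
Let U0 : 0 <= U. Proof. exact: le_trans (normr_ge0 _) (uU 0). Qed.
Let K0 : 0 <= K.
Proof. by have := uK 1 0; rewrite subr0 normr1 mulr1; exact: le_trans. Qed.
Let mcX : joint_measurable (fun r w => c (X r w)). Proof. exact: joint_measurable_comp. Qed.
Let muX : joint_measurable (fun r w => u (X r w)). Proof. exact: joint_measurable_comp. Qed.
Let cXM r w : `|c (X r w)| <= M. Proof. exact: cn. Qed.

Definition discount (t : R) (w : T) : R := expR (- \int[leb]_(r in `[0, t]) c (X r w)).

Let A s t w := \int[leb]_(r in `[s, t]) c (X r w).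

Let A_ge s t w : s <= t -> m * (t - s) <= A s t w.
Proof.
move=> st; rewrite -(fine_lebesgue_itvcc st) -Rintegral_cst//; apply: le_Rintegral => //.
  by apply: (bounded_integrable _ (lebesgue_itvcc_lty s t) (M := `|m|)).
exact: (time_integrable mcX cXM).
Qed.

Let A0 s t w : s <= t -> 0 <= A s t w.
Proof. by move=> st; apply: le_trans (A_ge w st); rewrite mulr_ge0 ?subr_ge0// ltW. Qed.

Let A_le s t w : s <= t -> A s t w <= M * (t - s).
Proof. by move=> st; have := time_integral_bound mcX cXM w st; apply: le_trans; exact: ler_norm. Qed.

Lemma discount_gt0 t w : 0 < discount t w. Proof. exact: expR_gt0. Qed.

Lemma discount_le1 t w : discount t w <= 1.
Proof.
rewrite -expR0 ler_expR oppr_le0; have [t0|t0] := leP 0 t; first exact: A0.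
by rewrite set_itv_ge ?Rintegral_set0// bnd_simp -ltNge.
Qed.

Let dn t w : `|discount t w| <= 1.
Proof. by rewrite gtr0_norm ?discount_gt0// discount_le1. Qed.

Lemma discount_joint : joint_measurable discount.
Proof.
apply: continuous_joint_measurable => [t|w t].
  apply: measurableT_comp => //; apply: measurable_funN.
  exact: (time_integral_measurable mcX cXM).
apply: continuous_comp; last exact: continuous_expR.
by apply: continuousN; exact: (time_integral_continuous mcX cXM).
Qed.

Lemma discount_Fmeas t : 0 <= t -> Fmeas F t (discount t).
Proof.
move=> t0; apply: measurableT_comp => //; apply: measurable_funN.
exact: (progressive_time_integral fF cX FX mc cn (lexx 0) t0).
Qed.

Lemma discount_le t w : 0 <= t -> discount t w <= expR (- (m * t)).
Proof. by move=> t0; rewrite ler_expR lerN2; have := A_ge w t0; rewrite subr0. Qed.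

Lemma discount_split s t w : 0 <= s -> s <= t -> discount t w = discount s w * expR (- A s t w).
Proof. by move=> s0 st; rewrite /discount (time_integral_split mcX cXM w s0 st) opprD expRD. Qed.

Let md t : measurable_fun setT (discount t). Proof. exact: joint_measurable_sec2 discount_joint. Qed.
Let mut t : measurable_fun setT (fun w => u (X t w)). Proof. exact: joint_measurable_sec2 muX. Qed.
Let bd t : bounded_rv (discount t). Proof. by split => //; exists 1. Qed.
Let bu t : bounded_rv (fun w => u (X t w)). Proof. by split => //; exists U. Qed.

(** The increment over [s, t] of E (d_t u(X_t)) plus the time integral of E d_r, with d the
    discount; the aim is that it vanishes. *)
Let gap s t := \int[P]_w (discount t w * u (X t w)) - \int[P]_w (discount s w * u (X s w)) +
  \int[leb]_(r in `[s, t]) \int[P]_w discount r w.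

Let me_discount : measurable_fun setT (fun r => \int[P]_w discount r w).
Proof. exact: (expectation_measurable discount_joint dn). Qed.

Let me_bound r : `|\int[P]_w discount r w| <= 1.
Proof. exact: expectation_bound. Qed.

Let me_integrable s t : leb.-integrable `[s, t] (EFin \o (fun r => \int[P]_w discount r w)).
Proof.
apply: (bounded_integrable _ (lebesgue_itvcc_lty s t) (M := 1)) => //.
by apply: measurable_funTS; exact: me_discount.
Qed.

Let gap_add r s v : r <= s -> s <= v -> gap r v = gap r s + gap s v.
Proof.
move=> rs sv; rewrite /gap.
have := @time_integral_split _ T R (fun v _ => \int[P]_w discount v w) 1 _ _ r s v point rs sv.
move=> ->; first by ring.
  by apply: (measurableT_comp me_discount); exact: measurable_fst.
by move=> v' _; exact: me_bound.
Qed.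

(** Write the discount at t as that at s times e^(-A). The linear term -A u(X_t) cancels the part c
    u of the generator, up to replacing u(X_r) by u(X_t); the part -1 cancels the time integral of
    the discount, up to freezing the discount at s. What is left are the second-order term of the
    exponential and these two freezing errors. *)
Let gap_eq s t : 0 <= s -> s <= t ->
  gap s t = \int[P]_w (discount s w * (expR (- A s t w) - 1 + A s t w) * u (X t w)) +
    \int[P]_w (discount s w * \int[leb]_(r in `[s, t]) (c (X r w) * (u (X r w) - u (X t w)))) +
    \int[leb]_(r in `[s, t]) \int[P]_w (discount r w - discount s w).
Proof.
move=> s0 st; have bA : bounded_rv (A s t).
  exact: (bounded_rv_time_integral mcX cXM st).
have bE : bounded_rv (fun w => expR (- A s t w)).
  split; first by apply: measurableT_comp => //; apply: measurable_funN; case: bA.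
  by exists 1 => w; rewrite gtr0_norm ?expR_gt0// -expR0 ler_expR oppr_le0 A0.
have be1 : bounded_rv (fun w => expR (- A s t w) - 1) by exact: (bounded_rvB bE (bounded_rv_cst 1)).
have mI : joint_measurable (fun r w => c (X r w) * u (X r w) - 1).
  by apply: measurable_funB => //; exact: measurable_funM.
have cuM r w : `|c (X r w) * u (X r w)| <= M * U by rewrite normrM ler_pM.
have bI r w : `|c (X r w) * u (X r w) - 1| <= M * U + 1.
  by rewrite (le_trans (ler_normB _ _))// normr1 lerD2r.
have mJ : joint_measurable (fun r w => c (X r w) * (u (X r w) - u (X t w))).
  apply: measurable_funM => //; apply: measurable_funB => //.
  by apply: (measurableT_comp (mut t)); exact: measurable_snd.
have bJ r w : `|c (X r w) * (u (X r w) - u (X t w))| <= M * (U + U).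
  by rewrite normrM ler_pM// (le_trans (ler_normB _ _))// lerD.
have bII : bounded_rv (fun w => \int[leb]_(r in `[s, t]) (c (X r w) * u (X r w) - 1)).
  exact: (bounded_rv_time_integral mI bI st).
have bJJ : bounded_rv (fun w => \int[leb]_(r in `[s, t]) (c (X r w) * (u (X r w) - u (X t w)))).
  exact: (bounded_rv_time_integral mJ bJ st).
have IJ w : \int[leb]_(r in `[s, t]) (c (X r w) * u (X r w) - 1) =
    \int[leb]_(r in `[s, t]) (c (X r w) * (u (X r w) - u (X t w))) + A s t w * u (X t w) - (t - s).
  have j1 := time_integrable mcX cXM s t w.
  have j2 := time_integrable (measurable_funM mcX muX) cuM s t w.
  have j3 : leb.-integrable `[s, t] (EFin \o cst (1 : R)).
    by apply: (bounded_integrable _ (lebesgue_itvcc_lty s t) (M := 1)) => // x _; rewrite normr1.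
  have j4 : leb.-integrable `[s, t] (EFin \o (fun r => u (X t w) * c (X r w))).
    exact: (integrableZl _ _ j1).
  rewrite RintegralB// Rintegral_cst// fine_lebesgue_itvcc// mul1r; congr (_ - _).
  rewrite /A mulrC -RintegralZl// -RintegralD//; last exact: (time_integrable mJ bJ).
  by apply: eq_Rintegral => r _; ring.
have e1 : \int[P]_w (discount t w * u (X t w)) - \int[P]_w (discount s w * u (X s w)) =
    \int[P]_w (discount s w * (u (X t w) - u (X s w))) + \int[P]_w (discount s w * (expR (- A s t w) - 1) * u (X t w)).
  rewrite -bounded_expectationB -?bounded_expectationD; last 4 first.
  - exact: (bounded_rvM (bd s) (bounded_rvB (bu t) (bu s))).
  - exact: (bounded_rvM (bounded_rvM (bd s) be1) (bu t)).
  - exact: (bounded_rvM (bd t) (bu t)).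
  - exact: (bounded_rvM (bd s) (bu s)).
  by apply: eq_Rintegral => w _; rewrite (discount_split w s0 st); ring.
rewrite /gap e1 (generator s0 st (discount_Fmeas s0)); last 2 first.
- by move=> w; rewrite ltW ?discount_gt0.
- by move=> w; exact: discount_le1.
have e2 : \int[leb]_(r in `[s, t]) \int[P]_w (discount r w - discount s w) =
    \int[leb]_(r in `[s, t]) \int[P]_w discount r w - (t - s) * \int[P]_w discount s w.
  have eB r : \int[P]_w (discount r w - discount s w) = \int[P]_w discount r w - \int[P]_w discount s w.
    exact: (bounded_expectationB P (bd r) (bd s)).
  transitivity (\int[leb]_(r in `[s, t]) (\int[P]_w discount r w - \int[P]_w discount s w)).
    by apply: eq_Rintegral => r _; exact: eB.
  have jc : leb.-integrable `[s, t] (EFin \o cst (\int[P]_w discount s w)).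
    by apply: (bounded_integrable _ (lebesgue_itvcc_lty s t) (M := 1)) => [||x _]; [exact: measurable_itv|exact: measurable_cst|exact: me_bound].
  rewrite (@RintegralB _ _ _ leb _ _ _ _ (me_integrable s t) jc); last exact: measurable_itv.
  by congr (_ - _); exact: Rintegral_itvcc_cst.
rewrite e2 -[LHS]subr0 -[RHS]subr0.
have e3 : \int[P]_w (discount s w * \int[leb]_(r in `[s, t]) (c (X r w) * u (X r w) - 1)) +
    \int[P]_w (discount s w * (expR (- A s t w) - 1) * u (X t w)) =
    \int[P]_w (discount s w * (expR (- A s t w) - 1 + A s t w) * u (X t w)) +
    \int[P]_w (discount s w * \int[leb]_(r in `[s, t]) (c (X r w) * (u (X r w) - u (X t w)))) -
    (t - s) * \int[P]_w discount s w.
  have B1 := bounded_rvM (bd s) bII.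
  have B2 := bounded_rvM (bounded_rvM (bd s) be1) (bu t).
  have B3 := bounded_rvM (bounded_rvM (bd s) (bounded_rvD be1 bA)) (bu t).
  have B4 := bounded_rvM (bd s) bJJ.
  have B5 := bounded_rvM (bounded_rv_cst (t - s)) (bd s).
  have E1 := bounded_expectationD P B1 B2; have E2 := bounded_expectationD P B3 B4.
  have E3 := bounded_expectationB P (bounded_rvD B3 B4) B5; have E4 := bounded_expectationZ P (t - s) (bd s).
  apply: (etrans (esym E1)); symmetry; apply: (etrans _ (etrans (esym E3) _)).
    by congr (_ - _); [exact: esym E2|exact: esym E4].
  by apply: eq_Rintegral => w _; rewrite IJ /cst; ring.
by rewrite e3; ring.
Qed.

Let gap_le b s t : 0 <= s -> s < t -> t <= b ->
  `|gap s t| <= ((M ^+ 2 * U + M) * Num.sqrt b + M * K) * ((t - s) * Num.sqrt (t - s)).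
Proof.
move=> s0 lt_st tb; have st := ltW lt_st; have h0 : 0 <= t - s by rewrite subr_ge0.
have b0 : 0 <= b := le_trans (le_trans s0 st) tb.
rewrite (gap_eq s0 st).
have t1 : `|\int[P]_w (discount s w * (expR (- A s t w) - 1 + A s t w) * u (X t w))| <= (M * (t - s)) ^+ 2 * U.
  apply: expectation_bound.
    have mA : measurable_fun setT (A s t) := time_integral_measurable mcX cXM s t.
    apply: measurable_funM => //; apply: measurable_funM => //.
    apply: measurable_funD => //; apply: measurable_funB => //.
    by apply: measurableT_comp => //; exact: measurable_funN.
  move=> w; rewrite !normrM ler_pM ?mulr_ge0// -[leRHS]mul1r ler_pM//.
  have /andP[e0 e1] := expR_taylor1 (A0 w st).
  by rewrite ger0_norm// (le_trans e1)// lerXn2r ?nnegrE ?A0 ?mulr_ge0// A_le.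
have t3 : `|\int[leb]_(r in `[s, t]) \int[P]_w (discount r w - discount s w)| <= M * (t - s) * (t - s).
  rewrite -[X in _ * X](fine_lebesgue_itvcc st); apply: Rintegral_le_bound => //.
  - exact: lebesgue_itvcc_lty.
  - apply: measurable_funTS.
    rewrite (_ : (fun r => _) = fun r => \int[P]_w discount r w - \int[P]_w discount s w).
      exact: (measurable_funB me_discount (measurable_cst _)).
    by apply/funext => r; rewrite bounded_expectationB.
  - move=> r /=; rewrite in_itv/= => /andP[sr rt]; apply: expectation_bound; first exact: measurable_funB.
    move=> w; rewrite (discount_split w s0 sr) -[X in _ - X]mulr1 -mulrBr normrM -[leRHS]mul1r ler_pM//.
    have h1 := expR_ge1Dx (- A s r w); have h2 := A_le w sr.
    have h3 : expR (- A s r w) <= 1 by rewrite -expR0 ler_expR oppr_le0 A0.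
    have h4 : M * (r - s) <= M * (t - s) by rewrite ler_wpM2l// lerD2r.
    by rewrite ler0_norm ?subr_le0//; lra.
have t2 : `|\int[P]_w (discount s w * \int[leb]_(r in `[s, t]) (c (X r w) * (u (X r w) - u (X t w))))| <=
    M * K * Num.sqrt (t - s) * (t - s).
  have mJ : joint_measurable (fun r w => c (X r w) * (u (X r w) - u (X t w))).
    apply: measurable_funM => //; apply: measurable_funB => //.
    by apply: (measurableT_comp (mut t)); exact: measurable_snd.
  have bJ r w : `|c (X r w) * (u (X r w) - u (X t w))| <= M * (U + U).
    by rewrite normrM ler_pM// (le_trans (ler_normB _ _))// lerD.
  have mG : joint_measurable (fun r w => M * `|u (X r w) - u (X t w)|).
    apply: measurable_funM => //; apply: measurableT_comp => //; apply: measurable_funB => //.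
    by apply: (measurableT_comp (mut t)); exact: measurable_snd.
  have bG r w : `|M * `|u (X r w) - u (X t w)| | <= M * (U + U).
    by rewrite normrM normr_id (ger0_norm M0) ler_wpM2l// (le_trans (ler_normB _ _))// lerD.
  have bJJ : bounded_rv (fun w => \int[leb]_(r in `[s, t]) (c (X r w) * (u (X r w) - u (X t w)))).
    exact: (bounded_rv_time_integral mJ bJ st).
  have bGG : bounded_rv (fun w => \int[leb]_(r in `[s, t]) (M * `|u (X r w) - u (X t w)|)).
    exact: (bounded_rv_time_integral mG bG st).
  apply: (@le_trans _ _ (\int[P]_w \int[leb]_(r in `[s, t]) (M * `|u (X r w) - u (X t w)|))).
    have iJ := bounded_rv_integrable P (bounded_rvM (bd s) bJJ).
    apply: le_trans (le_normr_Rintegral measurableT iJ) _.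
    apply: le_Rintegral => //; [exact: (integrable_norm iJ)|exact: bounded_rv_integrable|].
    move=> w _; rewrite normrM -[leRHS]mul1r ler_pM//.
    apply: le_trans (le_normr_Rintegral _ (time_integrable mJ bJ s t w)) _ => //.
    apply: le_Rintegral => //; [exact: (integrable_norm (time_integrable mJ bJ s t w))|exact: (time_integrable mG bG)|].
    by move=> r _; rewrite normrM ler_wpM2r.
  rewrite (time_integral_Fubini mG bG) -[X in _ * X](fine_lebesgue_itvcc st) -Rintegral_cst//.
  apply: le_Rintegral => //.
  - apply: (bounded_integrable _ (lebesgue_itvcc_lty s t) (M := M * (U + U))) => //.
      by apply: measurable_funTS; exact: (expectation_measurable mG bG).
    by move=> r _; apply: expectation_bound => //; exact: (joint_measurable_sec2 r mG).
  - by apply: (bounded_integrable _ (lebesgue_itvcc_lty s t) (M := `|M * K * Num.sqrt (t - s)|)).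
  move=> r /=; rewrite in_itv/= => /andP[sr rt]; have r0 := le_trans s0 sr.
  have iX : P.-integrable setT (EFin \o (fun w => `|X t w - X r w|)).
    have i1 := increment_integrable mX dX r0 rt (isT : (1 <= 4)%N).
    exact: (integrable_norm i1).
  apply: (@le_trans _ _ (\int[P]_w (M * K * `|X t w - X r w|))).
    apply: le_Rintegral => //.
    - by apply: (prob_bounded_integrable P _ (bG r)); exact: (joint_measurable_sec2 r mG).
    - exact: (integrableZl measurableT _ iX).
    - by move=> w _; rewrite -mulrA ler_wpM2l// (distrC (X t w)).
  rewrite RintegralZl// ler_wpM2l ?mulr_ge0//.
  have [rtE|rt'] := eqVneq r t.
    by rewrite rtE; under eq_Rintegral do rewrite subrr normr0; rewrite Rintegral_prob_cst.
  apply: le_trans (increment_abs_le mX mH HH dX r0 rt _) _; first by rewrite lt_neqAle rt'.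
  by rewrite ler_wsqrtr// lerD2l lerN2.
set h := t - s in h0 t1 t2 t3 *; set q := Num.sqrt h in t2 *.
have qE : h = q * q by rewrite -expr2 sqr_sqrtr.
have q0 : 0 <= q := sqrtr_ge0 _; have qb : q <= Num.sqrt b by rewrite ler_wsqrtr// /h; lra.
move: (Num.sqrt b) qb => sb qb.
apply: le_trans (ler_normD _ _) _; apply: le_trans (lerD (ler_normD _ _) (lexx _)) _.
apply: le_trans (lerD (lerD t1 t2) t3) _.
by rewrite exprMn; exact: gap_arith.
Qed.

Lemma discounted_formula t : 0 <= t ->
  \int[P]_w (discount t w * u (X t w)) + \int[leb]_(r in `[0, t]) \int[P]_w discount r w =
  \int[P]_w u (X 0 w).
Proof.
move=> t0.
have : gap 0 t = 0.
  apply: (sewing (C := (M ^+ 2 * U + M) * Num.sqrt t + M * K) t0) => [r s v r0 rs sv vt|r s r0 rs st].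
    exact: gap_add.
  have [->|rs'] := eqVneq r s; last by apply: gap_le => //; rewrite lt_neqAle rs'.
  by rewrite /gap !subrr set_itv1 Rintegral_set1 addr0 normr0 mul0r mulr0.
rewrite /gap => /eqP; rewrite addrAC subr_eq0 => /eqP ->.
apply: eq_Rintegral => w _; rewrite /discount set_itv1 Rintegral_set1 oppr0 expR0 mul1r//.
Qed.

(** Time goes to infinity in [discounted_formula]: the rate is at least m > 0, so the boundary term
    decays exponentially, and the time integrals increase to the integral over the half-line. *)
Lemma discounted_resolvent :
  (\int[leb]_(r in `[0%R, +oo[) (\int[P]_w discount r w)%:E = (\int[P]_w u (X 0 w))%:E)%E.
Proof.
have D0 r : 0 <= \int[P]_w discount r w by apply: Rintegral_ge0 => w _; rewrite ltW ?discount_gt0.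
have nd : nondecreasing_seq (fun n : nat => `[0, n%:R]%classic : set R).
  move=> n k nk; rewrite subsetEset; apply: subset_itvl; rewrite bnd_simp.
  by rewrite ler_nat.
have me : measurable_fun setT (fun r => (\int[P]_w discount r w)%:E).
  by apply/measurable_EFinP.
have := ge0_nondecreasing_set_cvg_integral (mu := leb) nd
  (fun n => measurable_itv _) (fun n => measurable_funTS me) (fun n r _ => D0 r).
have -> : \bigcup_i `[0, i%:R]%classic = `[0, +oo[%classic :> set R.
  apply/seteqP; split => [r [n _]/=|r /=]; rewrite !in_itv/= ?andbT; first by case/andP.
  move=> r0; exists (Num.truncn r).+1 => //=; rewrite in_itv/= r0/=.
  by rewrite ltW// truncnS_gt.
move=> cv; apply: (cvg_unique _ cv) => //.
have E n : (\int[leb]_(r in `[0%R, n%:R]) (\int[P]_w discount r w)%:E =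
    (\int[P]_w u (X 0 w) - \int[P]_w (discount n%:R w * u (X n%:R w)))%:E)%E.
  rewrite -(discounted_formula (ler0n R n)) addrC addKr /Rintegral fineK//.
  exact: integrable_fin_num (me_integrable 0 n%:R).
rewrite /= (funext E).
apply: cvg_EFin; first exact: nearW.
rewrite -[X in _ --> X]subr0; apply: cvgB; first exact: cvg_cst.
apply/norm_cvg0P; apply: (@squeeze_cvgr _ _ _ _ (cst 0) (fun n : nat => expR (- m) ^+ n * U)).
- near=> n; rewrite normr_ge0/=; apply: expectation_bound; first exact: measurable_funM.
  move=> w; rewrite normrM ler_pM// gtr0_norm ?discount_gt0//.
  by rewrite -expRM_natl mulrN mulrC discount_le.
- exact: cvg_cst.
- rewrite -[X in _ --> X](mul0r U); apply: cvgM; last exact: cvg_cst.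
  by apply: cvg_expr; rewrite gtr0_norm ?expR_gt0// -expR0 ltr_expR oppr_lt0.
Unshelve. all: by end_near. Qed.

End discounting.

Section rates.
Context (R : realType).
Implicit Types (p q r x y a sg : R).

Definition rate p q r x : R := p * \1_[set y | 0 < y] x + q * \1_[set 0] x + r * \1_[set y | y < 0] x.

Lemma rate_pos p q r x : 0 < x -> rate p q r x = p.
Proof.
move=> x0; rewrite /rate !indicE mem_set// memNset ?memNset/= ?mulr0 ?addr0 ?mulr1//.
  by apply/negP; rewrite -leNgt ltW.
by move=> xE; rewrite xE ltxx in x0.
Qed.

Lemma rate_neg p q r x : x < 0 -> rate p q r x = r.
Proof.
move=> x0; rewrite /rate !indicE [in r * _]mem_set// memNset ?memNset/= ?mulr0 ?add0r ?mulr1//.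
  by move=> xE; rewrite xE ltxx in x0.
by apply/negP; rewrite -leNgt ltW.
Qed.

Lemma rate_0 p q r : rate p q r 0 = q.
Proof. by rewrite /rate !indicE memNset/= ?ltxx// mem_set// memNset/= ?ltxx// !mulr0 mulr1 addr0 add0r. Qed.

Lemma measurable_rate p q r : measurable_fun setT (rate p q r).
Proof.
have m1 : measurable ([set y | 0 < y] : set R).
  rewrite (_ : [set _ | _] = `]0, +oo[%classic)//.
  by apply/seteqP; split => x /=; rewrite in_itv/= andbT.
have m2 : measurable ([set y | y < 0] : set R).
  rewrite (_ : [set _ | _] = `]-oo, 0[%classic)//.
by apply: measurable_funD; [apply: measurable_funD|]; apply: measurable_funM => //; exact: measurable_indic.
Qed.

Lemma rate_ge p q r m x : m <= p -> m <= q -> m <= r -> m <= rate p q r x.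
Proof. by have [h|h|->] := ltgtP x 0; [rewrite rate_neg|rewrite rate_pos|rewrite rate_0]. Qed.

Lemma rate_le p q r m x : p <= m -> q <= m -> r <= m -> rate p q r x <= m.
Proof. by have [h|h|->] := ltgtP x 0; [rewrite rate_neg|rewrite rate_pos|rewrite rate_0]. Qed.

Lemma expRN_lipschitz x y : 0 <= x -> 0 <= y -> `|expR (- x) - expR (- y)| <= `|x - y|.
Proof.
wlog xy : x y / x <= y => [H x0 y0|x0 _].
  have [xy|/ltW yx] := leP x y; first exact: H.
  by rewrite distrC (distrC x); exact: H.
rewrite ger0_norm ?subr_ge0 ?ler_expR ?lerN2// ler0_norm ?subr_le0// opprB.
have -> : - y = - x + - (y - x) by ring.
rewrite expRD -{1}[expR (- x)]mulr1 -mulrBr.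
have h1 := expR_ge1Dx (- (y - x)); have h2 : expR (- x) <= 1 by rewrite -expR0 ler_expR oppr_le0.
have h3 : expR (- (y - x)) <= 1 by rewrite -expR0 ler_expR oppr_le0 subr_ge0.
apply: (@le_trans _ _ (1 * (1 - expR (- (y - x))))); first by rewrite ler_wpM2r// subr_ge0.
by rewrite mul1r; lra.
Qed.

Lemma side_exp_lipschitz a sg x y : 0 <= a -> sg ^+ 2 = 1 ->
  `|side_exp a sg x - side_exp a sg y| <= a * `|x - y|.
Proof.
move=> a0 sg1; have sgn : `|sg| = 1 by apply/eqP; rewrite -(@eqrXn2 _ 2)// ?expr1n real_normK ?num_real// sg1.
have p0 (v : R) : 0 <= a * Num.max v 0 by rewrite mulr_ge0// le_max lexx orbT.
apply: le_trans (expRN_lipschitz (p0 _) (p0 _)) _.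
rewrite -mulrBr normrM (ger0_norm a0) ler_wpM2l//.
have -> : `|x - y| = `|sg * x - sg * y| by rewrite -mulrBr normrM sgn mul1r.
by rewrite ler_norml; case: (leP (sg * x) 0) => h1; case: (leP (sg * y) 0) => h2; case: (ger0P (sg * x - sg * y)) => h3; apply/andP; split; lra.
Qed.

End rates.

Lemma tanaka_arith (R : realType) (C D a b theta i1 i2 i3 : R) :
  C * (2^-1 * (a ^+ 2 * i1 - a * (theta * i3))) + D * (2^-1 * (b ^+ 2 * i2 - b * (theta * i3))) =
  2^-1 * C * a ^+ 2 * i1 + 2^-1 * D * b ^+ 2 * i2 - 2^-1 * theta * (a * C + b * D) * i3.
Proof. by ring. Qed.

Section piecewise_constant_resolvent.
Context d (T : measurableType d) (R : realType).
Notation leb := (@lebesgue_measure R).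
Variables (theta : R) (P : probability T R) (F : R -> set_system T) (X L : R -> T -> R).
Let ne : R -> R := \1_(~` [set 0]).
Hypotheses (theta0 : 0 < theta) (fF : filtration F) (cX : forall w, continuous (X ^~ w))
  (FX : forall t, 0 <= t -> Fmeas F t (X t)) (mX : joint_measurable X)
  (dX : diffusion_increments P F X (fun r w => ne (X r w)))
  (hL : local_time0 P X L)
  (occ : {ae P, forall w, forall t, 0 <= t -> occupation_time X [set 0] t w = theta^-1 * L t w}).

Variables (p q r a b k C D : R).
Hypotheses (p0 : 0 < p) (q0 : 0 < q) (r0 : 0 < r) (a0 : 0 <= a) (b0 : 0 <= b)
  (a2 : a ^+ 2 = 2 * p) (b2 : b ^+ 2 = 2 * r)
  (eqp : p * (k + D) = 1) (eqr : r * (k + C) = 1)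
  (eqq : q * (k + C + D) - 1 = - (2^-1 * theta * (a * C + b * D))).

(** On each side only one exponential varies; a^2 = 2 p and b^2 = 2 r match its second derivative
    with the rate, and [eqp], [eqr] make the constant part equal to 1. At 0 the kinks of the two
    exponentials contribute -(a C + b D) / 2 per unit of local time, that is theta times as much per
    unit of time spent at 0, which is [eqq]. *)
Let u x := k + C * side_exp a 1 x + D * side_exp b (-1) x.
Let sp : (1 : R) ^+ 2 = 1. Proof. by rewrite expr1n. Qed.
Let sn : (-1 : R) ^+ 2 = 1. Proof. by rewrite sqrrN expr1n. Qed.

Let ipos : R -> R := \1_[set x | 0 < 1 * x].
Let ineg : R -> R := \1_[set x | 0 < -1 * x].
Let i0 : R -> R := \1_[set 0].

Let uE x : rate p q r x * u x - 1 =
  2^-1 * C * a ^+ 2 * (ipos x * side_exp a 1 x) + 2^-1 * D * b ^+ 2 * (ineg x * side_exp b (-1) x)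
  - 2^-1 * theta * (a * C + b * D) * i0 x.
Proof.
rewrite /ipos /ineg /i0 /u !indicE a2 b2 /side_exp mul1r mulN1r.
have [h|h|->] := ltgtP x 0.
- rewrite rate_neg// (memNset (A := [set _ | 0 < 1 * _]))/=; last by rewrite mul1r; apply/negP; rewrite -leNgt ltW.
  rewrite mem_set/=; last by rewrite mulN1r oppr_gt0.
  rewrite memNset/=; last by move=> h'; rewrite h' ltxx in h.
  have -> : expR (- (a * 0)) = 1 by rewrite mulr0 oppr0 expR0.
  by rewrite mulr1 mulrDr eqr; field.
- rewrite rate_pos// mem_set/=; last by rewrite mul1r.
  rewrite (memNset (A := [set _ | 0 < -1 * _]))/=; last by rewrite mulN1r; apply/negP; rewrite -leNgt oppr_le0 ltW.
  rewrite memNset/=; last by move=> h'; rewrite h' ltxx in h.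
  rewrite [Num.max (- x) 0]max_r ?oppr_le0 ?(ltW h)// mulr0 oppr0 expR0 !mulr1 mul1r.
  rewrite (_ : k + _ + D = k + D + C * expR (- (a * x))); last by ring.
  by rewrite mulrDr eqp; field.
- rewrite rate_0 oppr0 maxxx !mulr0 oppr0 expR0 !mulr1 memNset/= ?mulr0 ?ltxx// memNset/= ?mulr0 ?ltxx//.
  by rewrite mem_set//= mulr1 !add0r eqq.
Qed.

Let mX' t : measurable_fun setT (X t). Proof. exact: joint_measurable_sec2. Qed.
Let mse e sg : measurable_fun setT (side_exp e sg : R -> R).
Proof. by apply: continuous_measurable_fun; exact: continuous_side_exp. Qed.
Let mu : measurable_fun setT u.
Proof. by apply: measurable_funD; [apply: measurable_funD => //|]; exact: measurable_funM. Qed.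

Let ind_joint e sg : joint_measurable (fun v w => \1_[set x | 0 < sg * x] (X v w) * side_exp e sg (X v w)).
Proof.
apply: measurable_funM; last exact: (joint_measurable_comp (mse e sg) mX).
apply: (joint_measurable_comp (g := \1_[set x | 0 < sg * x]) _ mX); apply: measurable_indic.
rewrite (_ : [set _ | _] = (fun x => sg * x) @^-1` `]0, +oo[).
  rewrite -[Y in measurable Y]setTI; apply: (_ : measurable_fun setT (fun x => sg * x)) => //.
  by apply: measurable_funM.
by apply/seteqP; split => x /=; rewrite in_itv/= andbT.
Qed.

Let ind_norm e sg v w : 0 <= e -> `|\1_[set x | 0 < sg * x] (X v w) * side_exp e sg (X v w)| <= 1.
Proof.
move=> e0; rewrite normrM -[leRHS]mul1r ler_pM//; last exact: side_exp_bounded.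
by rewrite indicE; case: (_ \in _); rewrite ?normr1 ?normr0.
Qed.

Let i0_joint : joint_measurable (fun v w => i0 (X v w)).
Proof. by apply: (joint_measurable_comp _ mX); exact: measurable_indic. Qed.

Let i0_norm v w : `|i0 (X v w)| <= 1.
Proof. by rewrite /i0 indicE; case: (_ \in _); rewrite ?normr1 ?normr0. Qed.

Lemma side_generator (s t : R) (z : T -> R) : 0 <= s -> s <= t -> Fmeas F s z ->
  (forall w, 0 <= z w) -> (forall w, z w <= 1) ->
  \int[P]_w (z w * (u (X t w) - u (X s w))) =
  \int[P]_w (z w * \int[leb]_(v in `[s, t]) (rate p q r (X v w) * u (X v w) - 1)).
Proof.
move=> s0 st Fz z0 z1.
have bz : bounded_rv z.
  by split; [exact: (Fmeas_fun fF s0 Fz)|exists 1 => w; rewrite ger0_norm].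
have bs e sg v : 0 <= e -> bounded_rv (fun w => side_exp e sg (X v w)).
  by move=> e0; split; [exact: (measurableT_comp (mse e sg))|exists 1 => w; exact: side_exp_bounded].
have Ta := tanaka_expectation theta0 fF cX FX mX dX hL occ a0 sp s0 st Fz z0 z1.
have Tb := tanaka_expectation theta0 fF cX FX mX dX hL occ b0 sn s0 st Fz z0 z1.
have B1 := bounded_rvM bz (bounded_rvB (bs a 1 t a0) (bs a 1 s a0)).
have B2 := bounded_rvM bz (bounded_rvB (bs b (-1) t b0) (bs b (-1) s b0)).
have B3 := bounded_rvM bz (bounded_rv_time_integral (ind_joint a 1) (fun v w => @ind_norm a 1 v w a0) st).
have B4 := bounded_rvM bz (bounded_rv_time_integral (ind_joint b (-1)) (fun v w => @ind_norm b (-1) v w b0) st).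
have B5 := bounded_rvM bz (bounded_rv_time_integral i0_joint i0_norm st).
have E1 := bounded_expectationZ P C B1; have E2 := bounded_expectationZ P D B2.
have E3 := bounded_expectationD P (bounded_rvM (bounded_rv_cst C) B1) (bounded_rvM (bounded_rv_cst D) B2).
have F1 := bounded_expectationZ P (2^-1 * C * a ^+ 2) B3.
have F2 := bounded_expectationZ P (2^-1 * D * b ^+ 2) B4.
have F3 := bounded_expectationZ P (2^-1 * theta * (a * C + b * D)) B5.
pose g1 := bounded_rvM (bounded_rv_cst (2^-1 * C * a ^+ 2)) B3.
pose g2 := bounded_rvM (bounded_rv_cst (2^-1 * D * b ^+ 2)) B4.
pose g3 := bounded_rvM (bounded_rv_cst (2^-1 * theta * (a * C + b * D))) B5.
have F4 := bounded_expectationD P g1 g2; have F5 := bounded_expectationB P (bounded_rvD g1 g2) g3.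
have lhs : \int[P]_w (z w * (u (X t w) - u (X s w))) =
    C * \int[P]_w (z w * (side_exp a 1 (X t w) - side_exp a 1 (X s w))) +
    D * \int[P]_w (z w * (side_exp b (-1) (X t w) - side_exp b (-1) (X s w))).
  apply: (etrans _ (etrans E3 (congr2 +%R E1 E2))).
  by apply: eq_Rintegral => w _; rewrite /u /cst; ring.
have rhs : \int[P]_w (z w * \int[leb]_(v in `[s, t]) (rate p q r (X v w) * u (X v w) - 1)) =
    2^-1 * C * a ^+ 2 * \int[P]_w (z w * \int[leb]_(v in `[s, t]) (ipos (X v w) * side_exp a 1 (X v w))) +
    2^-1 * D * b ^+ 2 * \int[P]_w (z w * \int[leb]_(v in `[s, t]) (ineg (X v w) * side_exp b (-1) (X v w))) -
    2^-1 * theta * (a * C + b * D) * \int[P]_w (z w * \int[leb]_(v in `[s, t]) i0 (X v w)).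
  apply: (etrans _ (etrans F5 (congr2 (fun x y => x - y) (etrans F4 (congr2 +%R F1 F2)) F3))).
  apply: eq_Rintegral => w _; rewrite /cst.
  have j1 := time_integrable (ind_joint a 1) (fun v w => @ind_norm a 1 v w a0) s t w.
  have j2 := time_integrable (ind_joint b (-1)) (fun v w => @ind_norm b (-1) v w b0) s t w.
  have j3 := time_integrable i0_joint i0_norm s t w.
  have k1 : leb.-integrable `[s, t] (EFin \o (fun v => 2^-1 * C * a ^+ 2 * (ipos (X v w) * side_exp a 1 (X v w)))).
    exact: (integrableZl _ _ j1).
  have k2 : leb.-integrable `[s, t] (EFin \o (fun v => 2^-1 * D * b ^+ 2 * (ineg (X v w) * side_exp b (-1) (X v w)))).
    exact: (integrableZl _ _ j2).
  have k3 : leb.-integrable `[s, t] (EFin \o (fun v => 2^-1 * theta * (a * C + b * D) * i0 (X v w))).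
    exact: (integrableZl _ _ j3).
  under eq_Rintegral do rewrite uE.
  rewrite RintegralB//; last exact: (integrableD _ k1 k2).
  by rewrite RintegralD// !RintegralZl//; ring.
by rewrite lhs rhs Ta Tb; exact: tanaka_arith.
Qed.

Lemma piecewise_constant_resolvent :
  (\int[leb]_(s in `[0%R, +oo[) (\int[P]_w discount X (rate p q r) s w)%:E =
   (\int[P]_w u (X 0 w))%:E)%E.
Proof.
have ne2 x : ne x ^+ 2 = ne x.
  by rewrite /ne indicE; case: (_ \in _); rewrite ?expr1n ?expr0n.
have mne : measurable_fun setT ne by apply: measurable_indic; exact: measurableC.
apply: (discounted_resolvent (m := Num.min p (Num.min q r)) (M := Num.max p (Num.max q r))
  (U := `|k| + `|C| + `|D|) (K := `|C| * a + `|D| * b) fF cX FX mX (joint_measurable_comp mne mX) (fun v w => ne2 (X v w)) dX) => //.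
- by rewrite !lt_min p0 q0 r0.
- exact: measurable_rate.
- by move=> x; apply: rate_ge; rewrite !ge_min lexx ?orbT.
- by move=> x; apply: rate_le; rewrite !le_max lexx ?orbT.
- move=> x; rewrite (le_trans (ler_normD _ _))// lerD//; first rewrite (le_trans (ler_normD _ _))// lerD2l.
    by rewrite normrM -[leRHS]mulr1 ler_wpM2l// side_exp_bounded.
  by rewrite normrM -[leRHS]mulr1 ler_wpM2l// side_exp_bounded.
- move=> x y; rewrite (_ : u x - u y = C * (side_exp a 1 x - side_exp a 1 y) + D * (side_exp b (-1) x - side_exp b (-1) y)).
    rewrite (le_trans (ler_normD _ _))// mulrDl lerD// normrM -mulrA ler_wpM2l//; exact: side_exp_lipschitz.
  by rewrite /u; ring.
- exact: side_generator.
Qed.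

End piecewise_constant_resolvent.

Lemma ae_eq_Rintegral d (T : measurableType d) (R : realType) (mu : {measure set T -> \bar R}) (f g : T -> R) :
  measurable_fun setT f -> measurable_fun setT g -> {ae mu, forall w, f w = g w} ->
  \int[mu]_w f w = \int[mu]_w g w.
Proof.
move=> mf mg fg; rewrite /Rintegral; congr fine; apply: ae_eq_integral => //.
- exact/measurable_EFinP.
- exact/measurable_EFinP.
- by apply: filterS fg => w -> _.
Qed.

Lemma ae_eq_integrable d (T : measurableType d) (R : realType) (mu : {measure set T -> \bar R}) (f g : T -> R) :
  measurable_fun setT f -> measurable_fun setT g -> {ae mu, forall w, f w = g w} ->
  mu.-integrable setT (EFin \o f) -> mu.-integrable setT (EFin \o g).
Proof.
move=> mf mg fg /integrableP[mf' fi]; apply/integrableP; split; first exact/measurable_EFinP.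
have -> : (\int[mu]_w `|(EFin \o g) w| = \int[mu]_w `|(EFin \o f) w|)%E; last exact: fi.
apply: ae_eq_integral => //.
- by apply: measurableT_comp => //; exact/measurable_EFinP.
- by apply: measurableT_comp => //; exact/measurable_EFinP.
- by apply: filterS fg => w /= -> _.
Qed.

(** * Weak solutions extended to negative times *)

Section extended_solution.
Context d (T : measurableType d) (R : realType).
Notation leb := (@lebesgue_measure R).
Variables (theta : R) (P : probability T R) (F : R -> set_system T) (X B : R -> T -> R).
Hypothesis hXB : sticky_weak_solution theta P F X B.

Definition extend (Y : R -> T -> R) (r : R) (w : T) : R := Y (Num.max r 0) w.

Let Xe := extend X.
Let ne : R -> R := \1_(~` [set 0]).

Let mxr (r : R) : 0 <= Num.max r 0. Proof. by rewrite le_max lexx orbT. Qed.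

Let mne : measurable_fun setT ne. Proof. by apply: measurable_indic; exact: measurableC. Qed.

Let ne2 x : ne x ^+ 2 = ne x.
Proof. by rewrite /ne indicE; case: (_ \in _); rewrite ?expr1n ?expr0n. Qed.

Lemma extend_continuous w : continuous (extend X ^~ w).
Proof. by case: hXB => _ _ [_ cX] _ _; exact: continuous_path_extend (cX w). Qed.

Lemma extend_Fmeas t : 0 <= t -> Fmeas F t (extend X t).
Proof.
case: hXB => fF _ [aX _] _ _ t0; apply/(FmeasP fF) => //.
by rewrite /extend (_ : (fun w => _) = X t); [exact: aX|apply/funext => w; rewrite max_l].
Qed.

Lemma extend_measurable r : measurable_fun setT (extend X r).
Proof.
case: hXB => fF _ [aX _] _ _; apply: (Fmeas_fun fF (mxr r)).
by apply/(FmeasP fF (_ : T -> R) (mxr r)); exact: aX.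
Qed.

Lemma extend_joint : joint_measurable (extend X).
Proof. exact: continuous_joint_measurable extend_measurable extend_continuous. Qed.

(** Almost surely the increments of X are those of the Ito integral, so the moments carry over; at
    nonnegative times the extended process is X itself. *)
Lemma extend_increments : diffusion_increments P F (extend X) (fun r w => ne (extend X r w)).
Proof.
case: (hXB) => fF bB [aX cX] [I iI XI] _ s t s0 st; have t0 := le_trans s0 st.
have mH : joint_measurable (fun r w => ne (extend X r w)) by exact: (joint_measurable_comp mne extend_joint).
have HE r w : 0 <= r -> ne (X r w) = ne (extend X r w) by move=> r0; rewrite /extend max_l.
have mI r : 0 <= r -> measurable_fun setT (I r) by move=> r0; case: iI => mI _ _; exact: mI.
have mDI : measurable_fun setT (fun w => I t w - I s w) by apply: measurable_funB; exact: mI.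
have mDX : measurable_fun setT (fun w => extend X t w - extend X s w).
  by apply: measurable_funB; exact: extend_measurable.
have DE : {ae P, forall w, I t w - I s w = extend X t w - extend X s w}.
  apply: filterS XI => w h.
  have Et : extend X t w = X t w by rewrite /extend max_l.
  have Es : extend X s w = X s w by rewrite /extend max_l.
  by rewrite Et Es (h t t0) (h s s0) opprD addrACA subrr add0r.
have [i4 e4] := ito_increment_fourth fF bB mH (fun r w => ne2 (extend X r w)) HE iI s0 st.
split.
- apply: (ae_eq_integrable _ _ _ i4); [exact: measurable_funX|exact: measurable_funX|].
  by apply: filterS DE => w ->.
- apply: le_trans e4; rewrite le_eqVlt; apply/orP; left; apply/eqP.
  apply: ae_eq_Rintegral; [exact: measurable_funX|exact: measurable_funX|].
  by apply: filterS DE => w ->.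
- move=> z M Fz zM; have mz := Fmeas_fun fF s0 Fz.
  rewrite -[RHS](ito_increment_mean fF bB mH (fun r w => ne2 (extend X r w)) HE iI s0 st Fz zM).
  apply: ae_eq_Rintegral; [exact: measurable_funM|exact: measurable_funM|].
  by apply: filterS DE => w ->.
- move=> z M Fz zM; have mz := Fmeas_fun fF s0 Fz.
  rewrite -[RHS](ito_increment_second fF bB mH (fun r w => ne2 (extend X r w)) HE iI s0 st Fz zM).
  apply: ae_eq_Rintegral; [apply: measurable_funM => //; exact: measurable_funX|apply: measurable_funM => //; exact: measurable_funX|].
  by apply: filterS DE => w ->.
Qed.

Lemma extend_time_integral (g : R -> R) (t : R) w :
  \int[leb]_(r in `[0, t]) g (X r w) = \int[leb]_(r in `[0, t]) g (extend X r w).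
Proof.
by apply: eq_Rintegral => r; rewrite inE/= in_itv/= => /andP[r0 _]; rewrite /extend max_l.
Qed.

(** Once the value u at 0 is prescribed, k + C + D = u and the two equations off 0 force C = u -
    1/p, D = u - 1/r and k = 1/p + 1/r - u. The equation at 0 then becomes the linear condition on
    u. *)
Lemma sticky_resolvent (p q r a b u : R) : 0 < theta -> {ae P, forall w, X 0 w = 0} ->
  0 < p -> 0 < q -> 0 < r -> 0 <= a -> 0 <= b -> a ^+ 2 = 2 * p -> b ^+ 2 = 2 * r ->
  2^-1 * theta * (a * (u - p^-1) + b * (u - r^-1)) + q * u = 1 ->
  (\int[leb]_(s in `[0%R, +oo[) (\int[P]_w expR (- \int[leb]_(v in `[0, s]) rate p q r (extend X v w)))%:E = u%:E)%E.
Proof.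
move=> theta0 X0 p0 q0 r0 a0 b0 a2 b2 uE; case: (hXB) => fF bB [aX cX] _ [L hL occ].
have occ' : {ae P, forall w, forall t, 0 <= t -> occupation_time (extend X) [set 0] t w = theta^-1 * L t w}.
  by apply: filterS occ => w h t t0; rewrite -h// /occupation_time -extend_time_integral.
have := @piecewise_constant_resolvent _ T R theta P F (extend X) L theta0 fF extend_continuous
  extend_Fmeas extend_joint extend_increments (local_time0_extend hL) occ' p q r a b
  (p^-1 + r^-1 - u) (u - p^-1) (u - r^-1) p0 q0 r0 a0 b0 a2 b2 _ _ _.
rewrite /discount => ->; last 3 first.
- by field; rewrite gt_eqF// gt_eqF.
- by field; rewrite gt_eqF// gt_eqF.
- by move: uE; lra.
congr EFin; rewrite -[RHS](Rintegral_prob_cst P); apply: ae_eq_Rintegral => //.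
  have mse e sg : measurable_fun setT (fun w => side_exp e sg (extend X 0 w)).
    apply: measurableT_comp (extend_measurable 0).
    by apply: continuous_measurable_fun; exact: continuous_side_exp.
  by apply: measurable_funD; [apply: measurable_funD => //|]; exact: measurable_funM.
apply: filterS X0 => w h; rewrite /extend maxxx h /side_exp !mulr0 maxxx !mulr0 oppr0 expR0.
by ring.
Qed.

End extended_solution.

Lemma tonelli_on d1 d2 (T1 : measurableType d1) (T2 : measurableType d2) (R : realType)
    (m1 : {sigma_finite_measure set T1 -> \bar R}) (m2 : {sigma_finite_measure set T2 -> \bar R})
    (D : set T1) (E : set T2) (f : T1 * T2 -> \bar R) : measurable D -> measurable E ->
  measurable_fun setT f -> (forall z, 0 <= f z)%E ->
  (\int[m1]_(x in D) \int[m2]_(y in E) f (x, y) = \int[m2]_(y in E) \int[m1]_(x in D) f (x, y))%E.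
Proof.
move=> mD mE mf f0; pose g := f \_ (D `*` E).
have mDE : measurable (D `*` E) by exact: measurableX.
have mg : measurable_fun setT g.
  by apply/(measurable_restrictT f mDE); exact: measurable_funTS.
have g0 z : (0 <= g z)%E by apply: erestrict_ge0.
have gx x : (fun y => g (x, y)) = (fun y => (if x \in D then f (x, y) else 0)%E) \_ E.
  apply/funext => y; rewrite /g !patchE; have [xD|xD] := boolP (x \in D); have [yE|yE] := boolP (y \in E).
  - by rewrite mem_set//; split; exact/set_mem.
  - by rewrite memNset// => -[_ /= yE']; rewrite mem_set in yE.
  - by rewrite memNset// => -[/= xD' _]; rewrite mem_set in xD.
  - by rewrite memNset// => -[/= xD' _]; rewrite mem_set in xD.
have gy y : (fun x => g (x, y)) = (fun x => (if y \in E then f (x, y) else 0)%E) \_ D.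
  apply/funext => x; rewrite /g !patchE; have [xD|xD] := boolP (x \in D); have [yE|yE] := boolP (y \in E).
  - by rewrite mem_set//; split; exact/set_mem.
  - by rewrite memNset// => -[_ /= yE']; rewrite mem_set in yE.
  - by rewrite memNset// => -[/= xD' _]; rewrite mem_set in xD.
  - by rewrite memNset// => -[/= xD' _]; rewrite mem_set in xD.
rewrite [LHS]integral_mkcond [RHS]integral_mkcond.
have -> : ((fun x => \int[m2]_(y in E) f (x, y)) \_ D = fun x => \int[m2]_y g (x, y))%E.
  apply/funext => x; rewrite patchE gx -integral_mkcond; case: ifPn => // _.
  by rewrite integral0.
have -> : ((fun y => \int[m1]_(x in D) f (x, y)) \_ E = fun y => \int[m1]_x g (x, y))%E.
  apply/funext => y; rewrite patchE gy -integral_mkcond; case: ifPn => // _.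
  by rewrite integral0.
exact: fubini_tonelli.
Qed.

(** * Laplace inversion *)

Section exponential_integrals.
Context (R : realType).
Notation leb := (@lebesgue_measure R).

Lemma integral_exp (l c : R) : 0 < l ->
  (\int[leb]_(x in `[c, +oo[) (l * expR (- (l * x)))%:E = (expR (- (l * c)))%:E)%E.
Proof.
move=> l0; pose f (x : R) := l * expR (- (l * x)); pose g (x : R) := - expR (- (l * x)).
have f0 x : c <= x -> 0 <= f x by move=> _; rewrite mulr_ge0 ?expR_ge0 ?ltW.
have dg x : is_derive x (1 : R) g (f x).
  have dl : is_derive x (1 : R) (fun x : R => - (l * x)) (- l).
    by apply: is_derive_eq; rewrite /GRing.scale/= mulr1.
  have := @is_derive1_comp _ (expR : R -> R) _ x _ _ (is_derive_expR _) dl.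
  by move=> h; apply: is_derive_eq; rewrite /f; ring.
have cf : continuous f.
  move=> x; apply: cvgM; first exact: cvg_cst.
  apply: continuous_comp; last exact: continuous_expR.
  by apply: cvgN; apply: cvgM; [exact: cvg_cst|exact: cvg_id].
have gl : g x @[x --> +oo] --> (0 : R).
  rewrite -[X in _ --> X]oppr0; apply: cvgN.
  rewrite (_ : (fun x => expR (- (l * x))) = (fun z => expR (- z)) \o (fun z => l * z))//.
  apply: (@cvg_comp _ _ _ _ _ _ (pinfty_nbhs R)); last exact: cvgr_expR.
  exact: gt0_cvgMry.
by rewrite -/(f _) (ge0_integral_is_derive f0 cf dg gl) /g sub0r opprK.
Qed.

Lemma integral_indicator_tail (f : R -> R) (c : R) : 0 <= c ->
  (\int[leb]_(x in `[0%R, +oo[) (f x * \1_(`[c, +oo[) x)%:E = \int[leb]_(x in `[c, +oo[) (f x)%:E)%E.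
Proof.
move=> c0; rewrite [LHS]integral_mkcond [RHS]integral_mkcond; apply: eq_integral => x _.
rewrite !patchE indicE; have [cx|cx] := boolP (x \in `[c, +oo[%classic).
  rewrite mulr1 mem_set//=; move: cx; rewrite inE/= !in_itv/= !andbT.
  exact: le_trans.
by rewrite mulr0; case: ifP.
Qed.

Lemma integral_exp_tail (l c : R) : 0 < l -> 0 <= c ->
  (\int[leb]_(x in `[0%R, +oo[) (l * expR (- (l * x)) * \1_(`[c, +oo[) x)%:E = (expR (- (l * c)))%:E)%E.
Proof. by move=> l0 c0; rewrite integral_indicator_tail// integral_exp. Qed.

Lemma measurable_expl (l : R) : measurable_fun setT (fun x : R => expR (- (l * x))).
Proof.
apply: measurableT_comp => //; apply: measurable_funN; exact: measurable_funM.
Qed.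

Lemma integrable_exp_bounded (l M : R) (h : R -> R) : 0 < l -> measurable_fun setT h ->
  (forall x, 0 <= x -> `|h x| <= M) ->
  leb.-integrable `[0, +oo[ (EFin \o (fun x => expR (- (l * x)) * h x)).
Proof.
move=> l0 mh hM.
have M0 : 0 <= M := le_trans (normr_ge0 _) (hM 0 (lexx 0)).
have ie : leb.-integrable `[0, +oo[ (fun x => (M * l^-1 * (l * expR (- (l * x))))%:E).
  apply: (@integrableZl _ _ _ leb _ _ (M / l) (fun x => (l * expR (- (l * x)))%:E)) => //.
  apply/integrableP; split.
    by apply/measurable_EFinP; apply: measurable_funTS; apply: measurable_funM => //; exact: measurable_expl.
  under eq_integral do rewrite gee0_abs ?lee_fin ?mulr_ge0 ?expR_ge0 ?(ltW l0)//.
  by rewrite integral_exp// ltry.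
apply: le_integrable ie => //.
  by apply/measurable_EFinP; apply: measurable_funTS; apply: measurable_funM => //; exact: measurable_expl.
move=> x; rewrite /= in_itv/= andbT => x0; rewrite lee_fin normrM.
rewrite (_ : M * l^-1 * _ = M * expR (- (l * x))); last by field; rewrite gt_eqF.
rewrite (ger0_norm (expR_ge0 _)) [leRHS]ger0_norm ?mulr_ge0 ?expR_ge0// mulrC.
by apply: ler_wpM2r; [exact: expR_ge0|exact: hM].
Qed.

Lemma half_line_integrableZ (k : R) (h : R -> R) : leb.-integrable `[0, +oo[ (EFin \o h) ->
  leb.-integrable `[0, +oo[ (EFin \o (fun x => k * h x)).
Proof. by move=> ih; exact: (integrableZl _ k ih). Qed.

End exponential_integrals.

Section laplace_uniqueness.
Context (R : realType).
Notation leb := (@lebesgue_measure R).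
Implicit Types (h f g : R -> R).

(* The kernels [(1 - (e^-x - y0)^2)^n] concentrate at the point where [e^-x = y0]
   and are linear combinations of the functions [e^-kx]. *)
Lemma landau_kernel_zero h (M y0 : R) : measurable_fun setT h -> (forall x, 0 <= x -> `|h x| <= M) ->
  (forall k : nat, \int[leb]_(x in `[0, +oo[) (expR (- (k.+1%:R * x)) * h x) = 0) ->
  forall n k : nat, \int[leb]_(x in `[0, +oo[)
    (expR (- (k.+1%:R * x)) * ((1 - (expR (- x) - y0) ^+ 2) ^+ n * h x)) = 0.
Proof.
move=> mh hM h0; pose q (x : R) : R := 1 - (expR (- x) - y0) ^+ 2.
have mq : measurable_fun setT q.
  apply: measurable_funB => //; apply: measurable_funX; apply: measurable_funB => //.
  by apply: measurableT_comp => //; exact: measurable_funN.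
have qb x : 0 <= x -> `|q x| <= 1 + (1 + `|y0|) ^+ 2.
  move=> x0; rewrite (le_trans (ler_normB _ _))// normr1 lerD2l normrX lerXn2r ?nnegrE ?addr_ge0//.
  by rewrite (le_trans (ler_normB _ _))// lerD2r ger0_norm ?expR_ge0// -expR0 ler_expR oppr_le0.
have ik n k : leb.-integrable `[0, +oo[ (EFin \o (fun x => expR (- (k.+1%:R * x)) * (q x ^+ n * h x))).
  apply: (integrable_exp_bounded (M := (1 + (1 + `|y0|) ^+ 2) ^+ n * M)); first by rewrite ltr0n.
    by apply: measurable_funM => //; exact: measurable_funX.
  move=> x x0; rewrite normrM ler_pM// ?hM// normrX lerXn2r ?nnegrE ?qb// addr_ge0// sqr_ge0//.
elim=> [|n IH] k; first by under eq_Rintegral do rewrite expr0 mul1r; exact: h0.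
have E x : expR (- (k.+1%:R * x)) * (q x ^+ n.+1 * h x) =
    (1 - y0 ^+ 2) * (expR (- (k.+1%:R * x)) * (q x ^+ n * h x)) +
    (2 * y0) * (expR (- (k.+2%:R * x)) * (q x ^+ n * h x)) - expR (- (k.+3%:R * x)) * (q x ^+ n * h x).
  have -> : expR (- (k.+2%:R * x)) = expR (- (k.+1%:R * x)) * expR (- x).
    by rewrite -expRD -[k.+2%:R]natr1; congr expR; ring.
  have -> : expR (- (k.+3%:R * x)) = expR (- (k.+1%:R * x)) * expR (- x) * expR (- x).
    by rewrite -!expRD -[k.+3%:R]natr1 -[k.+2%:R]natr1; congr expR; ring.
  by rewrite exprS {1}/q; ring.
under eq_Rintegral do rewrite -/(q _) E.
have j1 := half_line_integrableZ (1 - y0 ^+ 2) (ik n k).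
have j2 := half_line_integrableZ (2 * y0) (ik n k.+1).
rewrite RintegralB//; last exact: (integrableD _ j1 j2).
rewrite RintegralD// !RintegralZl//.
by rewrite !IH !mulr0 addr0 subrr.
Qed.

(** Suppose kappa > 0 and centre the kernel q^n at the midpoint c. On [c, d2], inside [a, b], it is
    at least r1^n, and outside [a, b] at most r2^n with r2 < r1, while h >= 0 on [a, b]. Since the
    integral of the kernel against h is 0, kappa I r1^n <= M r2^n for every n, and dividing by r1^n
    gives a contradiction in the limit. *)
Lemma laplace_not_positive h (M a b kappa : R) : measurable_fun setT h -> (forall x, 0 <= x -> `|h x| <= M) ->
  (forall k : nat, \int[leb]_(x in `[0, +oo[) (expR (- (k.+1%:R * x)) * h x) = 0) ->
  0 <= a -> a < b -> (forall x, a <= x -> x <= b -> kappa <= h x) -> kappa <= 0.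
Proof.
move=> mh hM h0 a0 ab hk; rewrite leNgt; apply/negP => k0.
pose c := (a + b) / 2; have ac : a < c by rewrite /c; lra.
have cb : c < b by rewrite /c; lra.
pose e (x : R) := expR (- x); pose y0 := e c.
have ea : y0 < e a by rewrite ltr_expR ltrN2.
have eb : e b < y0 by rewrite ltr_expR ltrN2.
have e1 x : 0 <= x -> e x <= 1 by move=> x0; rewrite -expR0 ler_expR oppr_le0.
have e0 x : 0 < e x := expR_gt0 _.
(* In the variable e^(-x), every point outside [a, b] is at distance at least [dl] from y0. *)
pose dl := Num.min (y0 - e b) (e a - y0).
have dl0 : 0 < dl by rewrite lt_min !subr_gt0 ea eb.
have dl1 : dl < 1.
  rewrite gt_min; apply/orP; right; have := e1 a a0; have := e0 c; rewrite -/y0; lra.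
have dlc : dl <= b - c.
  rewrite ge_min; apply/orP; left.
  have := @expRN_lipschitz R c b (le_trans a0 (ltW ac)) (le_trans a0 (ltW ab)).
  rewrite -/(e c) -/(e b) -/y0 ger0_norm ?subr_ge0 ?(ltW eb)// => /le_trans; apply.
  by rewrite ler0_norm ?opprB// subr_le0 ltW.
pose r1 := 1 - (dl / 2) ^+ 2; pose r2 := 1 - dl ^+ 2.
have r2p : 0 < r2 by rewrite /r2 subr_gt0 expr_lt1// ltW.
have r12 : r2 < r1 by rewrite /r1 /r2; nra.
pose q x := 1 - (e x - y0) ^+ 2.
have M0 : 0 <= M := le_trans (normr_ge0 _) (hM 0 (lexx 0)).
have q0 x : 0 <= x -> 0 <= q x.
  move=> x0; rewrite /q subr_ge0 -real_normK ?num_real// expr_le1// ler_norml.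
  by have := e1 x x0; have := e0 x; have := e1 c (le_trans a0 (ltW ac)); rewrite -/y0; have := e0 c; rewrite -/y0 => *; apply/andP; split; lra.
(* The map e^(-x) is 1-Lipschitz on the half-line, so on [c, d2] it stays within dl / 2 of y0; and
   d2 <= b because dl <= b - c. *)
pose d2 := c + dl / 2.
have low n x : 0 <= x -> kappa * r1 ^+ n * \1_(`[c, d2]) x - M * r2 ^+ n <= q x ^+ n * h x.
  move=> x0; have qn := exprn_ge0 n (q0 x x0).
  have r1n : 0 <= r1 ^+ n by rewrite exprn_ge0// ltW// (lt_trans r2p).
  have r2n : 0 <= r2 ^+ n by rewrite exprn_ge0// ltW.
  have [xab|xab] := boolP (a <= x <= b).
    move/andP: xab => [ax xb]; have hx := hk x ax xb; have hx0 : 0 <= h x := le_trans (ltW k0) hx.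
    rewrite indicE; have [xc|xc] := boolP (x \in `[c, d2]%classic); last first.
      by rewrite mulr0 sub0r (@le_trans _ _ 0) ?mulr_ge0// oppr_le0 mulr_ge0.
    rewrite mulr1 lerBlDr; apply: (@le_trans _ _ (q x ^+ n * h x)); last by rewrite lerDl mulr_ge0.
    rewrite mulrC ler_pM ?(ltW k0)// lerXn2r ?nnegrE ?q0// ?(ltW (lt_trans r2p r12))//.
    rewrite /r1 /q lerD2l lerN2 -real_normK ?num_real// lerXn2r ?nnegrE ?divr_ge0 ?(ltW dl0)//.
    move: xc; rewrite inE/= in_itv/= => /andP[cx xd].
    apply: le_trans (expRN_lipschitz x0 (le_trans a0 (ltW ac))) _.
    by rewrite ger0_norm ?subr_ge0// lerBlDl.
  have -> : \1_(`[c, d2]) x = 0 :> R.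
    rewrite indicE memNset//= in_itv/= => /andP[cx xd]; move: xab; rewrite (le_trans (ltW ac) cx)/=.
    by apply/negP; rewrite negbK; apply: le_trans xd _; rewrite /d2; lra.
  rewrite mulr0 sub0r lerNl -mulrN.
  apply: (@le_trans _ _ (q x ^+ n * M)).
    by rewrite ler_wpM2l//; have := hM x x0; rewrite ler_norml => /andP[h1 _]; rewrite lerNl.
  rewrite mulrC ler_wpM2l// lerXn2r ?nnegrE ?q0 ?(ltW r2p)// /q /r2 lerD2l lerN2.
  rewrite -[leRHS]real_normK ?num_real// lerXn2r ?nnegrE ?(ltW dl0)//.
  have [ax|xa] := leP a x.
    have bx : b < x by rewrite ltNge; apply: contra xab => xb; rewrite ax.
    have ebx : e x < e b by rewrite ltr_expR ltrN2.
    rewrite ltr0_norm; last by rewrite subr_lt0 (lt_trans ebx).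
    by rewrite ge_min; apply/orP; left; lra.
  have eax : e a < e x by rewrite ltr_expR ltrN2.
  rewrite gtr0_norm; last by rewrite subr_gt0 (lt_trans ea).
  by rewrite ge_min; apply/orP; right; lra.
have mJ : measurable_fun setT (\1_(`[c, d2]) : R -> R) by exact: measurable_indic.
have J1 x : `|\1_(`[c, d2]) x : R| <= 1 by rewrite indicE; case: (_ \in _); rewrite ?normr1 ?normr0.
have iJ : leb.-integrable `[0, +oo[ (EFin \o (fun x => expR (- (1 * x)) * \1_(`[c, d2]) x)).
  exact: (integrable_exp_bounded (M := 1)).
have i1 : leb.-integrable `[0, +oo[ (EFin \o (fun x => expR (- (1 * x)) * 1)).
  by apply: (integrable_exp_bounded (M := 1)) => // x _; rewrite normr1.
pose I := \int[leb]_(x in `[0, +oo[) (expR (- (1 * x)) * \1_(`[c, d2]) x).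
have I1 : \int[leb]_(x in `[0, +oo[) (expR (- (1 * x)) * 1) = 1.
  rewrite /Rintegral; have := integral_exp 0 (@ltr01 R); rewrite mulr0 oppr0 expR0 => h1.
  by under eq_integral do rewrite mulrC; rewrite h1.
have I0 : 0 < I.
  have cd : c < d2 by rewrite /d2; lra.
  apply: (@lt_le_trans _ _ (e d2 * (d2 - c))); first by rewrite mulr_gt0 ?subr_gt0.
  rewrite -(fine_lebesgue_itvcc (ltW cd)) -Rintegral_cst//.
  have -> : I = \int[leb]_(x in `[c, d2]) expR (- (1 * x)).
    rewrite /I /Rintegral; congr fine; rewrite [LHS]integral_mkcond [RHS]integral_mkcond.
    apply: eq_integral => x _; rewrite !patchE indicE; have [xc|xc] := boolP (x \in `[c, d2]%classic).
      rewrite mulr1 mem_set//=; move: xc; rewrite inE/= !in_itv/= andbT => /andP[cx _].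
      exact: le_trans (le_trans a0 (ltW ac)) cx.
    by rewrite mulr0; case: ifP.
  apply: le_Rintegral => //.
  - by apply: (bounded_integrable _ (lebesgue_itvcc_lty c d2) (M := e d2)) => // x _; rewrite gtr0_norm.
  - apply: (bounded_integrable _ (lebesgue_itvcc_lty c d2) (M := 1)) => //.
      by apply: measurable_funTS; exact: measurable_expl.
    move=> x; rewrite /= in_itv/= => /andP[cx _]; rewrite gtr0_norm ?expR_gt0// mul1r e1//.
    exact: le_trans (le_trans a0 (ltW ac)) cx.
  - by move=> x; rewrite /= in_itv/= => /andP[_ xd]; rewrite mul1r ler_expR lerN2.
have key n : kappa * I * r1 ^+ n <= M * r2 ^+ n.
  have Z := landau_kernel_zero y0 mh hM h0 n 0.
  have mq : measurable_fun setT q.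
    apply: measurable_funB => //; apply: measurable_funX; apply: measurable_funB => //.
    by apply: measurableT_comp => //; exact: measurable_funN.
  have iq : leb.-integrable `[0, +oo[ (EFin \o (fun x => expR (- (1 * x)) * (q x ^+ n * h x))).
    apply: (integrable_exp_bounded (M := M)) => //.
      by apply: measurable_funM => //; exact: measurable_funX.
    move=> x x0; rewrite normrM -[leRHS]mul1r ler_pM ?hM//.
    by rewrite ger0_norm ?exprn_ge0 ?q0// exprn_ile1 ?q0// /q gerBl sqr_ge0.
  have iZ1 := half_line_integrableZ (kappa * r1 ^+ n) iJ.
  have iZ2 := half_line_integrableZ (M * r2 ^+ n) i1.
  have : \int[leb]_(x in `[0, +oo[) (kappa * r1 ^+ n * (expR (- (1 * x)) * \1_(`[c, d2]) x) -
      M * r2 ^+ n * (expR (- (1 * x)) * 1)) <= \int[leb]_(x in `[0, +oo[) (expR (- (1 * x)) * (q x ^+ n * h x)).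
    apply: le_Rintegral => //; first exact: (integrableB _ iZ1 iZ2).
    move=> x; rewrite /= in_itv/= andbT => x0; have := ler_wpM2l (expR_ge0 (- (1 * x))) (low n x x0).
    by apply: le_trans; rewrite le_eqVlt; apply/orP; left; apply/eqP; ring.
  rewrite Z RintegralB// !RintegralZl// I1 mulr1 -/I subr_le0.
  by rewrite mulrAC.
have r1p := lt_trans r2p r12.
have : kappa * I <= 0.
  have cv : (M * (r2 / r1) ^+ n) @[n --> \oo] --> (0 : R).
    rewrite -[X in _ --> X](mulr0 M); apply: cvgM; first exact: cvg_cst.
    by apply: cvg_expr; rewrite gtr0_norm ?divr_gt0// ltr_pdivrMr// mul1r.
  apply: (cvgr_to_ge cv); apply: nearW => n; rewrite expr_div_n mulrA ler_pdivlMr ?exprn_gt0//.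
by rewrite leNgt mulr_gt0.
Qed.

(** Monotonicity of [f] propagates a strict inequality at x0 to an interval: to the right of x0 if f
    x0 > g x0, to the left if f x0 < g x0, with [g] nearly constant there by continuity.
    [laplace_not_positive] excludes both. *)
Lemma laplace_inj f g (M x0 : R) : 0 < x0 -> measurable_fun setT f -> measurable_fun setT g ->
  (forall x, 0 <= x -> `|f x| <= M) -> (forall x, 0 <= x -> `|g x| <= M) ->
  (forall x y, 0 <= x -> x <= y -> f x <= f y) -> {for x0, continuous g} ->
  (forall k : nat, \int[leb]_(x in `[0, +oo[) (expR (- (k.+1%:R * x)) * f x) =
                   \int[leb]_(x in `[0, +oo[) (expR (- (k.+1%:R * x)) * g x)) ->
  f x0 = g x0.
Proof.
move=> x00 mf mg fM gM fnd cg fg.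
have ikf (k : nat) := integrable_exp_bounded (ltr0n R k.+1) mf fM.
have ikg (k : nat) := integrable_exp_bounded (ltr0n R k.+1) mg gM.
have near_g e : 0 < e -> exists2 dl, 0 < dl & forall x, `|x0 - x| < dl -> `|g x0 - g x| < e.
  move=> e0; have /cvgrPdist_lt/(_ _ e0) := cg.
  by move=> /nbhs_ballP[dl /= dl0 h]; exists dl => // x hx; exact: h.
apply/eqP; rewrite eq_le; apply/andP; split.
- rewrite -subr_le0 leNgt; apply/negP => k0.
  have [dl dl0 hdl] := near_g ((f x0 - g x0) / 2) (divr_gt0 k0 (ltr0Sn R 1)).
  have : (f x0 - g x0) / 2 <= 0; last by rewrite leNgt divr_gt0.
  apply: (@laplace_not_positive (fun x => f x - g x) (M + M) x0 (x0 + dl / 2)).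
  + exact: measurable_funB.
  + by move=> x x0'; rewrite (le_trans (ler_normB _ _))// lerD// ?fM ?gM.
  + move=> k; under eq_Rintegral do rewrite mulrBr.
    by rewrite RintegralB// fg subrr.
  + exact: ltW.
  + by rewrite ltrDl divr_gt0.
  + move=> x xx xd; have h1 := fnd _ _ (ltW x00) xx.
    have := hdl x; rewrite ler0_norm ?subr_le0// opprB ltr_norml => /(_ _)/andP[]; first lra.
    lra.
- rewrite -subr_le0 leNgt; apply/negP => k0.
  have [dl dl0 hdl] := near_g ((g x0 - f x0) / 2) (divr_gt0 k0 (ltr0Sn R 1)).
  have : (g x0 - f x0) / 2 <= 0; last by rewrite leNgt divr_gt0.
  pose m := Num.min dl x0; have m0 : 0 < m by rewrite lt_min dl0.
  have md : m <= dl by rewrite ge_min lexx.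
  have mx : m <= x0 by rewrite ge_min lexx orbT.
  apply: (@laplace_not_positive (fun x => g x - f x) (M + M) (x0 - m / 2) x0).
  + exact: measurable_funB.
  + by move=> x x0'; rewrite (le_trans (ler_normB _ _))// lerD// ?fM ?gM.
  + move=> k; under eq_Rintegral do rewrite mulrBr.
    by rewrite RintegralB// fg subrr.
  + lra.
  + by rewrite ltrBlDr ltrDl divr_gt0.
  + move=> x xx xd; have h1 : f x <= f x0 by apply: fnd => //; lra.
    have := hdl x; rewrite ger0_norm ?subr_ge0// ltr_norml => /(_ _)/andP[]; first lra.
    lra.
Qed.

End laplace_uniqueness.

Lemma Rintegral_EFin d (T : measurableType d) (R : realType) (mu : {measure set T -> \bar R}) (D : set T)
    (f : T -> R) : measurable D -> mu.-integrable D (EFin \o f) ->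
  ((\int[mu]_(x in D) f x)%:E = \int[mu]_(x in D) (f x)%:E)%E.
Proof. by move=> mD fi; rewrite /Rintegral fineK//; exact: integrable_fin_num. Qed.

Section laplace_inversion.
Context (R : realType).
Notation leb := (@lebesgue_measure R).
Implicit Types f g : R -> R.

Lemma laplace_normalize (l M : R) f : 0 < l -> measurable_fun setT f -> (forall x, 0 <= x -> `|f x| <= M) ->
  (\int[leb]_(x in `[0%R, +oo[) (l * expR (- (l * x)) * f x)%:E =
   (l * \int[leb]_(x in `[0, +oo[) (expR (- (l * x)) * f x))%:E)%E.
Proof.
move=> l0 mf fM; have fi := integrable_exp_bounded l0 mf fM.
rewrite -RintegralZl// Rintegral_EFin//; last exact: half_line_integrableZ.
by apply: eq_integral => x _; rewrite mulrA.
Qed.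

Lemma laplace_inversion f g (M x0 : R) : 0 < x0 -> measurable_fun setT f -> measurable_fun setT g ->
  (forall x, 0 <= x -> `|f x| <= M) -> (forall x, 0 <= x -> `|g x| <= M) ->
  (forall x y, 0 <= x -> x <= y -> f x <= f y) -> {for x0, continuous g} ->
  (forall k : nat, \int[leb]_(x in `[0%R, +oo[) (k.+1%:R * expR (- (k.+1%:R * x)) * f x)%:E =
                   \int[leb]_(x in `[0%R, +oo[) (k.+1%:R * expR (- (k.+1%:R * x)) * g x)%:E)%E ->
  f x0 = g x0.
Proof.
move=> x00 mf mg fM gM fnd cg fg; apply: (@laplace_inj R f g M) => // k.
have k0 : 0 < k.+1%:R :> R by [].
have := fg k; rewrite (laplace_normalize k0 mf fM) (laplace_normalize k0 mg gM) => -[].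
by apply: mulfI; rewrite gt_eqF.
Qed.

Lemma laplace_inversion_nonincreasing f g (M x0 : R) : 0 < x0 -> measurable_fun setT f -> measurable_fun setT g ->
  (forall x, 0 <= x -> `|f x| <= M) -> (forall x, 0 <= x -> `|g x| <= M) ->
  (forall x y, 0 <= x -> x <= y -> f y <= f x) -> {for x0, continuous g} ->
  (forall k : nat, \int[leb]_(x in `[0%R, +oo[) (k.+1%:R * expR (- (k.+1%:R * x)) * f x)%:E =
                   \int[leb]_(x in `[0%R, +oo[) (k.+1%:R * expR (- (k.+1%:R * x)) * g x)%:E)%E ->
  f x0 = g x0.
Proof.
move=> x00 mf mg fM gM fnd cg fg; apply: oppr_inj.
have mf' : measurable_fun setT (fun x => - f x) by exact: measurable_funN.
have mg' : measurable_fun setT (fun x => - g x) by exact: measurable_funN.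
have fM' x : 0 <= x -> `|- f x| <= M by move=> x0'; rewrite normrN fM.
have gM' x : 0 <= x -> `|- g x| <= M by move=> x0'; rewrite normrN gM.
apply: (@laplace_inversion (fun x => - f x) (fun x => - g x) M) => //.
- by move=> x y x0' xy; rewrite lerN2 fnd.
- exact: cvgN.
move=> k; have k0 : 0 < k.+1%:R :> R by [].
have := fg k; rewrite (laplace_normalize k0 mf fM) (laplace_normalize k0 mg gM).
rewrite (laplace_normalize k0 mf' fM') (laplace_normalize k0 mg' gM') => -[h].
congr EFin; congr (_ * _); have {}h : \int[leb]_(x in `[0, +oo[) (expR (- (k.+1%:R * x)) * f x) =
    \int[leb]_(x in `[0, +oo[) (expR (- (k.+1%:R * x)) * g x) by apply: mulfI h; rewrite gt_eqF.
have oppE (q : R -> R) : measurable_fun setT q -> (forall x : R, 0 <= x -> `|q x| <= M) ->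
    \int[leb]_(x in `[0, +oo[) (expR (- (k.+1%:R * x)) * - q x) = - 1 * \int[leb]_(x in `[0, +oo[) (expR (- (k.+1%:R * x)) * q x).
  move=> mq qM; rewrite -RintegralZl//; last exact: (integrable_exp_bounded k0 mq qM).
  by apply: eq_Rintegral => x _; ring.
by rewrite !oppE// h.
Qed.

End laplace_inversion.

(** * Distribution functions at an exponential time *)

Section exponential_time.
Context d (T : measurableType d) (R : realType).
Notation leb := (@lebesgue_measure R).
Variables (P : probability T R) (Y : R -> T -> R).
Hypotheses (mY : joint_measurable Y) (Y0 : forall s w, 0 <= s -> 0 <= Y s w).

(** The probability that Y s <= t. The indicator is taken as a function of t, so that its Laplace
    transform in t is the integral of an exponential tail. *)
Definition marginal_cdf (s t : R) : R := \int[P]_w \1_(`[Y s w, +oo[) t.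

Let ind_joint t : joint_measurable (fun s w => \1_(`[Y s w, +oo[) t : R).
Proof.
rewrite (_ : (fun s w => _) = (fun s w => \1_(`]-oo, t]) (Y s w))).
  by apply: (joint_measurable_comp _ mY); exact: measurable_indic.
apply/funext => s; apply/funext => w; rewrite !indicE; congr (_%:R).
by congr nat_of_bool; apply/idP/idP; rewrite !inE/= !in_itv/= andbT.
Qed.

Let ind01 s w t : 0 <= (\1_(`[Y s w, +oo[) t : R) <= 1.
Proof. by rewrite indicE; case: (_ \in _); rewrite ?lexx ler01. Qed.

Let ind_norm s w t : `|\1_(`[Y s w, +oo[) t : R| <= 1.
Proof. by have /andP[h0 h1] := ind01 s w t; rewrite ger0_norm. Qed.

Let ind_rv s t : bounded_rv (fun w => \1_(`[Y s w, +oo[) t : R).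
Proof. by split; [exact: (joint_measurable_sec2 s (ind_joint t))|exists 1 => w; exact: ind_norm]. Qed.

Lemma cdf_ge0 s t : 0 <= marginal_cdf s t.
Proof. by apply: Rintegral_ge0 => w _; have /andP[] := ind01 s w t. Qed.

Lemma cdf_norm s t : `|marginal_cdf s t| <= 1.
Proof. by apply: expectation_bound => [|w]; [exact: (joint_measurable_sec2 s (ind_joint t))|exact: ind_norm]. Qed.

Lemma measurable_cdf t : measurable_fun setT (marginal_cdf ^~ t).
Proof. exact: (expectation_measurable (ind_joint t) (fun s w => ind_norm s w t)). Qed.

Lemma cdf_nondecreasing s t t' : t <= t' -> marginal_cdf s t <= marginal_cdf s t'.
Proof.
move=> tt; apply: expectation_ler => // w; rewrite !indicE.
have [h|h] := boolP (t \in `[Y s w, +oo[%classic); last by rewrite ler0n.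
rewrite mem_set//=; move: h; rewrite inE/= !in_itv/= !andbT => h; exact: le_trans h tt.
Qed.

Lemma cdf_nonincreasing s s' t : (forall w, Y s w <= Y s' w) -> marginal_cdf s' t <= marginal_cdf s t.
Proof.
move=> ss; apply: expectation_ler => // w; rewrite !indicE.
have [h|h] := boolP (t \in `[Y s' w, +oo[%classic); last by rewrite ler0n.
have -> : t \in `[Y s w, +oo[%classic = true; last by [].
apply/mem_set => /=; move: h; rewrite inE/= !in_itv/= !andbT; exact: le_trans (ss w).
Qed.

Lemma probability_gt s t : P [set w | t < Y s w] = (1 - marginal_cdf s t)%:E.
Proof.
have mA : measurable [set w | Y s w <= t].
  rewrite (_ : [set w | _] = Y s @^-1` `]-oo, t]).
    by rewrite -[X in measurable X]setTI; exact: (joint_measurable_sec2 s mY).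
  by apply/seteqP; split => w /=; rewrite in_itv.
have E : (marginal_cdf s t)%:E = P [set w | Y s w <= t].
  rewrite /marginal_cdf Rintegral_EFin//; last exact: bounded_rv_integrable.
  transitivity (\int[P]_w (\1_[set w | Y s w <= t] w)%:E)%E; last by rewrite integral_indic// setIT.
  apply: eq_integral => w _; congr EFin.
  rewrite !indicE; congr (_%:R); congr nat_of_bool.
  by apply/idP/idP; rewrite !inE/= in_itv/= andbT.
have -> : [set w | t < Y s w] = ~` [set w | Y s w <= t].
  by apply/seteqP; split => w /=; [move=> h; apply/negP; rewrite -ltNge|move/negP; rewrite -ltNge].
by rewrite probability_setC// -E EFinB.
Qed.

Section rate.
Variable l : R.
Hypothesis l0 : 0 < l.

(** The distribution function of Y at an independent exponential time of rate l. *)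
Definition exp_cdf (t : R) : R := \int[leb]_(s in `[0, +oo[) (l * expR (- (l * s)) * marginal_cdf s t).

Let exp_cdf_integrable t : leb.-integrable `[0, +oo[ (EFin \o (fun s => l * expR (- (l * s)) * marginal_cdf s t)).
Proof.
have i1 := integrable_exp_bounded l0 (measurable_cdf t) (fun s _ => cdf_norm s t).
by apply: eq_integrable (half_line_integrableZ l i1) => // s _; rewrite /= mulrA.
Qed.

Lemma exp_cdfE t : ((exp_cdf t)%:E = \int[leb]_(s in `[0%R, +oo[) (l * expR (- (l * s)) * marginal_cdf s t)%:E)%E.
Proof. by rewrite /exp_cdf Rintegral_EFin//; exact: exp_cdf_integrable. Qed.

Lemma exp_cdf_nondecreasing t t' : t <= t' -> exp_cdf t <= exp_cdf t'.
Proof.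
move=> tt; apply: le_Rintegral => // s _; rewrite ler_wpM2l ?mulr_ge0 ?expR_ge0 ?(ltW l0)//.
exact: cdf_nondecreasing.
Qed.

Lemma measurable_exp_cdf : measurable_fun setT exp_cdf.
Proof. exact: (nondecreasing_measurable measurableT exp_cdf_nondecreasing). Qed.

Lemma exp_cdf_norm t : `|exp_cdf t| <= 1.
Proof.
rewrite ger0_norm; last by apply: Rintegral_ge0 => s _; rewrite mulr_ge0 ?cdf_ge0// mulr_ge0 ?expR_ge0 ?ltW.
rewrite -lee_fin exp_cdfE; have := integral_exp 0 l0; rewrite mulr0 oppr0 expR0 => <-.
apply: ge0_le_integral => //.
- by move=> s _; rewrite lee_fin mulr_ge0 ?cdf_ge0// mulr_ge0 ?expR_ge0 ?ltW.
- apply/measurable_EFinP; apply: measurable_funTS; apply: measurable_funM; last exact: measurable_cdf.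
  by apply: measurable_funM => //; exact: measurable_expl.
- by apply/measurable_EFinP; apply: measurable_funTS; apply: measurable_funM => //; exact: measurable_expl.
- move=> s _; rewrite lee_fin -[leRHS]mulr1 ler_wpM2l ?mulr_ge0 ?expR_ge0 ?(ltW l0)//.
  by have := cdf_norm s t; rewrite ger0_norm ?cdf_ge0.
Qed.

(** Tonelli moves the integral in t inside, where the indicator of t >= Y s integrates the
    exponential density to e^(-a Y_s). *)
Lemma exp_cdf_laplace (a : R) : 0 < a ->
  (\int[leb]_(t in `[0%R, +oo[) (a * expR (- (a * t)) * exp_cdf t)%:E =
   \int[leb]_(s in `[0%R, +oo[) (l * expR (- (l * s)) * \int[P]_w expR (- (a * Y s w)))%:E)%E.
Proof.
move=> a0; pose k (z : R * R * T) : \bar R := (\1_(`[Y z.1.2 z.2, +oo[) z.1.1)%:E.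
have mk : measurable_fun setT k.
  apply/measurable_EFinP; rewrite (_ : (fun z => _) = (fun z : R * R * T => \1_(`[0, +oo[) (z.1.1 - Y z.1.2 z.2))).
    apply: (measurableT_comp (_ : measurable_fun setT (\1_(`[0, +oo[) : R -> R))); first exact: measurable_indic.
    apply: measurable_funB; first exact: (measurableT_comp measurable_fst measurable_fst).
    apply: (measurableT_comp mY (g := fun z : R * R * T => (z.1.2, z.2))).
    by apply: measurable_fun_pair => //; exact: (measurableT_comp measurable_snd measurable_fst).
  apply/funext => z; rewrite !indicE; congr (_%:R); congr nat_of_bool.
  by apply/idP/idP; rewrite !inE/= !in_itv/= !andbT subr_ge0.
have k0 z : (0 <= k z)%E by rewrite lee_fin; have /andP[] := ind01 z.1.2 z.2 z.1.1.
have cdfE s t : (marginal_cdf s t)%:E = (\int[P]_w k ((t, s), w))%E.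
  by rewrite /marginal_cdf Rintegral_EFin//; exact: bounded_rv_integrable.
pose f (z : R * R) : \bar R := ((a * expR (- (a * z.1)) * (l * expR (- (l * z.2))))%:E * fubini_F P k z)%E.
have mf : measurable_fun setT f.
  apply: emeasurable_funM; last exact: (measurable_fun_fubini_tonelli_F (m2 := P) k mk k0).
  apply/measurable_EFinP; apply: measurable_funM; apply: measurable_funM => //.
    exact: (measurableT_comp (measurable_expl a) measurable_fst).
  exact: (measurableT_comp (measurable_expl l) measurable_snd).
have e0 (u v : R) : 0 <= a * expR (- (a * u)) * (l * expR (- (l * v))).
  by rewrite !mulr_ge0 ?expR_ge0// ltW.
have f0 z : (0 <= f z)%E by rewrite mule_ge0 ?lee_fin//; exact: integral_ge0.
transitivity (\int[leb]_(t in `[0%R, +oo[) \int[leb]_(s in `[0%R, +oo[) f (t, s))%E.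
  apply: eq_integral => t _; rewrite EFinM exp_cdfE -ge0_integralZl//; last 3 first.
  - apply/measurable_EFinP; apply: measurable_funTS; apply: measurable_funM; last exact: measurable_cdf.
    by apply: measurable_funM => //; exact: measurable_expl.
  - by move=> s _; rewrite lee_fin mulr_ge0 ?cdf_ge0// mulr_ge0 ?expR_ge0 ?ltW.
  - by rewrite lee_fin mulr_ge0 ?expR_ge0 ?ltW.
  apply: eq_integral => s _; rewrite /f /fubini_F -cdfE -!EFinM; congr EFin; by rewrite /= !mulrA.
rewrite tonelli_on//; apply: eq_integral => s; rewrite inE/= in_itv/= andbT => s0.
pose f2 (z : R * T) : \bar R := ((a * expR (- (a * z.1)))%:E * k ((z.1, s), z.2))%E.
have mk2 : measurable_fun setT (fun z : R * T => k ((z.1, s), z.2)).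
  apply: (measurableT_comp mk); apply: measurable_fun_pair => //.
  by apply: measurable_fun_pair => //; exact: measurable_cst.
have mf2 : measurable_fun setT f2.
  apply: emeasurable_funM => //; apply/measurable_EFinP; apply: measurable_funM => //.
  exact: (measurableT_comp (measurable_expl a) measurable_fst).
have f20 z : (0 <= f2 z)%E by rewrite mule_ge0// lee_fin mulr_ge0 ?expR_ge0 ?ltW.
transitivity ((l * expR (- (l * s)))%:E * \int[leb]_(t in `[0%R, +oo[) \int[P]_w f2 (t, w))%E.
  rewrite -ge0_integralZl//; last 3 first.
  - by apply: measurable_funTS; exact: (measurable_fun_fubini_tonelli_F (m2 := P) f2 mf2 f20).
  - by move=> t _; exact: integral_ge0.
  - by rewrite lee_fin mulr_ge0 ?expR_ge0 ?ltW.
  apply: eq_integral => t _; rewrite /f /fubini_F /f2 [in RHS]/= ge0_integralZl//; last 2 first.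
  - exact: (measurableT_comp mk2 (measurable_pair1 _)).
  - by rewrite lee_fin mulr_ge0 ?expR_ge0 ?ltW.
  by rewrite muleA -EFinM [X in (X%:E * _)%E = _]mulrC.
rewrite [RHS]EFinM; congr (_ * _)%E; rewrite tonelli_on// Rintegral_EFin//; last first.
  apply: bounded_rv_integrable; split.
    by apply: (measurableT_comp (measurable_expl a)); exact: (joint_measurable_sec2 s mY).
  by exists 1 => w; rewrite gtr0_norm ?expR_gt0// -expR0 ler_expR oppr_le0 mulr_ge0 ?Y0// ltW.
apply: eq_integral => w _; rewrite -(integral_exp_tail a0 (Y0 w s0)).
by apply: eq_integral => t _; rewrite /f2 /k /= -EFinM.
Qed.

End rate.
End exponential_time.

Lemma measurable_partial_integral d1 d2 (T1 : measurableType d1) (T2 : measurableType d2) (R : realType)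
    (m2 : {sigma_finite_measure set T2 -> \bar R}) (E : set T2) (f : T1 * T2 -> \bar R) :
  measurable E -> measurable_fun setT f -> (forall z, 0 <= f z)%E ->
  measurable_fun setT (fun x => \int[m2]_(y in E) f (x, y))%E.
Proof.
move=> mE mf f0; pose g := f \_ (setT `*` E).
have mDE : measurable ([set: T1] `*` E) by exact: measurableX.
have mg : measurable_fun setT g by apply/(measurable_restrictT f mDE); exact: measurable_funTS.
have g0 z : (0 <= g z)%E by apply: erestrict_ge0.
have := measurable_fun_fubini_tonelli_F (m2 := m2) g mg g0.
apply: eq_measurable_fun => x _; rewrite /fubini_F [RHS]integral_mkcond.
apply: eq_integral => y _; rewrite /g !patchE; have [yE|yE] := boolP (y \in E).
  by rewrite mem_set//; split => //; exact/set_mem.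
by rewrite memNset// => -[_ /= yE']; rewrite mem_set in yE.
Qed.

Lemma integral_product_on d1 d2 (T1 : measurableType d1) (T2 : measurableType d2) (R : realType)
    (m1 : {sigma_finite_measure set T1 -> \bar R}) (m2 : {sigma_finite_measure set T2 -> \bar R})
    (D : set T1) (E : set T2) (f : T1 * T2 -> \bar R) : measurable D -> measurable E ->
  measurable_fun setT f -> (forall z, 0 <= f z)%E ->
  (\int[m1 \x m2]_(z in D `*` E) f z = \int[m1]_(x in D) \int[m2]_(y in E) f (x, y))%E.
Proof.
move=> mD mE mf f0; pose g := f \_ (D `*` E).
have mDE : measurable (D `*` E) by exact: measurableX.
have mg : measurable_fun setT g by apply/(measurable_restrictT f mDE); exact: measurable_funTS.
have g0 z : (0 <= g z)%E by apply: erestrict_ge0.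
rewrite [LHS]integral_mkcond -/g fubini_tonelli1// [RHS]integral_mkcond; apply: eq_integral => x _.
rewrite /fubini_F patchE; have [xD|xD] := boolP (x \in D).
  rewrite [RHS]integral_mkcond; apply: eq_integral => y _; rewrite /g !patchE.
  have [yE|yE] := boolP (y \in E); first by rewrite mem_set//; split; exact/set_mem.
  by rewrite memNset// => -[_ /= yE']; rewrite mem_set in yE.
apply: integral0_eq => y _; rewrite /g patchE memNset// => -[/= xD' _].
by rewrite mem_set in xD.
Qed.

(* Stated for the three factors separately, because the product of two sigma-finite
   measures carries no canonical sigma-finite structure in the library. *)
Lemma tonelli_product_on d0 d1 d2 (T0 : measurableType d0) (T1 : measurableType d1) (T2 : measurableType d2)
    (R : realType) (m0 : {sigma_finite_measure set T0 -> \bar R})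
    (m1 : {sigma_finite_measure set T1 -> \bar R}) (m2 : {sigma_finite_measure set T2 -> \bar R})
    (C : set T0) (D : set T1) (E : set T2) (k : T0 * (T1 * T2) -> \bar R) :
  measurable C -> measurable D -> measurable E ->
  measurable_fun setT k -> (forall z, 0 <= k z)%E ->
  (\int[m0]_(s in C) \int[m1 \x m2]_(y in D `*` E) k (s, y) =
   \int[m1 \x m2]_(y in D `*` E) \int[m0]_(s in C) k (s, y))%E.
Proof.
move=> mC mD mE mk k0.
have mks s : measurable_fun setT (fun y => k (s, y)).
  by apply: (measurableT_comp mk); exact: measurable_pair1.
have mkx x : measurable_fun setT (fun z : T0 * T2 => k (z.1, (x, z.2))).
  apply: (measurableT_comp mk); apply: measurable_fun_pair => //.
  by apply: measurable_fun_pair => //; exact: measurable_cst.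
have mk01 : measurable_fun setT (fun z : (T0 * T1) * T2 => k (z.1.1, (z.1.2, z.2))).
  apply: (measurableT_comp mk); apply: measurable_fun_pair.
    exact: (measurableT_comp measurable_fst measurable_fst).
  apply: measurable_fun_pair; last exact: measurable_snd.
  exact: (measurableT_comp measurable_snd measurable_fst).
have mk12 : measurable_fun setT (fun z : (T1 * T2) * T0 => k (z.2, z.1)).
  by apply: (measurableT_comp mk); apply: measurable_fun_pair; [exact: measurable_snd|exact: measurable_fst].
transitivity (\int[m0]_(s in C) \int[m1]_(x in D) \int[m2]_(y in E) k (s, (x, y)))%E.
  apply: eq_integral => s _.
  exact: (integral_product_on m1 m2 mD mE (mks s) (fun z => k0 (s, z))).
have := @tonelli_on _ _ _ _ _ m0 m1 C D (fun z => \int[m2]_(y in E) k (z.1, (z.2, y)))%E mC mD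
  (measurable_partial_integral m2 mE mk01 (fun z => k0 _)).
move=> /= ->; last by move=> z; exact: integral_ge0.
have := integral_product_on m1 m2 mD mE (measurable_partial_integral m0 mC mk12 (fun z => k0 _)).
move=> /= ->; last by move=> z; exact: integral_ge0.
apply: eq_integral => x _.
exact: (tonelli_on m0 m2 mC mE (mkx x) (fun z => k0 _)).
Qed.

(** The distribution function at [s] of the variable c(y), when y has density [f] with respect to
    [mu] on [E]. *)
Definition mixture d (T : measurableType d) (R : realType) (mu : set T -> \bar R) (E : set T)
    (f c : T -> R) (s : R) : \bar R :=
  (\int[mu]_(y in E) (f y * \1_(`[c y, +oo[) s)%:E)%E.

(** * Mixtures *)

Section exponential_mixture.
Context d (T : measurableType d) (R : realType).
Notation leb := (@lebesgue_measure R).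
Variables (mu : {measure set T -> \bar R}) (E : set T) (f c : T -> R).
Hypotheses (mE : measurable E) (mf : measurable_fun setT f) (f0 : forall y, 0 <= f y)
  (mc : measurable_fun setT c) (c0 : forall y, E y -> 0 <= c y).

Let ind_measurable : measurable_fun setT (fun z : R * T => \1_(`[c z.2, +oo[) z.1 : R).
Proof.
rewrite (_ : (fun z => _) = (fun z : R * T => \1_(`[0, +oo[) (z.1 - c z.2))).
  apply: (measurableT_comp (_ : measurable_fun setT (\1_(`[0, +oo[) : R -> R))); first exact: measurable_indic.
  by apply: measurable_funB => //; exact: (measurableT_comp mc measurable_snd).
apply/funext => z; rewrite !indicE; congr (_%:R); congr nat_of_bool.
by apply/idP/idP; rewrite !inE/= !in_itv/= !andbT subr_ge0.
Qed.

Let ind0 (s : R) (v : R) : 0 <= (\1_(`[v, +oo[) s : R). Proof. by rewrite indicE. Qed.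

Lemma mixture_exponential (l : R) :
  (forall k : R * T -> \bar R, measurable_fun setT k -> (forall z, 0 <= k z)%E ->
    \int[leb]_(s in `[0%R, +oo[) \int[mu]_(y in E) k (s, y) =
    \int[mu]_(y in E) \int[leb]_(s in `[0%R, +oo[) k (s, y))%E ->
  0 < l ->
  (\int[leb]_(s in `[0%R, +oo[) ((l * expR (- (l * s)))%:E * mixture mu E f c s) =
   \int[mu]_(y in E) (f y * expR (- (l * c y)))%:E)%E.
Proof.
move=> tonelli l0; pose k (z : R * T) : \bar R := (l * expR (- (l * z.1)) * (f z.2 * \1_(`[c z.2, +oo[) z.1))%:E.
have mk : measurable_fun setT k.
  apply/measurable_EFinP; apply: measurable_funM.
    by apply: measurable_funM => //; exact: (measurableT_comp (measurable_expl l) measurable_fst).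
  by apply: measurable_funM => //; exact: (measurableT_comp mf measurable_snd).
have k0 z : (0 <= k z)%E.
  by rewrite lee_fin; apply: mulr_ge0; [rewrite mulr_ge0 ?expR_ge0 ?ltW|rewrite mulr_ge0].
transitivity (\int[leb]_(s in `[0%R, +oo[) \int[mu]_(y in E) k (s, y))%E.
  apply: eq_integral => s _; rewrite /mixture -ge0_integralZl//.
  - apply/measurable_EFinP; apply: measurable_funTS; apply: measurable_funM => //.
    exact: (measurableT_comp ind_measurable (measurable_pair1 s)).
  - by move=> y _; rewrite lee_fin mulr_ge0.
  - by rewrite lee_fin mulr_ge0 ?expR_ge0 ?ltW.
rewrite tonelli//; apply: eq_integral => y /set_mem Ey.
rewrite [RHS]EFinM -(integral_exp_tail l0 (c0 Ey)) -ge0_integralZl//.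
- by apply: eq_integral => s _; rewrite -EFinM /k/=; congr EFin; ring.
- apply/measurable_EFinP; apply: measurable_funTS; apply: measurable_funM; last exact: measurable_indic.
  by apply: measurable_funM => //; exact: measurable_expl.
- by move=> s _; rewrite lee_fin mulr_ge0// mulr_ge0 ?expR_ge0 ?ltW.
- by rewrite lee_fin.
Qed.

Hypothesis f1 : (\int[mu]_(y in E) (f y)%:E = 1)%E.

Lemma mixture_ge0 s : (0 <= mixture mu E f c s)%E.
Proof. by apply: integral_ge0 => y _; rewrite lee_fin mulr_ge0. Qed.

Let mfs s : measurable_fun setT (fun y => f y * \1_(`[c y, +oo[) s).
Proof. by apply: measurable_funM => //; exact: (measurableT_comp ind_measurable (measurable_pair1 s)). Qed.

Lemma mixture_le1 s : (mixture mu E f c s <= 1)%E.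
Proof.
rewrite -f1; apply: ge0_le_integral => //.
- by move=> y _; rewrite lee_fin mulr_ge0.
- by apply/measurable_EFinP; exact: measurable_funTS.
- by apply/measurable_EFinP; exact: measurable_funTS.
- by move=> y _; rewrite lee_fin -[leRHS]mulr1 ler_wpM2l// indicE; case: (_ \in _).
Qed.

Lemma mixture_fin s : mixture mu E f c s \is a fin_num.
Proof. by rewrite ge0_fin_numE ?mixture_ge0// (le_lt_trans (mixture_le1 s))// ltry. Qed.

Lemma measurable_mixture : measurable_fun setT (fun s => fine (mixture mu E f c s)).
Proof.
apply: nondecreasing_measurable => // s s' ss; apply: fine_le; rewrite ?mixture_fin//.
apply: ge0_le_integral => //.
- by move=> y _; rewrite lee_fin mulr_ge0.
- by apply/measurable_EFinP; exact: measurable_funTS.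
- by apply/measurable_EFinP; exact: measurable_funTS.
- move=> y _; rewrite lee_fin ler_wpM2l// !indicE.
  have [h|h] := boolP (s \in `[c y, +oo[%classic); last by rewrite ler0n.
  by rewrite mem_set//=; move: h; rewrite inE/= !in_itv/= !andbT => h; exact: le_trans h ss.
Qed.

End exponential_mixture.

(** * Gaussian tails and subordination *)

Section gauss_tails.
Context (R : realType).
Notation leb := (@lebesgue_measure R).

Lemma integral_head (f : R -> R) (c tau : R) : measurable_fun setT f -> (forall x, 0 <= f x) -> 0 <= c ->
  (\int[leb]_(x in `[0%R, +oo[) (f x)%:E = 1)%E -> (\int[leb]_(x in `[c, +oo[) (f x)%:E = tau%:E)%E ->
  (\int[leb]_(x in `]0%R, +oo[) (f x * \1_(`]-oo, c]) x)%:E = (1 - tau)%:E)%E.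
Proof.
move=> mf f0 c0 f1 ft.
have mfE (D : set R) : measurable_fun D (EFin \o f) by apply/measurable_EFinP; exact: measurable_funTS.
have E1 : (\int[leb]_(x in `]0%R, +oo[) (f x * \1_(`]-oo, c]) x)%:E = \int[leb]_(x in `[0%R, c]) (f x)%:E)%E.
  rewrite integral_itv_obnd_cbnd; last first.
    by apply/measurable_EFinP; apply: measurable_funTS; apply: measurable_funM => //; exact: measurable_indic.
  rewrite [LHS]integral_mkcond [RHS]integral_mkcond; apply: eq_integral => x _.
  rewrite !patchE indicE; have [xc|xc] := boolP (x \in `[0, c]%classic).
    move: xc; rewrite inE/= in_itv/= => /andP[x0 xc]; rewrite mem_set/=; last by rewrite in_itv/= x0.
    by rewrite mem_set/= ?in_itv//= mulr1.
  case: ifPn => // x0; rewrite memNset ?mulr0//= in_itv/= => xc'; move/negP: xc; apply.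
  by rewrite inE/= in_itv/= xc' andbT; move: x0; rewrite inE/= in_itv/= andbT.
have E2 : (\int[leb]_(x in `[0%R, c]) (f x)%:E + \int[leb]_(x in `]c, +oo[) (f x)%:E = 1)%E.
  rewrite -f1 -ge0_integral_setU//=.
  - by congr (integral _ _ _); rewrite -itv_bndbnd_setU// ?bnd_simp.
  - exact: mfE.
  - by move=> x _; rewrite lee_fin.
  - apply/disj_set2P; apply/seteqP; split => // x [/=]; rewrite !in_itv/= andbT => /andP[_ xc] cx.
    by move: (le_lt_trans xc cx); rewrite ltxx.
rewrite E1; move: E2; rewrite integral_itv_obnd_cbnd// ft => E2.
by rewrite EFinB -E2 addeK.
Qed.

(** On x > 0, the density of |Z| / sqrt 2 with Z standard Gaussian, whose tail is [Erfc]. *)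
Definition half_gauss (x : R) : R := 2 / Num.sqrt pi * gauss_fun x.

Let sp0 : 0 < Num.sqrt (pi : R). Proof. by rewrite sqrtr_gt0 pi_gt0. Qed.

Lemma half_gauss_ge0 x : 0 <= half_gauss x.
Proof. by rewrite mulr_ge0 ?gauss_fun_ge0// divr_ge0// ltW. Qed.

Lemma measurable_half_gauss : measurable_fun setT half_gauss.
Proof. by apply: measurable_funM => //; exact: measurable_gauss_fun. Qed.

Lemma integral_half_gauss : (\int[leb]_(x in `[0%R, +oo[) (half_gauss x)%:E = 1)%E.
Proof.
under eq_integral do rewrite EFinM.
rewrite ge0_integralZl//.
- by rewrite integral0y_gauss -EFinM; congr EFin; field; rewrite gt_eqF.
- by apply/measurable_EFinP; apply: measurable_funTS; exact: measurable_gauss_fun.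
- by move=> x _; rewrite lee_fin gauss_fun_ge0.
Qed.

Lemma integral_half_gauss_tail (z : R) : (\int[leb]_(x in `[z, +oo[) (half_gauss x)%:E = (Erfc z)%:E)%E.
Proof.
rewrite /Erfc -RintegralZl//; last first.
  by apply: integrableS (@integrableT_gauss R).
rewrite Rintegral_EFin//.
have ig : leb.-integrable `[z, +oo[ (EFin \o gauss_fun).
  by apply: integrableS (@integrableT_gauss R).
exact: (integrableZl _ (2 / Num.sqrt pi) ig).
Qed.

Lemma Erfc_head (z : R) : 0 <= z ->
  (\int[leb]_(x in `]0%R, +oo[) (half_gauss x * \1_(`]-oo, z]) x)%:E = (1 - Erfc z)%:E)%E.
Proof.
move=> z0; apply: integral_head => //; [exact: measurable_half_gauss|exact: half_gauss_ge0|exact: integral_half_gauss|].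
exact: integral_half_gauss_tail.
Qed.

Lemma Erfc_tail (z : R) : 0 <= z ->
  (\int[leb]_(x in `]0%R, +oo[) (half_gauss x * \1_(`[z, +oo[) x)%:E = (Erfc z)%:E)%E.
Proof.
move=> z0; rewrite integral_itv_obnd_cbnd; last first.
  apply/measurable_EFinP; apply: measurable_funTS; apply: measurable_funM; last exact: measurable_indic.
  exact: measurable_half_gauss.
by rewrite integral_indicator_tail// integral_half_gauss_tail.
Qed.

Lemma Erfc_ge0 (z : R) : 0 <= Erfc z.
Proof. by rewrite -lee_fin -integral_half_gauss_tail; apply: integral_ge0 => x _; rewrite lee_fin half_gauss_ge0. Qed.

Lemma Erfc_le1 (z : R) : 0 <= z -> Erfc z <= 1.
Proof.
move=> z0; rewrite -subr_ge0 -lee_fin -Erfc_head//; apply: integral_ge0 => x _.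
by rewrite lee_fin mulr_ge0 ?half_gauss_ge0// indicE.
Qed.

Lemma continuous_Erfc : continuous (@Erfc R).
Proof.
pose p := @lower_primitive R gauss_fun.
have dp (x : R) : is_derive x 1 p (gauss_fun x).
  exact: (is_derive_lower_primitive (@continuous_gauss_fun R) (@integrableT_gauss R)).
have py : p x @[x --> +oo] --> \int[leb]_x gauss_fun x.
  exact: (lower_primitive_cvgy (@continuous_gauss_fun R) (@gauss_fun_ge0 R) (@integrableT_gauss R)).
have -> : @Erfc R = (fun z : R => 2 / Num.sqrt pi * (\int[leb]_x gauss_fun x - p z)).
  apply/funext => z; rewrite /Erfc; congr (_ * _); rewrite /Rintegral.
  by rewrite (ge0_integral_is_derive (fun x _ => gauss_fun_ge0 x) (@continuous_gauss_fun R) dp py).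
move=> z; apply: cvgM; first exact: cvg_cst.
by apply: cvgB; [exact: cvg_cst|exact: (is_derive_continuous (dp z))].
Qed.

(** The bridge between the two kinds of exponent: with m proportional to sqrt l, the left side is a
    mixture of exponentials that are linear in l, as [mixture_exponential] requires. *)
Lemma integral_half_gauss_inverse (m : R) : 0 <= m ->
  (\int[leb]_(x in `]0%R, +oo[) (half_gauss x * expR (- (m / x) ^+ 2))%:E = (expR (- (2 * m)))%:E)%E.
Proof.
move=> m0; have mg : measurable_fun setT (fun x : R => expR (- (m / x) ^+ 2)).
  apply: measurableT_comp => //; apply: measurable_funN; apply: measurable_funX.
  by apply: measurable_funM => //; exact: measurable_inv.
rewrite integral_itv_obnd_cbnd; last first.
  by apply/measurable_EFinP; apply: measurable_funTS; apply: measurable_funM => //; exact: measurable_half_gauss.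
transitivity ((2 / Num.sqrt pi)%:E * \int[leb]_(x in `[0%R, +oo[) (expR (- (1 * x) ^+ 2 - (m / x) ^+ 2))%:E)%E.
  rewrite -ge0_integralZl//.
  - by apply: eq_integral => x _; rewrite -EFinM /half_gauss /gauss_fun mul1r expRD mulrA.
  - apply/measurable_EFinP; apply: measurable_funTS.
    apply: measurableT_comp => //; apply: measurable_funB; first by apply: measurable_funN; apply: measurable_funX; exact: measurable_funM.
    by apply: measurable_funX; apply: measurable_funM => //; exact: measurable_inv.
rewrite integral_gauss_inverse// -EFinM; congr EFin.
by rewrite !mulr1; field; rewrite gt_eqF.
Qed.

End gauss_tails.

Section integral_helpers.
Context d (T : measurableType d) (R : realType) (mu : {measure set T -> \bar R}) (D : set T).
Hypothesis mD : measurable D.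

Lemma integral_scale (k : R) (f : T -> R) : 0 <= k -> measurable_fun setT f -> (forall x, D x -> 0 <= f x) ->
  (\int[mu]_(x in D) (k * f x)%:E = k%:E * \int[mu]_(x in D) (f x)%:E)%E.
Proof.
move=> k0 mf f0; under eq_integral do rewrite EFinM.
rewrite ge0_integralZl//; first by apply/measurable_EFinP; exact: measurable_funTS.
Qed.

Lemma integral_ler (f g : T -> R) : measurable_fun setT f -> measurable_fun setT g ->
  (forall x, D x -> 0 <= f x) -> (forall x, D x -> f x <= g x) ->
  (\int[mu]_(x in D) (f x)%:E <= \int[mu]_(x in D) (g x)%:E)%E.
Proof.
move=> mf mg f0 fg; apply: ge0_le_integral => //.
- by apply/measurable_EFinP; exact: measurable_funTS.
- by apply/measurable_EFinP; exact: measurable_funTS.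
Qed.

End integral_helpers.

Section laplace_transforms.
Context (R : realType).
Notation leb := (@lebesgue_measure R).

Lemma laplace_complement (a v : R) (phi : R -> R) : 0 < a -> measurable_fun setT phi ->
  (forall t, 0 <= t -> 0 <= phi t <= 1) ->
  (\int[leb]_(t in `[0%R, +oo[) (a * expR (- (a * t)) * phi t)%:E = v%:E)%E ->
  (\int[leb]_(t in `[0%R, +oo[) (a * expR (- (a * t)) * (1 - phi t))%:E = (1 - v)%:E)%E.
Proof.
move=> a0 mphi phi01 hv; have e0 t : 0 <= a * expR (- (a * t)) by rewrite mulr_ge0 ?expR_ge0 ?ltW.
have me : measurable_fun setT (fun t => a * expR (- (a * t))).
  by apply: measurable_funM => //; exact: measurable_expl.
have : (\int[leb]_(t in `[0%R, +oo[) (a * expR (- (a * t)) * (1 - phi t))%:E +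
    \int[leb]_(t in `[0%R, +oo[) (a * expR (- (a * t)) * phi t)%:E = 1)%E.
  have := integral_exp 0 a0; rewrite mulr0 oppr0 expR0 => <-.
  rewrite -ge0_integralD//.
  - by apply: eq_integral => t _; rewrite -EFinD; congr EFin; ring.
  - move=> t; rewrite /= in_itv/= andbT => t0; rewrite lee_fin mulr_ge0// subr_ge0.
    by have /andP[] := phi01 t t0.
  - by apply/measurable_EFinP; apply: measurable_funTS; apply: measurable_funM => //; exact: measurable_funB.
  - move=> t; rewrite /= in_itv/= andbT => t0; rewrite lee_fin mulr_ge0//.
    by have /andP[] := phi01 t t0.
  - by apply/measurable_EFinP; apply: measurable_funTS; apply: measurable_funM.
by rewrite hv EFinB => <-; rewrite addeK.
Qed.

Lemma laplace_exp (a b : R) : 0 < a -> 0 < a + b ->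
  (\int[leb]_(t in `[0%R, +oo[) (a * expR (- (a * t)) * expR (- (b * t)))%:E = (a / (a + b))%:E)%E.
Proof.
move=> a0 ab0; transitivity ((a / (a + b))%:E * \int[leb]_(t in `[0%R, +oo[) ((a + b) * expR (- ((a + b) * t)))%:E)%E.
  rewrite -ge0_integralZl//.
  - apply: eq_integral => t _; rewrite -EFinM; congr EFin.
    rewrite -mulrA -expRD mulrA divfK ?gt_eqF//; congr (_ * expR _); ring.
  - by apply/measurable_EFinP; apply: measurable_funTS; apply: measurable_funM => //; exact: measurable_expl.
  - by move=> t _; rewrite lee_fin mulr_ge0 ?expR_ge0 ?ltW.
  - by rewrite lee_fin divr_ge0 ?ltW.
by rewrite integral_exp// mulr0 oppr0 expR0 mule1.
Qed.

Lemma sqr_half_le (x y r : R) : 0 < x -> 0 <= y -> 0 <= r ->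
  (y ^+ 2 / (2 * x ^+ 2) <= r) = (y <= x * Num.sqrt (2 * r)).
Proof.
move=> x0 y0 r0; have x20 : 0 < 2 * x ^+ 2 by rewrite mulr_gt0// exprn_gt0.
have s0 : 0 <= 2 * r by rewrite mulr_ge0.
rewrite ler_pdivrMr// -[RHS]ler_sqr ?nnegrE ?mulr_ge0 ?sqrtr_ge0 ?(ltW x0)//.
by rewrite exprMn sqr_sqrtr//; congr (_ <= _); ring.
Qed.

Let half : set R := `]0, +oo[%classic.
Let mhalf : measurable half. Proof. exact: measurable_itv. Qed.

Lemma measurable_delay (t y : R) : measurable_fun setT (fun x : R => t + y ^+ 2 / (2 * x ^+ 2)).
Proof.
apply: measurable_funD => //; apply: measurable_funM => //.
apply: (measurableT_comp (@measurable_inv R)); apply: measurable_funM => //; exact: measurable_funX.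
Qed.

Lemma half_gauss_total : (\int[leb]_(x in half) (half_gauss x)%:E = 1)%E.
Proof.
rewrite integral_itv_obnd_cbnd ?integral_half_gauss//.
by apply/measurable_EFinP; apply: measurable_funTS; exact: measurable_half_gauss.
Qed.

Section occupation_zero.
Variables (t y : R).
Hypotheses (t0 : 0 <= t) (y0 : 0 < y).
(** Under [half_gauss] the second term has the law of y^2 / Z^2 with Z standard Gaussian, which is
    that of the first time at which a Brownian motion reaches y. *)
Let c x : R := t + y ^+ 2 / (2 * x ^+ 2).

Lemma gauss_delay_exponential (b : R) : 0 <= b ->
  (\int[leb]_(x in half) (half_gauss x * expR (- (2^-1 * b ^+ 2 * c x)))%:E =
   (expR (- (2^-1 * b ^+ 2 * t)) * expR (- (b * y)))%:E)%E.
Proof.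
move=> b0; have m0 : 0 <= 2^-1 * (b * y) by rewrite mulr_ge0// mulr_ge0// ltW.
have mg : measurable_fun setT (fun x => half_gauss x * expR (- (2^-1 * (b * y) / x) ^+ 2)).
  apply: measurable_funM; first exact: measurable_half_gauss.
  apply: measurableT_comp => //; apply: measurable_funN; apply: measurable_funX.
  by apply: measurable_funM => //; exact: measurable_inv.
have := integral_scale leb mhalf (expR_ge0 (- (2^-1 * b ^+ 2 * t))) mg (fun x _ => mulr_ge0 (half_gauss_ge0 x) (expR_ge0 _)).
rewrite integral_half_gauss_inverse// -EFinM (_ : 2 * (2^-1 * (b * y)) = b * y); last by field.
move=> <-; apply: eq_integral => x /set_mem; rewrite /half /= in_itv/= andbT => x0.
congr EFin; rewrite [RHS]mulrCA -expRD; congr (_ * expR _).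
by rewrite /c; field; rewrite gt_eqF.
Qed.

Lemma gauss_delay_mixture (s : R) : t < s ->
  mixture leb half (@half_gauss R) c s = (Erfc (y / Num.sqrt (2 * (s - t))))%:E.
Proof.
move=> ts; have st0 : 0 < s - t by rewrite subr_gt0.
have q0 : 0 < Num.sqrt (2 * (s - t)) by rewrite sqrtr_gt0 mulr_gt0.
rewrite -Erfc_tail; last by rewrite divr_ge0 ?ltW.
apply: eq_integral => x /set_mem; rewrite /half /= in_itv/= andbT => x0; congr EFin; congr (_ * _).
rewrite !indicE; congr (_%:R); congr nat_of_bool.
apply/idP/idP; rewrite !inE/= !in_itv/= !andbT /c -lerBrDl sqr_half_le ?(ltW y0) ?(ltW st0)// ler_pdivrMr//.
Qed.

End occupation_zero.

Section occupation_positive.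
Variables (theta k : R).
Hypotheses (theta0 : 0 < theta) (k0 : 0 < k).

(** The mean of e^(-k |B_t|) for a Brownian motion started at 0, since x sqrt (2 t) has under
    [half_gauss] the law of |B_t|. *)
Definition gauss_exp (t : R) : R := \int[leb]_(x in half) (half_gauss x * expR (- (k * (x * Num.sqrt (2 * t))))).

Let kern (t x : R) := half_gauss x * expR (- (k * (x * Num.sqrt (2 * t)))).
Let mkern t : measurable_fun setT (kern t).
Proof.
apply: measurable_funM; first exact: measurable_half_gauss.
by apply: measurableT_comp => //; apply: measurable_funN; apply: measurable_funM => //; exact: measurable_funM.
Qed.

Let kern0 t x : 0 <= kern t x. Proof. by rewrite mulr_ge0 ?half_gauss_ge0 ?expR_ge0. Qed.

Let kern_le t x : 0 < x -> kern t x <= half_gauss x.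
Proof.
move=> x0; rewrite -[leRHS]mulr1 ler_wpM2l ?half_gauss_ge0// -expR0 ler_expR oppr_le0.
by rewrite mulr_ge0 ?(ltW k0)// mulr_ge0 ?sqrtr_ge0// ltW.
Qed.

Let half_gauss_integrable : leb.-integrable half (EFin \o @half_gauss R).
Proof.
apply/integrableP; split; first by apply/measurable_EFinP; apply: measurable_funTS; exact: measurable_half_gauss.
under eq_integral do rewrite /= ger0_norm ?half_gauss_ge0//.
by rewrite half_gauss_total ltry.
Qed.

Let kern_integrable t : leb.-integrable half (EFin \o kern t).
Proof.
apply: le_integrable half_gauss_integrable => //.
  by apply/measurable_EFinP; exact: (measurable_funTS (mkern t)).
move=> x; rewrite /half /= in_itv/= andbT => x0; rewrite lee_fin !ger0_norm ?half_gauss_ge0 ?kern_le//.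
Qed.

Lemma gauss_expE t : ((gauss_exp t)%:E = \int[leb]_(x in half) (kern t x)%:E)%E.
Proof. by rewrite /gauss_exp Rintegral_EFin//; exact: kern_integrable. Qed.

Lemma gauss_exp01 t : 0 <= gauss_exp t <= 1.
Proof.
rewrite -!lee_fin gauss_expE; apply/andP; split; first by apply: integral_ge0 => x _; rewrite lee_fin.
rewrite -half_gauss_total; apply: (integral_ler leb mhalf (mkern t) (@measurable_half_gauss R)) => [x _|x].
  exact: kern0.
by rewrite /half /= in_itv/= andbT => x0; exact: kern_le.
Qed.

Lemma gauss_exp_nonincreasing t t' : t <= t' -> gauss_exp t' <= gauss_exp t.
Proof.
move=> tt; apply: le_Rintegral; [exact: mhalf|exact: (kern_integrable t')|exact: (kern_integrable t)|move=> x].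
rewrite /half /= in_itv/= andbT => x0; apply: ler_wpM2l; first exact: half_gauss_ge0.
rewrite ler_expR lerN2; apply: ler_wpM2l; first exact: ltW.
by apply: ler_wpM2l; [exact: ltW|rewrite ler_wsqrtr// ler_wpM2l].
Qed.

Lemma measurable_gauss_exp : measurable_fun setT gauss_exp.
Proof.
have mN : measurable_fun setT (fun t => - gauss_exp t).
  have nd : {homo (fun t => - gauss_exp t) : x y / x <= y}.
    by move=> x y xy; rewrite lerN2; exact: gauss_exp_nonincreasing.
  exact: (nondecreasing_measurable measurableT nd).
by apply: eq_measurable_fun (measurable_funN mN) => t _; exact: opprK.
Qed.

Lemma continuous_gauss_exp : continuous gauss_exp.
Proof.
move=> t; have tI : t \in (`]t - 1, t + 1[%classic : set R) by rewrite inE/= in_itv/=; apply/andP; split; lra.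
have H : {in `]t - 1, t + 1[%classic, continuous (fun l : R => \int[leb]_(x in half) kern l x)}; last exact: (H t tI).
have CI := @continuity_under_integral R _ _ leb kern half (measurable_itv _) (t - 1) (t + 1) _ _ (@half_gauss R) half_gauss_integrable.
apply: CI => //.
- apply: aeW => x _ r _; apply: cvgM; first exact: cvg_cst.
  apply: continuous_comp; last exact: continuous_expR.
  apply: cvgN; apply: cvgM; first exact: cvg_cst.
  apply: cvgM; first exact: cvg_cst.
  apply: (continuous_comp (f := fun t : R => 2 * t)); last exact: sqrt_continuous.
  by apply: cvgM; [exact: cvg_cst|exact: cvg_id].
- move=> r _; apply: aeW => x; rewrite /half /= in_itv/= andbT => x0.
  by rewrite ger0_norm ?kern0 ?kern_le.
Qed.

(** At an exponential time of rate a^2 / 2, |B| is exponential of rate a, whence a / (k + a). The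
    proof goes through the complement: 1 - [gauss_exp] is the distribution function in t of w^2 / (2
    x^2), with w exponential of rate k and x distributed as [half_gauss]. By [mixture_exponential]
    and [integral_half_gauss_inverse] its transform is the mean of e^(-a w), that is k / (k + a). *)
Lemma laplace_gauss_exp (a : R) : 0 < a ->
  (\int[leb]_(t in `[0%R, +oo[) (2^-1 * a ^+ 2 * expR (- (2^-1 * a ^+ 2 * t)) * gauss_exp t)%:E = (a / (k + a))%:E)%E.
Proof.
move=> a0; have p0 : 0 < 2^-1 * a ^+ 2 by rewrite mulr_gt0// exprn_gt0.
have ka : 0 < k + a by rewrite addr_gt0.
pose fp (z : R * R) : R := k * expR (- (k * z.1)) * half_gauss z.2.
pose cp (z : R * R) : R := z.1 ^+ 2 / (2 * z.2 ^+ 2).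
have mfp : measurable_fun setT fp.
  apply: measurable_funM; last exact: (measurableT_comp (@measurable_half_gauss R) measurable_snd).
  by apply: measurable_funM => //; exact: (measurableT_comp (measurable_expl k) measurable_fst).
have mcp : measurable_fun setT cp.
  apply: measurable_funM; first by apply: measurable_funX; exact: measurable_fst.
  apply: (measurableT_comp (@measurable_inv R)); apply: measurable_funM => //.
  by apply: measurable_funX; exact: measurable_snd.
have fp0 z : 0 <= fp z by rewrite mulr_ge0 ?half_gauss_ge0// mulr_ge0 ?expR_ge0 ?ltW.
have cp0 z : (half `*` half) z -> 0 <= cp z.
  by move=> _; rewrite divr_ge0 ?sqr_ge0// mulr_ge0 ?sqr_ge0.
have mhh : measurable (half `*` half) by exact: measurableX.
have k_exp w : 0 <= k * expR (- (k * w)) by rewrite mulr_ge0 ?expR_ge0 ?ltW.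
have mk_exp : measurable_fun setT (fun w => k * expR (- (k * w))).
  by apply: measurable_funM => //; exact: measurable_expl.
have total : (\int[leb]_(w in `[0%R, +oo[) (k * expR (- (k * w)))%:E = 1)%E.
  by rewrite integral_exp// mulr0 oppr0 expR0.
(* For fixed x the event w^2 / (2 x^2) <= t is w <= x sqrt (2 t), of probability 1 - e^(-k x sqrt (2
   t)). *)
have mixE t : 0 <= t -> mixture (leb \x leb)%E (half `*` half) fp cp t = (1 - gauss_exp t)%:E.
  move=> t0; pose mt (z : R * R) := (fp z * \1_(`[cp z, +oo[) t)%:E.
  have mmt : measurable_fun setT mt.
    apply/measurable_EFinP; apply: measurable_funM => //.
    rewrite (_ : (fun z => _) = (fun z => \1_(`]-oo, t]) (cp z))).
      by apply: (measurableT_comp (_ : measurable_fun setT (\1_(`]-oo, t]) : R -> R))); first exact: measurable_indic.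
    apply/funext => z; rewrite !indicE; congr (_%:R); congr nat_of_bool.
    by apply/idP/idP; rewrite !inE/= !in_itv/= andbT.
  have mt0 z : (0 <= mt z)%E by rewrite lee_fin mulr_ge0 ?fp0// indicE.
  rewrite /mixture (integral_product_on leb leb mhalf mhalf mmt mt0) tonelli_on//.
  transitivity (\int[leb]_(x in half) (half_gauss x * (1 - expR (- (k * (x * Num.sqrt (2 * t))))))%:E)%E.
    apply: eq_integral => x /set_mem; rewrite /half /= in_itv/= andbT => x0.
    have v0 : 0 <= x * Num.sqrt (2 * t) by rewrite mulr_ge0 ?sqrtr_ge0// ltW.
    have mh : measurable_fun setT (fun w => k * expR (- (k * w)) * \1_(`]-oo, x * Num.sqrt (2 * t)]) w).
      by apply: measurable_funM => //; exact: measurable_indic.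
    have := integral_scale leb mhalf (half_gauss_ge0 x) mh (fun w _ => _).
    rewrite (integral_head mk_exp k_exp v0 total (integral_exp _ k0)) -EFinM => <-; last first.
      by move=> w; rewrite mulr_ge0 ?k_exp// indicE.
    apply: eq_integral => w /set_mem; rewrite /half /= in_itv/= andbT => w0.
    rewrite /mt /fp/=; congr EFin; rewrite mulrAC mulrC; congr (_ * (_ * _)).
    rewrite !indicE; congr (_%:R); congr nat_of_bool.
    by apply/idP/idP; rewrite !inE/= !in_itv/= ?andbT /cp/= sqr_half_le// ltW.
  have : (\int[leb]_(x in half) (half_gauss x * (1 - expR (- (k * (x * Num.sqrt (2 * t))))))%:E +
      \int[leb]_(x in half) (kern t x)%:E = 1)%E.
    rewrite -half_gauss_total -ge0_integralD//.
    - by apply: eq_integral => x _; rewrite -EFinD /kern; congr EFin; ring.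
    - move=> x; rewrite /half /= in_itv/= andbT => x0; rewrite lee_fin mulr_ge0 ?half_gauss_ge0// subr_ge0.
      by rewrite -expR0 ler_expR oppr_le0 mulr_ge0 ?(ltW k0)// mulr_ge0 ?sqrtr_ge0// ltW.
    - apply/measurable_EFinP; apply: measurable_funTS; apply: measurable_funM; first exact: measurable_half_gauss.
      apply: measurable_funB => //; apply: measurableT_comp => //; apply: measurable_funN.
      by apply: measurable_funM => //; exact: measurable_funM.
    - by move=> x _; rewrite lee_fin kern0.
    - by apply/measurable_EFinP; exact: (measurable_funTS (mkern t)).
  by rewrite -gauss_expE EFinB => <-; rewrite addeK.
have mixL : (\int[leb]_(s in `[0%R, +oo[) ((2^-1 * a ^+ 2 * expR (- (2^-1 * a ^+ 2 * s)))%:E *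
    mixture (leb \x leb) (half `*` half) fp cp s) =
    \int[(leb \x leb)]_(z in half `*` half) (fp z * expR (- (2^-1 * a ^+ 2 * cp z)))%:E)%E.
  have mixL0 := @mixture_exponential _ _ R (product_measure1 leb leb).
  apply: (mixL0 _ fp cp mhh mfp fp0 mcp cp0 _ _ p0) => h mh h0.
  have mI : measurable (`[0%R, +oo[%classic : set R) by exact: measurable_itv.
  exact: (tonelli_product_on leb leb leb mI mhalf mhalf mh h0).
have kE : (\int[leb]_(t in `[0%R, +oo[) (2^-1 * a ^+ 2 * expR (- (2^-1 * a ^+ 2 * t)) * (1 - gauss_exp t))%:E = (k / (k + a))%:E)%E.
  transitivity (\int[leb \x leb]_(z in half `*` half) (fp z * expR (- (2^-1 * a ^+ 2 * cp z)))%:E)%E.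
    rewrite -mixL; apply: eq_integral => t /set_mem; rewrite /= in_itv/= andbT => t0.
    by rewrite mixE// -EFinM.
  pose me (z : R * R) := (fp z * expR (- (2^-1 * a ^+ 2 * cp z)))%:E.
  have mme : measurable_fun setT me.
    apply/measurable_EFinP; apply: measurable_funM => //.
    by apply: (measurableT_comp (measurable_expl (2^-1 * a ^+ 2))).
  have me0 z : (0 <= me z)%E by rewrite lee_fin mulr_ge0 ?fp0 ?expR_ge0.
  rewrite (integral_product_on leb leb mhalf mhalf mme me0) -(laplace_exp k0 ka).
  rewrite integral_itv_obnd_cbnd; last first.
    by apply: measurable_funTS; exact: (measurable_partial_integral leb mhalf mme me0).
  apply: eq_integral => w /set_mem; rewrite /= in_itv/= andbT => w0.
  have m0 : 0 <= 2^-1 * (a * w) by rewrite mulr_ge0// mulr_ge0// ltW.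
  have mg : measurable_fun setT (fun x => half_gauss x * expR (- (2^-1 * (a * w) / x) ^+ 2)).
    apply: measurable_funM; first exact: measurable_half_gauss.
    apply: measurableT_comp => //; apply: measurable_funN; apply: measurable_funX.
    by apply: measurable_funM => //; exact: measurable_inv.
  have := integral_scale leb mhalf (k_exp w) mg (fun x _ => mulr_ge0 (half_gauss_ge0 x) (expR_ge0 _)).
  rewrite integral_half_gauss_inverse// -EFinM (_ : 2 * (2^-1 * (a * w)) = a * w); last by field.
  move=> <-; apply: eq_integral => x /set_mem; rewrite /half /= in_itv/= andbT => x0.
  rewrite /me /fp /cp/=; congr EFin; rewrite mulrA; congr (_ * expR _).
  by field; rewrite gt_eqF.
have mcmp : measurable_fun setT (fun t => 1 - gauss_exp t).
  by apply: measurable_funB => //; exact: measurable_gauss_exp.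
have cmp01 t : 0 <= t -> 0 <= 1 - gauss_exp t <= 1.
  by move=> _; have /andP[h1 h2] := gauss_exp01 t; apply/andP; split; lra.
have cE := laplace_complement p0 mcmp cmp01 kE.
rewrite (_ : a / (k + a) = 1 - k / (k + a)); last by field; rewrite gt_eqF.
rewrite -cE.
by apply: eq_integral => t _; congr EFin; ring.
Qed.

End occupation_positive.

Definition half_normal (z : R) : R := 2 * normal_pdf 0 1 z.

Lemma half_normal_ge0 z : 0 <= half_normal z.
Proof. by rewrite mulr_ge0 ?normal_pdf_ge0. Qed.

Lemma measurable_half_normal : measurable_fun setT half_normal.
Proof. by apply: measurable_funM => //; exact: measurable_normal_pdf. Qed.

Lemma half_normalE z : half_normal z = Num.sqrt 2 / Num.sqrt pi * expR (- (z ^+ 2 / 2)).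
Proof.
have p0 : 0 < Num.sqrt (pi : R) by rewrite sqrtr_gt0 pi_gt0.
have s20 : 0 < Num.sqrt (2 : R) by rewrite sqrtr_gt0.
rewrite /half_normal normal_pdfE ?oner_neq0// /normal_peak /normal_fun subr0 expr1n mul1r mulrA; congr (_ * expR _).
  have E : Num.sqrt 2 * Num.sqrt 2 = 2 :> R by rewrite -expr2 sqr_sqrtr.
  rewrite (_ : pi *+ 2 = pi * 2); last by rewrite mulr_natr.
  by rewrite sqrtrM ?pi_ge0// -{1}E; field; rewrite !gt_eqF.
by rewrite mulNr.
Qed.

Lemma integral_half_normal_inverse (v : R) : 0 <= v ->
  (\int[leb]_(z in half) (half_normal z * expR (- (v / Num.sqrt 2 / z) ^+ 2))%:E = (expR (- v))%:E)%E.
Proof.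
move=> v0; have p0 : 0 < Num.sqrt (pi : R) by rewrite sqrtr_gt0 pi_gt0.
have s20 : 0 < Num.sqrt (2 : R) by rewrite sqrtr_gt0.
have E : Num.sqrt 2 ^+ 2 = 2 :> R by rewrite sqr_sqrtr.
pose A := (Num.sqrt 2 : R)^-1; have A0 : 0 < A by rewrite invr_gt0.
have M0 : 0 <= v / Num.sqrt 2 by rewrite divr_ge0// ltW.
have mg : measurable_fun setT (fun x : R => expR (- (A * x) ^+ 2 - (v / Num.sqrt 2 / x) ^+ 2)).
  apply: measurableT_comp => //; apply: measurable_funB; first by apply: measurable_funN; apply: measurable_funX; exact: measurable_funM.
  by apply: measurable_funX; apply: measurable_funM => //; exact: measurable_inv.
have k0 : 0 <= Num.sqrt 2 / Num.sqrt (pi : R) by rewrite divr_ge0 ?ltW.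
have := integral_scale leb mhalf k0 mg (fun x _ => expR_ge0 _).
rewrite [X in _ = (_ * X)%E]integral_itv_obnd_cbnd; last by apply/measurable_EFinP; exact: (measurable_funTS mg).
rewrite (integral_gauss_inverse A0 M0) -EFinM => h.
transitivity (\int[leb]_(x in half) (Num.sqrt 2 / Num.sqrt pi * expR (- (A * x) ^+ 2 - (v / Num.sqrt 2 / x) ^+ 2))%:E)%E.
  apply: eq_integral => z _; congr EFin; rewrite half_normalE -[LHS]mulrA -expRD; congr (_ * expR _).
  by rewrite /A; congr (- _ - _); rewrite [RHS]exprMn exprVn E mulrC.
rewrite h; congr EFin; rewrite (_ : 2 * A * (v / Num.sqrt 2) = v).
  by rewrite /A -{2}E; field; rewrite !gt_eqF.
by rewrite /A -[X in X * _ * _]E; field; rewrite !gt_eqF.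
Qed.

Lemma half_normal_total : (\int[leb]_(z in half) (half_normal z)%:E = 1)%E.
Proof.
have := integral_half_normal_inverse (lexx 0); rewrite oppr0 expR0 => <-.
by apply: eq_integral => z _; rewrite !mul0r expr0n/= oppr0 expR0 mulr1.
Qed.

(** Multiplied by theta^2 z^2 and completed to a square, the left side reads (theta u + z^2)^2 <=
    z^2 (z^2 + theta^2 r); the square root may be taken because theta u + z^2 >= 0. This is the
    origin of the argument of [Erfc] in the law of the positive side. *)
Lemma excursion_condition (theta z u r : R) : 0 < theta -> 0 < z -> 0 <= u -> 0 <= r ->
  (u ^+ 2 / z ^+ 2 + 2 * u / theta <= r) = (theta * u <= - z ^+ 2 + z * Num.sqrt (z ^+ 2 + theta ^+ 2 * r)).
Proof.
move=> th0 z0 u0 r0; rewrite -lerBlDl opprK.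
have q0 : 0 <= z ^+ 2 + theta ^+ 2 * r by rewrite addr_ge0 ?sqr_ge0// mulr_ge0 ?sqr_ge0.
rewrite -[RHS]ler_sqr ?nnegrE ?mulr_ge0 ?addr_ge0 ?sqr_ge0 ?sqrtr_ge0 ?mulr_ge0 ?(ltW z0) ?(ltW th0)//.
rewrite exprMn sqr_sqrtr// -subr_ge0 -[RHS]subr_ge0.
rewrite (_ : z ^+ 2 * _ - _ = (z ^+ 2 * theta ^+ 2) * (r - (u ^+ 2 / z ^+ 2 + 2 * u / theta))).
  by rewrite subr0 (pmulr_rge0 _ (_ : 0 < z ^+ 2 * theta ^+ 2)) ?subr_ge0// mulr_gt0// exprn_gt0.
by field; rewrite !gt_eqF.
Qed.

Section excursion_mixture.
Variables (theta t : R).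
Hypotheses (theta0 : 0 < theta) (t0 : 0 < t).

(* With [u = z.2 * sqrt (2 t)]: averaging [exp (-l u^2 / z.1^2)] over [z.1] gives
   [exp (-u sqrt (2 l))], and [2 u / theta] accounts for the time spent at [0]. *)
Definition excursion_delay (z : R * R) : R :=
  t + (z.2 * Num.sqrt (2 * t)) ^+ 2 / z.1 ^+ 2 + 2 * (z.2 * Num.sqrt (2 * t)) / theta.

Definition excursion_density (z : R * R) : R := half_normal z.1 * half_gauss z.2.

Lemma measurable_excursion_delay : measurable_fun setT excursion_delay.
Proof.
have m1 : measurable_fun setT (fun z : R * R => z.2 * Num.sqrt (2 * t)).
  by apply: measurable_funM => //; exact: measurable_snd.
apply: measurable_funD; last by apply: measurable_funM => //; exact: measurable_funM.
apply: measurable_funD => //; apply: measurable_funM; first exact: measurable_funX.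
apply: (measurableT_comp (@measurable_inv R)); apply: measurable_funX; exact: measurable_fst.
Qed.

Lemma measurable_excursion_density : measurable_fun setT excursion_density.
Proof.
apply: measurable_funM; first exact: (measurableT_comp measurable_half_normal measurable_fst).
exact: (measurableT_comp (@measurable_half_gauss R) measurable_snd).
Qed.

Lemma excursion_density_ge0 z : 0 <= excursion_density z.
Proof. by rewrite mulr_ge0 ?half_normal_ge0 ?half_gauss_ge0. Qed.

Lemma excursion_delay_ge0 z : (half `*` half) z -> 0 <= excursion_delay z.
Proof.
move=> [_]; rewrite /half /= in_itv/= andbT => z20; rewrite !addr_ge0 ?(ltW t0)//.
  by rewrite divr_ge0 ?sqr_ge0.
by rewrite divr_ge0 ?(ltW theta0)// mulr_ge0// mulr_ge0 ?sqrtr_ge0// ltW.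
Qed.

Lemma excursion_density_total : (\int[(leb \x leb)]_(z in half `*` half) (excursion_density z)%:E = 1)%E.
Proof.
have m1 : measurable_fun setT (fun z => (excursion_density z)%:E).
  by apply/measurable_EFinP; exact: measurable_excursion_density.
rewrite (integral_product_on leb leb mhalf mhalf m1); last by move=> z; rewrite lee_fin excursion_density_ge0.
rewrite -half_normal_total; apply: eq_integral => z _.
rewrite -[RHS]mule1 -half_gauss_total -integral_scale ?half_normal_ge0//; first exact: measurable_half_gauss.
by move=> x _; exact: half_gauss_ge0.
Qed.

Lemma excursion_exponential (b : R) : 0 < b ->
  (\int[(leb \x leb)]_(z in half `*` half) (excursion_density z * expR (- (2^-1 * b ^+ 2 * excursion_delay z)))%:E =
   (expR (- (2^-1 * b ^+ 2 * t)) * gauss_exp (b + b ^+ 2 / theta) t)%:E)%E.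
Proof.
move=> b0; pose k := b + b ^+ 2 / theta.
have k0 : 0 < k by rewrite addr_gt0// divr_gt0// exprn_gt0.
have s20 : 0 < Num.sqrt (2 : R) by rewrite sqrtr_gt0.
have E : Num.sqrt 2 ^+ 2 = 2 :> R by rewrite sqr_sqrtr.
pose m (z : R * R) := (excursion_density z * expR (- (2^-1 * b ^+ 2 * excursion_delay z)))%:E.
have mm : measurable_fun setT m.
  apply/measurable_EFinP; apply: measurable_funM; first exact: measurable_excursion_density.
  exact: (measurableT_comp (measurable_expl (2^-1 * b ^+ 2)) measurable_excursion_delay).
have m0 z : (0 <= m z)%E by rewrite lee_fin mulr_ge0 ?excursion_density_ge0 ?expR_ge0.
rewrite (integral_product_on leb leb mhalf mhalf mm m0) tonelli_on// EFinM (gauss_expE k0).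
have mk : measurable_fun setT (fun x => half_gauss x * expR (- (k * (x * Num.sqrt (2 * t))))).
  apply: measurable_funM; first exact: measurable_half_gauss.
  by apply: measurableT_comp => //; apply: measurable_funN; apply: measurable_funM => //; exact: measurable_funM.
rewrite -(integral_scale leb mhalf (expR_ge0 _) mk); last first.
  by move=> x _; rewrite mulr_ge0 ?half_gauss_ge0 ?expR_ge0.
apply: eq_integral => x /set_mem; rewrite /half /= in_itv/= andbT => x0.
pose u := x * Num.sqrt (2 * t); have u0 : 0 <= u by rewrite mulr_ge0 ?sqrtr_ge0// ltW.
have mg : measurable_fun setT (fun z : R => half_normal z * expR (- (b * u / Num.sqrt 2 / z) ^+ 2)).
  apply: measurable_funM; first exact: measurable_half_normal.
  apply: measurableT_comp => //; apply: measurable_funN; apply: measurable_funX.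
  by apply: measurable_funM => //; exact: measurable_inv.
have c0 : 0 <= half_gauss x * expR (- (2^-1 * b ^+ 2 * t)) * expR (- (b ^+ 2 / theta * u)).
  by rewrite !mulr_ge0 ?half_gauss_ge0 ?expR_ge0.
have := integral_scale leb mhalf c0 mg (fun z _ => mulr_ge0 (half_normal_ge0 z) (expR_ge0 _)).
rewrite integral_half_normal_inverse; last by rewrite mulr_ge0// ltW.
rewrite -EFinM => h.
transitivity ((half_gauss x * expR (- (2^-1 * b ^+ 2 * t)) * expR (- (b ^+ 2 / theta * u)) * expR (- (b * u)))%:E).
  rewrite -h; apply: eq_integral => z /set_mem; rewrite /half /= in_itv/= andbT => z0.
  rewrite /m /excursion_density /excursion_delay/= -/u; congr EFin.
  rewrite (_ : expR (- (2^-1 * b ^+ 2 * _)) = expR (- (2^-1 * b ^+ 2 * t)) * expR (- (b ^+ 2 / theta * u)) * expR (- (b * u / Num.sqrt 2 / z) ^+ 2)).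
    by ring.
  rewrite -!expRD; congr expR; rewrite !exprMn !exprVn E.
  by field; rewrite !gt_eqF.
congr EFin; rewrite /k mulrDl opprD expRD -/u; ring.
Qed.

(** For fixed z, [excursion_condition] turns the constraint on the delay into an upper bound on the
    second coordinate, whose probability is 1 - [Erfc] of that bound. *)
Lemma excursion_mixture (s : R) : t < s ->
  mixture (leb \x leb)%E (half `*` half) excursion_density excursion_delay s =
  (\int[leb]_(z in half) (half_normal z *
     (1 - Erfc ((- z ^+ 2 + z * Num.sqrt (z ^+ 2 + theta ^+ 2 * (s - t))) / (theta * Num.sqrt (2 * t)))))%:E)%E.
Proof.
move=> ts; have st0 : 0 < s - t by rewrite subr_gt0.
have q0 : 0 < Num.sqrt (2 * t) by rewrite sqrtr_gt0 mulr_gt0.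
pose mt (z : R * R) := (excursion_density z * \1_(`[excursion_delay z, +oo[) s)%:E.
have mmt : measurable_fun setT mt.
  apply/measurable_EFinP; apply: measurable_funM; first exact: measurable_excursion_density.
  rewrite (_ : (fun z => _) = (fun z => \1_(`]-oo, s]) (excursion_delay z))).
    apply: (measurableT_comp (_ : measurable_fun setT (\1_(`]-oo, s]) : R -> R)) measurable_excursion_delay); exact: measurable_indic.
  apply/funext => z; rewrite !indicE; congr (_%:R); congr nat_of_bool.
  by apply/idP/idP; rewrite !inE/= !in_itv/= andbT.
have mt0 z : (0 <= mt z)%E by rewrite lee_fin mulr_ge0 ?excursion_density_ge0// indicE.
rewrite /mixture (integral_product_on leb leb mhalf mhalf mmt mt0).
apply: eq_integral => z /set_mem; rewrite /half /= in_itv/= andbT => z0.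
set v := (_ / _); have v0 : 0 <= v.
  rewrite divr_ge0 ?mulr_ge0 ?(ltW theta0) ?(ltW q0)// addrC subr_ge0 expr2 ler_pM2l//.
  by rewrite -expr2 -{1}(gtr0_norm z0) -sqrtr_sqr ler_wsqrtr// lerDl mulr_ge0 ?sqr_ge0// ltW.
rewrite EFinM -Erfc_head// -integral_scale ?half_normal_ge0//.
- apply: eq_integral => x /set_mem; rewrite /= in_itv/= andbT => x0.
  rewrite /mt /excursion_density/= mulrA; congr EFin; congr (_ * _).
  rewrite !indicE; congr (_%:R); congr nat_of_bool.
  have u0 : 0 <= x * Num.sqrt (2 * t) by rewrite mulr_ge0 ?(ltW x0) ?(ltW q0).
  apply/idP/idP; rewrite !inE/= !in_itv/= ?andbT /excursion_delay/= -addrA -lerBrDl (excursion_condition theta0 z0 u0 (ltW st0)).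
    by rewrite /v ler_pdivlMr ?mulr_gt0// mulrCA.
  by rewrite /v ler_pdivlMr ?mulr_gt0// mulrCA.
- by apply: measurable_funM; [exact: measurable_half_gauss|exact: measurable_indic].
- by move=> x _; rewrite mulr_ge0 ?half_gauss_ge0// indicE.
Qed.

End excursion_mixture.
End laplace_transforms.

(** * Laws of the occupation times *)

Section occupation_law.
Context d (T : measurableType d) (R : realType).
Notation leb := (@lebesgue_measure R).
Variables (theta : R) (P : probability T R) (F : R -> set_system T) (X B : R -> T -> R).
Hypothesis hXB : sticky_weak_solution theta P F X B.
Variable S : set R.
Hypothesis mS : measurable S.
Let Y : R -> T -> R := occupation_time (extend X) S.
Let q (r : R) (w : T) : R := \1_S (extend X r w).

Let mq : joint_measurable q.
Proof. by apply: (joint_measurable_comp _ (extend_joint hXB)); exact: measurable_indic. Qed.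

Let q0 r w : 0 <= q r w. Proof. by rewrite /q indicE. Qed.

Let q1 r w : `|q r w| <= 1.
Proof. by rewrite ger0_norm ?q0// /q indicE; case: (_ \in _). Qed.

Lemma occupation_joint : joint_measurable Y.
Proof.
apply: continuous_joint_measurable => [t|w]; first exact: (time_integral_measurable mq q1).
exact: (time_integral_continuous mq q1).
Qed.

Lemma occupation_ge0 s w : 0 <= Y s w.
Proof. by apply: Rintegral_ge0 => r _; exact: q0. Qed.

Lemma occupation_nondecreasing s s' w : 0 <= s -> s <= s' -> Y s w <= Y s' w.
Proof.
move=> s0 ss; rewrite /Y /occupation_time (time_integral_split mq q1 w s0 ss) lerDl.
by apply: Rintegral_ge0 => r _; exact: q0.
Qed.

Lemma rate_time_integral (l a p0 p1 p2 s : R) w : 0 <= s ->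
  (forall x, rate p0 p1 p2 x = l + a * \1_S x) ->
  \int[leb]_(r in `[0, s]) rate p0 p1 p2 (extend X r w) = l * s + a * Y s w.
Proof.
move=> s0 rE; transitivity (\int[leb]_(r in `[0, s]) (l + a * q r w)).
  by apply: eq_Rintegral => r _; rewrite rE.
have iq := time_integrable mq q1 0 s w.
have ic : leb.-integrable `[0, s] (EFin \o cst l).
  exact: (@time_integrable _ T R (fun _ _ => l) `|l| (measurable_cst l) (fun _ _ => lexx _) 0 s w).
have iz : leb.-integrable `[0, s] (EFin \o (fun r => a * q r w)).
  apply: (@time_integrable _ T R (fun r w => a * q r w) `|a|) => [|r v].
    exact: measurable_funM.
  by rewrite normrM ler_piMr.
rewrite (RintegralD _ ic iz)//; congr (_ + _).
  by rewrite (Rintegral_itvcc_cst _ s0) subr0 mulrC.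
by rewrite RintegralZl.
Qed.

Lemma exp_cdf_occupation_laplace (l a p0 p1 p2 v : R) : 0 < l -> 0 < a ->
  (forall x, rate p0 p1 p2 x = l + a * \1_S x) ->
  (\int[leb]_(s in `[0%R, +oo[) (\int[P]_w expR (- \int[leb]_(r in `[0, s]) rate p0 p1 p2 (extend X r w)))%:E = v%:E)%E ->
  (\int[leb]_(t in `[0%R, +oo[) (a * expR (- (a * t)) * exp_cdf P Y l t)%:E = (l * v)%:E)%E.
Proof.
move=> l0 a0 rE hv.
rewrite (exp_cdf_laplace P occupation_joint (fun s w _ => occupation_ge0 s w) l0 a0) EFinM -hv.
have jY : joint_measurable (fun s w => expR (- (a * Y s w))).
  exact: (joint_measurable_comp (g := fun x => expR (- (a * x))) (measurable_expl a) occupation_joint).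
have bY s w : `|expR (- (a * Y s w))| <= 1.
  by rewrite ger0_norm ?expR_ge0// -expR0 ler_expR oppr_le0 mulr_ge0 ?occupation_ge0// ltW.
have mE : measurable_fun setT (fun s => \int[P]_w expR (- (a * Y s w))).
  exact: (expectation_measurable jY bY).
have := @integral_scale _ _ R leb `[0%R, +oo[%classic _ l (fun s => expR (- (l * s)) * \int[P]_w expR (- (a * Y s w))) (ltW l0).
move=> /(_ (measurable_itv _)) hs.
transitivity (\int[leb]_(s in `[0%R, +oo[) (l * (expR (- (l * s)) * \int[P]_w expR (- (a * Y s w))))%:E)%E.
  by apply: eq_integral => s _; rewrite mulrA.
rewrite hs.
- congr (_ * _)%E; apply: eq_integral => s /set_mem; rewrite /= in_itv/= andbT => s0; congr EFin.
  have bs : bounded_rv (fun w => expR (- (a * Y s w))).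
    by split; [exact: (joint_measurable_sec2 s jY)|exists 1; exact: bY].
  rewrite -(bounded_expectationZ P _ bs); apply: eq_Rintegral => w _.
  by rewrite (rate_time_integral w s0 rE) opprD expRD.
- by apply: measurable_funM => //; exact: measurable_expl.
- move=> s _; rewrite mulr_ge0 ?expR_ge0//; apply: Rintegral_ge0 => w _; exact: expR_ge0.
Qed.

(** The inversion in the level t, at a fixed rate l of the exponential time. *)
Lemma exp_cdf_occupation (l t : R) (g : R -> R) : 0 < l -> 0 < t ->
  measurable_fun setT g -> (forall x, 0 <= x -> `|g x| <= 1) -> {for t, continuous g} ->
  (forall a : R, 0 < a ->
    (\int[leb]_(x in `[0%R, +oo[) (a * expR (- (a * x)) * exp_cdf P Y l x)%:E =
     \int[leb]_(x in `[0%R, +oo[) (a * expR (- (a * x)) * g x)%:E)%E) ->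
  exp_cdf P Y l t = g t.
Proof.
move=> l0 t0 mg g1 cg h; apply: (laplace_inversion t0 _ mg _ g1 _ cg (f := exp_cdf P Y l)).
- exact: (measurable_exp_cdf P occupation_joint l0).
- by move=> x _; exact: (exp_cdf_norm P occupation_joint l0).
- by move=> x y _ xy; exact: (exp_cdf_nondecreasing P occupation_joint l0 xy).
- by move=> k; exact: h.
Qed.

(** The inversion in the time s, at a fixed level t. The probability that the occupation time is at
    most t decreases in s, and it has for every rate l the same transform as one minus the mixture.
    The mixture is continuous at s = 1, where the inversion is read off. *)
Lemma occupation_mixture d' (T' : measurableType d') (mu : {measure set T' -> \bar R}) (E : set T')
    (f c : T' -> R) (t : R) : measurable E -> measurable_fun setT f -> (forall y, 0 <= f y) ->
  measurable_fun setT c -> (forall y, E y -> 0 <= c y) -> (\int[mu]_(y in E) (f y)%:E = 1)%E ->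
  (forall k : R * T' -> \bar R, measurable_fun setT k -> (forall z, 0 <= k z)%E ->
    \int[leb]_(s in `[0%R, +oo[) \int[mu]_(y in E) k (s, y) =
    \int[mu]_(y in E) \int[leb]_(s in `[0%R, +oo[) k (s, y))%E ->
  (forall l : R, 0 < l -> (\int[mu]_(y in E) (f y * expR (- (l * c y)))%:E = (1 - exp_cdf P Y l t)%:E)%E) ->
  {for 1, continuous (fun s => fine (mixture mu E f c s))} ->
  P [set w | t < occupation_time X S 1 w] = mixture mu E f c 1.
Proof.
move=> mE mf f0 mc c0 f1 ton hl cont.
have mfin s : mixture mu E f c s \is a fin_num := mixture_fin mE mf f0 mc f1 s.
have m01 s : 0 <= fine (mixture mu E f c s) <= 1.
  rewrite -!lee_fin fineK//; apply/andP; split; first exact: mixture_ge0.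
  exact: (mixture_le1 mE mf f0 mc f1).
have mm : measurable_fun setT (fun s => fine (mixture mu E f c s)) by exact: measurable_mixture.
have -> : [set w | t < occupation_time X S 1 w] = [set w | t < Y 1 w].
  by apply/seteqP; split => w; rewrite /= /Y /occupation_time (extend_time_integral X (\1_S)).
rewrite (probability_gt P occupation_joint).
rewrite (_ : marginal_cdf P Y 1 t = 1 - fine (mixture mu E f c 1)); first by rewrite opprB addrC subrK fineK.
apply: (laplace_inversion_nonincreasing ltr01 (f := marginal_cdf P Y ^~ t) (g := fun s => 1 - fine (mixture mu E f c s)) (M := 1)).
- exact: (measurable_cdf P occupation_joint).
- exact: measurable_funB.
- by move=> x _; exact: (cdf_norm P occupation_joint).
- by move=> x _; have /andP[h1 h2] := m01 x; rewrite ger0_norm ?subr_ge0// gerBl.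
- by move=> x y x0 xy; apply: (cdf_nonincreasing P occupation_joint) => w; exact: occupation_nondecreasing.
- by apply: continuousB => //; exact: cst_continuous.
move=> k; have k0 : 0 < k.+1%:R :> R by [].
rewrite -(exp_cdfE P occupation_joint k0).
rewrite (laplace_complement (v := 1 - exp_cdf P Y k.+1%:R t) k0 mm (fun s _ => m01 s)); first by congr EFin; ring.
rewrite -hl// -(mixture_exponential mE mf f0 mc c0 ton k0).
by apply: eq_integral => s _; rewrite EFinM fineK.
Qed.

End occupation_law.

Lemma eventually_continuous (R : realType) (f h : R -> R) (x t : R) : t < x ->
  (forall s, t < s -> f s = h s) -> {for x, continuous h} -> {for x, continuous f}.
Proof.
move=> tx fh ch; rewrite /prop_for /continuous_at (fh x tx); apply: (cvg_trans _ ch).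
by apply: near_eq_cvg; near=> s; rewrite fh//; near: s; exact: lt_nbhsr.
Unshelve. all: by end_near. Qed.

Section occupation_at_zero.
Context d (T : measurableType d) (R : realType).
Notation leb := (@lebesgue_measure R).
Variables (theta : R) (P : probability T R) (F : R -> set_system T) (X B : R -> T -> R).
Hypotheses (theta0 : 0 < theta) (hXB : sticky_weak_solution theta P F X B)
  (X0 : {ae P, forall w, X 0 w = 0}).

Let rate_zero (l al x : R) : rate l (l + al) l x = l + al * \1_[set 0] x.
Proof.
have [x0|x0|->] := ltgtP x 0; last by rewrite rate_0 indicE mem_set// mulr1.
  by rewrite rate_neg// indicE memNset ?mulr0 ?addr0//= => e; rewrite e ltxx in x0.
by rewrite rate_pos// indicE memNset ?mulr0 ?addr0//= => e; rewrite e ltxx in x0.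
Qed.

(** The rates are l off 0 and l + al at 0, so a = b = sqrt (2 l) in the use and the fraction is the
    value of u at 0. With beta = l + theta a, the second identity displays it as the transform of 1
    - e^(-beta t): the time spent at 0 before an exponential time is itself exponential, of rate
    beta. *)
Let zero_arith (l al a : R) : 0 < l -> 0 < al -> 0 <= a ->
  2^-1 * theta * (a * ((1 + theta * a / l) / (l + al + theta * a) - l^-1) +
    a * ((1 + theta * a / l) / (l + al + theta * a) - l^-1)) +
  (l + al) * ((1 + theta * a / l) / (l + al + theta * a)) = 1 /\
  l * ((1 + theta * a / l) / (l + al + theta * a)) = 1 - al / (al + (l + theta * a)).
Proof.
move=> l0 al0 a0; have ta : 0 <= theta * a by rewrite mulr_ge0// ltW.
have n1 : l + al + theta * a != 0 by rewrite gt_eqF// ltr_wpDr// addr_gt0.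
have n2 : al + (l + theta * a) != 0 by rewrite addrA (addrC al).
have n3 : l != 0 by rewrite gt_eqF.
by split; field; rewrite ?n3 ?n1 ?n2.
Qed.

Lemma exp_cdf_zero (l t : R) : 0 < l -> 0 < t ->
  exp_cdf P (occupation_time (extend X) [set 0]) l t = 1 - expR (- ((l + theta * Num.sqrt (2 * l)) * t)).
Proof.
move=> l0 t0; set a := Num.sqrt (2 * l); have a0 : 0 <= a by exact: sqrtr_ge0.
have a2 : a ^+ 2 = 2 * l by rewrite sqr_sqrtr// mulr_ge0// ltW.
have b0 : 0 < l + theta * a by rewrite ltr_wpDr// mulr_ge0// ltW.
have me : measurable_fun setT (fun x : R => expR (- ((l + theta * a) * x))) by exact: measurable_expl.
have e01 x : 0 <= x -> 0 <= expR (- ((l + theta * a) * x)) <= 1.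
  by move=> x0; rewrite expR_ge0/= -expR0 ler_expR oppr_le0 mulr_ge0// ltW.
apply: (exp_cdf_occupation hXB (measurable_set1 0) (g := fun x => 1 - expR (- ((l + theta * a) * x))) l0 t0).
- exact: measurable_funB.
- by move=> x x0; have /andP[h1 h2] := e01 x x0; rewrite ger0_norm ?subr_ge0// gerBl.
- apply: continuousB; first exact: cst_continuous.
  apply: continuous_comp; last exact: continuous_expR.
  by apply: continuousN; apply: cvgM; [exact: cvg_cst|exact: cvg_id].
move=> al al0; have lal : 0 < l + al by rewrite addr_gt0.
have [h1 h2] := zero_arith l0 al0 a0.
rewrite (exp_cdf_occupation_laplace hXB (measurable_set1 0) l0 al0 (rate_zero l al)
  (sticky_resolvent hXB theta0 X0 l0 lal l0 a0 a0 a2 a2 h1)) h2.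
have lb : 0 < al + (l + theta * a) by rewrite addr_gt0.
by rewrite (laplace_complement al0 me e01 (laplace_exp al0 lb)).
Qed.

(** The exponential e^(-(l + theta sqrt (2 l)) t) is the transform of t plus the first time at which
    a Brownian motion reaches theta t. In terms of paths: when the time spent at 0 equals t, the
    local time is theta t, and the time spent elsewhere is the Brownian inverse local time at that
    level. *)
Lemma occupation_zero_law (t : R) : 0 < t -> t < 1 ->
  P [set w | t < occupation_time X [set 0] 1 w] = (Erfc (theta * t / Num.sqrt (2 * (1 - t))))%:E.
Proof.
move=> t0 t1; have y0 : 0 < theta * t by rewrite mulr_gt0.
pose c (x : R) := t + (theta * t) ^+ 2 / (2 * x ^+ 2).
have mI : measurable (`[0%R, +oo[%classic : set R) by exact: measurable_itv.
have mh : measurable (`]0%R, +oo[%classic : set R) by exact: measurable_itv.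
rewrite -(gauss_delay_mixture y0 t1).
apply: (occupation_mixture hXB (measurable_set1 0) (mu := leb) mh (@measurable_half_gauss R)
  (@half_gauss_ge0 R) (measurable_delay t (theta * t)) _ (half_gauss_total R)).
- by move=> x _; rewrite addr_ge0 ?(ltW t0)// divr_ge0 ?sqr_ge0// mulr_ge0 ?sqr_ge0.
- by move=> k mk k0; exact: (tonelli_on leb leb mI mh mk k0).
- move=> l l0; set a := Num.sqrt (2 * l); have a0 : 0 <= a by exact: sqrtr_ge0.
  have a2 : 2^-1 * a ^+ 2 = l by rewrite sqr_sqrtr ?mulrA ?mulVf ?mul1r// mulr_ge0// ltW.
  have := gauss_delay_exponential t y0 a0; rewrite a2 => ->; congr EFin.
  by rewrite exp_cdf_zero// opprB addrC subrK -expRD; congr expR; rewrite -/a; ring.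
apply: (eventually_continuous (h := fun s => Erfc (theta * t / Num.sqrt (2 * (s - t)))) t1).
  by move=> s ts; rewrite (gauss_delay_mixture y0 ts).
apply: continuous_comp; last exact: continuous_Erfc.
apply: cvgM; first exact: cvg_cst.
apply: cvgV; first by rewrite gt_eqF// sqrtr_gt0 mulr_gt0// subr_gt0.
apply: (continuous_comp (f := fun s : R => 2 * (s - t))); last exact: sqrt_continuous.
by apply: cvgM; [exact: cvg_cst|apply: cvgB; [exact: cvg_id|exact: cvg_cst]].
Qed.

End occupation_at_zero.

(** Here the rate is l + al on the positive side and l elsewhere, and [u] solves the equation of
    [sticky_resolvent]. The product in the second identity is ready for inversion: a / (k + a), with
    k = b + b^2 / theta, is the transform of [gauss_exp k] at rate l + al = a^2 / 2, and al / (l +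
    al) accounts for an extra factor e^(-l t). *)
Lemma half_line_resolvent (R : realType) (theta l al a b : R) : 0 < theta -> 0 < l -> 0 < al -> 0 < a -> 0 < b ->
  a ^+ 2 = 2 * (l + al) -> b ^+ 2 = 2 * l ->
  let u := (1 + theta * (a^-1 + b^-1)) / (l + 2^-1 * theta * (a + b)) in
  2^-1 * theta * (a * (u - (l + al)^-1) + b * (u - l^-1)) + l * u = 1 /\
  l * u = 1 - al / (l + al) * (a / (b + b ^+ 2 / theta + a)).
Proof.
(* Expressing l and al through a and b leaves rational identities, within reach of [field]. *)
move=> theta0 l0 al0 a0 b0 a2 b2; have -> : al = 2^-1 * a ^+ 2 - l by rewrite a2; field.
have -> : l = 2^-1 * b ^+ 2 by rewrite b2; field.
have -> : 2^-1 * b ^+ 2 + (2^-1 * a ^+ 2 - 2^-1 * b ^+ 2) = 2^-1 * a ^+ 2 by ring.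
have na : a != 0 by rewrite gt_eqF.
have nb : b != 0 by rewrite gt_eqF.
have nt : theta != 0 by rewrite gt_eqF.
have nab : b ^+ 2 + theta * (a + b) != 0.
  by rewrite gt_eqF// addr_gt0 ?exprn_gt0// mulr_gt0// addr_gt0.
have nab2 : b * theta + b ^+ 2 + a * theta != 0.
  by rewrite (_ : _ + _ = b ^+ 2 + theta * (a + b))//; ring.
by split; field; rewrite ?na ?nb ?nt ?nab ?nab2.
Qed.

Lemma excursion_bound_ge0 (R : realType) (theta t r z : R) : 0 < theta -> 0 <= r -> 0 <= z ->
  0 <= (- z ^+ 2 + z * Num.sqrt (z ^+ 2 + theta ^+ 2 * r)) / (theta * Num.sqrt (2 * t)).
Proof.
move=> theta0 r0 z0; have st : 0 <= theta ^+ 2 * r by rewrite mulr_ge0 ?sqr_ge0.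
apply: divr_ge0; last by apply: mulr_ge0; [exact: ltW|exact: sqrtr_ge0].
rewrite addrC subr_ge0 expr2 ler_wpM2l// -[leLHS]ger0_norm// -sqrtr_sqr ler_wsqrtr//.
by rewrite lerDl.
Qed.

Section occupation_of_half_line.
Context d (T : measurableType d) (R : realType).
Notation leb := (@lebesgue_measure R).
Variables (theta : R) (P : probability T R) (F : R -> set_system T) (X B : R -> T -> R).
Hypotheses (theta0 : 0 < theta) (hXB : sticky_weak_solution theta P F X B)
  (X0 : {ae P, forall w, X 0 w = 0}).
Let S : set R := [set x | 0 < x].
Let half : set R := `]0, +oo[%classic.
Let mhalf : measurable half. Proof. exact: measurable_itv. Qed.

Let mS : measurable S.
Proof. by rewrite (_ : S = half)//; apply/seteqP; split => x; rewrite /S /half /= in_itv/= andbT. Qed.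

Let rate_positive (l al x : R) : rate (l + al) l l x = l + al * \1_S x.
Proof.
have [x0|x0|->] := ltgtP x 0.
- by rewrite rate_neg// indicE memNset ?mulr0 ?addr0//= /S/= => h; have := lt_trans h x0; rewrite ltxx.
- by rewrite rate_pos// indicE mem_set// mulr1.
- by rewrite rate_0 indicE memNset ?mulr0 ?addr0//= /S/= ltxx.
Qed.

Let kk (l : R) := Num.sqrt (2 * l) + Num.sqrt (2 * l) ^+ 2 / theta.

Let kk0 l : 0 < l -> 0 < kk l.
Proof.
move=> l0; have b0 : 0 < Num.sqrt (2 * l) by rewrite sqrtr_gt0 mulr_gt0.
by apply: addr_gt0 => //; apply: divr_gt0 => //; exact: exprn_gt0.
Qed.

(** The parameter [kk l] has two origins: sqrt (2 l) comes from the negative side, and 2 l / theta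
    from the time spent at 0. *)
Lemma exp_cdf_positive (l t : R) : 0 < l -> 0 < t ->
  exp_cdf P (occupation_time (extend X) S) l t = 1 - expR (- (l * t)) * gauss_exp (kk l) t.
Proof.
move=> l0 t0; have k0 := kk0 l0; set b := Num.sqrt (2 * l).
have b0 : 0 < b by rewrite sqrtr_gt0 mulr_gt0.
have b2 : b ^+ 2 = 2 * l by rewrite sqr_sqrtr// mulr_ge0// ltW.
pose phi (x : R) := expR (- (l * x)) * gauss_exp (kk l) x.
have mphi : measurable_fun setT phi.
  by apply: measurable_funM; [exact: measurable_expl|exact: measurable_gauss_exp].
have phi01 x : 0 <= x -> 0 <= phi x <= 1.
  move=> x0; have /andP[h1 h2] := gauss_exp01 k0 x; rewrite mulr_ge0 ?expR_ge0//=.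
  by apply: mulr_ile1 => //; rewrite ?expR_ge0// -expR0 ler_expR oppr_le0 mulr_ge0// ltW.
apply: (exp_cdf_occupation hXB mS (g := fun x => 1 - phi x) l0 t0).
- exact: measurable_funB.
- by move=> x x0; have /andP[h1 h2] := phi01 x x0; rewrite ger0_norm ?subr_ge0// gerBl.
- apply: continuousB; first exact: cst_continuous.
  apply: cvgM; last exact: continuous_gauss_exp.
  apply: continuous_comp; last exact: continuous_expR.
  by apply: continuousN; apply: cvgM; [exact: cvg_cst|exact: cvg_id].
move=> al al0; have p0 : 0 < l + al by rewrite addr_gt0.
set a := Num.sqrt (2 * (l + al)).
have a0 : 0 < a by rewrite sqrtr_gt0 mulr_gt0.
have a2 : a ^+ 2 = 2 * (l + al) by rewrite sqr_sqrtr// mulr_ge0// ltW.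
have [h1 h2] := half_line_resolvent theta0 l0 al0 a0 b0 a2 b2.
rewrite (exp_cdf_occupation_laplace hXB mS l0 al0 (rate_positive l al)
  (sticky_resolvent hXB theta0 X0 p0 l0 l0 (ltW a0) (ltW b0) a2 b2 h1)) h2.
have mG : measurable_fun setT (fun x => (l + al) * expR (- ((l + al) * x)) * gauss_exp (kk l) x).
  by apply: measurable_funM; [apply: measurable_funM => //; exact: measurable_expl|exact: measurable_gauss_exp].
have mI : measurable (`[0%R, +oo[%classic : set R) by exact: measurable_itv.
have q0 : 0 <= al / (l + al) by rewrite divr_ge0 ?ltW.
have lap : (\int[leb]_(x in `[0%R, +oo[) (al * expR (- (al * x)) * phi x)%:E =
    (al / (l + al) * (a / (kk l + a)))%:E)%E.
  transitivity (\int[leb]_(x in `[0%R, +oo[) (al / (l + al) * ((l + al) * expR (- ((l + al) * x)) * gauss_exp (kk l) x))%:E)%E.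
    apply: eq_integral => x _; congr EFin; rewrite /phi.
    rewrite (_ : - ((l + al) * x) = - (al * x) + - (l * x)); last by ring.
    by rewrite expRD; field; rewrite gt_eqF.
  rewrite (integral_scale leb mI q0 mG); last first.
    move=> x _; have /andP[g0 _] := gauss_exp01 k0 x.
    by rewrite mulr_ge0// mulr_ge0 ?expR_ge0// ltW.
  have := laplace_gauss_exp k0 a0; rewrite (_ : 2^-1 * a ^+ 2 = l + al); last by rewrite a2; field.
  by move=> ->; rewrite -EFinM.
by rewrite (laplace_complement al0 mphi phi01 lap).
Qed.

Let H (t s z : R) := (- z ^+ 2 + z * Num.sqrt (z ^+ 2 + theta ^+ 2 * (s - t))) / (theta * Num.sqrt (2 * t)).

Let H_ge0 t s z : 0 < t -> t <= s -> 0 <= z -> 0 <= H t s z.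
Proof.
by move=> t0 ts z0; apply: excursion_bound_ge0; rewrite ?subr_ge0.
Qed.

Let continuous_H_time t z : 0 < t -> continuous (H t ^~ z).
Proof.
move=> t0 s; apply: cvgM; last exact: cvg_cst.
apply: cvgD; first exact: cvg_cst.
apply: cvgM; first exact: cvg_cst.
apply: (continuous_comp (f := fun s : R => z ^+ 2 + theta ^+ 2 * (s - t))); last exact: sqrt_continuous.
apply: cvgD; first exact: cvg_cst.
by apply: cvgM; [exact: cvg_cst|apply: cvgB; [exact: cvg_id|exact: cvg_cst]].
Qed.

Let continuous_H t s : continuous (H t s).
Proof.
move=> z; apply: cvgM; last exact: cvg_cst.
have cz2 : (fun x : R => x ^+ 2) @ z --> z ^+ 2 by exact: exprn_continuous.
apply: cvgD; first exact: cvgN.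
apply: cvgM; first exact: cvg_id.
apply: (continuous_comp (f := fun z : R => z ^+ 2 + theta ^+ 2 * (s - t))); last exact: sqrt_continuous.
by apply: cvgD; [exact: cz2|exact: cvg_cst].
Qed.

Let hn (t s z : R) := half_normal z * (1 - Erfc (H t s z)).

Let mErfcH t s : measurable_fun setT (fun z => Erfc (H t s z)).
Proof.
apply: continuous_measurable_fun => z; apply: (continuous_comp (f := H t s)); first exact: continuous_H.
exact: continuous_Erfc.
Qed.

Let mhn t s : measurable_fun setT (hn t s).
Proof.
apply: measurable_funM; first exact: measurable_half_normal.
by apply: measurable_funB => //; exact: mErfcH.
Qed.

Let hn_bound t s z : 0 < t -> t <= s -> 0 <= z -> 0 <= hn t s z <= half_normal z.
Proof.
move=> t0 ts z0; have h1 := Erfc_le1 (H_ge0 t0 ts z0); have h2 := Erfc_ge0 (H t s z).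
have h3 := half_normal_ge0 z.
by rewrite /hn mulr_ge0 ?subr_ge0//= ler_piMr// gerBl.
Qed.

Let half_normal_integrable : leb.-integrable half (EFin \o @half_normal R).
Proof.
apply/integrableP; split; first by apply/measurable_EFinP; apply: measurable_funTS; exact: measurable_half_normal.
under eq_integral do rewrite /= ger0_norm ?half_normal_ge0//.
by rewrite half_normal_total ltry.
Qed.

Let hn_integrable t s : 0 < t -> t <= s -> leb.-integrable half (EFin \o hn t s).
Proof.
move=> t0 ts; apply: (@le_integrable _ _ R leb half mhalf (EFin \o hn t s) (EFin \o @half_normal R)) => //.
  by apply/measurable_EFinP; apply: measurable_funTS; exact: mhn.
move=> z; rewrite /half /= in_itv/= andbT => z0; have /andP[h1 h2] := hn_bound t0 ts (ltW z0).
by rewrite lee_fin !ger0_norm ?half_normal_ge0.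
Qed.

(** The Laplace inversion in s identifies the law at s = 1 only if the mixture is continuous there;
    this is dominated convergence with the half-normal density as bound. *)
Let continuous_hn t : 0 < t -> t < 1 -> {for 1, continuous (fun s => \int[leb]_(z in half) hn t s z)}.
Proof.
move=> t0 t1; have tI : 1 \in (`]t, 2[%classic : set R) by rewrite inE/= in_itv/= t1 ltr1n.
suff Hc : {in `]t, 2[%classic, continuous (fun s : R => \int[leb]_(z in half) hn t s z)} by exact: (Hc 1 tI).
have CI := @continuity_under_integral R _ _ leb (hn t) half (measurable_itv _) t 2 _ _ (@half_normal R) half_normal_integrable.
apply: CI.
- by move=> s; rewrite /= in_itv/= => /andP[ts _]; apply: hn_integrable => //; exact: ltW.
- apply: aeW => z _ s _; apply: cvgM; first exact: cvg_cst.
  apply: cvgB; first exact: cvg_cst.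
  apply: (continuous_comp (f := H t ^~ z)); first exact: continuous_H_time.
  exact: continuous_Erfc.
- move=> s; rewrite /= in_itv/= => /andP[ts _]; apply: aeW => z; rewrite /half /= in_itv/= andbT => z0.
  by have /andP[h1 h2] := hn_bound t0 (ltW ts) (ltW z0); rewrite ger0_norm.
Qed.

Lemma occupation_positive_law (t : R) : 0 < t -> t < 1 ->
  P [set w | t < occupation_time X S 1 w] = (\int[leb]_(z in half) (hn t 1 z)%:E)%E.
Proof.
move=> t0 t1.
have mI : measurable (`[0%R, +oo[%classic : set R) by exact: measurable_itv.
have mhh : measurable (half `*` half) by exact: measurableX.
rewrite -(excursion_mixture theta0 t0 t1).
have OM := @occupation_mixture _ _ _ theta P F X B hXB S mS _ _ (product_measure1 leb leb).
have OM1 := (OM _ _ _ t mhh (@measurable_excursion_density R) (@excursion_density_ge0 R) (measurable_excursion_delay theta t)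
  (excursion_delay_ge0 theta0 t0) (excursion_density_total R)).
refine (OM1 _ _ _).
- by move=> k mk k0; exact: (tonelli_product_on leb leb leb mI mhalf mhalf mk k0).
- move=> l l0; set b := Num.sqrt (2 * l); have b0 : 0 < b by rewrite sqrtr_gt0 mulr_gt0.
  have b2 : 2^-1 * b ^+ 2 = l by rewrite sqr_sqrtr ?mulrA ?mulVf ?mul1r// mulr_ge0// ltW.
  have := excursion_exponential t theta0 b0; rewrite b2 => ->; congr EFin.
  by rewrite exp_cdf_positive// subKr.
apply: (eventually_continuous (h := fun s => \int[leb]_(z in half) hn t s z) t1); last exact: continuous_hn.
by move=> s ts; rewrite (excursion_mixture theta0 t0 ts).
Qed.

End occupation_of_half_line.

(** * Passage from half-normal integrals to Gaussian expectations *)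

Lemma integral_normal_even (R : realType) (f : R -> R) : (forall x, 0 <= f x) -> continuous f -> f =1 f \o -%R ->
  (\int[normal_prob 0 1]_x (f x)%:E = \int[lebesgue_measure]_(x in `]0%R, +oo[) (half_normal x * f x)%:E)%E.
Proof.
move=> f0 cf ef; have mf : measurable_fun setT f by exact: continuous_measurable_fun.
have n1 : (1 : R) != 0 by exact: oner_neq0.
rewrite (integral_normal _ mf f0) ge0_symfun_integralT; last 3 first.
- by move=> x; rewrite mulr_ge0// normal_pdf_ge0.
- by move=> x; apply: cvgM; [exact: cf|exact: continuous_normal_pdf].
- by move=> x; rewrite /= {1}ef /= !normal_pdfE// /normal_fun !subr0 sqrrN.
have mg : measurable_fun setT (fun x => f x * normal_pdf 0 1 x).
  by apply: measurable_funM => //; exact: measurable_normal_pdf.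
have -> : [set x : R | 0 <= x] = `[0, +oo[%classic by apply/seteqP; split => x; rewrite /= in_itv/= andbT.
rewrite -integral_itv_obnd_cbnd; last by apply/measurable_EFinP; exact: measurable_funTS.
have mh : measurable (`]0, +oo[%classic : set R) by exact: measurable_itv.
rewrite -(integral_scale lebesgue_measure mh _ mg)//; last by move=> x _; rewrite mulr_ge0// normal_pdf_ge0.
by apply: eq_integral => x _; rewrite /half_normal; congr EFin; ring.
Qed.

(* The random variable is retyped with values in [measurableTypeR R], the
   measurable space on which [normal_prob] is a measure. *)
Lemma expectation_normal (R : realType) d (T : measurableType d) (Q : probability T R) (Z : {RV Q >-> R}) (f : R -> R) :
  measurable_fun setT f -> (forall x, 0 <= f x) ->
  (forall A : set R, measurable A -> distribution Q Z A = normal_prob 0 1 A) ->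
  'E_Q[fun w => f (Z w)]%E = (\int[normal_prob 0 1]_x (f x)%:E)%E.
Proof.
move=> mf f0 hZ; have mZ : @measurable_fun _ _ T (measurableTypeR R) setT Z.
  by move=> _ A mA; exact: (@measurable_funPT _ _ _ _ Z measurableT A mA).
pose Z' := @mfun_Sub _ _ T (measurableTypeR R) Z (mem_set mZ).
pose m1 : {measure set (measurableTypeR R) -> \bar R} := @distribution _ _ T (measurableTypeR R) R Q Z'.
pose m2 : {measure set (measurableTypeR R) -> \bar R} := @normal_prob R 0 1.
have dZ := @ge0_integral_distribution _ _ T (measurableTypeR R) R Q Z' (fun z => (f z)%:E).
have E := @eq_measure_integral _ (measurableTypeR R) R setT m2 m1 (fun z => (f z)%:E).
rewrite unlock -[LHS]dZ.
- by apply: E => A mA _; exact: hZ.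
- exact/measurable_EFinP.
- by move=> z; rewrite lee_fin f0.
Qed.

Lemma integral_half_normal_complement (R : realType) (f : R -> R) : measurable_fun setT f ->
  (forall x, 0 < x -> 0 <= f x <= 1) ->
  (\int[lebesgue_measure]_(x in `]0%R, +oo[) (half_normal x * (1 - f x))%:E =
   1 - \int[lebesgue_measure]_(x in `]0%R, +oo[) (half_normal x * f x)%:E)%E.
Proof.
move=> mf f01; have mh : measurable (`]0, +oo[%classic : set R) by exact: measurable_itv.
have mg : measurable_fun setT (fun x => half_normal x * f x).
  by apply: measurable_funM => //; exact: measurable_half_normal.
have mg' : measurable_fun setT (fun x => half_normal x * (1 - f x)).
  by apply: measurable_funM; [exact: measurable_half_normal|exact: measurable_funB].
have g0 x : (`]0, +oo[%classic : set R) x -> 0 <= half_normal x * f x <= half_normal x.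
  rewrite /= in_itv/= andbT => x0; have /andP[h1 h2] := f01 x x0; have h := half_normal_ge0 x.
  by rewrite mulr_ge0//= ler_piMr.
have fin : (\int[lebesgue_measure]_(x in `]0%R, +oo[) (half_normal x * f x)%:E)%E \is a fin_num.
  rewrite ge0_fin_numE; last by apply: integral_ge0 => x /g0 /andP[h _]; rewrite lee_fin.
  apply: (@le_lt_trans _ _ 1%E); last by rewrite ltry.
  rewrite -half_normal_total.
  by apply: (integral_ler lebesgue_measure mh mg (@measurable_half_normal R)) => x /g0 /andP[].
rewrite -half_normal_total -[LHS](addeK _ fin); congr (_ - _)%E; rewrite -ge0_integralD//.
- by apply: eq_integral => x _; rewrite -EFinD; congr EFin; ring.
- by move=> x /g0 /andP[_ h]; rewrite lee_fin mulrBr mulr1 subr_ge0.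
- by apply/measurable_EFinP; exact: measurable_funTS.
- by move=> x /g0 /andP[h _]; rewrite lee_fin.
- by apply/measurable_EFinP; exact: measurable_funTS.
Qed.

Theorem theorem3 (R : realType) (theta : R) (htheta : 0 < theta)
    (d : measure_display) (T : measurableType d) (P : probability T R)
    (F : R -> set_system T) (X B : R -> T -> R)
    (hXB : sticky_weak_solution theta P F X B)
    (hX0 : {ae P, forall w, X 0 w = 0})
    (t : R) (ht0 : 0 < t) (ht1 : t < 1) :
  P [set w | t < occupation_time X [set 0] 1 w]
    = (Erfc (theta * t / Num.sqrt (2 * (1 - t))))%:E
  /\
  forall (d' : measure_display) (T' : measurableType d')
    (Q : probability T' R) (Z : {RV Q >-> R}),
    (forall A : set R, measurable A -> distribution Q Z A = normal_prob 0 1 A) ->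
    P [set w | t < occupation_time X [set x : R | 0 < x] 1 w]
    = (1 - 'E_Q[fun w =>
             Erfc ((- Z w ^+ 2
                    + `|Z w| * Num.sqrt (Z w ^+ 2 + theta ^+ 2 * (1 - t)))
                   / (theta * Num.sqrt (2 * t)))%R])%E.
Proof.
split; first exact: (occupation_zero_law htheta hXB hX0 ht0 ht1).
move=> d' T' Q Z hZ; rewrite (occupation_positive_law htheta hXB hX0 ht0 ht1).
pose G (z : R) := (- z ^+ 2 + `|z| * Num.sqrt (z ^+ 2 + theta ^+ 2 * (1 - t))) / (theta * Num.sqrt (2 * t)).
have G0 z : 0 <= G z.
  have := @excursion_bound_ge0 R theta t (1 - t) `|z| htheta _ (normr_ge0 z).
  by rewrite real_normK ?num_real//; apply; rewrite subr_ge0 ltW.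
have cG : continuous G.
  move=> z; apply: cvgM; last exact: cvg_cst.
  have cz2 : (fun x : R => x ^+ 2) @ z --> z ^+ 2 by exact: exprn_continuous.
  apply: cvgD; first exact: cvgN.
  apply: cvgM; first exact: norm_continuous.
  apply: (continuous_comp (f := fun z : R => z ^+ 2 + theta ^+ 2 * (1 - t))); last exact: sqrt_continuous.
  by apply: cvgD; [exact: cz2|exact: cvg_cst].
have cE : continuous (fun z => Erfc (G z)).
  by move=> z; apply: (continuous_comp (f := G)); [exact: cG|exact: continuous_Erfc].
have mE : measurable_fun setT (fun z => Erfc (G z)) by exact: continuous_measurable_fun.
have EQ : 'E_Q[fun w => Erfc (G (Z w))]%E =
    (\int[lebesgue_measure]_(z in `]0%R, +oo[) (half_normal z * Erfc (G z))%:E)%E.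
  rewrite (expectation_normal mE _ hZ); last by move=> z; exact: Erfc_ge0.
  apply: (integral_normal_even (f := fun z => Erfc (G z)) _ cE) => [z|z]; first exact: Erfc_ge0.
  by rewrite /= /G sqrrN normrN.
rewrite EQ -(integral_half_normal_complement mE).
  apply: eq_integral => z /set_mem; rewrite /= in_itv/= andbT => z0.
  by rewrite /G gtr0_norm.
by move=> z _; rewrite Erfc_ge0 Erfc_le1.
Qed.
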